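(* Let $X_\theta=\mu^{-1}(0)/\!\!/_\theta G$ be the hypertoric varieties associated to an integer matrix $A$ with Gale dual $B$ as in the context, where no row of $B$ is zero, and suppose that $X_\theta$ is nonsingular for generic $\theta$ (equivalently, $A$ is unimodular). Then, for $\theta$ generic, the GIT chamber $C$ containing $\theta$ satisfies the following three conditions: (1) $X_\theta$ is a $\mathbb{Q}$-factorial normal variety and the linearisation map $L_C\colon G^\vee_{\mathbb{Q}}\to\mathrm{Pic}(X_\theta/X_0)_{\mathbb{Q}}$ is an isomorphism of rational vector spaces; (2) each GIT wall in the interior of the GIT region $R_C$ containing $C$ is a flipping wall; (3) each boundary wall of $R_C$ is either divisorial or of fibre type.
   Context: We work over $\mathbb{C}$. Hypertoric varieties. Let $r<n$ be natural numbers and $A$ an $r\times n$ integer matrix whose columns $a_1,\dots,a_n$ span $\mathbb{Z}^r$. Choose an integer $n\times(n-r)$ matrix $B$ with $0\to\mathbb{Z}^{n-r}\xrightarrow{B}\mathbb{Z}^n\xrightarrow{A}\mathbb{Z}^r\to0$ exact. The torus $G=(\mathbb{C}^\times)^r$ acts on $T^*\mathbb{C}^n=\mathbb{C}^n\times(\mathbb{C}^n)^*$ with weight matrix $(A,-A)$, with moment map $\mu(z,w)=\sum_{i=1}^nz_iw_i\,a_i$. When no row of $B$ is zero, $V:=\mu^{-1}(0)$ is an affine variety, and $X_\theta:=V/\!\!/_\theta G$ for $\theta\in G^\vee$. $A$ is unimodular if all its nonzero $r\times r$ minors are $\pm1$. GIT. $\mathbb{C}[V]_\theta:=\{f:f(g\cdot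 v)=\theta(g)f(v)\}$; $v$ is $\theta$-semistable if $f(v)\ne0$ for some $f\in\mathbb{C}[V]_{j\theta}$, $j>0$; $V^\theta$ is the semistable locus; $v\in V^\theta$ is $\theta$-stable if its stabiliser is finite and its orbit is closed in $V^\theta$; $\theta$ is generic if $V^\theta\ne\emptyset$ and all $\theta$-semistable points are $\theta$-stable. These notions extend to $G^\vee_{\mathbb{Q}}=G^\vee\otimes\mathbb{Q}$. $X_\theta=\mathrm{Proj}\bigoplus_{j\ge0}\mathbb{C}[V]_{j\theta}$, projective over $Y:=X_0=\mathrm{Spec}\,\mathbb{C}[V]^G$. The equivalence classes of effective characters ($V^\theta\neq\emptyset$) under $V^\theta=V^{\theta'}$ are relative interiors of finitely many cones (GIT cones) forming the GIT fan; the generic locus is a union of finitely many chambers, each the interior of a top-dimensional GIT cone; a GIT wall is a codimension-one face of the closure of a chamber. For $\theta\in C$ and $\theta_0\in\overline C$ there is an induced projective VGIT morphism $\tau\colon X_\theta\to X_{\theta_0}$ over $Y$. For a chamber $C\ni\theta$, the linearisation map $L_C\colon G^\vee_{\mathbb{Q}}\to\mathrm{Pic}(X_\theta/Y)_{\mathbb{Q}}:=(\mathrm{Pic}(X_\theta)/f^*\mathrm{Pic}(Y))\otimes\mathbb{Q}$ ($f\colon X_\theta\to Y$) sends $\chi$ to $\frac1jL_{j\chi}$, where $L_{j\chi}$ is the line bundle to which the trivial bundle on $V^\theta$ linearised by a suitable multiple $j\chi$ descends (sections of $L_{j\chi}$ are $j\chi$-semi-invariant functions on $V^\theta$). Walls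 and regions. Types of a VGIT morphism are read off from the connected-fibre part $X_\theta\to\widetilde X_{\theta_0}$ of its Stein factorisation: fibre type if the dimension drops; otherwise divisorial or small according to whether or not the exceptional locus contains a divisor (isomorphisms are small). For chambers $C_\pm$ separated by a wall, $\theta_\pm\in C_\pm$ and $\theta_0$ general in the wall, with $\tau_\pm\colon X_{\theta_\pm}\to X_{\theta_0}$ and quotient map $\pi_0\colon V^{\theta_0}\to X_{\theta_0}$, set $\mathrm{Uns}(\tau_\pm)=\tau_\pm^{-1}(\pi_0(\text{strictly }\theta_0\text{-semistable points}))$. The wall is flipping if $X_{\theta_\pm}$ are normal, $\mathrm{Uns}(\tau_\pm)$ have codimension at least two, and each of $\tau_\pm$ contracts at least one curve. Delete the walls for which $\tau_+$ and $\tau_-$ are both small; GIT regions are the top-dimensional closed cones of the resulting coarser decomposition, and $R_C$ is the GIT region containing $C$. A boundary wall of $R_C$ is divisorial or of fibre type if the VGIT morphism into it from the unique chamber in $R_C$ having it in its closure is of that type. *)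

(* Defs.v *)
From HB Require Import structures.
From mathcomp Require Import all_boot all_order all_algebra generic_quotient ring_quotient.
From mathcomp Require Import all_classical reals topology.
From mathcomp Require Import complex ring.
From mathcomp Require mpoly.
Import -(notations) mpoly.
From Stdlib Require Import Relation_Operators.

Set Implicit Arguments.
Unset Strict Implicit.
Unset Printing Implicit Defensive.

Import Order.TTheory GRing.Theory Num.Theory.
Import numFieldTopology.Exports.
Local Open Scope classical_set_scope.
Local Open Scope quotient_scope.
Local Open Scope ring_scope.

Section Rationalisation.
Variable M : zmodType.

(* The pair [(m, k)] stands for the fraction [m / (k + 1)]. *)
Definition frac_eq (u v : M * nat) : bool :=
  `[< exists2 c : nat, (0 < c)%N &
        u.1 *+ (v.2.+1 * c) = v.1 *+ (u.2.+1 * c) >].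

Lemma frac_eq_equiv : equiv_class_of frac_eq.
Proof.
split=> [u|u v|v u w].
- by apply/asboolP; exists 1%N.
- by apply/asboolP/asboolP => -[c c0 e]; exists c.
move=> /asboolP[c c0 e] /asboolP[d d0 e']; apply/asboolP.
exists (v.2.+1 * c * d)%N; first by rewrite !muln_gt0 c0 d0.
have -> : (w.2.+1 * (v.2.+1 * c * d) = v.2.+1 * c * (w.2.+1 * d))%N by ring.
rewrite mulrnA e -mulrnA.
have -> : (u.2.+1 * c * (w.2.+1 * d) = w.2.+1 * d * (u.2.+1 * c))%N by ring.
by rewrite mulrnA e' -mulrnA; congr (_ *+ _); ring.
Qed.

Canonical frac_eq_rel := EquivRelPack frac_eq_equiv.

Definition ratmod := {eq_quot frac_eq}.
HB.instance Definition _ := Choice.on ratmod.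

Definition frac (m : M) (a : nat) : ratmod := \pi_ratmod (m, a.-1).

Lemma fracP m a m' b : (0 < a)%N -> (0 < b)%N ->
  frac m a = frac m' b <->
  exists2 c, (0 < c)%N & m *+ (b * c) = m' *+ (a * c).
Proof.
move=> a0 b0; rewrite /frac; split.
  move=> /eqmodP/asboolP /=; by rewrite !prednK.
by move=> h; apply/eqmodP/asboolP => /=; rewrite !prednK.
Qed.

Lemma ratmodP (x : ratmod) : exists m a, (0 < a)%N /\ x = frac m a.
Proof.
exists (repr x).1, (repr x).2.+1; split=> //.
by rewrite /frac /= -surjective_pairing reprK.
Qed.

Definition rm_add (x y : ratmod) : ratmod :=
  let u := repr x in let v := repr y in
  frac (u.1 *+ v.2.+1 + v.1 *+ u.2.+1) (u.2.+1 * v.2.+1).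
Definition rm_opp (x : ratmod) : ratmod :=
  let u := repr x in frac (- u.1) u.2.+1.
Definition rm_scale (q : rat) (x : ratmod) : ratmod :=
  let u := repr x in frac (u.1 *~ numq q) (u.2.+1 * `|denq q|).

Lemma repr_frac m a : (0 < a)%N ->
  exists2 c, (0 < c)%N &
  (repr (frac m a)).1 *+ (a * c) = m *+ ((repr (frac m a)).2.+1 * c).
Proof.
move=> a0; apply/fracP => //.
by rewrite /frac /= -surjective_pairing reprK.
Qed.

Lemma frac_add m a m' b : (0 < a)%N -> (0 < b)%N ->
  rm_add (frac m a) (frac m' b) = frac (m *+ b + m' *+ a) (a * b).
Proof.
move=> a0 b0; have [c c0 e] := repr_frac m a0; have [d d0 f] := repr_frac m' b0.
rewrite /rm_add; set u := repr (frac m a) in e *.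
set v := repr (frac m' b) in f *.
apply/fracP; rewrite ?muln_gt0 ?a0 ?b0 //.
exists (c * d)%N; first by rewrite muln_gt0 c0.
rewrite !mulrnDl -!mulrnA; congr (_ + _).
  have -> : (v.2.+1 * (a * b * (c * d)) = a * c * (v.2.+1 * b * d))%N by ring.
  by rewrite mulrnA e -mulrnA; congr (_ *+ _); ring.
have -> : (u.2.+1 * (a * b * (c * d)) = b * d * (u.2.+1 * a * c))%N by ring.
by rewrite mulrnA f -mulrnA; congr (_ *+ _); ring.
Qed.

Lemma frac_opp m a : (0 < a)%N -> rm_opp (frac m a) = frac (- m) a.
Proof.
move=> a0; have [c c0 e] := repr_frac m a0.
rewrite /rm_opp; apply/fracP => //; exists c => //.
by rewrite !mulNrn e.
Qed.

Lemma frac_scale q m a : (0 < a)%N ->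
  rm_scale q (frac m a) = frac (m *~ numq q) (a * `|denq q|).
Proof.
move=> a0; have [c c0 e] := repr_frac m a0.
have d0 : (0 < `|denq q|)%N by rewrite absz_gt0 denq_neq0.
rewrite /rm_scale; set u := repr _ in e *.
apply/fracP; rewrite ?muln_gt0 ?a0 ?d0 //; exists c => //.
rewrite !pmulrn -!mulrzA ![numq q * _]mulrC !mulrzA -!pmulrn; congr (_ *~ _).
have -> : (a * `|denq q| * c = a * c * `|denq q|)%N by ring.
by rewrite mulrnA e -mulrnA; congr (_ *+ _); ring.
Qed.

Lemma eq_frac m a m' b : (0 < a)%N -> (0 < b)%N ->
  m *+ b = m' *+ a -> frac m a = frac m' b.
Proof.
by move=> a0 b0 e; apply/fracP => //; exists 1%N => //; rewrite !muln1.
Qed.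

Fact rm_addA : associative rm_add.
Proof.
move=> x y z; have [m [a [a0 ->]]] := ratmodP x.
have [n [b [b0 ->]]] := ratmodP y; have [p [c [c0 ->]]] := ratmodP z.
rewrite !frac_add ?muln_gt0 ?a0 ?b0 ?c0 //.
apply: eq_frac; rewrite ?muln_gt0 ?a0 ?b0 ?c0 //.
rewrite !mulrnDl -!mulrnA -addrA.
by congr (_ *+ _ + (_ *+ _ + _ *+ _)); ring.
Qed.

Fact rm_addC : commutative rm_add.
Proof.
move=> x y; have [m [a [a0 ->]]] := ratmodP x.
by have [n [b [b0 ->]]] := ratmodP y; rewrite !frac_add // addrC mulnC.
Qed.

Fact rm_add0 : left_id (frac 0 1) rm_add.
Proof.
move=> x; have [m [a [a0 ->]]] := ratmodP x.
by rewrite frac_add // mul0rn add0r mulr1n mul1n.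
Qed.

Fact rm_addN : left_inverse (frac 0 1) rm_opp rm_add.
Proof.
move=> x; have [m [a [a0 ->]]] := ratmodP x.
rewrite frac_opp // frac_add //; apply: eq_frac; rewrite ?muln_gt0 ?a0 //.
by rewrite mulNrn addNr !mul0rn.
Qed.

HB.instance Definition _ :=
  GRing.isZmodule.Build ratmod rm_addA rm_addC rm_add0 rm_addN.

Lemma fracD m a m' b : (0 < a)%N -> (0 < b)%N ->
  frac m a + frac m' b = frac (m *+ b + m' *+ a) (a * b).
Proof. exact: frac_add. Qed.

Fact rm_scaleA p q x : rm_scale p (rm_scale q x) = rm_scale (p * q) x.
Proof.
have [m [a [a0 ->]]] := ratmodP x.
have d0 s : (0 < `|denq s|)%N by rewrite absz_gt0 denq_neq0.
rewrite !frac_scale ?muln_gt0 ?a0 ?d0 //.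
apply: eq_frac; rewrite ?muln_gt0 ?a0 ?d0 //.
rewrite !pmulrn -!mulrzA; congr (_ *~ _).
rewrite !PoszM !gez0_abs ?denq_ge0 //.
apply: (@intr_inj rat); rewrite !rmorphM /=.
have nz s : (denq s)%:~R != 0 :> rat by rewrite intr_eq0 denq_neq0.
have /eqP : (numq (p * q))%:~R / (denq (p * q))%:~R =
  ((numq p)%:~R / (denq p)%:~R) * ((numq q)%:~R / (denq q)%:~R) :> rat.
  by rewrite !divq_num_den.
rewrite mulf_div eqr_div ?mulf_neq0 // => /eqP e.
rewrite [LHS](_ : _ = a%:~R * (((numq p)%:~R * (numq q)%:~R) * (denq (p * q))%:~R)); last by ring.
by rewrite -e; ring.
Qed.

Fact rm_scale1 x : rm_scale 1 x = x.
Proof.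
by have [m [a [a0 ->]]] := ratmodP x; rewrite frac_scale // (numq_int 1) (denq_int 1) mulr1z muln1.
Qed.

Fact rm_scaleDr q (x y : ratmod) :
  rm_scale q (x + y) = rm_scale q x + rm_scale q y.
Proof.
have [m [a [a0 ->]]] := ratmodP x; have [n [b [b0 ->]]] := ratmodP y.
have d0 : (0 < `|denq q|)%N by rewrite absz_gt0 denq_neq0.
rewrite fracD // !frac_scale ?fracD ?muln_gt0 ?a0 ?b0 //.
apply: eq_frac; rewrite ?muln_gt0 ?a0 ?b0 ?d0 //.
rewrite mulrzDl !mulrnDl !pmulrn -!mulrzA.
by congr (_ *~ _ + _ *~ _); rewrite !PoszM; ring.
Qed.

Fact rm_scaleDl p q (x : ratmod) :
  rm_scale (p + q) x = rm_scale p x + rm_scale q x.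
Proof.
have [m [a [a0 ->]]] := ratmodP x.
have d0 s : (0 < `|denq s|)%N by rewrite absz_gt0 denq_neq0.
rewrite !frac_scale ?fracD ?muln_gt0 ?a0 ?d0 //.
apply: eq_frac; rewrite ?muln_gt0 ?a0 ?d0 //.
rewrite mulrnDl !pmulrn -!mulrzA -mulrzDr; congr (_ *~ _).
rewrite !PoszM !gez0_abs ?denq_ge0 //.
apply: (@intr_inj rat); rewrite rmorphD !rmorphM /=.
have nz s : (denq s)%:~R != 0 :> rat by rewrite intr_eq0 denq_neq0.
have /eqP : (numq (p + q))%:~R / (denq (p + q))%:~R =
  (numq p)%:~R / (denq p)%:~R + (numq q)%:~R / (denq q)%:~R :> rat.
  by rewrite !divq_num_den.
rewrite addf_div // eqr_div ?mulf_neq0 // => /eqP e.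
rewrite [LHS](_ : _ = a%:~R ^+ 2 * ((numq (p + q))%:~R * ((denq p)%:~R * (denq q)%:~R))); last by ring.
by rewrite e; ring.
Qed.

HB.instance Definition _ :=
  GRing.Zmodule_isLmodule.Build rat ratmod
    rm_scaleA rm_scale1 rm_scaleDr (fun x p q => rm_scaleDl p q x).

End Rationalisation.

(* A variety is represented by the topological space of its closed points and
   its sheaf of regular [K]-valued functions; [reg U f] says that [f] restricts
   to a regular function on the open set [U], and the values of [f] outside [U]
   are irrelevant. *)
Record fspace (K : fieldType) := FSpace {
  fpoint :> topologicalType;
  reg : set fpoint -> set (fpoint -> K);
  reg_ext : forall U f g, (forall x, U x -> f x = g x) -> reg U f -> reg U g;
  reg_res : forall U W f, W `<=` U -> reg U f -> reg W f;
  reg_glue : forall U f,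
    (forall x, U x -> exists W, [/\ open W, W x & reg (U `&` W) f]) -> reg U f;
  reg_cst : forall U c, reg U (fun=> c);
  reg_add : forall U f g, reg U f -> reg U g -> reg U (fun x => f x + g x);
  reg_mul : forall U f g, reg U f -> reg U g -> reg U (fun x => f x * g x);
  reg_inv : forall U f, (forall x, U x -> f x != 0) -> reg U f ->
    reg U (fun x => (f x)^-1);
  reg_open : forall U f, open U -> reg U f -> open (U `&` [set x | f x != 0])
}.

Record morphism (K : fieldType) (X Y : fspace K) := Morphism {
  mfun :> X -> Y;
  mfun_continuous : continuous mfun;
  mfun_reg : forall U f, open U -> reg U f ->
    reg (mfun @^-1` U) (fun x => f (mfun x))
}.

Definition iso_on (K : fieldType) (X Y : fspace K) (f : X -> Y)
    (U : set X) (W : set Y) :=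
  [/\ open U, open W, set_bij U W f,
      forall O, O `<=` U -> open O <-> open (f @` O) &
      forall O phi, O `<=` W -> open O ->
        reg O phi <-> reg (U `&` f @^-1` O) (fun x => phi (f x))].

(* [cls x] is the block containing [x] of a partition of [X]; a function on the
   quotient is regular when its pullback to [X] is. *)
Section QuotientSpace.
Variables (K : fieldType) (X : fspace K) (cls : X -> set X).

Definition quo_point : Type := set_type (range cls).
HB.instance Definition _ := Choice.on quo_point.

Definition quo_pi (x : X) : quo_point :=
  SigSub (mem_set (imageT cls x)).

Definition quo_open (U : set quo_point) := open (quo_pi @^-1` U).

Fact quo_openT : quo_open setT.
Proof. by rewrite /quo_open preimage_setT; exact: openT. Qed.
Fact quo_openI : setI_closed quo_open.
Proof. by move=> U W; exact: openI. Qed.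
Fact quo_open_bigU (I : Type) (f : I -> set quo_point) :
  (forall i, quo_open (f i)) -> quo_open (\bigcup_i f i).
Proof. by move=> of_; apply: bigcup_open => i _; exact: of_. Qed.
HB.instance Definition _ :=
  isOpenTopological.Build quo_point quo_openT quo_openI quo_open_bigU.

Definition quo_reg (U : set quo_point) (f : quo_point -> K) :=
  reg (quo_pi @^-1` U) (fun x => f (quo_pi x)).

Definition quo : fspace K.
Proof.
refine (@FSpace K quo_point quo_reg _ _ _ _ _ _ _ _).
- by move=> U f g e; apply: reg_ext => x; exact: e.
- by move=> U W f WU; apply: reg_res => x; exact: WU.
- move=> U f loc; apply: reg_glue => x Ux; have [W [oW Wx rW]] := loc _ Ux.
  by exists (quo_pi @^-1` W).
- by move=> U c; exact: reg_cst.
- by move=> U f g; exact: reg_add.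
- by move=> U f g; exact: reg_mul.
- by move=> U f f0; apply: reg_inv => x; exact: f0.
- by move=> U f oU; exact: reg_open.
Defined.

End QuotientSpace.

Definition mpeval (K : fieldType) N (p : mpoly.mpoly N K) (x : 'rV[K]_N) : K :=
  mpoly.meval (fun i => x 0 i) p.

Definition zeros (K : fieldType) N (S : set (mpoly.mpoly N K)) : set 'rV[K]_N :=
  [set x | forall p, S p -> mpeval p x = 0].

Section Affine.
Variables (K : fieldType) (N : nat) (Z : set 'rV[K]_N).

Definition aff_point : Type := set_type Z.
HB.instance Definition _ := Choice.on aff_point.

Definition aff_val (x : aff_point) : 'rV[K]_N := \val x.

Definition aff_open (U : set aff_point) := forall x, U x ->
  exists p, mpeval p (aff_val x) != 0 /\
    forall y, mpeval p (aff_val y) != 0 -> U y.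

Lemma mpevalM (p q : mpoly.mpoly N K) x :
  mpeval (p * q) x = mpeval p x * mpeval q x.
Proof. exact: mpoly.mevalM. Qed.

Lemma mpevalD (p q : mpoly.mpoly N K) x :
  mpeval (p + q) x = mpeval p x + mpeval q x.
Proof. exact: mpoly.mevalD. Qed.

Fact aff_openT : aff_open setT.
Proof.
by move=> x _; exists 1; split=> //; rewrite /mpeval mpoly.meval1 oner_neq0.
Qed.
Fact aff_openI : setI_closed aff_open.
Proof.
move=> U W oU oW x [/oU[p [px pU]] /oW[q [qx qW]]]; exists (p * q).
rewrite mpevalM mulf_neq0 //; split=> // y.
by rewrite mpevalM mulf_eq0 negb_or => /andP[/pU ? /qW].
Qed.
Fact aff_open_bigU (I : Type) (f : I -> set aff_point) :
  (forall i, aff_open (f i)) -> aff_open (\bigcup_i f i).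
Proof.
move=> of_ x [i _ fx]; have [p [px pf]] := of_ i x fx.
by exists p; split=> // y /pf; exists i.
Qed.
HB.instance Definition _ :=
  isOpenTopological.Build aff_point aff_openT aff_openI aff_open_bigU.

Definition aff_reg (U : set aff_point) (f : aff_point -> K) := forall x, U x ->
  exists p q, mpeval q (aff_val x) != 0 /\
    forall y, U y -> mpeval q (aff_val y) != 0 ->
      f y = mpeval p (aff_val y) / mpeval q (aff_val y).

Definition aff : fspace K.
Proof.
refine (@FSpace K aff_point aff_reg _ _ _ _ _ _ _ _).
- move=> U f g e rf x Ux; have [p [q [qx fE]]] := rf x Ux.
  by exists p, q; split=> // y Uy qy; rewrite -e // fE.
- move=> U W f WU rf x Wx; have [p [q [qx fE]]] := rf x (WU _ Wx).
  by exists p, q; split=> // y Wy; apply: fE; exact: WU.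
- move=> U f loc x Ux; have [W [oW Wx rW]] := loc x Ux.
  have [h [hx hW]] := oW x Wx; have [p [q [qx fE]]] := rW x (conj Ux Wx).
  exists (p * h), (q * h); rewrite mpevalM mulf_neq0 //; split=> // y Uy.
  rewrite !mpevalM mulf_eq0 negb_or => /andP[qy hy].
  by rewrite -mulf_div divff // mulr1; apply: fE => //; split=> //; exact: hW.
- move=> U c x Ux; exists (mpoly.mpolyC N c), 1.
  rewrite /mpeval mpoly.meval1 oner_neq0; split=> // y _ _.
  by rewrite mpoly.mevalC mpoly.meval1 divr1.
- move=> U f g rf rg x Ux; have [p [q [qx fE]]] := rf x Ux.
  have [p' [q' [qx' gE]]] := rg x Ux.
  exists (p * q' + p' * q), (q * q'); rewrite mpevalM mulf_neq0 //.
  split=> // y Uy; rewrite mpevalM mulf_eq0 negb_or => /andP[qy qy'].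
  by rewrite fE // gE // mpevalD !mpevalM addf_div.
- move=> U f g rf rg x Ux; have [p [q [qx fE]]] := rf x Ux.
  have [p' [q' [qx' gE]]] := rg x Ux.
  exists (p * p'), (q * q'); rewrite mpevalM mulf_neq0 //.
  split=> // y Uy; rewrite mpevalM mulf_eq0 negb_or => /andP[qy qy'].
  by rewrite fE // gE // !mpevalM mulf_div.
- move=> U f f0 rf x Ux; have [p [q [qx fE]]] := rf x Ux.
  have px : mpeval p (aff_val x) != 0.
    by apply: contra (f0 x Ux); rewrite fE // => /eqP ->; rewrite mul0r.
  exists (q * q), (p * q); rewrite mpevalM mulf_neq0 //; split=> // y Uy.
  rewrite !mpevalM mulf_eq0 negb_or => /andP[py qy].
  by rewrite fE // invf_div -mulf_div divff // mulr1.
- move=> U f oU rf; change (aff_open (U `&` [set x | f x != 0])) => x [Ux /= fx]; have [p [q [qx fE]]] := rf x Ux.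
  have [h [hx hU]] := oU x Ux.
  have px : mpeval p (aff_val x) != 0.
    by apply: contra fx; rewrite fE // => /eqP ->; rewrite mul0r.
  exists (h * (p * q)); rewrite !mpevalM !mulf_neq0 //; split=> // y.
  rewrite !mpevalM !mulf_eq0 !negb_or => /and3P[hy py qy].
  by split; [exact: hU|rewrite /= fE ?mulf_neq0 ?invr_eq0 //; exact: hU].
Defined.

End Affine.

Record gralg (K : fieldType) (T : Type) := GrAlg {
  gr :> nat -> set (T -> K);
  gr_scale : forall j c f, gr j f -> gr j (fun v => c * f v);
  gr_add : forall j f g, gr j f -> gr j g -> gr j (fun v => f v + g v);
  gr_mul : forall i j f g, gr i f -> gr j g -> gr (i + j)%N (fun v => f v * g v)
}.

Section Proj.
Variables (K : fieldType) (T : Type) (S : gralg K T).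

Definition semistable : set T :=
  [set v | exists j f, [/\ (0 < j)%N, S j f & f v != 0]].

(* The homogeneous prime ideal of [v], given by its graded pieces. For the
   semi-invariants of a reductive group acting on an affine variety, every
   closed point of Proj is the ideal of a semistable point. *)
Definition hideal (v : T) : nat -> set (T -> K) :=
  fun j => [set f | S j f /\ f v = 0].

Definition proj_point : Type := set_type (hideal @` semistable).
HB.instance Definition _ := Choice.on proj_point.

Definition proj_ideal (p : proj_point) : nat -> set (T -> K) := \val p.

Definition proj_pi (v : set_type semistable) : proj_point :=
  SigSub (mem_set (imageP hideal (set_valP v))).

Definition proj_basic j (f : T -> K) : set proj_point :=
  [set p | ~ proj_ideal p j f].

Lemma proj_piP (p : proj_point) : exists v, p = proj_pi v.
Proof.
have [v sv e] := set_valP p; exists (SigSub (mem_set sv)).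
by apply: val_inj; rewrite /= -e.
Qed.

Lemma proj_basicE j f v : S j f -> proj_basic j f (proj_pi v) <-> f (\val v) != 0.
Proof.
move=> Sf; rewrite /proj_basic /=; split.
  by move=> h; apply/eqP => f0; apply: h; split.
by move=> /eqP h [_ /h].
Qed.

Definition proj_open (U : set proj_point) := forall p, U p ->
  exists j f, [/\ (0 < j)%N, S j f, proj_basic j f p & proj_basic j f `<=` U].

Fact proj_openT : proj_open setT.
Proof.
move=> p _; have [v ->] := proj_piP p.
have [j [f [j0 Sf fv]]] := set_valP v.
by exists j, f; split=> //; apply/proj_basicE.
Qed.

Lemma proj_basicM i f j g : S i f -> S j g ->
  proj_basic (i + j)%N (fun v => f v * g v) = proj_basic i f `&` proj_basic j g.
Proof.
move=> Sf Sg; apply/seteqP; split=> p; have [v ->] := proj_piP p.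
  move=> /(proj_basicE _ (gr_mul Sf Sg)); rewrite mulf_eq0 negb_or => /andP[? ?].
  by split; apply/proj_basicE.
move=> [/(proj_basicE _ Sf) fv /(proj_basicE _ Sg) gv].
by apply/(proj_basicE _ (gr_mul Sf Sg)); rewrite mulf_neq0.
Qed.

Fact proj_openI : setI_closed proj_open.
Proof.
move=> U W oU oW p [/oU[i [f [i0 Sf fp fU]]] /oW[j [g [j0 Sg gp gW]]]].
exists (i + j)%N, (fun v => f v * g v); rewrite proj_basicM //; split=> //.
- by rewrite addn_gt0 i0.
- exact: gr_mul.
- exact: setISS.
Qed.

Fact proj_open_bigU (I : Type) (f : I -> set proj_point) :
  (forall i, proj_open (f i)) -> proj_open (\bigcup_i f i).
Proof.
move=> of_ p [i _ fp]; have [j [g [j0 Sg gp gf]]] := of_ i p fp.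
by exists j, g; split=> // q /gf; exists i.
Qed.

HB.instance Definition _ :=
  isOpenTopological.Build proj_point proj_openT proj_openI proj_open_bigU.

(* Locally, fractions [g / f] with [f] and [g] of the same degree. *)
Definition proj_reg (U : set proj_point) (phi : proj_point -> K) :=
  forall p, U p -> exists j f g, [/\ (0 < j)%N, S j f, S j g,
    proj_basic j f p & forall v, U (proj_pi v) -> f (\val v) != 0 ->
      phi (proj_pi v) = g (\val v) / f (\val v)].

Definition proj : fspace K.
Proof.
refine (@FSpace K proj_point proj_reg _ _ _ _ _ _ _ _).
- move=> U f g e rf p Up; have [j [a [b [j0 Sa Sb ap fE]]]] := rf p Up.
  by exists j, a, b; split=> // v Uv av; rewrite -e // fE.
- move=> U W f WU rf p Wp; have [j [a [b [j0 Sa Sb ap fE]]]] := rf p (WU _ Wp).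
  by exists j, a, b; split=> // v Wv; apply: fE; exact: WU.
- move=> U phi loc p Up; have [W [oW Wp rW]] := loc p Up.
  have [i [h [i0 Sh hp hW]]] := oW p Wp.
  have [j [a [b [j0 Sa Sb ap fE]]]] := rW p (conj Up Wp).
  exists (j + i)%N, (fun v => a v * h v), (fun v => b v * h v).
  rewrite proj_basicM // addn_gt0 j0; split=> //; try exact: gr_mul.
  move=> v Uv; rewrite mulf_eq0 negb_or => /andP[av hv].
  rewrite -mulf_div divff // mulr1; apply: fE => //; split=> //.
  by apply: hW; apply/proj_basicE.
- move=> U c p Up; have [j [f [j0 Sf fp _]]] := proj_openT (I : setT p).
  exists j, f, (fun v => c * f v); split=> //; first exact: gr_scale.
  by move=> v _ fv; rewrite mulfK.
- move=> U phi psi rphi rpsi p Up.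
  have [i [a [b [i0 Sa Sb ap fE]]]] := rphi p Up.
  have [j [c [d [j0 Sc Sd cp gE]]]] := rpsi p Up.
  exists (i + j)%N, (fun v => a v * c v), (fun v => b v * c v + d v * a v).
  rewrite proj_basicM // addn_gt0 i0; split=> //; try exact: gr_mul.
    by apply: gr_add; [exact: gr_mul|rewrite addnC; exact: gr_mul].
  move=> v Uv; rewrite mulf_eq0 negb_or => /andP[av cv].
  by rewrite fE // gE // addf_div.
- move=> U phi psi rphi rpsi p Up.
  have [i [a [b [i0 Sa Sb ap fE]]]] := rphi p Up.
  have [j [c [d [j0 Sc Sd cp gE]]]] := rpsi p Up.
  exists (i + j)%N, (fun v => a v * c v), (fun v => b v * d v).
  rewrite proj_basicM // addn_gt0 i0; split=> //; try exact: gr_mul.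
  move=> v Uv; rewrite mulf_eq0 negb_or => /andP[av cv].
  by rewrite fE // gE // mulf_div.
- move=> U phi phi0 rphi p Up; have [j [a [b [j0 Sa Sb ap fE]]]] := rphi p Up.
  have bp : proj_basic j b p.
    move: Up ap; have [v ->] := proj_piP p => Uv /(proj_basicE _ Sa) av.
    apply/(proj_basicE _ Sb); apply: contra (phi0 _ Uv).
    by rewrite fE // => /eqP ->; rewrite mul0r.
  exists (j + j)%N, (fun v => b v * a v), (fun v => a v * a v).
  rewrite proj_basicM // addn_gt0 j0; split=> //; try exact: gr_mul.
  move=> v Uv; rewrite mulf_eq0 negb_or => /andP[bv av].
  by rewrite fE // invf_div -mulf_div divff // mulr1.
- move=> U phi oU rphi; change (proj_open (U `&` [set x | phi x != 0])) => p [Up /= phip].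
  have [j [a [b [j0 Sa Sb ap fE]]]] := rphi p Up.
  have [i [h [i0 Sh hp hU]]] := oU p Up.
  have bp : proj_basic j b p.
    move: Up ap phip {hp}; have [v ->] := proj_piP p.
    move=> Uv /(proj_basicE _ Sa) av phiv.
    apply/(proj_basicE _ Sb); apply: contra phiv.
    by rewrite fE // => /eqP ->; rewrite mul0r.
  have Sab := gr_mul Sa Sb.
  exists (i + (j + j))%N, (fun v => h v * (a v * b v)).
  rewrite (proj_basicM Sh Sab) (proj_basicM Sa Sb).
  rewrite addn_gt0 i0; split=> //; first exact: gr_mul.
  move=> q; have [v ->] := proj_piP q => -[/hU Uv [av bv]]; split=> //=.
  move/(proj_basicE _ Sa): av => av; move/(proj_basicE _ Sb): bv => bv.
  by rewrite fE // mulf_neq0 ?invr_eq0.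
Defined.

End Proj.

Section Picard.
Variables (K : fieldType) (X : fspace K).

(* A line bundle is given by a trivialisation around each point, with transition
   functions [ltr x y] from the trivialisation at [y] to that at [x]. *)
Record line_bundle := LineBundle {
  ldom : X -> set X;
  ltr : X -> X -> X -> K;
  ldom_open : forall x, open (ldom x);
  ldom_self : forall x, ldom x x;
  ltr_reg : forall x y, reg (ldom x `&` ldom y) (ltr x y);
  ltr_id : forall x p, ldom x p -> ltr x x p = 1;
  ltr_cocycle : forall x y z p, ldom x p -> ldom y p -> ldom z p ->
    ltr x y p * ltr y z p = ltr x z p
}.

HB.instance Definition _ := gen_eqMixin line_bundle.
HB.instance Definition _ := gen_choiceMixin line_bundle.

Definition lb_iso (L M : line_bundle) := exists (W : X -> set X) (h : X -> X -> K),
  (forall x, [/\ open (W x), W x x, W x `<=` ldom L x `&` ldom M x,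
    reg (W x) (h x) & forall p, W x p -> h x p != 0]) /\
  forall x y p, W x p -> W y p -> h x p * ltr L x y p = ltr M x y p * h y p.

Lemma ltr_sym (L : line_bundle) x y p :
  ldom L x p -> ldom L y p -> ltr L x y p * ltr L y x p = 1.
Proof. by move=> xp yp; rewrite ltr_cocycle // ltr_id. Qed.

Lemma ltr_neq0 (L : line_bundle) x y p :
  ldom L x p -> ldom L y p -> ltr L x y p != 0.
Proof.
move=> xp yp; apply/eqP => e; have := ltr_sym xp yp.
by rewrite e mul0r => /esym/eqP; rewrite oner_eq0.
Qed.

Definition lb_triv : line_bundle.
Proof.
refine (@LineBundle (fun=> setT) (fun _ _ _ => 1) _ _ _ _ _) => //.
- by move=> _; exact: openT.
- by move=> x y; exact: reg_cst.
- by move=> *; rewrite mulr1.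
Defined.

Definition lb_tensor (L M : line_bundle) : line_bundle.
Proof.
refine (@LineBundle (fun x => ldom L x `&` ldom M x)
  (fun x y p => ltr L x y p * ltr M x y p) _ _ _ _ _).
- by move=> x; apply: openI; exact: ldom_open.
- by move=> x; split; exact: ldom_self.
- move=> x y; apply: reg_mul.
    by apply: reg_res (ltr_reg L x y) => p [[? ?] [? ?]].
  by apply: reg_res (ltr_reg M x y) => p [[? ?] [? ?]].
- by move=> x p [Lp Mp]; rewrite !ltr_id // mulr1.
- move=> x y z p [? ?] [? ?] [? ?].
  by rewrite mulrACA !ltr_cocycle.
Defined.

Definition lb_dual (L : line_bundle) : line_bundle.
Proof.
refine (@LineBundle (ldom L) (fun x y p => (ltr L x y p)^-1) _ _ _ _ _).
- exact: ldom_open.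
- exact: ldom_self.
- move=> x y; apply: reg_inv; last exact: ltr_reg.
  by move=> p [xp yp]; exact: ltr_neq0.
- by move=> x p xp; rewrite ltr_id // invr1.
- by move=> x y z p xp yp zp; rewrite -invfM ltr_cocycle.
Defined.

Lemma lb_iso_refl L : lb_iso L L.
Proof.
exists (ldom L), (fun _ _ => 1); split=> [x|x y p _ _]; last first.
  by rewrite mul1r mulr1.
split=> //; [exact: ldom_open|exact: ldom_self|exact: reg_cst|].
by move=> p _; exact: oner_neq0.
Qed.

Lemma lb_iso_sym L M : lb_iso L M -> lb_iso M L.
Proof.
move=> [W [h [Wh hE]]]; exists W, (fun x p => (h x p)^-1); split=> [x|x y p xp yp].
  have [oW Wx WLM rh h0] := Wh x; split=> //.
  - by move=> p /WLM [].
  - exact: reg_inv.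
  - by move=> p /h0; rewrite invr_eq0.
have [_ _ _ _ /(_ p xp) h0] := Wh x; have [_ _ _ _ /(_ p yp) k0] := Wh y.
apply: (mulfI h0); rewrite mulrA divff // mul1r; apply: (mulIf k0).
by rewrite -hE // -!mulrA mulVf // mulr1.
Qed.

Lemma lb_iso_trans L M N : lb_iso L M -> lb_iso M N -> lb_iso L N.
Proof.
move=> [W [h [Wh hE]]] [W' [h' [Wh' hE']]].
exists (fun x => W x `&` W' x), (fun x p => h' x p * h x p).
split=> [x|x y p [xp xp'] [yp yp']]; last first.
  by rewrite -mulrA hE // !mulrA hE'.
have [oW Wx WLM rh h0] := Wh x; have [oW' Wx' WMN rh' h0'] := Wh' x.
split=> //.
- exact: openI.
- by move=> p [/WLM[? _] /WMN[_ ?]].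
- by apply: reg_mul; [apply: reg_res rh' => p []|apply: reg_res rh => p []].
- by move=> p [Wp Wp']; rewrite mulf_neq0 ?h0 ?h0'.
Qed.

Lemma lb_iso_tensor L L' M M' :
  lb_iso L L' -> lb_iso M M' -> lb_iso (lb_tensor L M) (lb_tensor L' M').
Proof.
move=> [W [h [Wh hE]]] [W' [h' [Wh' hE']]].
exists (fun x => W x `&` W' x), (fun x p => h x p * h' x p).
split=> [x|x y p [xp xp'] [yp yp'] /=]; last first.
  by rewrite mulrACA hE // hE' // mulrACA.
have [oW Wx WLM rh h0] := Wh x; have [oW' Wx' WMN rh' h0'] := Wh' x.
split=> //.
- exact: openI.
- by move=> p [/WLM[? ?] /WMN[? ?]].
- by apply: reg_mul; [apply: reg_res rh => p []|apply: reg_res rh' => p []].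
- by move=> p [Wp Wp']; rewrite mulf_neq0 ?h0 ?h0'.
Qed.

Lemma lb_iso_dual L M : lb_iso L M -> lb_iso (lb_dual L) (lb_dual M).
Proof.
move=> [W [h [Wh hE]]]; exists W, (fun x p => (h x p)^-1).
split=> [x|x y p xp yp /=]; last by rewrite -!invfM hE.
have [oW Wx WLM rh h0] := Wh x; split=> //; first exact: reg_inv.
by move=> p /h0; rewrite invr_eq0.
Qed.

Lemma lb_iso_eq L M :
  (forall x y p, ldom L x p -> ldom L y p -> ldom M x p -> ldom M y p ->
    ltr L x y p = ltr M x y p) -> lb_iso L M.
Proof.
move=> e; exists (fun x => ldom L x `&` ldom M x), (fun _ _ => 1).
split=> [x|x y p [? ?] [? ?]]; last by rewrite mul1r mulr1 e.
split=> //.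
- by apply: openI; exact: ldom_open.
- by split; exact: ldom_self.
- exact: reg_cst.
- by move=> p _; exact: oner_neq0.
Qed.

Definition lb_eq (L M : line_bundle) : bool := `[< lb_iso L M >].

Lemma lb_eq_equiv : equiv_class_of lb_eq.
Proof.
split=> [L|L M|M L N].
- by apply/asboolP; exact: lb_iso_refl.
- by apply/asboolP/asboolP; exact: lb_iso_sym.
- by move=> /asboolP a /asboolP b; apply/asboolP; exact: lb_iso_trans a b.
Qed.

Canonical lb_eq_rel := EquivRelPack lb_eq_equiv.

Definition Pic := {eq_quot lb_eq}.
HB.instance Definition _ := Choice.on Pic.

Definition pic (L : line_bundle) : Pic := \pi_Pic L.

Lemma picP L M : pic L = pic M <-> lb_iso L M.
Proof.
split=> [|h]; last exact/eqmodP/asboolP.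
by move=> /eqmodP/asboolP.
Qed.

Lemma pic_repr (a : Pic) : pic (repr a) = a.
Proof. exact: reprK. Qed.

Lemma picW (a : Pic) : exists L, a = pic L.
Proof. by exists (repr a); rewrite pic_repr. Qed.

Definition pic_add (a b : Pic) := pic (lb_tensor (repr a) (repr b)).
Definition pic_opp (a : Pic) := pic (lb_dual (repr a)).

Lemma pic_tensor L M : pic_add (pic L) (pic M) = pic (lb_tensor L M).
Proof. by apply/picP/lb_iso_tensor; apply/picP; rewrite pic_repr. Qed.

Lemma pic_dual L : pic_opp (pic L) = pic (lb_dual L).
Proof. by apply/picP/lb_iso_dual; apply/picP; rewrite pic_repr. Qed.

Fact pic_addA : associative pic_add.
Proof.
move=> a b c; have [L ->] := picW a; have [M ->] := picW b.
have [N ->] := picW c; rewrite !pic_tensor; apply/picP/lb_iso_eq => * /=.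
by rewrite mulrA.
Qed.

Fact pic_addC : commutative pic_add.
Proof.
move=> a b; have [L ->] := picW a; have [M ->] := picW b.
by rewrite !pic_tensor; apply/picP/lb_iso_eq => * /=; rewrite mulrC.
Qed.

Fact pic_add0 : left_id (pic lb_triv) pic_add.
Proof.
move=> a; have [L ->] := picW a.
by rewrite pic_tensor; apply/picP/lb_iso_eq => * /=; rewrite mul1r.
Qed.

Fact pic_addN : left_inverse (pic lb_triv) pic_opp pic_add.
Proof.
move=> a; have [L ->] := picW a; rewrite pic_dual pic_tensor.
by apply/picP/lb_iso_eq => x y p [? ?] [? ?] _ _ /=; rewrite mulVf // ltr_neq0.
Qed.

HB.instance Definition _ :=
  GRing.isZmodule.Build Pic pic_addA pic_addC pic_add0 pic_addN.

End Picard.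

Arguments pic {K X} L.

Section PicardOver.
Variables (K : fieldType) (X Y : fspace K) (f : morphism X Y).

Definition lb_pullback (M : line_bundle Y) : line_bundle X.
Proof.
refine (@LineBundle K X (fun x => f @^-1` ldom M (f x))
  (fun x y p => ltr M (f x) (f y) (f p)) _ _ _ _ _).
- move=> x; have /continuousP := @mfun_continuous _ _ _ f; apply.
  exact: ldom_open.
- by move=> x; exact: ldom_self.
- move=> x y; apply: (@mfun_reg _ _ _ f (ldom M (f x) `&` ldom M (f y))); last exact: ltr_reg.
  by apply: openI; exact: ldom_open.
- by move=> x p; exact: ltr_id.
- by move=> x y z p; exact: ltr_cocycle.
Defined.

Definition pullback_class : {pred Pic X} :=
  fun a => `[< exists M : line_bundle Y, a = pic (lb_pullback M) >].

Fact pullback_class_zmod_closed : zmod_closed pullback_class.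
Proof.
split=> [|a b].
  apply/asboolP; exists (lb_triv Y); apply/picP/lb_iso_eq => * /=.
  by [].
move=> /asboolP[M ->] /asboolP[N ->]; apply/asboolP.
exists (lb_tensor M (lb_dual N)).
rewrite [_ - _](_ : _ = pic_add (pic (lb_pullback M)) (pic_opp (pic (lb_pullback N)))) //.
by rewrite pic_dual pic_tensor; apply/picP/lb_iso_eq => * /=.
Qed.

HB.instance Definition _ :=
  GRing.isZmodClosed.Build (Pic X) pullback_class pullback_class_zmod_closed.

(* [(Pic X / f^* Pic Y) (x) Q] *)
Definition PicQ_over := ratmod (Quotient.quot pullback_class).
HB.instance Definition _ := GRing.Lmodule.on PicQ_over.

Definition pic_fraction (j : nat) (L : line_bundle X) : PicQ_over :=
  frac (\pi_(Quotient.quot pullback_class) (pic L)) j.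

End PicardOver.

Section Dimension.
Variable T : topologicalType.
Implicit Types (S D : set T) (Z : nat -> set T).

Definition irreducible_set S := S !=set0 /\
  forall F G, closed F -> closed G -> S `<=` F `|` G -> S `<=` F \/ S `<=` G.

Definition irr_chain Z d :=
  (forall i, (i <= d)%N -> closed (Z i) /\ irreducible_set (Z i)) /\
  (forall i, (i < d)%N -> Z i `<` Z i.+1).

Definition dim_ge d := exists Z, irr_chain Z d.

(* The Krull dimension of the local ring at [x]. *)
Definition dim_at_ge (x : T) d := exists Z, irr_chain Z d /\ Z 0%N x.

Definition codim_ge S c := forall D, closed D -> irreducible_set D ->
  D `<=` closure S -> exists Z, irr_chain Z c /\ Z 0%N = D.

Definition prime_divisor D := [/\ closed D, irreducible_set D,
  codim_ge D 1 & ~ codim_ge D 2].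

Definition curve D := [/\ closed D, irreducible_set D,
  exists Z, irr_chain Z 1 /\ Z 1%N = D &
  ~ exists Z, irr_chain Z 2 /\ Z 2%N = D].

End Dimension.

Section Varieties.
Variables (K : fieldType) (X : fspace K).

Definition affine_open (U : set X) :=
  exists N (S : set (mpoly.mpoly N K)) (phi : aff (zeros S) -> X),
    iso_on phi setT U.

(* Separatedness is tested on morphisms from affine algebraic sets. *)
Definition variety := [/\ irreducible_set [set: X],
  exists k (U : 'I_k -> set X),
    (forall i, affine_open (U i)) /\ forall x, exists i, U i x &
  forall N (S : set (mpoly.mpoly N K)) (f g : morphism (aff (zeros S)) X),
    closed [set z | f z = g z]].

(* Each local ring [O_x] is integrally closed in the field of rational
   functions; [f], regular on a nonempty open [U], is a rational function. *)
Definition normal := irreducible_set [set: X] /\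
  forall (x : X) (U : set X) f, open U -> U !=set0 -> reg U f ->
    (exists (W : set X) m (a : nat -> X -> K), [/\ open W, W x,
       forall i, (i < m)%N -> reg W (a i) &
       forall y, U y -> W y -> f y ^+ m + \sum_(i < m) a i y * f y ^+ i = 0]) ->
    exists (W : set X) g, [/\ open W, W x, reg W g &
       forall y, U y -> W y -> g y = f y].

(* Each [O_x] is a regular local ring: its maximal ideal is generated by
   [dim O_x] elements. *)
Definition nonsingular := forall x : X, exists d (W : set X) (t : 'I_d -> X -> K),
  [/\ dim_at_ge x d, ~ dim_at_ge x d.+1,
      open W /\ W x, forall i, reg W (t i) /\ t i x = 0 &
      forall U f, open U -> U x -> reg U f -> f x = 0 ->
        exists (W' : set X) (h : 'I_d -> X -> K),
          [/\ open W', W' x, W' `<=` U `&` W, forall i, reg W' (h i) &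
              forall y, W' y -> f y = \sum_i h i y * t i y]].

Definition meets (U E : set X) := U `&` E !=set0.

(* [t], regular on [U], generates the maximal ideal of the local ring of [X]
   along [E]. *)
Definition uniformizer (E U : set X) (t : X -> K) :=
  [/\ open U, meets U E, reg U t, forall x, U x -> E x -> t x = 0 &
      forall U' h, open U' -> meets U' E -> reg U' h ->
        (forall x, U' x -> E x -> h x = 0) ->
        exists U'' q, [/\ open U'', meets U'' E, U'' `<=` U `&` U', reg U'' q &
          forall x, U'' x -> h x = q x * t x]].

Definition ord_along (E W : set X) (f : X -> K) (k : nat) :=
  exists U t u, [/\ uniformizer E U t, U `<=` W, reg U u,
    forall x, U x -> u x != 0 & forall x, U x -> f x = u x * t x ^+ k].

Definition weil_divisor (D : set X -> int) :=
  finite_set [set E | D E != 0] /\ forall E, D E != 0 -> prime_divisor E.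

(* The local equation of [D] on [W] is the rational function [a / b]. *)
Definition cartier (D : set X -> int) := forall x : X,
  exists (W : set X) a b, [/\ open W, W x, reg W a, reg W b &
    forall E, prime_divisor E -> meets W E -> exists k l : nat,
      [/\ ord_along E W a k, ord_along E W b l & k%:Z - l%:Z = D E]].

Definition Qfactorial := forall D, weil_divisor D ->
  exists2 m : nat, (0 < m)%N & cartier (fun E => m%:Z * D E).

End Varieties.

Arguments variety {K} X.
Arguments normal {K} X.
Arguments nonsingular {K} X.
Arguments Qfactorial {K} X.

Section MorphismTypes.
Variables (K : fieldType) (X Y : fspace K) (tau : X -> Y).

Definition fibre_component (x : X) : set X :=
  connected_component (tau @^-1` [set tau x]) x.

(* For projective [tau], the middle term [Spec_Y (tau_* O_X)] of the Stein
   factorisation: its points are the connected components of the fibres. The map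
   [stein_map] is proper and surjective, so the topology is the quotient one,
   and the structure sheaf is the direct image of that of [X]. *)
Definition stein : fspace K := quo fibre_component.
Definition stein_map : X -> stein := quo_pi fibre_component.

Definition exceptional_locus : set X :=
  [set x | ~ exists U W, U x /\ iso_on stein_map U W].

Definition fibre_type := exists d, dim_ge X d /\ ~ dim_ge stein d.

Definition divisorial := ~ fibre_type /\
  exists D, prime_divisor D /\ D `<=` exceptional_locus.

Definition small := ~ fibre_type /\
  ~ exists D, prime_divisor D /\ D `<=` exceptional_locus.

Definition contracts_curve := exists D (y : Y), curve D /\ tau @` D = [set y].

End MorphismTypes.

Definition spans_lattice r n (A : 'M[int]_(r, n)) :=
  forall y : 'cV[int]_r, exists x : 'cV[int]_n, y = A *m x.

Definition gale_dual r n (A : 'M[int]_(r, n)) (B : 'M[int]_(n, n - r)) :=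
  [/\ forall x : 'cV[int]_(n - r), B *m x = 0 -> x = 0,
      forall y : 'cV[int]_n, A *m y = 0 <-> exists x, y = B *m x &
      spans_lattice A].

Section Hypertoric.
Variables (R : realType) (r n : nat) (A : 'M[int]_(r, n)).
Local Notation C := R[i].

(* A point of [T^* C^n] is the row [(z, w)]. *)
Definition moment (v : 'rV[C]_(n + n)) : 'cV[C]_r :=
  \sum_i (lsubmx v 0 i * rsubmx v 0 i) *: map_mx intr (col i A).

(* When no row of the Gale dual is zero, the ideal of [mu^-1(0)] is prime, so
   the scheme [mu^-1(0)] is the variety of its closed points. *)
Definition V : fspace C := aff [set v | moment v = 0].

Definition torus : Type := {g : 'rV[C]_r | [forall k, g 0 k != 0]}.

Definition chr (chi : 'rV[int]_r) (g : torus) : C :=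
  \prod_k (\val g 0 k) ^ (chi 0 k).

Lemma chr_neq0 chi g : chr chi g != 0.
Proof.
rewrite prodf_seq_neq0; apply/allP => k _ /=; apply: expfz_neq0.
by have /forallP := valP g.
Qed.

Lemma chrD chi psi g : chr (chi + psi) g = chr chi g * chr psi g.
Proof.
rewrite -big_split /=; apply: eq_bigr => k _; rewrite mxE expfzDr //.
by have /forallP := valP g.
Qed.

Definition act_pt (g : torus) (v : 'rV[C]_(n + n)) : 'rV[C]_(n + n) :=
  row_mx (\row_i (chr (col i A)^T g * lsubmx v 0 i))
         (\row_i ((chr (col i A)^T g)^-1 * rsubmx v 0 i)).

Fact act_moment g v : moment v = 0 -> moment (act_pt g v) = 0.
Proof.
move=> <-; apply: eq_bigr => i _; rewrite row_mxKl row_mxKr !mxE.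
by rewrite mulrACA divff ?chr_neq0 // mul1r.
Qed.

Definition act (g : torus) (v : V) : V :=
  SigSub (mem_set (act_moment g (set_valP v))).

Lemma intr_mx_inj m : injective (map_mx intr : 'rV[int]_m -> 'rV[rat]_m).
Proof.
move=> chi psi /rowP e; apply/rowP => k; apply: (@intr_inj rat).
by have := e k; rewrite !mxE.
Qed.

Definition semi_invariant (chi : 'rV[int]_r) : set (V -> C) :=
  [set f | (exists p, forall v, f v = mpeval p (aff_val v)) /\
           forall g v, f (act g v) = chr chi g * f v].

(* [C[V]_(j theta)] for a rational [theta]; empty when [j theta] is not
   integral. *)
Definition weight_part (theta : 'rV[rat]_r) (j : nat) : set (V -> C) :=
  [set f | exists2 chi, map_mx intr chi = theta *+ j & semi_invariant chi f].

Definition semi_invariants (theta : 'rV[rat]_r) : gralg C V.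
Proof.
refine (@GrAlg C V (weight_part theta) _ _ _).
- move=> j c f [chi e [[p fE] finv]]; exists chi => //; split.
    exists (mpoly.mpolyC _ c * p) => v.
    by rewrite mpevalM fE /mpeval mpoly.mevalC.
  by move=> g v; rewrite finv mulrCA.
- move=> j f g [chi e [[p fE] finv]] [psi e' [[q gE] ginv]].
  have ep : psi = chi.
    by apply: intr_mx_inj; rewrite e e'.
  exists chi => //; split.
    by exists (p + q) => v; rewrite mpevalD fE gE.
  by move=> h v; rewrite finv ginv ep mulrDr.
- move=> i j f g [chi e [[p fE] finv]] [psi e' [[q gE] ginv]].
  exists (chi + psi); first by rewrite map_mxD e e' mulrnDr.
  split; first by exists (p * q) => v; rewrite mpevalM fE gE.
  by move=> h v; rewrite finv ginv chrD mulrACA.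
Defined.

Definition Vss theta : set V := semistable (semi_invariants theta).

Definition orbit (v : V) : set V := range (act^~ v).

Definition stable theta (v : V) := [/\ Vss theta v,
  finite_set [set g | act g v = v] &
  closure (orbit v) `&` Vss theta `<=` orbit v].

Definition generic theta := Vss theta !=set0 /\ Vss theta `<=` stable theta.

Definition X theta : fspace C := proj (semi_invariants theta).

Definition quot_map theta (v : set_type (Vss theta)) : X theta :=
  proj_pi (S := semi_invariants theta) v.

Fact weight0_const : weight_part 0 1 (fun=> 1).
Proof.
exists 0; first by rewrite map_mx0 mul0rn.
split; first by exists 1 => v; rewrite /mpeval mpoly.meval1.
move=> g v; rewrite /chr big1 ?mulr1 // => k _.
by rewrite mxE expr0z.
Qed.

Fact Vss0 (v : V) : Vss 0 v.
Proof.
by exists 1%N, (fun=> 1); split; [|exact: weight0_const|exact: oner_neq0].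
Qed.

Lemma weight0_mul theta i j f h : weight_part theta j f -> weight_part 0 i h ->
  weight_part theta j (fun v => f v * h v).
Proof.
move=> [chi e [[p fE] finv]] [psi e' [[q hE] hinv]].
have psi0 : psi = 0.
  by apply: intr_mx_inj; rewrite e' mul0rn map_mx0.
exists chi => //; split; first by exists (p * q) => v; rewrite mpevalM fE hE.
by move=> g v; rewrite finv hinv psi0 -[chi in RHS]addr0 chrD mulrACA.
Qed.

Definition to_ss0 theta (v : set_type (Vss theta)) : set_type (Vss 0) :=
  SigSub (mem_set (Vss0 (\val v))).

Definition aff_quot_fun theta (p : X theta) : X 0 :=
  quot_map (to_ss0 (projT1 (cid (proj_piP (p : proj_point _))))).

Lemma aff_quot_funE theta (v : set_type (Vss theta)) :
  aff_quot_fun (quot_map v) = quot_map (to_ss0 v).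
Proof.
rewrite /aff_quot_fun; case: cid => u /= e; apply: val_inj => /=.
have [j [f [j0 Sf fv]]] := set_valP v.
have vu i h : weight_part theta i h -> h (\val v) = 0 <-> h (\val u) = 0.
  move=> Sh; have := congr1 (fun p => proj_ideal p i h) e.
  rewrite /proj_ideal /= /hideal /= => E.
  by split=> h0; [have: weight_part theta i h /\ h (\val u) = 0 by rewrite -E
    | have: weight_part theta i h /\ h (\val v) = 0 by rewrite E] => -[].
have fu : f (\val u) != 0 by apply: contra fv => /eqP/(vu _ _ Sf)/eqP.
apply/funext => i; apply/seteqP; split=> h [Sh h0]; split=> //.
  have := (vu _ _ (weight0_mul Sf Sh)).2; rewrite h0 mulr0 => /(_ erefl)/eqP.
  by rewrite mulf_eq0 (negPf fv) => /eqP.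
have := (vu _ _ (weight0_mul Sf Sh)).1; rewrite h0 mulr0 => /(_ erefl)/eqP.
by rewrite mulf_eq0 (negPf fu) => /eqP.
Qed.

Definition aff_quot theta : morphism (X theta) (X 0).
Proof.
refine (@Morphism _ _ _ (@aff_quot_fun theta) _ _).
  apply/continuousP => U oU; change (proj_open (@aff_quot_fun theta @^-1` U)).
  move=> p; have [v ->] := proj_piP p.
  rewrite /preimage /= -[proj_pi v]/(quot_map v) aff_quot_funE => Uv.
  have [i [h [i0 Sh hv hU]]] := (oU : proj_open _) _ Uv.
  have [j [f [j0 Sf fv]]] := set_valP v.
  have Sfh : semi_invariants theta j (fun v => f v * h v) := weight0_mul Sf Sh.
  exists j, (fun v => f v * h v); split=> //.
    apply/(proj_basicE _ Sfh); rewrite mulf_neq0 //.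
    by move/(proj_basicE _ Sh): hv.
  move=> q; have [u ->] := proj_piP q => /(proj_basicE _ Sfh).
  rewrite mulf_eq0 negb_or => /andP[_ hu]; rewrite /preimage /=.
  rewrite -[proj_pi u]/(quot_map u) aff_quot_funE; apply: hU.
  exact/(proj_basicE _ Sh).
move=> U phi oU rphi p; have [v ->] := proj_piP p.
rewrite /preimage /= -[proj_pi v]/(quot_map v) aff_quot_funE => Uv.
have [i [a [b [i0 Sa Sb av phiE]]]] := rphi _ Uv.
have [j [f [j0 Sf fv]]] := set_valP v.
have Sfa : semi_invariants theta j (fun v => f v * a v) := weight0_mul Sf Sa.
exists j, (fun v => f v * a v), (fun v => f v * b v); split=> //.
- exact: (weight0_mul Sf Sb).
- apply/(proj_basicE _ Sfa); rewrite mulf_neq0 //.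
  by move/(proj_basicE _ Sa): av.
- move=> u; rewrite /preimage /= -[proj_pi u]/(quot_map u) aff_quot_funE => Uu.
  rewrite mulf_eq0 negb_or => /andP[fu au].
  by rewrite phiE // -mulf_div divff // mul1r.
Defined.

(* The trivial bundle on [V^theta] linearised by [chi] descends to [L]: over
   each [ldom L x] there is a nowhere vanishing [chi]-semi-invariant frame
   [s x] of the pulled back bundle, and frames are related by the transition
   functions of [L]. A section [phi] of [L], with components [phi_x], then
   corresponds to the [chi]-semi-invariant function [phi_x * s x]. *)
Definition descends_to theta (chi : 'rV[int]_r) (L : line_bundle (X theta)) :=
  exists s : X theta -> V -> C,
    (forall x, let O := [set u : V | exists2 v : set_type (Vss theta),
                          u = \val v & ldom L x (quot_map v)] in
       [/\ reg O (s x), forall v, O v -> s x v != 0 &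
           forall g v, O v -> s x (act g v) = chr chi g * s x v]) /\
    forall x y (v : set_type (Vss theta)),
      ldom L x (quot_map v) -> ldom L y (quot_map v) ->
      ltr L x y (quot_map v) * s x (\val v) = s y (\val v).

Definition PicQ theta := PicQ_over (aff_quot theta).
HB.instance Definition _ theta := GRing.Lmodule.on (PicQ theta).

Definition linearisation_map theta (L_C : 'rV[rat]_r -> PicQ theta) :=
  forall chi, (exists (j : nat) psi (L : line_bundle (X theta)), [/\ (0 < j)%N,
      map_mx intr psi = chi *+ j & descends_to psi L]) /\
    forall (j : nat) psi (L : line_bundle (X theta)), (0 < j)%N ->
      map_mx intr psi = chi *+ j -> descends_to psi L ->
      L_C chi = pic_fraction (aff_quot theta) j L.

Definition vgit_morphism theta theta0 (tau : X theta -> X theta0) :=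
  Vss theta `<=` Vss theta0 /\
  forall (v : set_type (Vss theta)) (v0 : set_type (Vss theta0)),
    \val v = \val v0 -> tau (quot_map v) = quot_map v0.

Definition Uns theta theta0 (tau : X theta -> X theta0) : set (X theta) :=
  [set x | exists2 v : set_type (Vss theta0),
     ~ stable theta0 (\val v) & tau x = quot_map v].

(* [G^vee_Q] carries the topology of [Q^r]. *)
Definition clQ (S : set 'rV[rat]_r) : set 'rV[rat]_r := @closure 'rV[rat^o]_r S.
Definition intQ (S : set 'rV[rat]_r) : set 'rV[rat]_r := @interior 'rV[rat^o]_r S.

Definition span (S : set 'rV[rat]_r) : set 'rV[rat]_r :=
  [set x | exists k (M : 'M[rat]_(k, r)),
     (forall i, S (row i M)) /\ (x <= M)%MS].

Definition relint (S : set 'rV[rat]_r) : set 'rV[rat]_r :=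
  [set x | S x /\ exists U : set 'rV[rat^o]_r,
     [/\ open U, U x & U `&` span S `<=` S]].

Definition git_class theta : set 'rV[rat]_r :=
  [set eta | Vss eta !=set0 /\ Vss eta = Vss theta].

Definition chamber (D : set 'rV[rat]_r) :=
  exists2 theta, generic theta & D = git_class theta.

Definition facet (W P : set 'rV[rat]_r) :=
  (exists l : 'cV[rat]_r, (forall x, P x -> 0 <= (x *m l) 0 0) /\
     W = [set x | P x /\ x *m l = 0]) /\
  exists k (M : 'M[rat]_(k, r)), [/\ forall i, W (row i M),
     forall x, W x -> (x <= M)%MS & (\rank M).+1 = r].

Definition wall_of (D W : set 'rV[rat]_r) := chamber D /\ facet W (clQ D).

Definition git_wall W := exists D, wall_of D W.

Definition separates W D D' := [/\ D <> D', wall_of D W & wall_of D' W].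

(* The VGIT morphism [tau] is determined by [vgit_morphism], and its type does
   not depend on the choice of [theta] in [D] and [theta0] general in [W]. *)
Definition vgit_type
    (P : forall X Y : fspace C, (X -> Y) -> Prop) (D W : set 'rV[rat]_r) :=
  forall theta theta0, D theta -> relint W theta0 ->
    exists tau : X theta -> X theta0, vgit_morphism tau /\ P _ _ tau.

Definition flipping W := exists D D', separates W D D' /\
  forall E, E = D \/ E = D' -> forall theta theta0, E theta -> relint W theta0 ->
    exists tau : X theta -> X theta0, [/\ vgit_morphism tau,
      normal (X theta), codim_ge (Uns tau) 2 & contracts_curve tau].

Definition small_crossing (D D' : set 'rV[rat]_r) := exists W,
  [/\ separates W D D', vgit_type (@small C) D W & vgit_type (@small C) D' W].

Definition region (D : set 'rV[rat]_r) : set 'rV[rat]_r :=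
  [set x | exists2 D', clos_refl_trans _ small_crossing D D' & clQ D' x].

(* The apex of the fan lies in every wall, so a wall in the interior of [P] is
   one whose relative interior is there. *)
Definition interior_wall (P W : set 'rV[rat]_r) :=
  git_wall W /\ relint W `<=` intQ P.

Definition boundary_wall (P W : set 'rV[rat]_r) :=
  git_wall W /\ W `<=` P `\` intQ P.

Definition inner_chamber (P W D : set 'rV[rat]_r) :=
  unique (fun D => [/\ chamber D, D `<=` P & W `<=` clQ D]) D.

End Hypertoric.

(* Main.v *)
Require Import Defs.
From HB Require Import structures.
From mathcomp Require Import all_boot all_order all_algebra generic_quotient ring_quotient.
From mathcomp Require Import all_classical reals topology.
From mathcomp Require Import complex ring zify lra.
From mathcomp Require mpoly.
Import -(notations) mpoly.
From Stdlib Require Import Relation_Operators.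

Set Implicit Arguments.
Unset Strict Implicit.
Unset Printing Implicit Defensive.

Import Order.TTheory GRing.Theory Num.Theory.
Local Open Scope classical_set_scope.
Local Open Scope ring_scope.

(* The weights of the coordinates are the columns of [A] and their opposites.
   Choosing a base [J] of columns in which the coordinates of [theta] are nonzero,
   the semistable points whose coordinates on [J] of the right sign do not vanish
   form an open set of [X]; normalising these coordinates to 1 and solving the
   moment equation for the opposite ones identifies it with an affine space,
   provided that [A] is unimodular. Otherwise it is a quotient of an affine space
   by a finite group preserving the symplectic pairs of coordinates, whose
   invariants need too many generators for it to be smooth. Two charts whose bases differ in one column meet along the product
   of an affine space with C^*, and the bases are connected by such moves: this
   computes the Picard group and shows that every class comes from a character,
   and only one.
   Chambers are the sign classes of the coordinates of [theta] in all bases. A wall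
   is a piece of a hyperplane spanned by columns; let [s >= 2] be the number of
   columns off it. Crossing the wall modifies the locus where the [s] coordinates
   of negative weight vanish, which in the charts is linear of codimension [s - 1],
   and along which the coordinates of positive weight are contracted. Hence the wall
   is divisorial if [s = 2] and flipping if [s >= 3]. Small crossings never change
   the side of a hyperplane with [s = 2], so a region lies on one side of each of
   them. *)

(** * Factorisation into primes *)

(** On a chart, which is an affine space, questions become questions on primes of a polynomial ring:
    normality, local equations of divisors and triviality of line bundles all compare multiplicities
    of prime factors. If a base [J] is not unimodular, the finite quotient has an indecomposable
    invariant power of each of the N coordinates of the slice, and one more indecomposable invariant
    [z_i w_i]; they are independent cotangent vectors at the origin, while the dimension is at most
    N. A character that becomes trivial relative to [X_0] has the same coordinates in all bases,
    because adjacent bases give a projective line contracted in [X_0]; each index is avoided by some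
    base, so all coordinates vanish. Conversely the transition functions of a line bundle are
    monomials, whose exponents in [Z^n] are read off with the n-dimensional torus acting on [V]: the
    i-th exponent is constant on the bases avoiding [i], and these constants determine the
    character. Nonzero rows of [B] mean that no column is a coloop, which yields these bases and
    [s >= 2]. Every boundary wall turns out to be divisorial. *)

Section Divisibility.
Variable R : idomainType.
Implicit Types a b c : R.

Definition divides a b := exists c, b = c * a.

Definition prime_elt a :=
  [/\ a != 0, a \isn't a GRing.unit &
      forall b c, divides a (b * c) -> divides a b \/ divides a c].

(** Factors are required to be prime rather than irreducible, so uniqueness up to units follows by
    cancellation. *)
Definition ufd := forall a, a != 0 -> exists u (s : seq R),
  [/\ u \is a GRing.unit, forall p, p \in s -> prime_elt p &
      a = u * \prod_(p <- s) p].

Lemma divides_refl a : divides a a.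
Proof. by exists 1; rewrite mul1r. Qed.

Lemma divides0 a : divides a 0.
Proof. by exists 0; rewrite mul0r. Qed.

Lemma divides_trans a b c : divides a b -> divides b c -> divides a c.
Proof. by move=> [x ->] [y ->]; exists (y * x); rewrite mulrA. Qed.

Lemma divides_mulr a b c : divides a b -> divides a (b * c).
Proof. by move=> [x ->]; exists (x * c); rewrite mulrAC. Qed.

Lemma divides_mull a b c : divides a b -> divides a (c * b).
Proof. by rewrite mulrC; exact: divides_mulr. Qed.

Lemma divides_add a b c : divides a b -> divides a c -> divides a (b + c).
Proof. by move=> [x ->] [y ->]; exists (x + y); rewrite mulrDl. Qed.

Lemma divides_sub a b c : divides a b -> divides a c -> divides a (b - c).
Proof. by move=> [x ->] [y ->]; exists (x - y); rewrite mulrBl. Qed.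

Lemma divides_sum a (I : Type) (s : seq I) (P : pred I) (F : I -> R) :
  (forall i, P i -> divides a (F i)) -> divides a (\sum_(i <- s | P i) F i).
Proof.
move=> h; apply: (big_ind (divides a)) => //; first exact: divides0.
exact: divides_add.
Qed.

Lemma divides_unit a b : b \is a GRing.unit -> divides a b -> a \is a GRing.unit.
Proof. by move=> ub [c e]; move: ub; rewrite e unitrM => /andP[]. Qed.

Lemma prime_neq0 a : prime_elt a -> a != 0.
Proof. by case. Qed.

Lemma prime_prod a (s : seq R) : prime_elt a -> divides a (\prod_(p <- s) p) ->
  exists2 p, p \in s & divides a p.
Proof.
move=> pa; elim: s => [|x s IHs].
  rewrite big_nil => /divides_unit h; case: pa => _ /negP[].
  by apply: h; exact: unitr1.
rewrite big_cons; case: (pa) => _ _ h /h[ax|/IHs[p ps ap]].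
  by exists x; rewrite ?mem_head.
by exists p; rewrite // in_cons ps orbT.
Qed.

Lemma prime_exp a b k : prime_elt a -> divides a (b ^+ k) -> divides a b.
Proof.
move=> pa; elim: k => [|k IHk].
  rewrite expr0 => /divides_unit h; case: pa => _ /negP[].
  by apply: h; exact: unitr1.
by rewrite exprS; case: (pa) => _ _ h /h[].
Qed.

Lemma prime_divides_prime a b : prime_elt a -> prime_elt b -> divides a b ->
  exists2 u, u \is a GRing.unit & b = u * a.
Proof.
move=> pa pb [c e]; exists c => //.
have [_ _ h] := pb; have [b0 _ _] := pb.
have : divides b (c * a) by rewrite -e; exact: divides_refl.
move=> /h[[d ed]|[d ed]].
  have [_ /negP[]] := pa; apply/unitrP; exists d.
  have : 1 * b = (d * a) * b by rewrite mul1r {1}e ed mulrAC.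
  by move/(mulIf b0) => e1; rewrite [a * d]mulrC -e1.
apply/unitrP; exists d.
have : 1 * b = (d * c) * b.
  by rewrite mul1r {1}e ed; ring.
by move/(mulIf b0) => e1; rewrite [c * d]mulrC -e1.
Qed.

(** A prime dividing the product is associate to one of its factors, which can be cancelled. The
    length of the remaining factorisation is the measure of several inductions below. *)
Lemma factor_cancel u (s : seq R) p a : u \is a GRing.unit ->
  (forall q, q \in s -> prime_elt q) -> prime_elt p ->
  a * p = u * \prod_(q <- s) q ->
  exists v (t : seq R), [/\ v \is a GRing.unit,
    forall q, q \in t -> prime_elt q, a = v * \prod_(q <- t) q &
    (size t < size s)%N].
Proof.
move=> uu sp pp e.
have : divides p (u * \prod_(q <- s) q) by exists a.
have [p0 npu h] := pp => /h[/(divides_unit uu)|]; first by rewrite (negPf npu).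
move=> /(prime_prod pp)[q qs pq].
have [w uw eq] := prime_divides_prime pp (sp q qs) pq.
exists (u * w), (rem q s); split; first by rewrite unitrM uu.
- by move=> x /mem_rem/sp.
- apply: (mulIf p0); rewrite e (big_rem q) //= eq.
  by rewrite !mulrA -!mulrA; congr (_ * (_ * _)); rewrite mulrC.
- by rewrite size_rem //; case: (s) qs.
Qed.

Lemma ufd_prime_divisor a : ufd -> a != 0 ->
  a \isn't a GRing.unit -> exists2 p, prime_elt p & divides p a.
Proof.
move=> fR a0 ua; have [u [[|p s] [uu sp e]]] := fR a a0.
  by move: ua; rewrite e big_nil mulr1 uu.
exists p; first by apply: sp; rewrite mem_head.
by rewrite e big_cons; apply: divides_mull; apply: divides_mulr; exact: divides_refl.
Qed.

End Divisibility.

(** * Gauss's lemma *)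

Section Gauss.
Variable R : idomainType.
Import Pdiv.Idomain.
Implicit Types p q f : {poly R}.

Lemma divides_polyCP (c : R) p : divides c%:P p <-> forall i, divides c p`_i.
Proof.
split=> [[q ->] i|h]; first by exists q`_i; rewrite coefMC.
have /choice[g gE] : forall i, exists d, p`_i = d * c by move=> i; exact: h.
exists (\poly_(i < size p) g i); apply/polyP => i.
rewrite coefMC coef_poly; case: ltnP => [_|/(nth_default 0)->]; first exact: gE.
by rewrite mul0r.
Qed.

(** Leading terms are stripped one at a time: [c] divides the product of the leading coefficients,
    hence one of them, and that leading term can be removed without affecting divisibility of the
    product. *)
Lemma prime_polyC (c : R) : prime_elt c -> prime_elt c%:P.
Proof.
move=> [c0 uc pc]; split; first by rewrite polyC_eq0.
  by rewrite poly_unitE coefC eqxx (negPf uc) andbF.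
have lc (s : {poly R}) : s != 0 ->
    s = take_poly (size s).-1 s + (lead_coef s)%:P * 'X^((size s).-1).
  move=> s0; rewrite -{1}(poly_take_drop (size s).-1 s); congr (_ + _ * _).
  apply/polyP => i; rewrite coef_drop_poly coefC.
  case: i => [|i]; first by rewrite add0n.
  rewrite nth_default // addSn -[leqLHS](@prednK (size s)) ?size_poly_gt0 //.
  by rewrite ltnS leq_addl.
have sz (s : {poly R}) : s != 0 -> (size (take_poly (size s).-1 s) < size s)%N.
  move=> s0; rewrite (leq_ltn_trans (size_take_poly _ _)) //.
  by rewrite prednK ?size_poly_gt0.
move=> p q; have [n] := ubnP (size p + size q).
elim: n p q => // n IHn p q; rewrite ltnS => le_n h.
have [->|p0] := eqVneq p 0; first by left; exact: divides0.
have [->|q0] := eqVneq q 0; first by right; exact: divides0.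
have dl (s : {poly R}) k : divides c (lead_coef s) -> divides c%:P ((lead_coef s)%:P * 'X^k).
  by move=> [d ->]; rewrite polyCM; apply: divides_mulr; exists d%:P.
have /pc[lp|lq] : divides c (lead_coef p * lead_coef q).
- by rewrite -lead_coefM lead_coefE; move/divides_polyCP: h.
- have /IHn[]: (size (take_poly (size p).-1 p) + size q < n)%N.
    by rewrite (leq_trans _ le_n) // ltn_add2r sz.
  + rewrite [take_poly _ _](_ : _ = p - (lead_coef p)%:P * 'X^((size p).-1)).
      by rewrite mulrBl; apply: divides_sub => //; apply: divides_mulr; exact: dl.
    by apply/esym/eqP; rewrite subr_eq -lc.
  + by move=> h'; left; rewrite (lc p p0); apply: divides_add => //; exact: dl.
  + by right.
- have /IHn[]: (size p + size (take_poly (size q).-1 q) < n)%N.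
    by rewrite (leq_trans _ le_n) // ltn_add2l sz.
  + rewrite [take_poly _ _](_ : _ = q - (lead_coef q)%:P * 'X^((size q).-1)).
      by rewrite mulrBr; apply: divides_sub => //; apply: divides_mull; exact: dl.
    by apply/esym/eqP; rewrite subr_eq -lc.
  + by left.
  + by move=> h'; right; rewrite (lc q q0); apply: divides_add => //; exact: dl.
Qed.

(** Prime constants suffice as tests, since in a factorial ring every nonzero nonunit has a prime
    divisor. *)
Definition primitive p := forall c, prime_elt c -> ~ divides c%:P p.

Hypothesis fR : ufd R.

(** Each prime constant taken out shortens the factorisation of the leading coefficient, so the
    process stops. *)
Lemma primitive_part p : p != 0 -> exists (s : seq R) q,
  [/\ forall c, c \in s -> prime_elt c, primitive q, size q = size p &
      p = (\prod_(c <- s) c)%:P * q].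
Proof.
move=> p0; have lp0 : lead_coef p != 0 by rewrite lead_coef_eq0.
have [u [t [uu tp e]]] := fR lp0.
have [n] := ubnP (size t); elim: n u t p p0 lp0 uu tp e => // n IHn u t p p0 lp0 uu tp e.
rewrite ltnS => le_n; have [prim|] := pselect (primitive p).
  by exists [::], p; rewrite big_nil mul1r.
move=> /existsNP[c /not_implyP[pc /contrapT[q eq]]].
have c0 : c != 0 by case: pc.
have q0 : q != 0 by apply: contraNneq p0 => q0; rewrite eq q0 mul0r.
have el : lead_coef q * c = u * \prod_(x <- t) x.
  by rewrite -e eq lead_coefM lead_coefC.
have [v [t' [uv tp' e' lt']]] := factor_cancel uu tp pc el.
have lq0 : lead_coef q != 0 by rewrite lead_coef_eq0.
have [s [q' [sp prim sz e'']]] :=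
  IHn v t' q q0 lq0 uv tp' e' (leq_trans lt' le_n).
exists (c :: s), q'; split=> //.
- by move=> x; rewrite in_cons => /orP[/eqP->|/sp].
- by rewrite sz eq mulrC size_Cmul.
- by rewrite eq e'' big_cons polyCM mulrC mulrA.
Qed.

(** The relation [f %| p] only makes [c *: p] a multiple [g * f] for some nonzero constant [c]. Each
    prime factor of [c] divides [g * f] but not the primitive [f], so it can be cancelled from
    [g]. *)
Lemma dvdp_primitive f p : primitive f -> f %| p -> divides f p.
Proof.
move=> prim /dvdpP[[c g] /= c0 e].
have [u [s [uu sp ec]]] := fR c0.
have {e} : u%:P * (\prod_(x <- s) x)%:P * p = g * f.
  by rewrite -polyCM -ec mul_polyC.
have uP : u%:P \is a GRing.unit by rewrite rmorph_unit.
clear c0 ec; elim: s sp g => [|x s IHs] sp g.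
  rewrite big_nil mulr1 => e; exists (u%:P^-1 * g).
  by rewrite -mulrA -e mulKr.
rewrite big_cons => e.
have px : prime_elt x by apply: sp; rewrite mem_head.
have [_ _ h] := prime_polyC px.
have : divides x%:P (g * f).
  rewrite -e polyCM; apply: divides_mulr; apply: divides_mull.
  by apply: divides_mulr; exact: divides_refl.
move=> /h[[g' eg]|/prim]; last by move/(_ px).
apply: (IHs _ g'); first by move=> y ys; apply: sp; rewrite in_cons ys orbT.
have xP : x%:P != 0 :> {poly R} by rewrite polyC_eq0; case: px.
apply: (mulIf xP); rewrite -[RHS]mulrAC -eg -e polyCM; ring.
Qed.

(** By minimality a nonconstant common factor with [a] has the degree of [f]. So either [f] is
    coprime to [a] and passes to [b], or it divides [a] up to a constant, which primitivity
    removes. *)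
Lemma min_factor_prime p f : (1 < size f)%N -> f %| p -> primitive f ->
  (forall g : {poly R}, (1 < size g)%N -> g %| p -> (size f <= size g)%N) -> prime_elt f.
Proof.
move=> sf fp prim mf; split.
- by rewrite -size_poly_gt0 ltnW.
- by rewrite poly_unitE gtn_eqF.
have f0 : f != 0 by rewrite -size_poly_gt0 ltnW.
move=> a b; have [c1|nc] := boolP (coprimep f a).
  move=> fab; right; apply: dvdp_primitive => //.
  rewrite -(Gauss_dvdpr _ c1); case: fab => h ->.
  exact: dvdp_mulIr.
left; apply: dvdp_primitive => //.
have gf := dvdp_gcdl f a.
have g0 : gcdp f a != 0 by rewrite gcdp_eq0 (negPf f0).
have sg : (1 < size (gcdp f a))%N.
  by move: nc; rewrite coprimep_def; have := size_poly_gt0 (gcdp f a);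
     rewrite g0; case: (size _) => [|[|]].
have := mf _ sg (dvdp_trans gf fp) => le.
have : size (gcdp f a) == size f by rewrite eqn_leq le dvdp_leq.
by rewrite (dvdp_size_eqp gf) => /eqp_dvdl<-; exact: dvdp_gcdr.
Qed.

(** The content factors in [R]. The primitive part, while nonconstant, loses a factor of least
    positive degree, which is prime once it has been made primitive. *)
Lemma ufd_poly : ufd {poly R}.
Proof.
move=> p; have [n] := ubnP (size p).
elim: n p => // n IHn p; rewrite ltnS => le_n p0.
have [s [q [sp prim sz ->]]] := primitive_part p0.
have main : exists (u : {poly R}) (s : seq {poly R}), [/\ u \is a GRing.unit,
    forall p, p \in s -> prime_elt p & q = u * \prod_(p <- s) p].
  have q0 : q != 0 by rewrite -size_poly_gt0 sz size_poly_gt0.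
  have [s1|s1] := leqP (size q) 1.
    have [c eq] : exists c, q = c%:P by exists q`_0; exact: size1_polyC.
    exists q, [::]; rewrite big_nil mulr1; split=> //.
    rewrite eq in prim q0 *; rewrite rmorph_unit //.
    apply/negPn/negP => uc; have c0 : c != 0 by rewrite -polyC_eq0.
    have [x px [d e]] := ufd_prime_divisor fR c0 uc.
    by apply: (prim x px); exists d%:P; rewrite e polyCM.
  pose P k := `[< exists g : {poly R}, [/\ (1 < size g)%N, g %| q & size g = k] >].
  have exP : exists k, P k.
    by exists (size q); apply/asboolP; exists q; rewrite dvdpp.
  case: (ex_minnP exP) => k /asboolP[g [sg gq ek]] mk.
  have g0 : g != 0 by rewrite -size_poly_gt0 ltnW.
  have [s' [f [sp' primf sf eg]]] := primitive_part g0.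
  have fq : f %| q.
    by apply: dvdp_trans gq; rewrite eg dvdp_mull // dvdpp.
  have sf1 : (1 < size f)%N by rewrite sf.
  have pf : prime_elt f.
    apply: (min_factor_prime sf1 fq primf) => h sh hq.
    by rewrite sf ek; apply: mk; apply/asboolP; exists h.
  have [h eq] := dvdp_primitive primf fq.
  have h0 : h != 0 by apply: contraNneq q0 => h0; rewrite eq h0 mul0r.
  have f0 := prime_neq0 pf.
  have [|u [t [uu tp e]]] := IHn h _ h0.
    rewrite (leq_trans _ le_n) // -sz eq size_mul //.
    by rewrite -ltnS prednK ?ltn_add2l ?addn_gt0 ?size_poly_gt0 ?h0 // -addn1 ltn_add2l.
  exists u, (f :: t); split=> //; first by move=> x; rewrite in_cons => /orP[/eqP->|/tp].
  by rewrite eq e big_cons; ring.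
have [u [t [uu tp ->]]] := main; exists u, ([seq c%:P | c <- s] ++ t); split=> //.
  by move=> x; rewrite mem_cat => /orP[/mapP[c cs ->]|/tp//]; apply/prime_polyC/sp.
by rewrite big_cat big_map rmorph_prod /=; ring.
Qed.

End Gauss.

Lemma prime_iso (R S : idomainType) (f : {rmorphism R -> S})
    (g : {rmorphism S -> R}) (p : R) : cancel f g -> cancel g f ->
  prime_elt p -> prime_elt (f p).
Proof.
move=> fK gK [p0 up pp]; split.
- by apply: contraNneq p0 => fp; rewrite -(fK p) fp rmorph0.
- by apply: contra up => /(rmorph_unit g); rewrite fK.
move=> b c [d e]; have : divides p (g b * g c).
  by exists (g d); rewrite -rmorphM e rmorphM fK.
by move=> /pp[[h eh]|[h eh]]; [left|right]; exists (f h); rewrite -[LHS]gK eh rmorphM.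
Qed.

Lemma ufd_iso (R S : idomainType) (f : {rmorphism R -> S})
    (g : {rmorphism S -> R}) : cancel f g -> cancel g f ->
  ufd R -> ufd S.
Proof.
move=> fK gK fR a a0.
have ga0 : g a != 0 by apply: contraNneq a0 => ga; rewrite -(gK a) ga rmorph0.
have [u [s [uu sp e]]] := fR _ ga0.
exists (f u), [seq f p | p <- s]; split.
- exact: rmorph_unit.
- by move=> x /mapP[p /sp pp ->]; exact: prime_iso fK gK pp.
- by rewrite -[LHS]gK e rmorphM big_map rmorph_prod.
Qed.

Lemma ufd_field (K : fieldType) : ufd K.
Proof.
move=> a a0; exists a, [::]; rewrite big_nil mulr1; split=> //.
by rewrite unitfE.
Qed.

(** * Polynomials in several variables *)

Section SeveralVariables.
Variable K : fieldType.
Local Notation MP n := (mpoly n K).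

Lemma mpoly_ind n (Q : MP n -> Prop) : (forall c, Q (mpolyC n c)) ->
  (forall i, Q (mpolyX K (mnm1 i))) ->
  (forall p q, Q p -> Q q -> Q (p + q)) -> (forall p q, Q p -> Q q -> Q (p * q)) ->
  forall p, Q p.
Proof.
move=> QC QX QD QM p; rewrite [p]mpolyE; apply: big_ind => //.
  by rewrite -mpolyC0; exact: QC.
move=> m _; rewrite -mul_mpolyC; apply: (QM _ _); first exact: QC.
rewrite mpolyXE_id; apply: big_ind => //; first by rewrite -mpolyC1; exact: QC.
move=> i _; elim: (m i) => [|k IHk]; first by rewrite expr0 -mpolyC1; exact: QC.
by rewrite exprS; apply: (QM).
Qed.

Definition uni n (p : MP n.+1) : {poly MP n} := muni p.
HB.instance Definition _ n := GRing.RMorphism.copy (@uni n) (@muni n K).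

Definition wide n (p : MP n) : MP n.+1 := mwiden p.
HB.instance Definition _ n := GRing.RMorphism.copy (@wide n) (@mwiden n K).

Fact multi_comm n (x : MP n.+1) : commr_rmorph (@wide n) x.
Proof. by move=> y; exact: mulrC. Qed.

Definition multi n : {poly MP n} -> MP n.+1 :=
  horner_morph (multi_comm (mpolyX K (mnm1 ord_max))).
HB.instance Definition _ n := GRing.RMorphism.on (@multi n).

Lemma uniD n : {morph @uni n : p q / p + q}. Proof. exact: raddfD. Qed.
Lemma uniM n : {morph @uni n : p q / p * q}. Proof. exact: rmorphM. Qed.
Lemma wideD n : {morph @wide n : p q / p + q}. Proof. exact: raddfD. Qed.
Lemma wideM n : {morph @wide n : p q / p * q}. Proof. exact: rmorphM. Qed.
Lemma multiD n : {morph @multi n : p q / p + q}. Proof. exact: raddfD. Qed.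
Lemma multiM n : {morph @multi n : p q / p * q}. Proof. exact: rmorphM. Qed.

Lemma uniC n c : uni (mpolyC n.+1 c) = (mpolyC n c)%:P.
Proof. exact: muniC. Qed.

Lemma uniX_max n : uni (mpolyX K (mnm1 (ord_max : 'I_n.+1))) = 'X.
Proof.
rewrite /uni /muni mmapX mmap1U; case: splitP => //= j /= e.
by have := ltn_ord j; rewrite -e ltnn.
Qed.

Lemma uniX_widen n (i : 'I_n) :
  uni (mpolyX K (mnm1 (widen_ord (leqnSn n) i))) = (mpolyX K (mnm1 i))%:P.
Proof.
rewrite /uni /muni mmapX mmap1U; case: splitP => [j /= e|j /=].
  by congr ((mpolyX _ (mnm1 _))%:P); apply: val_inj.
by rewrite ord1 addn0 => e; have := ltn_ord i; rewrite e ltnn.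
Qed.

Lemma wideX n (i : 'I_n) :
  wide (mpolyX K (mnm1 i)) = mpolyX K (mnm1 (widen_ord (leqnSn n) i)).
Proof. by rewrite [LHS]mwidenX mnmwiden1. Qed.

Lemma ord_S_case n (i : 'I_n.+1) : i = ord_max \/ exists j, i = widen_ord (leqnSn n) j.
Proof.
have [e|ne] := eqVneq (i : nat) n; first by left; exact: val_inj.
have lt : (i < n)%N by rewrite ltn_neqAle ne -ltnS ltn_ord.
by right; exists (Ordinal lt); exact: val_inj.
Qed.

Lemma uniK n : cancel (@uni n) (@multi n).
Proof.
apply: mpoly_ind => [c|i|p q ep eq|p q ep eq].
- by rewrite uniC [LHS]horner_morphC; exact: mwidenC.
- have [->|[j ->]] := ord_S_case i.
    by rewrite uniX_max [LHS]horner_morphX.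
  by rewrite uniX_widen; rewrite [LHS]horner_morphC; exact: wideX.
- by rewrite uniD multiD; congr (_ + _).
- by rewrite uniM multiM; congr (_ * _).
Qed.

Lemma uni_wide n (p : MP n) : uni (wide p) = p%:P.
Proof.
elim/mpoly_ind: p => [c|i|p q ep eq|p q ep eq].
- by rewrite [wide _]mwidenC uniC.
- by rewrite wideX uniX_widen.
- by rewrite wideD uniD ep eq polyCD.
- by rewrite wideM uniM ep eq polyCM.
Qed.

Lemma multiK n : cancel (@multi n) (@uni n).
Proof.
elim/poly_ind => [|p c IHp]; first by rewrite /multi rmorph0 /uni rmorph0.
rewrite multiD multiM uniD uniM IHp; congr (_ * _ + _).
  by rewrite [multi _]horner_morphX uniX_max.
by rewrite [multi _]horner_morphC uni_wide.
Qed.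

Lemma ufd_mpoly n : ufd (MP n).
Proof.
elim: n => [|n /ufd_poly IHn].
  have h := @ufd_iso K (MP 0) (@mpolyC 0 K) (meval (fun=> 0)).
  refine (h _ _ (@ufd_field K)).
    exact: mevalC.
  elim/mpoly_ind => [c|[]//|p q ep eq|p q ep eq].
  - by congr mpolyC; exact: mevalC.
  - by rewrite -[in RHS]ep -[in RHS]eq -mpolyCD; congr mpolyC; exact: mevalD.
  - by rewrite -[in RHS]ep -[in RHS]eq -mpolyCM; congr mpolyC; exact: mevalM.
exact: (@ufd_iso {poly MP n} (MP n.+1) (@multi n) (@uni n)) (@multiK n) (@uniK n) IHn.
Qed.

Definition rcons_fun n (v : 'I_n -> K) (t : K) (i : 'I_n.+1) : K :=
  oapp v t (insub (val i)).

Lemma rcons_fun_max n (v : 'I_n -> K) t : rcons_fun v t ord_max = t.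
Proof. by rewrite /rcons_fun insubF //= ltnn. Qed.

Lemma rcons_fun_widen n (v : 'I_n -> K) t i :
  rcons_fun v t (widen_ord (leqnSn n) i) = v i.
Proof.
rewrite /rcons_fun insubT /=; first exact: ltn_ord.
by move=> lt; congr v; exact: val_inj.
Qed.

Lemma meval_uni n (p : MP n.+1) v t :
  meval (rcons_fun v t) p = (map_poly (meval v) (uni p)).[t].
Proof.
elim/mpoly_ind: p => [c|i|p q ep eq|p q ep eq].
- by rewrite uniC map_polyC hornerC /= !mevalC.
- have [->|[j ->]] := ord_S_case i.
    by rewrite uniX_max map_polyX hornerX mevalXU rcons_fun_max.
  by rewrite uniX_widen map_polyC hornerC /= !mevalXU rcons_fun_widen.
- by rewrite uniD [map_poly _ _]rmorphD hornerD mevalD ep eq.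
- by rewrite uniM [map_poly _ _]rmorphM hornerM mevalM ep eq.
Qed.

End SeveralVariables.

Lemma prime_polyC_inv (R : idomainType) (c : R) : prime_elt c%:P -> prime_elt c.
Proof.
move=> [c0 uc pc]; split; first by rewrite -polyC_eq0.
  by apply: contra uc; exact: rmorph_unit.
move=> a b [d e]; have : divides c%:P (a%:P * b%:P).
  by exists d%:P; rewrite -!polyCM e.
move=> /pc[] /divides_polyCP /(_ 0%N); rewrite coefC eqxx; by [left|right].
Qed.

Lemma bezout_eval (R S : idomainType) (phi : {rmorphism R -> S})
    (U F W H : {poly R}) (c : R) (t : S) : U * F + W * H = c%:P ->
  (map_poly phi F).[t] = 0 -> (map_poly phi H).[t] = 0 -> phi c = 0.
Proof.
move=> /(congr1 (map_poly phi)); rewrite rmorphD !rmorphM map_polyC /= => e F0 H0.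
by rewrite -[LHS](hornerC _ t) -e hornerD !hornerM F0 H0 !mulr0 addr0.
Qed.

Section PrimePolynomial.
Variable R : idomainType.
Import Pdiv.Idomain.
Variable F : {poly R}.
Hypotheses (pF : prime_elt F) (sF : (1 < size F)%N).

Lemma prime_polyN_divides_const (a : R) : a != 0 -> ~ divides F a%:P.
Proof.
move=> a0 [g e]; have g0 : g != 0.
  by apply: contraNneq a0 => g0; rewrite -polyC_eq0 e g0 mul0r.
have := congr1 (fun p : {poly R} => size p) e.
rewrite size_polyC a0 size_mul // ?(prime_neq0 pF) //.
have : (0 < size g)%N by rewrite size_poly_gt0.
by move: sF; case: (size g) => // k; case: (size F) => [|[|m]] //; rewrite addnS /= addnS.
Qed.

Lemma prime_dvdp p : F %| p -> divides F p.
Proof.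
move=> /dvdpP[[c g] /= c0 e]; have [_ _ hF] := pF.
have /hF[/(prime_polyN_divides_const c0)|] // : divides F (c%:P * p).
by exists g; rewrite -e mul_polyC.
Qed.

(** A constant multiple of [F] is [k] times the gcd. Being prime, [F] divides [k] or the gcd, and
    degrees exclude [k]. *)
Lemma prime_not_coprimep H : ~~ coprimep F H -> divides F H.
Proof.
rewrite coprimep_def => ng; apply: prime_dvdp; have F0 := prime_neq0 pF.
have gF := dvdp_gcdl F H.
have g0 : gcdp F H != 0 by rewrite gcdp_eq0 (negPf F0).
have sg : (1 < size (gcdp F H))%N.
  by move: ng g0; rewrite -size_poly_gt0; case: (size _) => [|[|]].
have /dvdpP[[c k] /= c0 e] := gF; have [_ _ hF] := pF.
have /hF[] : divides F (k * gcdp F H).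
- by rewrite -e -mul_polyC; apply: divides_mull; exact: divides_refl.
- move=> [k' ek]; have k'0 : k' != 0.
    apply: contraNneq c0 => k'0; move: e; rewrite ek k'0 !mul0r => /eqP.
    by rewrite -mul_polyC mulf_eq0 (negPf F0) orbF polyC_eq0.
  move: e; rewrite ek => /(congr1 (fun p : {poly R} => size p)).
  rewrite size_scale // size_mul ?mulf_neq0 // size_mul //.
  have : (0 < size k')%N by rewrite size_poly_gt0.
  move: sg; case: (size (gcdp F H)) => [|[|a]] // _.
  by case: (size k') => // b _; lia.
- move=> [k' ek]; apply: dvdp_trans (dvdp_gcdr F H).
  by rewrite ek dvdp_mulIr.
Qed.

End PrimePolynomial.

(** * Nullstellensatz for a prime polynomial *)

Section ClosedField.
Variable K : closedFieldType.
Local Notation MP n := (mpoly n K).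

Lemma mpoly_nonzero_value n (p : MP n) : p != 0 -> exists v, meval v p != 0.
Proof.
elim: n p => [|n IHn] p p0.
  exists (fun=> 0); apply: contraNneq p0 => e; apply/eqP.
  by move: e; rewrite [p]nvar0_mpolyC mevalC => ->; rewrite mpolyC0.
have up0 : uni p != 0.
  by apply: contraNneq p0 => e; rewrite -[p]uniK e /multi rmorph0.
have [|v vl] := IHn (lead_coef (uni p)); first by rewrite lead_coef_eq0.
have mp0 : map_poly (meval v) (uni p) != 0.
  by rewrite -size_poly_gt0 size_map_poly_id0 ?size_poly_gt0.
have /closed_nonrootP[t] := mp0.
by rewrite /root -meval_uni => ?; exists (rcons_fun v t).
Qed.

Lemma mpoly_value0 n (p : MP n) : (forall v, meval v p = 0) -> p = 0.
Proof.
move=> h; apply/eqP; apply: contraT => /mpoly_nonzero_value[v].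
by rewrite h eqxx.
Qed.

Lemma poly_value0 (p : {poly K}) : (forall t, p.[t] = 0) -> p = 0.
Proof.
move=> h; apply/eqP; apply: contraT => /closed_nonrootP[t].
by rewrite /root h eqxx.
Qed.

Lemma prime_uni n (f : MP n.+1) : prime_elt f -> prime_elt (uni f).
Proof. exact: (prime_iso (@uniK K n) (@multiK K n)). Qed.

Import Pdiv.Idomain.

(** Elimination of the last variable. If [f] does not involve it, the induction applies to the
    coefficients of [h]. Otherwise [f] divides [h] or the two are coprime, and in the latter case a
    Bezout identity gives a nonzero [c] in the other variables that vanishes below every zero of
    [f]. *)
Lemma prime_vanishing n (f h : MP n) : prime_elt f ->
  (forall v, meval v f = 0 -> meval v h = 0) -> divides f h.
Proof.
elim: n f h => [|n IHn] f h pf fh.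
  have [f0 /negP[]] := pf; rewrite [f]nvar0_mpolyC.
  apply: rmorph_unit; rewrite unitfE; apply: contraNneq f0 => e.
  by rewrite [f]nvar0_mpolyC e mpolyC0.
suff [g eg] : divides (uni f) (uni h).
  by exists (multi g); rewrite -[h]uniK eg multiM uniK.
have pF := prime_uni pf; have F0 := prime_neq0 pF.
have vF v t : (map_poly (meval v) (uni f)).[t] = 0 -> (map_poly (meval v) (uni h)).[t] = 0.
  by move=> e; rewrite -(meval_uni h v t); apply: fh; rewrite (meval_uni f v t).
set F := uni f in pF F0 vF *; set H := uni h in vF *.
have [sF|sF] := leqP (size F) 1.
  have eF := size1_polyC sF; rewrite eF in pF *.
  apply/divides_polyCP => i; apply: IHn; first exact: prime_polyC_inv.
  move=> v vc; have : map_poly (meval v) H = 0.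
    apply: poly_value0 => t; apply: vF.
    by rewrite eF map_polyC hornerC /= vc.
  by move/(congr1 (fun p : {poly K} => p`_i)); rewrite coef_map coef0.
have [cop|] := boolP (coprimep F H); last exact: prime_not_coprimep.
have /Bezout_coprimepP[[U W] /= e] := cop.
move: e; rewrite -size_poly_eq1 => /eqP e1.
have ec : U * F + W * H = ((U * F + W * H)`_0)%:P by apply: size1_polyC; rewrite e1.
set c := _`_0 in ec; have c0 : c != 0.
  by rewrite -(polyC_eq0 c) -ec -size_poly_gt0 e1.
(* The leading coefficient does not vanish at [v], so [F] keeps its degree there and has a root [t];
   as [c] does not vanish at [v] either, this contradicts the Bezout identity. *)
have [|v] := @mpoly_nonzero_value n (c * lead_coef F).
  by rewrite mulf_neq0 ?lead_coef_eq0.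
rewrite mevalM mulf_eq0 negb_or => /andP[vc vl].
have /closed_rootP[t /rootP Ft] : size (map_poly (meval v) F) != 1%N.
  by rewrite size_map_poly_id0 // gtn_eqF.
have Ht := vF v t Ft.
by case/eqP: vc; exact: (bezout_eval (phi := meval v) ec Ft Ht).
Qed.

End ClosedField.

(** * Multiplicities of prime factors *)

Section Multiplicity.
Variable R : idomainType.
Implicit Types p a b : R.

Lemma mult_exists p a : ufd R -> prime_elt p -> a != 0 ->
  exists k, exists2 b, a = b * p ^+ k & ~ divides p b.
Proof.
move=> fR pp a0; have [u [s [uu sp e]]] := fR a a0.
have [n] := ubnP (size s); elim: n a u s a0 uu sp e => // n IHn a u s a0 uu sp e.
rewrite ltnS => le_n; have [[b eb]|] := pselect (divides p a); last first.
  by move=> npa; exists 0%N, a => //; rewrite mulr1.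
have b0 : b != 0 by apply: contraNneq a0 => b0; rewrite eb b0 mul0r.
have [v [t [uv tp e' lt]]] := factor_cancel uu sp pp (etrans (esym eb) e).
have [k [c ec nc]] := IHn b v t b0 uv tp e' (leq_trans lt le_n).
by exists k.+1, c => //; rewrite eb ec exprSr mulrA.
Qed.

(** For prime [p] over a factorial ring, the default 0 is reached only at [a = 0]. *)
Definition mult p a : nat :=
  if pselect (exists k, exists2 b, a = b * p ^+ k & ~ divides p b) is left h
  then sval (cid h) else 0%N.

Lemma mult_mulX p b k : prime_elt p -> ~ divides p b -> mult p (b * p ^+ k) = k.
Proof.
move=> pp nb; rewrite /mult; case: pselect => [h|[]]; last by exists k, b.
case: cid => /= j [c e nc]; have p0 := prime_neq0 pp; clear h.
wlog lt : j k b c nb nc e / (j < k)%N.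
  move=> W; have [lt|lt|//] := ltngtP j k; first exact: W nb nc e lt.
  by apply/esym; apply: (W k j c b) => //.
have pj0 : p ^+ j != 0 by rewrite expf_neq0.
have : b * p ^+ (k - j) * p ^+ j = c * p ^+ j by rewrite -mulrA -exprD subnK ?(ltnW lt).
move/(mulIf pj0) => e'; case: nc; rewrite -e' -(@prednK (k - j)) ?subn_gt0 // exprS.
by apply: divides_mull; apply: divides_mulr; exact: divides_refl.
Qed.

Hypothesis fR : ufd R.
Variable p : R.
Hypothesis pp : prime_elt p.

Lemma mult_decomp a : a != 0 -> exists2 b, a = b * p ^+ mult p a & ~ divides p b.
Proof.
by move=> a0; have [k [b e nb]] := mult_exists fR pp a0; exists b; rewrite // {2}e mult_mulX.
Qed.

Lemma multM a b : a != 0 -> b != 0 -> mult p (a * b) = (mult p a + mult p b)%N.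
Proof.
move=> /mult_decomp[a' ea na] /mult_decomp[b' eb nb].
rewrite {1}ea {1}eb mulrACA -exprD mult_mulX //.
by case: pp => _ _ h /h[].
Qed.

Lemma mult_eq0 a : ~ divides p a -> mult p a = 0%N.
Proof. by move=> na; rewrite -[a]mulr1 -(expr0 p) mult_mulX. Qed.

Lemma mult_gt0 a : a != 0 -> divides p a -> (0 < mult p a)%N.
Proof.
move=> a0 pa; have [b e nb] := mult_decomp a0; rewrite lt0n; apply: contra_notN nb => /eqP e0.
by move: pa; rewrite {1}e e0 mulr1.
Qed.

Lemma mult_exp a k : a != 0 -> mult p (a ^+ k) = (k * mult p a)%N.
Proof.
move=> a0; elim: k => [|k IHk].
  rewrite expr0 mult_eq0 // => /divides_unit h; case: pp => _ /negP[].
  by apply: h; exact: unitr1.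
by rewrite exprS multM ?expf_neq0 // IHk mulSn.
Qed.

Lemma mult_divides a k : (k <= mult p a)%N -> a != 0 -> divides (p ^+ k) a.
Proof.
move=> le a0; have [b e _] := mult_decomp a0.
by rewrite e -(subnK le) exprD mulrA; exists (b * p ^+ (mult p a - k)).
Qed.

Lemma mult_ge a k : a != 0 -> divides (p ^+ k) a -> (k <= mult p a)%N.
Proof.
move=> a0 [c e]; have c0 : c != 0 by apply: contraNneq a0 => c0; rewrite e c0 mul0r.
have p0 := prime_neq0 pp.
rewrite e (multM c0 (expf_neq0 k p0)) (mult_exp k p0).
have -> : mult p p = 1%N.
  rewrite -[X in mult p X](mul1r p) -[X in 1 * X]expr1 mult_mulX //.
  by move=> /divides_unit h; case: pp => _ /negP[]; apply: h; exact: unitr1.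
by rewrite muln1 leq_addl.
Qed.

End Multiplicity.

Lemma mult_associate (R : idomainType) (p q a : R) : ufd R -> prime_elt p ->
  prime_elt q -> divides p q -> a != 0 -> mult p a = mult q a.
Proof.
move=> fR pp pq pdq a0; have [u uu eu] := prime_divides_prime pp pq pdq.
have [b e nb] := mult_decomp fR pq a0.
move: e; set k := mult q a; clearbody k => e.
rewrite e {1}eu exprMn mulrA mult_mulX // => -[c ec]; apply: nb.
exists (c * u^-1 * u^-1 ^+ k).
have uX : u ^+ k \is a GRing.unit by rewrite unitrX.
apply: (mulIr uX); rewrite ec eu exprVn.
rewrite [RHS](_ : _ = c * p * (u^-1 * u) * ((u ^+ k)^-1 * u ^+ k)); last by ring.
by rewrite !mulVr // !mulr1.
Qed.

(** Representatives of the prime divisors of [d] up to associates: with repetitions pruned,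
    multiplicities along them can be prescribed independently. *)
Lemma prime_support (R : idomainType) (d : R) : ufd R -> d != 0 ->
  exists s : seq R, [/\ uniq s, forall f, f \in s -> prime_elt f /\ divides f d,
    forall f g, f \in s -> g \in s -> f != g -> ~ divides f g &
    forall g, prime_elt g -> divides g d -> exists2 f, f \in s & divides f g].
Proof.
move=> fR d0; have [u [s0 [uu sp e]]] := fR d d0.
have sd f : f \in s0 -> divides f d.
  by move=> fs; rewrite e (big_rem f) //=; apply: divides_mull; apply: divides_mulr; exact: divides_refl.
have {u uu e} cov g : prime_elt g -> divides g d -> exists2 f, f \in s0 & divides g f.
  move=> pg; rewrite e; case: (pg) => _ ug hg /hg[/(divides_unit uu)|/(prime_prod pg)//].
  by rewrite (negPf ug).
suff [s [us ss nd cs]] : exists s : seq R, [/\ uniq s, {subset s <= s0},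
    forall f g, f \in s -> g \in s -> f != g -> ~ divides f g &
    forall f, f \in s0 -> exists2 f', f' \in s & divides f' f].
  exists s; split=> // [f /ss fs|g pg gd]; first by split; [exact: sp|exact: sd].
  have [f fs gf] := cov g pg gd; have [f' fs' ff] := cs f fs; exists f' => //.
  have [v uv ev] := prime_divides_prime pg (sp f fs) gf.
  case: ff => c ec; exists (v^-1 * c); apply: (mulrI uv).
  by rewrite -ev !mulrA mulrV // mul1r.
clear sd cov d0; elim: s0 sp => [|f s0 IHs] sp.
  by exists [::]; split.
have [|s [us ss nd cs]] := IHs; first by move=> g gs; apply: sp; rewrite in_cons gs orbT.
have [[f' fs' ff]|nf] := pselect (exists2 f', f' \in s & divides f' f).
  exists s; split=> // [g /ss gs|g]; first by rewrite in_cons gs orbT.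
  by rewrite in_cons => /orP[/eqP->|/cs//]; exists f'.
exists (f :: s); split.
- by rewrite /= us andbT; apply/negP => fs; case: nf; exists f => //; exact: divides_refl.
- by move=> g; rewrite !in_cons => /orP[->//|/ss->]; rewrite orbT.
- move=> g h; rewrite !in_cons => /orP[/eqP->|gs] /orP[/eqP->|hs]; rewrite ?eqxx // => ne fh.
  + have ph : prime_elt h by apply: sp; rewrite in_cons ss ?orbT.
    have pf : prime_elt f by apply: sp; rewrite mem_head.
    have [v uv ev] := prime_divides_prime pf ph fh.
    by case: nf; exists h => //; exists v^-1; rewrite ev mulKr.
  + by case: nf; exists g.
  + exact: nd fh.
- move=> g; rewrite in_cons => /orP[/eqP->|/cs[f' fs' ff]].
    by exists f; [rewrite mem_head|exact: divides_refl].
  by exists f'; rewrite // in_cons fs' orbT.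
Qed.

Section FractionCriteria.
Variables (R : idomainType) (K : fieldType) (phi : {rmorphism R -> K}).
Hypothesis fR : ufd R.
Implicit Types a b p q f : R.

Lemma prime_factor_at a : a != 0 -> phi a = 0 ->
  exists f, [/\ prime_elt f, divides f a & phi f = 0].
Proof.
move=> a0 pa; have [u [s [uu sp e]]] := fR a0.
have /eqP : phi u * \prod_(x <- s) phi x = 0 by rewrite -rmorph_prod -rmorphM -e.
rewrite mulf_eq0 => /orP[/eqP u0|].
  by have := rmorph_unit phi uu; rewrite u0 unitr0.
rewrite prodf_seq_eq0 => /hasP[f fs /eqP f0]; exists f; split=> //; first exact: sp.
by rewrite e (big_rem f) //=; apply: divides_mull; apply: divides_mulr; exact: divides_refl.
Qed.

(* [p / q] lies in the local ring at the point [phi] as soon as no prime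
   through that point has a pole. *)
Lemma regular_criterion p q : p != 0 -> q != 0 ->
  (forall f, prime_elt f -> phi f = 0 -> (mult f q <= mult f p)%N) ->
  exists a b, phi b != 0 /\ p * b = q * a.
Proof.
move=> p0 q0; have [u [s [uu sp e]]] := fR q0.
have [n] := ubnP (size s); elim: n p q u s p0 q0 uu sp e => // n IHn p q u s p0 q0 uu sp e.
rewrite ltnS => le_n h; have [q1|q1] := eqVneq (phi q) 0; last first.
  by exists p, q; rewrite mulrC.
have [f [pf fq f0]] := prime_factor_at q0 q1.
have fp : divides f p.
  rewrite -[f]expr1; apply: mult_divides => //.
  by apply: leq_trans (h f pf f0); apply: mult_gt0.
have [q' eq] := fq; have [p' ep] := fp.
have q'0 : q' != 0 by apply: contraNneq q0 => x0; rewrite eq x0 mul0r.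
have p'0 : p' != 0 by apply: contraNneq p0 => x0; rewrite ep x0 mul0r.
have f_0 := prime_neq0 pf.
have [v [t [uv tp e' lt]]] := factor_cancel uu sp pf (etrans (esym eq) e).
have [|a [b [b0 eab]]] := IHn p' q' v t p'0 q'0 uv tp e' (leq_trans lt le_n).
  move=> g pg g0; have := h g pg g0.
  by rewrite eq ep !multM // leq_add2r.
by exists a, b; split=> //; rewrite ep eq mulrAC eab mulrAC.
Qed.

(** If the numerator given by [regular_criterion] vanished at the point, a prime factor of it
    through the point would break the equality of multiplicities. *)
Lemma unit_criterion p q : p != 0 -> q != 0 ->
  (forall f, prime_elt f -> phi f = 0 -> mult f q = mult f p) ->
  exists a b, [/\ phi a != 0, phi b != 0 & p * b = q * a].
Proof.
move=> p0 q0 h; have [f pf f0|a [b [b0 e]]] := regular_criterion p0 q0.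
  by rewrite h.
exists a, b; split=> //; apply/eqP => pa0.
have b_0 : b != 0 by apply: contraNneq b0 => ->; rewrite rmorph0.
have a0 : a != 0.
  by apply: contra_eq_neq e => ->; rewrite mulr0 mulf_neq0.
have [f [pf fa f0]] := prime_factor_at a0 pa0.
have := congr1 (mult f) e; rewrite !multM // (h f pf f0) => /addnI.
rewrite (mult_eq0 pf) => [|[c eb]]; last first.
  by move: b0; rewrite eb rmorphM f0 mulr0 eqxx.
by have := mult_gt0 fR pf a0 fa => /[swap] <-.
Qed.

Lemma mult_unit_at f a : prime_elt f -> phi f = 0 -> phi a != 0 -> mult f a = 0%N.
Proof.
move=> pf f0 a0; apply: mult_eq0 => // -[c e].
by move: a0; rewrite e rmorphM f0 mulr0 eqxx.
Qed.

(** Valuative argument: if [p / q] had a pole along a prime [f] through the point, then [b * p ^+ m]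
    would have strictly smaller multiplicity along [f] than every other term of the relation. *)
Lemma integral_criterion p q m (a : nat -> R) b : p != 0 -> q != 0 ->
  phi b != 0 -> b * p ^+ m + \sum_(i < m) a i * p ^+ i * q ^+ (m - i) = 0 ->
  exists c d, phi d != 0 /\ p * d = q * c.
Proof.
move=> p0 q0 b0 e; apply: regular_criterion => // f pf f0.
rewrite leqNgt; apply/negP => lt.
have b_0 : b != 0 by apply: contraNneq b0 => ->; rewrite rmorph0.
have bp0 : b * p ^+ m != 0 by rewrite mulf_neq0 ?expf_neq0.
have : (mult f (b * p ^+ m) < mult f p * m + 1)%N.
  rewrite multM ?expf_neq0 // (mult_unit_at pf f0 b0) mult_exp //; lia.
rewrite ltnNge => /negP[]; apply: mult_ge => //.
have -> : b * p ^+ m = - \sum_(i < m) a i * p ^+ i * q ^+ (m - i).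
  by apply/eqP; rewrite -addr_eq0 e.
rewrite -sumrN; apply: divides_sum => i _.
rewrite -mulNr -mulNr -mulrA; apply: divides_mull.
have -> : (mult f p * m + 1 = mult f p * i + (mult f p * (m - i) + 1))%N.
  by rewrite addnA -mulnDr subnKC // ltnW.
have dm x k l : x != 0 -> (l <= k * mult f x)%N -> divides (f ^+ l) (x ^+ k).
  by move=> x0 le; apply: mult_divides; rewrite ?mult_exp ?expf_neq0.
have [x ->] : divides (f ^+ (mult f p * i)) (p ^+ i) by apply: dm; rewrite // mulnC.
have [y ->] : divides (f ^+ (mult f p * (m - i) + 1)) (q ^+ (m - i)).
  apply: dm => //; have := ltn_ord i; rewrite -subn_gt0; nia.
by exists (x * y); rewrite [f ^+ (_ + (_ + _))]exprD mulrACA.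
Qed.

End FractionCriteria.

(** * Affine charts *)

Section Irreducible.
Variable T : topologicalType.
Implicit Types S F G O : set T.

Lemma irreducible_open S O1 O2 : irreducible_set S -> open O1 -> open O2 ->
  S `&` O1 !=set0 -> S `&` O2 !=set0 -> S `&` (O1 `&` O2) !=set0.
Proof.
move=> [_ irr] o1 o2 [x [Sx O1x]] [y [Sy O2y]]; apply: contrapT => ne.
have [||z Sz|h|h] := irr (~` O1) (~` O2).
- exact: open_closedC.
- exact: open_closedC.
- apply: contrapT => /not_orP[/contrapT ? /contrapT ?]; apply: ne.
  by exists z.
- exact: h Sx O1x.
- exact: h Sy O2y.
Qed.

Lemma irreducibleP S : S !=set0 -> (forall O1 O2, open O1 -> open O2 ->
  S `&` O1 !=set0 -> S `&` O2 !=set0 -> S `&` (O1 `&` O2) !=set0) ->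
  irreducible_set S.
Proof.
move=> S0 h; split=> // F G cF cG sFG; apply: contrapT => /not_orP[].
move=> /existsNP[x /not_implyP[Sx Fx]] /existsNP[y /not_implyP[Sy Gy]].
have [||||z [Sz [Fz Gz]]] := h (~` F) (~` G).
- exact: closed_openC.
- exact: closed_openC.
- by exists x.
- by exists y.
by have [] := sFG z Sz.
Qed.

Lemma irreducible_closure S : irreducible_set S -> irreducible_set (closure S).
Proof.
move=> irr; apply: irreducibleP; first by have [[x Sx] _] := irr; exists x; exact: subset_closure.
move=> O1 O2 o1 o2 [x [cx O1x]] [y [cy O2y]].
have [||z [Sz O12z]] := irreducible_open irr o1 o2.
- exact: cx (open_nbhs_nbhs (conj o1 O1x)).
- exact: cy (open_nbhs_nbhs (conj o2 O2y)).
by exists z; split=> //; exact: subset_closure.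
Qed.

Lemma irreducible_subset_closed S F O : irreducible_set S -> closed F -> open O ->
  S `&` O !=set0 -> S `&` O `<=` F -> S `<=` F.
Proof.
move=> [_ irr] cF oO [x [Sx Ox]] h; have [|||//|h'] := irr F (~` O) => //.
- exact: open_closedC.
- move=> z Sz; have [Oz|] := pselect (O z); last by right.
  by left; apply: h.
- by case: (h' x Sx).
Qed.

End Irreducible.

Lemma irreducible_image (T T' : topologicalType) (f : T -> T') (S : set T) :
  (forall O, open O -> open (f @^-1` O)) -> irreducible_set S ->
  irreducible_set (f @` S).
Proof.
move=> cf irr; apply: irreducibleP; first by have [[x Sx] _] := irr; exists (f x), x.
move=> O1 O2 o1 o2 [_ [[x Sx <-] O1x]] [_ [[y Sy <-] O2y]].
have [||z [Sz [O1z O2z]]] := irreducible_open irr (cf _ o1) (cf _ o2).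
- by exists x.
- by exists y.
by exists (f z); split=> //; exists z.
Qed.

Section RegularFunctions.
Variables (K : fieldType) (X : fspace K).
Implicit Types (U : set X) (f g : X -> K).

Lemma reg_opp U f : reg U f -> reg U (fun x => - f x).
Proof.
by move=> rf; apply: (reg_ext _ (reg_mul (reg_cst U (-1)) rf)) => x _; rewrite mulN1r.
Qed.

Lemma reg_sub U f g : reg U f -> reg U g -> reg U (fun x => f x - g x).
Proof. by move=> rf rg; apply: reg_add => //; exact: reg_opp. Qed.

Lemma reg_exp U f k : reg U f -> reg U (fun x => f x ^+ k).
Proof.
move=> rf; elim: k => [|k IHk]; first exact: reg_cst.
by apply: (reg_ext _ (reg_mul rf IHk)) => x _; rewrite exprS.
Qed.

(** The locus where the two functions differ is open, and two open sets that meet an irreducible set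
    meet inside it. *)
Lemma reg_agree (S O U : set X) f g : irreducible_set S -> open U -> open O ->
  S `&` O !=set0 -> reg U f -> reg U g -> (forall x, S x -> O x -> U x -> f x = g x) ->
  forall x, S x -> U x -> f x = g x.
Proof.
move=> irr oU oO ne rf rg e x Sx Ux; apply/eqP; rewrite -subr_eq0; apply: contraT => nz.
have o := reg_open oU (reg_sub rf rg).
have [||z [Sz [[Uz nez] Oz]]] := irreducible_open irr o oO => //.
  by exists x; split.
by move: nez; rewrite /= (e z Sz Oz Uz) subrr eqxx.
Qed.

End RegularFunctions.

Section AffineSpace.
Variables (K : closedFieldType) (N : nat).
Local Notation MP := (mpoly N K).

Definition affine_space : fspace K := aff (@zeros K N set0).

Fact zeros_set0 (v : 'rV[K]_N) : zeros set0 v.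
Proof. by []. Qed.

Definition apt (v : 'rV[K]_N) : affine_space := SigSub (mem_set (zeros_set0 v)).

Definition ev (p : MP) (x : affine_space) : K := mpeval p (aff_val x).

Lemma ev_rmorph x : {phi : {rmorphism MP -> K} | forall p, phi p = ev p x}.
Proof. by exists (meval (fun i => aff_val x 0 i)). Qed.

Lemma evD p q x : ev (p + q) x = ev p x + ev q x. Proof. exact: mevalD. Qed.
Lemma evB p q x : ev (p - q) x = ev p x - ev q x. Proof. exact: mevalB. Qed.
Lemma evM p q x : ev (p * q) x = ev p x * ev q x. Proof. exact: mevalM. Qed.
Lemma evC c x : ev (mpolyC N c) x = c. Proof. exact: mevalC. Qed.
Lemma ev0 x : ev 0 x = 0. Proof. exact: meval0. Qed.
Lemma ev1 x : ev 1 x = 1. Proof. exact: meval1. Qed.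
Lemma evX p k x : ev (p ^+ k) x = ev p x ^+ k. Proof. exact: (rmorphXn (meval _)). Qed.

Lemma ev_sum (I : Type) (s : seq I) (P : pred I) (F : I -> MP) x :
  ev (\sum_(i <- s | P i) F i) x = \sum_(i <- s | P i) ev (F i) x.
Proof. exact: (raddf_sum (meval _)). Qed.

Lemma ev_prod (I : Type) (s : seq I) (P : pred I) (F : I -> MP) x :
  ev (\prod_(i <- s | P i) F i) x = \prod_(i <- s | P i) ev (F i) x.
Proof. exact: (rmorph_prod (meval _)). Qed.

Lemma apt_val x : apt (aff_val x) = x.
Proof. exact: val_inj. Qed.

Lemma ev_neq0 p : p != 0 -> exists x, ev p x != 0.
Proof.
move=> /mpoly_nonzero_value[v pv]; exists (apt (\row_i v i)).
by rewrite /ev /mpeval (meval_eq _ (v2 := v)) // => i; rewrite mxE.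
Qed.

Definition nonzero p : set affine_space := [set x | ev p x != 0].

Lemma nonzero_open p : open (nonzero p).
Proof.
change (@aff_open K N (zeros set0) (nonzero p)) => x px.
by exists p; split.
Qed.

Lemma nonzeroM p q : nonzero (p * q) = nonzero p `&` nonzero q.
Proof.
by apply/seteqP; split=> x; rewrite /nonzero /= evM mulf_eq0 negb_or => /andP.
Qed.

Lemma affine_openP (O : set affine_space) : open O ->
  forall x, O x -> exists2 p, nonzero p x & nonzero p `<=` O.
Proof.
move=> oO x Ox; have [p [px pO]] := (oO : @aff_open K N (zeros set0) O) x Ox.
by exists p.
Qed.

Lemma affine_irreducible : irreducible_set [set: affine_space].
Proof.
apply: irreducibleP; first by exists (apt 0).
move=> O1 O2 o1 o2 [x [_ O1x]] [y [_ O2y]].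
have [p px pO] := affine_openP o1 O1x; have [q qx qO] := affine_openP o2 O2y.
have nz r z : nonzero r z -> r != 0.
  by move=> rz; apply: contraNneq rz => ->; rewrite ev0.
have [|z] := @ev_neq0 (p * q); first by rewrite mulf_neq0 ?(nz _ _ px) ?(nz _ _ qx).
by rewrite evM mulf_eq0 negb_or => /andP[pz qz]; exists z; split=> //; split; [exact: pO|exact: qO].
Qed.

Lemma ev_zero_on_open (O : set affine_space) p : open O -> O !=set0 ->
  (forall x, O x -> ev p x = 0) -> p = 0.
Proof.
move=> oO [x Ox] h; apply/eqP; apply: contraT => /ev_neq0[y py].
have [||z [_ [Oz pz]]] := irreducible_open affine_irreducible oO (@nonzero_open p).
- by exists x.
- by exists y.
by move: pz; rewrite /nonzero /= h // eqxx.
Qed.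

Lemma reg_ev U p : reg U (ev p).
Proof.
change (@aff_reg K N (zeros set0) U (ev p)) => x _; exists p, 1.
rewrite -[mpeval 1 _]/(ev 1 x) ev1 oner_neq0; split=> // y _ _.
by rewrite -[mpeval 1 _]/(ev 1 y) ev1 divr1.
Qed.

(** The fraction is expanded by the equation of a basic neighbourhood, so that its denominator is
    nonzero only inside [U]. *)
Lemma reg_fraction U f : open U -> reg U f -> forall x, U x ->
  exists p q, [/\ nonzero q x, nonzero q `<=` U & forall y, nonzero q y -> f y * ev q y = ev p y].
Proof.
move=> oU rf x Ux; have [p [q [qx fE]]] := (rf : @aff_reg K N (zeros set0) U f) x Ux.
have [h hx hU] := affine_openP oU Ux.
exists (p * h), (q * h); rewrite nonzeroM; split=> [//|y [_ /hU]//|y [qy hy]].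
rewrite fE //; last exact: hU.
by rewrite !evM -[mpeval _ _]/(ev p y) -[mpeval _ _]/(ev q y) mulrA divfK.
Qed.

Lemma fraction_reg U f : (forall x, U x ->
  exists p q, nonzero q x /\ forall y, U y -> nonzero q y -> f y * ev q y = ev p y) -> reg U f.
Proof.
move=> h; change (@aff_reg K N (zeros set0) U f) => x Ux.
have [p [q [qx e]]] := h x Ux; exists p, q; split=> // y Uy qy.
by apply: (mulIf qy); rewrite [LHS]e // divfK.
Qed.

Definition hypersurface (f : MP) : set affine_space := [set x | ev f x = 0].

Lemma hypersurface_closed f : closed (hypersurface f).
Proof.
rewrite -openC (_ : ~` _ = nonzero f); first exact: nonzero_open.
by apply/seteqP; split=> x /=; [move/eqP|move=> h; apply/eqP].
Qed.

Lemma hypersurface_divides f h : prime_elt f -> hypersurface f `<=` hypersurface h ->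
  divides f h.
Proof.
move=> pf fh; apply: prime_vanishing => // v fv.
have E p : ev p (apt (\row_i v i)) = meval v p.
  by rewrite /ev /mpeval; apply: meval_eq => i; rewrite mxE.
by rewrite -E; apply: fh; rewrite /hypersurface /= E.
Qed.

Lemma hypersurface_irreducible f : prime_elt f -> irreducible_set (hypersurface f).
Proof.
move=> pf; have [f0 uf hf] := pf; apply: irreducibleP.
  apply/set0P/negP => /eqP e; case/negP: uf.
  have : divides f 1 by apply: hypersurface_divides => // x; rewrite e.
  by apply: divides_unit; exact: unitr1.
move=> O1 O2 o1 o2 [x [fx O1x]] [y [fy O2y]].
have [p px pO] := affine_openP o1 O1x; have [q qy qO] := affine_openP o2 O2y.
apply: contrapT => ne.
have nf r z : nonzero r z -> hypersurface f z -> ~ divides f r.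
  by move=> rz fz [g e]; move: rz; rewrite /nonzero /= e evM fz mulr0 eqxx.
have /hf[/(nf _ _ px fx)|/(nf _ _ qy fy)] // : divides f (p * q).
apply: hypersurface_divides => // z fz; apply/eqP; apply: contraT.
rewrite evM mulf_eq0 negb_or => /andP[pz qz]; case: ne.
by exists z; split=> //; split; [exact: pO|exact: qO].
Qed.

Lemma irreducible_prime_vanishing S g : irreducible_set S -> g != 0 ->
  S `<=` hypersurface g -> exists2 f, prime_elt f & S `<=` hypersurface f.
Proof.
move=> irr g0 Sg; have [u [s [uu sp e]]] := @ufd_mpoly K N g g0.
have {e} : S `<=` hypersurface (\prod_(f <- s) f).
  move=> x /Sg; rewrite /hypersurface /= e evM => /eqP; rewrite mulf_eq0 => /orP[/eqP u0|/eqP//].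
  have [phi phiE] := ev_rmorph x.
  by have := rmorph_unit phi uu; rewrite phiE u0 unitr0.
elim: s sp => [|f s IHs] sp.
  by case: irr => [[x Sx] _] /(_ x Sx); rewrite big_nil /hypersurface /= ev1 => /eqP; rewrite oner_eq0.
rewrite big_cons => h; have [||x Sx|?|?] := irr.2 (hypersurface f) (hypersurface (\prod_(j <- s) j)).
- exact: hypersurface_closed.
- exact: hypersurface_closed.
- have /eqP := h x Sx; rewrite evM mulf_eq0 => /orP[/eqP?|/eqP?]; by [left|right].
- by exists f => //; apply: sp; rewrite mem_head.
- by apply: IHs => // x xs; apply: sp; rewrite in_cons xs orbT.
Qed.

End AffineSpace.

Arguments apt {K N} v.
Arguments nonzero_open {K N} p.
Arguments reg_ev {K N} U p.

Section Chart.
Variables (K : closedFieldType) (N : nat) (X : fspace K).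
Local Notation MP := (mpoly N K).
Local Notation AN := (affine_space K N).
Variables (phi : AN -> X) (U : set X).
Hypothesis iso : iso_on phi setT U.
Hypothesis irrX : irreducible_set [set: X].

Lemma chart_open : open U. Proof. by case: iso. Qed.

Lemma chart_in y : U (phi y).
Proof. by case: iso => _ _ [h _ _] _ _; exact: h. Qed.

Lemma chart_inj : injective phi.
Proof. by case: iso => _ _ [_ h _] _ _ y z e; apply: h => //; rewrite inE. Qed.

Lemma chart_surj x : U x -> exists y, x = phi y.
Proof. by case: iso => _ _ [_ _ h] _ _ /h[y _ <-]; exists y. Qed.

Definition chart_inv (x : X) : AN := xget (apt 0) [set y | phi y = x].

Lemma chart_invK y : chart_inv (phi y) = y.
Proof.
rewrite /chart_inv; case: xgetP => [z _ /chart_inj//|/(_ y)].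
by move=> /(_ erefl).
Qed.

Lemma chart_image_open O : open O <-> open (phi @` O).
Proof. by case: iso => _ _ _ h _; apply: h. Qed.

Lemma chart_preimage_open O : open O -> open (phi @^-1` O).
Proof.
move=> oO; apply/chart_image_open.
rewrite (_ : _ @` _ = O `&` U); first exact: openI oO chart_open.
apply/seteqP; split=> x; first by move=> [y Oy <-]; split=> //; exact: chart_in.
by move=> [Ox /chart_surj[y e]]; exists y; rewrite // /preimage /= -e.
Qed.

Lemma chart_reg O f : open O -> O `<=` U ->
  reg O f <-> reg (phi @^-1` O) (fun y => f (phi y)).
Proof.
move=> oO OU; case: iso => _ _ _ _ /(_ O f OU oO).
by rewrite setTI.
Qed.

Lemma chart_pull_reg O f : open O -> reg O f -> reg (phi @^-1` O) (fun y => f (phi y)).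
Proof.
move=> oO rf; have rOU : reg (O `&` U) f by apply: reg_res rf => x [].
have /(chart_reg _ (openI oO chart_open)) : O `&` U `<=` U by move=> x [].
move=> /(_ f)[/(_ rOU) + _]; apply: reg_res => y Oy; split=> //; exact: chart_in.
Qed.

Definition poly_on (p : MP) (x : X) : K := ev p (chart_inv x).

Lemma poly_onE p y : poly_on p (phi y) = ev p y.
Proof. by rewrite /poly_on chart_invK. Qed.

Lemma reg_poly_on p : reg U (poly_on p).
Proof.
apply/chart_reg => //; first exact: chart_open.
by apply: (@reg_ext _ _ _ (ev p)) => [y _|]; [rewrite poly_onE|exact: reg_ev].
Qed.

Definition nonzero_on p : set X := phi @` nonzero p.

Lemma nonzero_on_open p : open (nonzero_on p).
Proof. exact/chart_image_open/nonzero_open. Qed.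

Lemma chart_dense O : open O -> O !=set0 -> U `&` O !=set0.
Proof.
move=> oO [x Ox]; have [||z [_ h]] := irreducible_open irrX chart_open oO.
- by exists (phi (apt 0)); split=> //; exact: chart_in.
- by exists x.
by exists z.
Qed.

(** Generically [f] is a quotient [p / q] of polynomials. Clearing the denominators of the integral
    equation gives a polynomial identity, to which [integral_criterion] applies at the point of the
    chart over [x]. *)
Lemma chart_normal (x : X) (W : set X) f : U x -> open W -> W !=set0 -> reg W f ->
  (exists (W' : set X) m (a : nat -> X -> K), [/\ open W', W' x,
       forall i, (i < m)%N -> reg W' (a i) &
       forall y, W y -> W' y -> f y ^+ m + \sum_(i < m) a i y * f y ^+ i = 0]) ->
  exists (W' : set X) g, [/\ open W', W' x, reg W' g & forall y, W y -> W' y -> g y = f y].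
Proof.
move=> Ux oW W0 rf [W' [m [a [oW' W'x ra ea]]]].
have [w [Uw Ww]] := chart_dense oW W0.
have [y0 ey0] := chart_surj Ux; have [yw eyw] := chart_surj Uw.
have oWp := chart_preimage_open oW.
have [|p [q [qw qW fE]]] := reg_fraction oWp (chart_pull_reg oW rf) (x := yw).
  by rewrite /preimage /= -eyw.
have nz (r : MP) (z : AN) : nonzero r z -> r != 0.
  by move=> rz; apply: contraNneq rz => ->; rewrite ev0.
suff [c [d [d0 e]]] : exists c d, ev d y0 != 0 /\ p * d = q * c.
  exists (nonzero_on d), (fun x => poly_on c x / poly_on d x); split.
  - exact: nonzero_on_open.
  - by exists y0.
  - apply: reg_mul.
      by apply: reg_res (reg_poly_on c) => _ [y _ <-]; exact: chart_in.
    apply: reg_inv; first by move=> _ [y dy <-]; rewrite poly_onE.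
    by apply: reg_res (reg_poly_on d) => _ [y _ <-]; exact: chart_in.
  move=> x' Wy [y dy ex]; rewrite -{x'}ex in Wy *; rewrite !poly_onE; apply: (mulIf (dy : ev d y != 0)).
  rewrite divfK //; apply/esym.
  have oWd := openI oWp (nonzero_open d).
  have rfd : reg (phi @^-1` W `&` nonzero d) (fun y => f (phi y) * ev d y).
    apply: reg_mul; last exact: reg_ev.
    by apply: reg_res (chart_pull_reg oW rf) => z [].
  have ne : [set: AN] `&` nonzero q !=set0 by exists yw.
  have H := reg_agree (affine_irreducible K N) oWd (nonzero_open q) ne rfd (reg_ev _ c).
  apply: (H _ y).
  - move=> z _ qz _; apply: (mulfI (qz : ev q z != 0)).
    by rewrite mulrA [ev q z * _]mulrC (fE z qz) -!evM e.
  - by [].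
  - by split.
have [p0|p0] := eqVneq p 0.
  by exists 0, 1; rewrite ev1 oner_neq0 p0 mul0r mulr0.
have oW'p := chart_preimage_open oW'.
have /choice[st stP] : forall i : 'I_m, exists st : MP * MP,
    [/\ nonzero st.2 y0, nonzero st.2 `<=` phi @^-1` W' &
    forall y, nonzero st.2 y -> a i (phi y) * ev st.2 y = ev st.1 y].
  move=> i; have [|s [t [ty tW sE]]] := reg_fraction oW'p (chart_pull_reg oW' (ra i (ltn_ord i))) (x := y0).
    by rewrite /preimage /= -ey0.
  by exists (s, t).
(* [b] is a common denominator of the coefficients and [al i] the numerator of the i-th one over it;
   [insub] only converts the natural number index to an ordinal. *)
pose b := \prod_i (st i).2; pose al (i : nat) :=
  if insub i is Some j then (st j).1 * \prod_(k | k != j) (st k).2 else 0.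
have b0 : ev b y0 != 0.
  by rewrite ev_prod; apply/prodf_neq0 => i _; have [] := stP i.
have [phy0 phE] := ev_rmorph y0.
have ide : b * p ^+ m + \sum_(i < m) al i * p ^+ i * q ^+ (m - i) = 0.
  have [||z [_ [[qz bz] W'z]]] := irreducible_open (affine_irreducible K N)
    (openI (nonzero_open q) (nonzero_open b)) oW'p.
  + have [|z] := @ev_neq0 K N (q * b).
      rewrite mulf_neq0 ?(nz _ _ qw) //.
      by apply: contraNneq b0 => ->; rewrite ev0.
    by rewrite evM mulf_eq0 negb_or => /andP[qz bz]; exists z.
  + by exists y0; split=> //; rewrite /preimage /= -ey0.
  apply: (@ev_zero_on_open K N (nonzero q `&` nonzero b `&` phi @^-1` W')).
  + by apply: openI => //; apply: openI; exact: nonzero_open.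
  + by exists z.
  move=> {z qz bz W'z} y [[qy by_] W'y].
  have := ea _ (qW _ qy) W'y.
  move/(congr1 (fun z => ev b y * ev q y ^+ m * z)); rewrite mulr0 => <-.
  rewrite evD evM evX ev_sum mulrDr -(fE _ qy) exprMn; congr (_ + _).
    by rewrite -mulrA; congr (_ * _); rewrite mulrC.
  rewrite mulr_sumr; apply: eq_bigr => i _.
  rewrite !evM !evX -(fE _ qy) exprMn /al insubT //= => lt.
  have -> : Sub (i : nat) lt = i :> 'I_m by exact: val_inj.
  have [_ _ sE] := stP i.
  have ebE : ev b y = ev (st i).2 y * ev (\prod_(k | k != i) (st k).2) y.
    by rewrite -evM /b (bigD1 i).
  have siy : nonzero (st i).2 y.
    by move: by_; rewrite /nonzero /= ebE mulf_eq0 negb_or => /andP[].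
  rewrite evM -(sE _ siy) ebE.
  have -> : ev q y ^+ m = ev q y ^+ i * ev q y ^+ (m - i).
    by rewrite -exprD subnKC // ltnW.
  ring.
have phb : phy0 b != 0 by rewrite phE.
have [c [d [d0 e]]] := integral_criterion (@ufd_mpoly K N) p0 (nz _ _ qw) phb ide.
by exists c, d; rewrite -phE.
Qed.

Implicit Types E F : set X.

Lemma closed_contains_chart F : closed F -> U `<=` F -> F = setT.
Proof.
move=> cF UF; apply/seteqP; split=> // x _; apply: (irreducible_subset_closed irrX cF chart_open) => //.
  by exists (phi (apt 0)); split=> //; exact: chart_in.
by move=> y [_ /UF].
Qed.

Lemma closed_chart_sub E F : irreducible_set E -> closed F -> Defs.meets U E ->
  phi @^-1` E `<=` phi @^-1` F -> E `<=` F.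
Proof.
move=> irr cF [x [Ux Ex]] h; apply: (irreducible_subset_closed irr cF chart_open).
  by exists x.
by move=> y [Ey /chart_surj[z ez]]; rewrite ez; apply: h; rewrite /preimage /= -ez.
Qed.

Lemma codim_ge1 E : closed E -> E != setT -> codim_ge E 1.
Proof.
move=> cE ET D cD irrD DE.
exists (fun i => if i is 0%N then D else setT); split=> //; split=> [[|i] _ //|[|//] _].
split=> // h; case/eqP: ET; apply/seteqP; split=> // x _.
by move: DE; rewrite -((closure_id E).1 cE) => DE; apply: DE; apply: h.
Qed.

Lemma codim_ge2 E F : closed E -> E `<` F -> closed F -> irreducible_set F ->
  F != setT -> codim_ge E 2.
Proof.
move=> cE [EF FE] cF irrF FT D cD irrD; rewrite -((closure_id E).1 cE) => DE.
exists (fun i => if i is 0%N then D else if i is 1%N then F else setT); split=> //.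
split=> [[|[|i]] _ //|[|[|//]] _ /=].
- split; first by move=> x /DE/EF.
  by move=> FD; apply: FE => x /FD/DE.
- by split=> // h; case/eqP: FT; apply/seteqP; split=> // x _; apply: h.
Qed.

Lemma prime_divisor_neqT E : prime_divisor E -> E != setT.
Proof.
move=> [cE irrE c1 _]; apply/eqP => ET.
have [|Z [[_ /(_ 0%N)]]] := c1 E cE irrE; first by rewrite -((closure_id E).1 cE).
by move=> /(_ isT) [_ h] e0; apply: h; rewrite e0 ET.
Qed.

Lemma image_hypersurface_closure f :
  phi @^-1` closure (phi @` hypersurface f) = hypersurface f.
Proof.
apply/seteqP; split=> y; last by move=> fy; apply: subset_closure; exists y.
move=> cy; apply: contrapT => nfy.
have [|_ [[z fz <-] [z' nz /chart_inj e]]] := cy (nonzero_on f).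
  apply: open_nbhs_nbhs; split; first exact: nonzero_on_open.
  by exists y => //; apply/eqP.
by move: nz; rewrite /nonzero /= e fz eqxx.
Qed.

Lemma hypersurface_neqT f : prime_elt f -> closure (phi @` hypersurface f) != setT.
Proof.
move=> pf; apply/eqP => e.
have [y fy] := ev_neq0 (prime_neq0 pf).
have : (phi @^-1` closure (phi @` hypersurface f)) y by rewrite e.
by rewrite image_hypersurface_closure /hypersurface /= => fy0; move: fy; rewrite fy0 eqxx.
Qed.

Lemma irreducible_image_hypersurface f : prime_elt f ->
  irreducible_set (closure (phi @` hypersurface f)).
Proof.
move=> pf; apply: irreducible_closure; apply: irreducible_image.
  exact: chart_preimage_open.
exact: hypersurface_irreducible.
Qed.

(** [E] lies in the closure of some prime hypersurface of the chart; a strict inclusion would give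
    [E] codimension at least two. *)
Lemma prime_divisor_equation E : prime_divisor E -> Defs.meets U E ->
  exists2 f, prime_elt f & phi @^-1` E = hypersurface f.
Proof.
move=> pE UE; have [cE irrE c1 c2] := pE; have ET := prime_divisor_neqT pE.
have irrE' : irreducible_set (phi @^-1` E).
  apply: irreducibleP.
    by have [x [/chart_surj[y ex] Ex]] := UE; exists y; rewrite /preimage /= -ex.
  move=> O1 O2 o1 o2 [y [Ey O1y]] [z [Ez O2z]].
  have [||x [Ew [[w O1w ex] [w' O2w]]]] := irreducible_open irrE
    ((chart_image_open O1).1 o1) ((chart_image_open O2).1 o2).
  - by exists (phi y); split=> //; exists y.
  - by exists (phi z); split=> //; exists z.
  rewrite -ex => /chart_inj e; exists w; split; first by rewrite /preimage /= ex.
  by split=> //; rewrite -e.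
have [y Ey] : exists y, ~ E (phi y).
  apply: contrapT => /forallNP h; case/eqP: ET; apply: closed_contains_chart => //.
  by move=> x /chart_surj[y ->]; apply: contrapT; exact: h.
have [g gy gE] := affine_openP (chart_preimage_open (closed_openC cE)) Ey.
have [||f pf Ef] := irreducible_prime_vanishing irrE' (g := g).
- by apply: contraNneq gy => ->; rewrite ev0.
- by move=> z Ez; apply/eqP; apply: contraT => gz; case: (gE z gz).
exists f => //; have EF : E `<=` closure (phi @` hypersurface f).
  apply: closed_chart_sub => //; first exact: closed_closure.
  by rewrite image_hypersurface_closure.
rewrite -image_hypersurface_closure; congr (_ @^-1` _); apply: contrapT => ne; apply: c2.
apply: (@codim_ge2 _ (closure (phi @` hypersurface f))) => //.
- by split=> // h; apply: ne; apply/seteqP.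
- exact: closed_closure.
- exact: irreducible_image_hypersurface.
- exact: hypersurface_neqT.
Qed.

(** Height one: suppose that an irreducible closed set lies strictly between the hypersurface and
    [X]. Some nonzero [g = b * f ^+ k], with [b] prime to [f], vanishes on it; as [f] does not
    vanish identically on it, [b] does, hence [b] vanishes on the hypersurface of [f], a
    contradiction. *)
Lemma hypersurface_prime_divisor f : prime_elt f ->
  prime_divisor (closure (phi @` hypersurface f)).
Proof.
move=> pf; have irr := irreducible_image_hypersurface pf.
split=> //; first exact: closed_closure.
  by apply: codim_ge1; [exact: closed_closure|exact: hypersurface_neqT].
move=> /(_ _ (@closed_closure _ _) irr)[|Z [[cZ sZ] e0]].
  by rewrite -((closure_id _).1 (@closed_closure _ _)).
have [cZ1 irrZ1] := cZ 1%N isT; have [Z01 Z10] := sZ 0%N isT; have [_ Z21] := sZ 1%N isT.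
have [y Zy] : exists y, ~ Z 1%N (phi y).
  apply: contrapT => /forallNP h; apply: Z21.
  rewrite (@closed_contains_chart (Z 1%N)) // => x /chart_surj[y ->].
  by apply: contrapT; exact: h.
have [g gy gZ] := affine_openP (chart_preimage_open (closed_openC cZ1)) Zy.
have g0 : g != 0 by apply: contraNneq gy => ->; rewrite ev0.
have [b e nb] := mult_decomp (@ufd_mpoly K N) pf g0.
have [z0 fz0] := (hypersurface_irreducible pf).1.
have Zz0 : Z 0%N (phi z0) by rewrite e0; apply: subset_closure; exists z0.
have fO := nonzero_on_open f.
apply: nb; apply: hypersurface_divides => // z fz.
suff h : phi @^-1` Z 1%N `<=` hypersurface b.
  apply: h; apply: Z01; rewrite e0; apply: subset_closure; by exists z.
have UZ : Z 1%N `&` nonzero_on f !=set0.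
  apply: contrapT => ne; apply: Z10.
  rewrite e0; apply: closed_chart_sub => //; first exact: closed_closure.
    by exists (phi z0); split; [exact: chart_in|exact: Z01].
  rewrite image_hypersurface_closure => w Zw; apply/eqP; apply: contraT => fw.
  by case: ne; exists (phi w); split=> //; exists w.
move=> w Zw; apply/eqP; apply: contraT => bw.
have [||v [Zv [[v' fv ev'] [v'' bv ev'']]]] := irreducible_open irrZ1 fO (nonzero_on_open b) => //.
  by exists (phi w); split=> //; exists w.
have e' : v' = v'' by apply: chart_inj; rewrite ev' ev''.
have gv : ev g v' = 0.
  apply/eqP; apply: contraT => gv; case: (gZ v' gv).
  by rewrite /preimage /= ev'.
have : ev b v' * ev f v' ^+ mult f g != 0 by rewrite mulf_neq0 ?expf_neq0 // e'.
by rewrite -evX -evM -e gv eqxx.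
Qed.

(** If [h = p / q] vanishes along [E], then [p * q] vanishes on the hypersurface of [f], so [f]
    divides [p]. *)
Lemma prime_divisor_equationP E f : prime_divisor E -> Defs.meets U E -> prime_elt f ->
  phi @^-1` E = hypersurface f -> uniformizer E U (poly_on f).
Proof.
move=> pE UE pf Ef; have [cE irrE _ _] := pE; split=> //.
- exact: chart_open.
- exact: reg_poly_on.
- by move=> x /chart_surj[y ->] Ey; rewrite poly_onE; have : (phi @^-1` E) y by []; rewrite Ef.
move=> U' h oU' mU' rh hE.
have [||z [Ez [/chart_surj[y ez] U'z]]] := irreducible_open irrE chart_open oU'.
- by have [x [? ?]] := UE; exists x.
- by have [x [? ?]] := mU'; exists x.
have oU'p := chart_preimage_open oU'.
have [|p [q [qy qU hpq]]] := reg_fraction oU'p (chart_pull_reg oU' rh) (x := y).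
  by rewrite /preimage /= -ez.
have fy : hypersurface f y by rewrite -Ef /preimage /= -ez.
have [c ep] : divides f p.
  have [_ _ hf] := pf; have /hf[//|[c eq]] : divides f (p * q).
    apply: hypersurface_divides => // w fw; rewrite /hypersurface /= evM.
    have [->|qw] := eqVneq (ev q w) 0; first by rewrite mulr0.
    rewrite -(hpq w qw) hE ?mul0r //; first exact: qU.
    by have : hypersurface f w by []; rewrite -Ef.
  by move: qy; rewrite /nonzero /= eq evM fy mulr0 eqxx.
exists (nonzero_on q), (fun x => poly_on c x / poly_on q x); split.
- exact: nonzero_on_open.
- by exists z; split=> //; exists y.
- by move=> _ [w qw <-]; split; [exact: chart_in|exact: qU].
- apply: reg_mul.
    by apply: reg_res (reg_poly_on c) => _ [w _ <-]; exact: chart_in.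
  apply: reg_inv; first by move=> _ [w dw <-]; rewrite poly_onE.
  by apply: reg_res (reg_poly_on q) => _ [w _ <-]; exact: chart_in.
- move=> _ [w qw <-]; rewrite !poly_onE; apply: (mulIf (qw : ev q w != 0)).
  by rewrite (hpq w qw) ep evM mulrAC divfK.
Qed.

Lemma uniformizer_subset E V V' t : irreducible_set E ->
  uniformizer E V t -> open V' -> Defs.meets V' E -> V' `<=` V -> uniformizer E V' t.
Proof.
move=> irrE [oV mV rt t0 ht] oV' mV' sub; split=> //.
- exact: reg_res rt.
- by move=> x /sub; exact: t0.
move=> U' h oU' mU' rh hE; have [U'' [q [oU'' mU'' sU'' rq qE]]] := ht U' h oU' mU' rh hE.
exists (U'' `&` V'), q; split.
- exact: openI.
- have [||z [Ez zU]] := irreducible_open irrE oU'' oV'.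
  + by have [x [? ?]] := mU''; exists x.
  + by have [x [? ?]] := mV'; exists x.
  by exists z.
- by move=> x [/sU''[_ ?] ?].
- by apply: reg_res rq => x [].
- by move=> x [? _]; exact: qE.
Qed.

(** The order is read off on the open set where the cofactor of the power of [f] is invertible; it
    meets [E] because [f] does not divide that cofactor. *)
Lemma ord_along_poly E f a : prime_divisor E -> Defs.meets U E -> prime_elt f ->
  phi @^-1` E = hypersurface f -> a != 0 -> ord_along E U (poly_on a) (mult f a).
Proof.
move=> pE UE pf Ef a0; have [b e nb] := mult_decomp (@ufd_mpoly K N) pf a0.
have bU : nonzero_on b `<=` U by move=> _ [y _ <-]; exact: chart_in.
exists (nonzero_on b), (poly_on f), (poly_on b); split=> //.
- apply: (uniformizer_subset _ (prime_divisor_equationP pE UE pf Ef)) => //.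
  + by case: pE.
  + exact: nonzero_on_open.
  apply: contrapT => ne; apply: nb; apply: hypersurface_divides => // y fy.
  apply/eqP; apply: contraT => bne; case: ne; exists (phi y); split; first by exists y.
  by have : (phi @^-1` E) y by rewrite Ef.
- exact: reg_res (reg_poly_on b).
- by move=> _ [y dy <-]; rewrite poly_onE.
- by move=> _ [y dy <-]; rewrite !poly_onE -evX -evM -e.
Qed.

Lemma hypersurface_eq_divides (f g : MP) : prime_elt f -> prime_elt g ->
  hypersurface f = hypersurface g -> divides f g.
Proof. by move=> pf pg e; apply: hypersurface_divides; rewrite // e. Qed.

Lemma mult_equations E E' (f f' : MP) : prime_divisor E -> prime_divisor E' ->
  Defs.meets U E -> Defs.meets U E' -> prime_elt f -> prime_elt f' ->
  phi @^-1` E = hypersurface f -> phi @^-1` E' = hypersurface f' ->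
  mult f f' = (E == E').
Proof.
move=> pE pE' mE mE' pf pf' Ef Ef'.
have fM := @ufd_mpoly K N.
have [e|ne] := eqVneq E E'.
  have [c ec] : divides f f' by apply: hypersurface_eq_divides; rewrite // -Ef e.
  rewrite ec -[f in c * f]expr1 mult_mulX // => -[d ed].
  have [_ _ h'] := pf'; have [_ uf _] := pf.
  have : divides f' (d * f * f) by exists 1; rewrite mul1r -ed -ec.
  have [f0 _ _] := pf; case: (prime_divides_prime pf pf' (ex_intro _ c ec)) => u uu eu _.
  have ecu : c = u.
    by apply: (mulIf f0); rewrite -ec -eu.
  move: uu; rewrite -ecu ed unitrM => /andP[_]; by rewrite (negPf uf).
apply: mult_eq0 => // h; case/eqP: ne.
have [u uu eu] := prime_divides_prime pf pf' h.
have efe : hypersurface f = hypersurface f'.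
  apply/seteqP; split=> y; rewrite /hypersurface /= eu evM => h'; first by rewrite h' mulr0.
  have [ph phE] := ev_rmorph y; apply/eqP; move/eqP: h'; rewrite mulf_eq0 => /orP[/eqP u0|//].
  by have := rmorph_unit ph uu; rewrite phE u0 unitr0.
have [cE irrE _ _] := pE; have [cE' irrE' _ _] := pE'.
by apply/seteqP; split; apply: closed_chart_sub; rewrite // Ef Ef' efe.
Qed.

(** On the chart every prime divisor has an equation, so the whole divisor is that of a quotient of
    two products of powers of such equations. *)
Lemma chart_cartier D x : U x -> weil_divisor D ->
  exists (W : set X) a b, [/\ open W, W x, reg W a, reg W b &
    forall E, prime_divisor E -> Defs.meets W E -> exists k l : nat,
      [/\ ord_along E W a k, ord_along E W b l & k%:Z - l%:Z = D E]].
Proof.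
move=> Ux [fD pD]; have fM := @ufd_mpoly K N.
have /choice[fe feP] : forall E, exists f, prime_divisor E -> Defs.meets U E ->
    prime_elt f /\ phi @^-1` E = hypersurface f.
  move=> E; have [h|h] := pselect (prime_divisor E /\ Defs.meets U E); last first.
    by exists 0 => ? ?; case: h.
  by have [f pf Ef] := prime_divisor_equation h.1 h.2; exists f.
have [s es] : exists s : seq (set X), [set E | D E != 0] = [set` s] by exact/finite_seqP.
pose ok E := `[< Defs.meets U E >].
pose P (k : set X -> nat) := \prod_(E <- undup s | ok E) fe E ^+ k E.
have sP E : E \in s -> prime_divisor E.
  by move=> Es; apply: pD; have : [set` s] E by []; rewrite -es.
have P0 k : P k != 0.
  rewrite /P prodf_seq_neq0; apply/allP => E; rewrite mem_undup => Es; apply/implyP => /asboolP m.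
  by rewrite expf_neq0 // prime_neq0 //; have [] := feP E (sP E Es) m.
have mP k E : prime_divisor E -> Defs.meets U E ->
    mult (fe E) (P k) = (if E \in s then k E else 0%N).
  move=> pE mE; have [pf Ef] := feP E pE mE.
  have : all (mem s) (undup s) by apply/allP => z; rewrite mem_undup.
  rewrite /P -(mem_undup s); have := undup_uniq s.
  elim: (undup s) => [|F t IHt].
    rewrite big_nil in_nil => _ _; apply: mult_eq0 => //; case => c /esym e.
    by have [_ /negP[]] := pf; apply/unitrP; exists c; rewrite [fe E * c]mulrC.
  rewrite /= big_cons => /andP[Ft ut] /andP[Fs ts].
  have pF := sP F Fs.
  have t0 : \prod_(E0 <- t | ok E0) fe E0 ^+ k E0 != 0.
    rewrite prodf_seq_neq0; apply/allP => E' Es; apply/implyP => /asboolP m.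
    rewrite expf_neq0 // prime_neq0 //; have [] := feP E' _ m => //.
    by apply: sP; move/allP: ts; apply.
  rewrite in_cons; case: ifP => [/asboolP mF|/asboolP nF].
    have [pfF EF] := feP F pF mF.
    rewrite (multM fM pf) ?expf_neq0 ?(prime_neq0 pfF) // (mult_exp fM pf) ?(prime_neq0 pfF) //.
    rewrite (mult_equations pE pF mE mF pf pfF Ef EF) IHt //.
    have [->|ne] := eqVneq E F; first by rewrite (negPf Ft) muln1 addn0.
    by rewrite muln0.
  rewrite IHt //; have [e|//] := eqVneq E F.
  by case: nF; rewrite -e.
(* Positive and negative parts of the coefficients; [Negz n] stands for [-(n + 1)]. *)
pose k1 E : nat := if D E is Posz n then n else 0.
pose k2 E : nat := if D E is Negz n then n.+1 else 0.
exists U, (poly_on (P k1)), (poly_on (P k2)); split=> //.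
- exact: chart_open.
- exact: reg_poly_on.
- exact: reg_poly_on.
move=> E pE mE; have [pf Ef] := feP E pE mE.
exists (mult (fe E) (P k1)), (mult (fe E) (P k2)); split.
- exact: ord_along_poly.
- exact: ord_along_poly.
rewrite !mP //; case: ifPn => Es.
  by rewrite /k1 /k2; case: (D E) => m; rewrite ?subr0 ?sub0r // NegzE.
apply/esym/eqP; apply: contraNT Es => DE.
by have : [set E | D E != 0] E by []; rewrite es.
Qed.

(** Near [w] the function [h] is a quotient of polynomials that do not vanish at [w], hence are not
    divisible by the prime [f] through [w]. It equals [p / q] as a rational function, so [p] and [q]
    have the same multiplicity. *)
Lemma mult_regular_unit O h (w : AN) (f p q : MP) O' : open O -> reg O h ->
  O w -> h w != 0 -> prime_elt f -> hypersurface f w -> p != 0 -> q != 0 ->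
  open O' -> O' !=set0 -> (forall y, O y -> O' y -> h y * ev q y = ev p y) ->
  mult f p = mult f q.
Proof.
move=> oO rh Ow hw pf fw p0 q0 oO' O'0 e.
have [al [be [bw bO ab]]] := reg_fraction oO rh Ow.
have aw : ev al w != 0 by rewrite -(ab w bw) mulf_neq0.
have fM := @ufd_mpoly K N.
have nd r : ev r w != 0 -> ~ divides f r.
  by move=> rw [c ec]; move: rw; rewrite ec evM fw mulr0 eqxx.
have nz r : ev r w != 0 -> r != 0 by apply: contraNneq => ->; rewrite ev0.
have : al * q = be * p.
  apply/eqP; rewrite -subr_eq0; apply/eqP.
  apply: (@ev_zero_on_open K N (nonzero be `&` O')).
  - by apply: openI => //; exact: nonzero_open.
  - have [||z [_ [? ?]]] := irreducible_open (affine_irreducible K N) (nonzero_open be) oO'.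
    + by exists w.
    + by have [z ?] := O'0; exists z.
    + by exists z.
  - move=> y [by_ O'y]; rewrite evB !evM -(ab y by_) -(e y (bO _ by_) O'y).
    by apply/eqP; rewrite subr_eq0; apply/eqP; ring.
move/(congr1 (mult f)); rewrite !(multM fM pf) // ?nz //.
by rewrite (mult_eq0 pf (nd _ aw)) (mult_eq0 pf (nd _ bw)) !add0n.
Qed.

(** Line bundles on affine space are trivial. The transition to the trivialisation at [x0] is a
    rational function [pp x / qq x]. Its order along a prime is the same for all [x] whose domain
    meets that prime, and dividing by one global fraction [P / Q] with these orders leaves units. *)
Lemma chart_frame (L : line_bundle X) : exists u : X -> X -> K,
  [/\ forall x, reg (ldom L x `&` U) (u x),
      forall x p, ldom L x p -> U p -> u x p != 0 &
      forall x y p, ldom L x p -> ldom L y p -> U p -> ltr L x y p * u y p = u x p].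
Proof.
have fM := @ufd_mpoly K N; have irrA := affine_irreducible K N.
pose dom x : set AN := phi @^-1` ldom L x; pose x0 := phi (apt 0).
pose g x y : AN -> K := fun w => ltr L x y (phi w).
have odom x : open (dom x) by apply: chart_preimage_open; exact: ldom_open.
have domx w : dom (phi w) w by exact: ldom_self.
have dom0 x : dom x !=set0.
  have [|z [/chart_surj[y ->] ?]] := chart_dense (ldom_open L x); last by exists y.
  by exists x; exact: ldom_self.
have rg x y : reg (dom x `&` dom y) (g x y).
  apply: (chart_pull_reg _ (ltr_reg L x y)).
  by apply: openI; exact: ldom_open.
have g0 x y w : dom x w -> dom y w -> g x y w != 0 by exact: ltr_neq0.
have gc x y z w : dom x w -> dom y w -> dom z w -> g x y w * g y z w = g x z w.
  exact: ltr_cocycle.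
have dmeet x y : exists z, dom x z /\ dom y z.
  have [||z [_ [? ?]]] := irreducible_open irrA (odom x) (odom y).
  - by have [z ?] := dom0 x; exists z.
  - by have [z ?] := dom0 y; exists z.
  - by exists z.
have /choice[pq pqP] : forall x, exists c : MP * MP, [/\ c.1 != 0, c.2 != 0,
    nonzero c.2 `<=` dom x `&` dom x0 &
    forall w, nonzero c.2 w -> g x x0 w * ev c.2 w = ev c.1 w].
  move=> x; have [z [xz x0z]] := dmeet x x0.
  have [|p [q [qz qd pqE]]] := reg_fraction (openI (odom x) (odom x0)) (rg x x0) (x := z) => //.
  have nz r : ev r z != 0 -> r != 0 by apply: contraNneq => ->; rewrite ev0.
  exists (p, q); split=> //=; apply: nz => //.
  by rewrite -(pqE z qz) mulf_neq0 ?g0.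
pose pp x := (pq x).1; pose qq x := (pq x).2.
have pp0 x : pp x != 0 by case: (pqP x).
have qq0 x : qq x != 0 by case: (pqP x).
have pqE x w : nonzero (qq x) w -> g x x0 w * ev (qq x) w = ev (pp x) w by case: (pqP x) => _ _ _; apply.
have qd x w : nonzero (qq x) w -> dom x w /\ dom x0 w by case: (pqP x) => _ _ h _ /h.
have nzM (a b : MP) : a != 0 -> b != 0 -> nonzero a `&` nonzero b !=set0.
  move=> a0 b0; have [z] := ev_neq0 (mulf_neq0 a0 b0).
  by rewrite evM mulf_eq0 negb_or => /andP[? ?]; exists z.
have rel x y f w : prime_elt f -> hypersurface f w -> dom x w -> dom y w ->
    mult f (pp x * qq y) = mult f (qq x * pp y).
  move=> pf fw xw yw.
  apply: (@mult_regular_unit _ (g x y) w f (pp x * qq y) (qq x * pp y)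
            (nonzero (qq x) `&` nonzero (qq y)) (openI (odom x) (odom y))) => //.
  - exact: g0.
  - by rewrite mulf_neq0.
  - by rewrite mulf_neq0.
  - by apply: openI; exact: nonzero_open.
  - exact: nzM.
  - move=> z [xz yz] [qxz qyz]; have [_ x0z] := qd _ _ qxz.
    rewrite !evM -(pqE x z qxz) -(pqE y z qyz) -(gc x y x0 z) //; ring.
(* Where [d] is nonzero the trivialisation at [x0] is available, so only the prime divisors of [d]
   need a correction. *)
have [d dx0 dsub] := affine_openP (odom x0) (domx (apt 0)).
have d0 : d != 0 by apply: contraNneq dx0 => ->; rewrite ev0.
have [s [us sP nd cov]] := prime_support fM d0.
(* [yy f] is a trivialisation whose domain meets the hypersurface of [f]: the one at any of its
   points. *)
have /choice[yy yyP] : forall f, exists y, prime_elt f -> exists2 w, hypersurface f w & dom y w.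
  move=> f; have [pf|npf] := pselect (prime_elt f); last by exists x0 => /npf.
  by have [[w fw] _] := hypersurface_irreducible pf; exists (phi w) => _; exists w.
pose PP (k : MP -> nat) := \prod_(f <- s) f ^+ k f.
have PP0 k : PP k != 0.
  rewrite prodf_seq_neq0; apply/allP => f fs /=; rewrite expf_neq0 //.
  by apply: prime_neq0; have [] := sP f fs.
have mPP0 k f : prime_elt f -> ~ divides f d -> mult f (PP k) = 0%N.
  move=> pf nfd; apply: mult_eq0 => // h.
  have [t ts ft] : exists2 t, t \in s & divides f t.
    rewrite /PP in h; elim: (s) h => [|t s' IHs].
      by rewrite big_nil => /divides_unit h; case: pf => _ /negP[]; apply: h; exact: unitr1.
    rewrite big_cons; case: (pf) => _ _ hf /hf[/(prime_exp pf)|/IHs[t' ? ?]].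
      by exists t; rewrite ?mem_head.
    by exists t'; rewrite // in_cons; apply/orP; right.
  by apply: nfd; apply: divides_trans ft _; have [] := sP t ts.
have mPP k f : f \in s -> mult f (PP k) = k f.
  move=> fs; have [pf _] := sP f fs; rewrite /PP (big_rem f) //=.
  rewrite mulrC mult_mulX // => h.
  have : all (fun t => (t \in s) && (t != f)) (rem f s).
    apply/allP => t; rewrite mem_rem_uniq // inE => /andP[-> ->].
    by [].
  elim: (rem f s) h => [|t s' IHs].
    by rewrite big_nil => /divides_unit h; case: pf => _ /negP[]; apply: h; exact: unitr1.
  rewrite big_cons /= => + /andP[/andP[ts tf] alls].
  case: (pf) => _ _ hf /hf[/(prime_exp pf) ft|h]; last exact: IHs h alls.
  by apply: (nd f t) => //; rewrite eq_sym.
(* [P / Q] has along each prime [f] of [s] the order of the transition function at [yy f]; by [rel]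
   any other domain meeting the hypersurface gives the same order. *)
pose P := PP (fun f => mult f (pp (yy f))); pose Q := PP (fun f => mult f (qq (yy f))).
have P0 : P != 0 by exact: PP0.
have Q0 : Q != 0 by exact: PP0.
have key x w f : dom x w -> prime_elt f -> hypersurface f w ->
    mult f (qq x * P) = mult f (pp x * Q).
  move=> xw pf fw; have [fd|nfd] := pselect (divides f d); last first.
    rewrite !(multM fM pf) // !(mPP0 _ f) // !addn0.
    have [||z [fz [xz dz]]] := irreducible_open (hypersurface_irreducible pf) (odom x) (nonzero_open d).
    - by exists w.
    - apply: contrapT => ne; apply: nfd; apply: hypersurface_divides => // z fz.
      by apply/eqP; apply: contraT => dz; case: ne; exists z.
    have := rel x x0 f z pf fz xz (dsub _ dz); rewrite !(multM fM pf) //.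
    suff -> : mult f (pp x0) = mult f (qq x0) by move/addIn.
    have := rel x0 x0 f z pf fz (dsub _ dz) (dsub _ dz); rewrite !(multM fM pf) //.
    by have := @mult_regular_unit (dom x0) (g x0 x0) z f (pp x0) (qq x0) (nonzero (qq x0));
       move=> H _; apply: H => //;
       [have := rg x0 x0; rewrite setIid|exact: dsub|apply: g0; exact: dsub|exact: nonzero_open|
        have [v ?] := ev_neq0 (qq0 x0); exists v|move=> y _; exact: pqE].
  have [t ts tf] := cov f pf fd; have [pt _] := sP t ts.
  have tw : hypersurface t w.
    have [u uu eu] := prime_divides_prime pt pf tf.
    have [ph phE] := ev_rmorph w; move: fw; rewrite /hypersurface /= eu evM => /eqP.
    rewrite mulf_eq0 => /orP[/eqP u0|/eqP//].
    by have := rmorph_unit ph uu; rewrite phE u0 unitr0.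
  rewrite -!(mult_associate fM pt pf tf) ?mulf_neq0 //.
  have [w' tw' yw'] := yyP t pt.
  have [||z [tz [xz yz]]] := irreducible_open (hypersurface_irreducible pt) (odom x) (odom (yy t)).
  - by exists w.
  - by exists w'.
  have := rel x (yy t) t z pt tz xz yz; rewrite !(multM fM pt) // !mPP // => ->.
(* The value at [w] of [(pp x / qq x) / (P / Q)], computed from a representation as a quotient of
   two polynomials that do not vanish at [w]. *)
have /choice[c0 c0P] : forall xw : X * AN, exists c, dom xw.1 xw.2 ->
    exists a b, [/\ ev a xw.2 != 0, ev b xw.2 != 0, pp xw.1 * Q * b = qq xw.1 * P * a &
      c = ev a xw.2 / ev b xw.2].
  move=> [x w] /=; have [xw|] := pselect (dom x w); last by exists 0.
  have [ph phE] := ev_rmorph w.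
  have [||f pf|a [b [a0 b0 e]]] := @unit_criterion MP K ph fM (pp x * Q) (qq x * P).
  - by rewrite mulf_neq0.
  - by rewrite mulf_neq0.
  - by rewrite phE => fw; exact: key xw pf fw.
  by exists (ev a w / ev b w) => _; exists a, b; rewrite -!phE.
pose c x w := c0 (x, w).
have cE x w a b : dom x w -> pp x * Q * b = qq x * P * a -> c x w * ev b w = ev a w.
  move=> xw e; have [a' [b' [a'0 b'0 e' ec]]] := c0P (x, w) xw.
  have E : a' * b = a * b'.
    have nz : qq x * P != 0 by rewrite mulf_neq0.
    by apply: (mulfI nz); rewrite !mulrA -e -e'; ring.
  by apply: (mulIf b'0); rewrite /c ec /= mulrAC divfK // -!evM E.
have rc x : reg (dom x) (c x).
  apply: fraction_reg => w xw; have [a [b [a0 b0 e _]]] := c0P (x, w) xw.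
  by exists a, b; split=> // y xy _; exact: cE.
have cN0 x w : dom x w -> c x w != 0.
  by move=> xw; rewrite /c; have [a [b [a0 b0 e ->]]] := c0P (x, w) xw; rewrite mulf_neq0 ?invr_eq0.
exists (fun x p => c x (chart_inv p)); split.
- move=> x; apply/chart_reg.
  + by apply: openI; [exact: ldom_open|exact: chart_open].
  + by move=> p [].
  apply: (@reg_ext _ _ _ (c x)) => [w _|]; first by rewrite chart_invK.
  by apply: reg_res (rc x) => w [].
- by move=> x p xp /chart_surj[w ew]; rewrite ew chart_invK; apply: cN0; rewrite /dom /preimage /= -ew.
move=> x y p xp yp /chart_surj[w ew]; rewrite ew chart_invK.
have xw : dom x w by rewrite /dom /preimage /= -ew.
have yw : dom y w by rewrite /dom /preimage /= -ew.
have oxy := openI (odom x) (odom y).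
have r1 : reg (dom x `&` dom y) (fun w => g x y w * c y w).
  by apply: reg_mul => //; apply: reg_res (rc y) => z [].
have r2 : reg (dom x `&` dom y) (c x) by apply: reg_res (rc x) => z [].
pose O := nonzero (qq x * qq y) `&` nonzero (P * Q).
have ne : [set: AN] `&` O !=set0.
  by have [z Oz] := nzM (qq x * qq y) (P * Q) (mulf_neq0 (qq0 x) (qq0 y)) (mulf_neq0 P0 Q0); exists z.
have oO : open O by apply: openI; exact: nonzero_open.
have H := reg_agree irrA oxy oO ne r1 r2.
apply: (H _ w) => // z _ [].
rewrite !nonzeroM => -[qxz qyz] [Pz Qz] [xz yz].
have cz v : nonzero (qq v) z -> dom v z -> c v z * ev P z = g v x0 z * ev Q z.
  move=> qvz vz; have [a [b [a0 b0 e]]] := c0P (v, z) vz; rewrite -/(c v z) /= => ce.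
  apply: (mulfI (qvz : ev (qq v) z != 0)).
  have := congr1 (fun r => ev r z) e; rewrite /= !evM -(pqE v z qvz) => E.
  apply: (mulIf b0); rewrite ce.
  rewrite [LHS](_ : _ = (ev (qq v) z * ev P z * ev a z) / ev b z * ev b z); last by ring.
  rewrite divfK // -E; ring.
apply: (mulIf (Pz : ev P z != 0)).
have [_ x0z] := qd _ _ qxz.
by rewrite -mulrA (cz y) // (cz x) // mulrA (gc x y x0).
Qed.

End Chart.

(** * Torus weights and stability *)

Section LaurentMonomials.
Variable K : numClosedFieldType.

Definition lmon s (t : 'I_s -> K) (e : 'rV[int]_s) : K := \prod_i t i ^ e 0 i.

Section Fixed.
Variables (s : nat) (t : 'I_s -> K).
Hypothesis t0 : forall i, t i != 0.

Lemma lmon_neq0 e : lmon t e != 0.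
Proof. by apply/prodf_neq0 => i _; apply: expfz_neq0. Qed.

Lemma lmonD e e' : lmon t (e + e') = lmon t e * lmon t e'.
Proof. by rewrite -big_split; apply: eq_bigr => i _; rewrite mxE expfzDr. Qed.

Lemma lmon0 : lmon t 0 = 1.
Proof. by rewrite /lmon big1 // => i _; rewrite mxE expr0z. Qed.

Lemma lmonN e : lmon t (- e) = (lmon t e)^-1.
Proof.
apply: (mulfI (lmon_neq0 e)); rewrite -lmonD subrr lmon0 divff //; exact: lmon_neq0.
Qed.

Lemma lmonZ (a : int) e : lmon t (a *: e) = lmon t e ^ a.
Proof.
rewrite /lmon; elim/big_rec2: _ => [|i y x _ ->]; first by rewrite exp1rz.
by rewrite expfzMl exprz_exp mxE [a * _]mulrC.
Qed.

Lemma lmon_sum (I : Type) (q : seq I) (P : pred I) (F : I -> 'rV[int]_s) :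
  lmon t (\sum_(i <- q | P i) F i) = \prod_(i <- q | P i) lmon t (F i).
Proof. exact: (big_morph (lmon t) lmonD lmon0). Qed.

Lemma lmon_mulmx q (E : 'M[int]_(q, s)) (e : 'rV[int]_q) :
  lmon t (e *m E) = lmon (fun j => lmon t (row j E)) e.
Proof.
by rewrite mulmx_sum_row lmon_sum; apply: eq_bigr => j _; rewrite lmonZ.
Qed.

Lemma lmon_delta i : lmon t (delta_mx 0 i) = t i.
Proof.
rewrite /lmon (bigD1 i) //= mxE !eqxx expr1z big1 ?mulr1 // => j ne.
by rewrite mxE (negPf ne) andbF expr0z.
Qed.

End Fixed.

Lemma lmon1 s (e : 'rV[int]_s) : lmon (fun=> 1) e = 1.
Proof. by rewrite /lmon big1 // => i _; rewrite exp1rz. Qed.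

Lemma eq_lmon s (t t' : 'I_s -> K) e : t =1 t' -> lmon t e = lmon t' e.
Proof. by move=> h; apply: eq_bigr => i _; rewrite h. Qed.

Lemma exists_root (x : K) (d : int) : x != 0 -> d != 0 -> exists2 y, y != 0 & y ^ d = x.
Proof.
have H m (y : K) : y != 0 -> exists2 z, z != 0 & z ^+ m.+1 = y.
  move=> y0; exists (m.+1.-root y); last by rewrite rootCK.
  by rewrite rootC_eq0.
case: d => [[|m]|m] x0 // _; first by have [y ? <-] := H m x x0; exists y.
have [|y y0 e] := H m x^-1; first by rewrite invr_eq0.
by exists y => //; rewrite NegzE -exprnN e invrK.
Qed.

(** The Smith normal form decouples the system into equations [y ^ d = t'], solvable because the
    field is algebraically closed. The hypothesis handles the rows where the normal form is zero:
    there the right-hand side is 1. *)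
Lemma torus_solve s r (M : 'M[int]_(s, r)) (t : 'I_s -> K) :
  (forall i, t i != 0) -> (forall e, e *m M = 0 -> lmon t e = 1) ->
  exists2 g : 'I_r -> K, forall k, g k != 0 & forall i, lmon g (row i M) = t i.
Proof.
move=> t0 h; have [L uL [Q uQ [d _ eM]]] := int_Smith_normal_form M.
set D := \matrix_(i, j) _ in eM.
pose t' i := lmon t (row i (invmx L)).
have t'0 i : t' i != 0 by apply: lmon_neq0.
have rD (i : 'I_s) (k : 'I_r) : i = k :> nat -> row i D = d`_i *: delta_mx 0 k.
  move=> e; apply/rowP => j; rewrite !mxE eqxx /= e.
  by rewrite mulr_natr [j == k]eq_sym.
have rD0 (i : 'I_s) : (r <= i)%N -> row i D = 0.
  move=> le; apply/rowP => j; rewrite !mxE; case: eqP => // e.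
  by have := ltn_ord j; rewrite -e ltnNge le.
have t'1 i : row i D = 0 -> t' i = 1.
  move=> r0; apply: h; rewrite eM -!row_mul !mulmxA mulVmx // mul1mx.
  by rewrite row_mul r0 mul0mx.
(* A coordinate beyond the number of equations, or with invariant factor 0, is unconstrained and is
   set to 1. *)
have /choice[g' g'P] : forall k : 'I_r, exists y : K, y != 0 /\
    forall i : 'I_s, i = k :> nat -> y ^ d`_i = t' i.
  move=> k; have [lt|ge] := ltnP k s; last first.
    by exists 1; split; [exact: oner_neq0|move=> i e; have := ltn_ord i; rewrite e ltnNge ge].
  have [d0|d0] := eqVneq d`_k 0.
    exists 1; split; first exact: oner_neq0.
    by move=> i e; rewrite exp1rz t'1 // (rD i k e) e d0 scale0r.
  have [y y0 yE] := exists_root (t'0 (Ordinal lt)) d0.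
  exists y; split=> // i e; have -> : i = Ordinal lt by exact: val_inj.
  by rewrite yE.
have g'0 k : g' k != 0 by case: (g'P k).
pose g k := lmon g' (row k (invmx Q)).
have g0 k : g k != 0 by apply: lmon_neq0.
exists g => // i.
have -> : row i M = row i (L *m D) *m Q by rewrite -row_mul -eM.
have -> : lmon g (row i (L *m D) *m Q) = lmon g' (row i (L *m D)).
  by rewrite -(lmon_mulmx g'0) -mulmxA mulmxV // mulmx1.
rewrite row_mul lmon_mulmx //.
rewrite (@eq_lmon _ _ t') => [|j]; last first.
  have [lt|ge] := ltnP j r; last by rewrite rD0 // lmon0 t'1 // rD0.
  rewrite (rD j (Ordinal lt)) // lmonZ lmon_delta.
  by have [_ ->] := g'P (Ordinal lt).
by rewrite -(lmon_mulmx t0) -row_mul mulmxV // row1 lmon_delta.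
Qed.

Lemma lmon_separates s (e : 'rV[int]_s) : e != 0 ->
  exists2 g : 'I_s -> K, forall k, g k != 0 & lmon g e != 1.
Proof.
move=> e0; have [k ek] : exists k, e 0 k != 0.
  apply/existsP; apply: contraNT e0; rewrite negb_exists => /forallP h.
  by apply/eqP/rowP => k; rewrite mxE; apply/eqP; rewrite -[_ == _]negbK h.
exists (fun j => if j == k then 2 else 1) => [j|].
  by case: ifP; rewrite ?oner_neq0 // pnatr_eq0.
rewrite /lmon (bigD1 k) //= eqxx big1 ?mulr1 => [|j /negPf->]; last by rewrite exp1rz.
have lt m : (1 : K) < 2 ^+ m.+1 by rewrite exprn_egt1 // ltr1n.
case: (e 0 k) ek => [[|m]|m] // _; first by rewrite -exprnP gt_eqF.
by rewrite NegzE -exprnN lt_eqF // invf_lt1 // (lt_trans ltr01).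
Qed.

(** Independence of characters: translating the relation by [g0] and subtracting [lmon g0 e0] times
    the original removes [e0], and [g0] is chosen to distinguish [e] from [e0]. *)
Lemma lmon_independent s (q : seq 'rV[int]_s) (c : 'rV[int]_s -> K) : uniq q ->
  (forall g : 'I_s -> K, (forall k, g k != 0) -> \sum_(e <- q) c e * lmon g e = 0) ->
  forall e, e \in q -> c e = 0.
Proof.
elim: q c => [//|e0 q IHq] c /= /andP[ne uq] h.
have cq e : e \in q -> c e = 0.
  move=> eq; have [|g0 g00 gE] := @lmon_separates s (e - e0).
    by rewrite subr_eq0; apply: contraNneq ne => <-.
  have : c e * (lmon g0 e - lmon g0 e0) = 0.
    apply: (IHq (fun e => c e * (lmon g0 e - lmon g0 e0))) => // g g_0.
    have := h (fun k => g k * g0 k) (fun k => mulf_neq0 (g_0 k) (g00 k)).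
    have M x : lmon (fun k => g k * g0 k) x = lmon g x * lmon g0 x.
      by rewrite -big_split; apply: eq_bigr => k _; rewrite expfzMl.
    have := h g g_0; rewrite !big_cons M => h1 h2.
    have -> : \sum_(j <- q) c j * (lmon g0 j - lmon g0 e0) * lmon g j =
       \sum_(j <- q) c j * lmon (fun k => g k * g0 k) j - lmon g0 e0 * \sum_(j <- q) c j * lmon g j.
      by rewrite mulr_sumr -sumrB; apply: eq_bigr => j _; rewrite M; ring.
    move/eqP: h1; rewrite addrC addr_eq0 => /eqP ->.
    by move/eqP: h2; rewrite addrC addr_eq0 => /eqP ->; ring.
  move/eqP; rewrite mulf_eq0 => /orP[/eqP//|]; rewrite subr_eq0 => /eqP ge.
  by move: gE; rewrite lmonD // lmonN // ge divff ?eqxx // lmon_neq0.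
move=> e; rewrite in_cons => /orP[/eqP->|/cq//].
have := h (fun=> 1) (fun=> oner_neq0 _); rewrite big_cons lmon1 mulr1 big1_seq ?addr0 //.
by move=> j /= /cq->; rewrite mul0r.
Qed.

(** Terms are grouped by weight before independence is applied, since several indices may share a
    weight. *)
Lemma lmon_coefficient s (I : eqType) (q : seq I) (w : I -> 'rV[int]_s) (c : I -> K) chi a :
  (forall g : 'I_s -> K, (forall k, g k != 0) ->
     \sum_(m <- q) c m * lmon g (w m) = a * lmon g chi) ->
  a = \sum_(m <- q | w m == chi) c m.
Proof.
move=> h; pose ws := undup (chi :: [seq w m | m <- q]).
pose d (x : 'rV[int]_s) : K := \sum_(m <- q | w m == x) c m - (if x == chi then a else 0).
have dw (g : 'I_s -> K) : (forall k, g k != 0) -> \sum_(x <- ws) d x * lmon g x = 0.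
  move=> g0; under eq_bigr => x _ do rewrite mulrBl.
  rewrite sumrB; apply/eqP; rewrite subr_eq0; apply/eqP.
  transitivity (\sum_(m <- q) c m * lmon g (w m)).
    under eq_bigr => x _ do rewrite mulr_suml.
    rewrite (exchange_big_dep xpredT) //=; apply: eq_big_seq => m mp.
    rewrite big_mkcond (bigD1_seq (w m)) ?undup_uniq //=; last first.
      by rewrite mem_undup in_cons map_f ?orbT.
    rewrite eqxx big1 ?addr0 // => x; rewrite eq_sym => /negPf ->; by [].
  rewrite h // (bigD1_seq chi) ?undup_uniq //=; last by rewrite mem_undup mem_head.
  rewrite eqxx big1_seq ?addr0 // => x /andP[/negPf-> _]; by rewrite mul0r.
have := lmon_independent (undup_uniq _) dw (e := chi).
rewrite mem_undup mem_head => /(_ isT); rewrite /d eqxx => /eqP.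
by rewrite subr_eq0 => /eqP.
Qed.

End LaurentMonomials.

Section Weights.
Variables (R : realType) (r n : nat) (A : 'M[int]_(r, n)).
Local Notation C := R[i].
Local Notation V := (V R A).
Local Notation torus := (torus R r).

Definition bvec (k : 'I_(n + n)) : 'rV[int]_r :=
  match fintype.split k with inl i => (col i A)^T | inr i => - (col i A)^T end.

Lemma bvec_l i : bvec (lshift n i) = (col i A)^T.
Proof. by rewrite /bvec (unsplitK (inl i)). Qed.

Lemma bvec_r i : bvec (rshift n i) = - (col i A)^T.
Proof. by rewrite /bvec (unsplitK (inr i)). Qed.

(* The index [lshift n i] stands for the coordinate [z_i], and [rshift n i] for
   [w_i]. *)
Definition bar (k : 'I_(n + n)) : 'I_(n + n) :=
  match fintype.split k with inl i => rshift n i | inr i => lshift n i end.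

Lemma bar_l i : bar (lshift n i) = rshift n i.
Proof. by rewrite /bar (unsplitK (inl i)). Qed.

Lemma bar_r i : bar (rshift n i) = lshift n i.
Proof. by rewrite /bar (unsplitK (inr i)). Qed.

Variant coord_spec : 'I_(n + n) -> Type :=
| CoordL i : coord_spec (lshift n i)
| CoordR i : coord_spec (rshift n i).

Lemma coordP k : coord_spec k.
Proof.
rewrite -(splitK k); case: (fintype.split k) => i /=; [exact: CoordL|exact: CoordR].
Qed.

Lemma barK : involutive bar.
Proof. by move=> k; case: (coordP k) => i; rewrite ?bar_l ?bar_r ?bar_l. Qed.

Lemma bvec_bar k : bvec (bar k) = - bvec k.
Proof. by case: (coordP k) => i; rewrite ?bar_l ?bar_r ?bvec_l ?bvec_r ?opprK. Qed.

Lemma bar_neq k : bar k != k.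
Proof.
by case: (coordP k) => i; rewrite ?bar_l ?bar_r; apply/eqP => /(congr1 val) /= e;
  have := ltn_ord i; lia.
Qed.

Definition co (v : V) (k : 'I_(n + n)) : C := aff_val v 0 k.

Lemma chrE (chi : 'rV[int]_r) (g : torus) : chr chi g = lmon (fun k => \val g 0 k) chi.
Proof. by []. Qed.

Lemma torus_neq0 (g : torus) k : \val g 0 k != 0.
Proof. by have /forallP := valP g. Qed.

Lemma chr0 (g : torus) : chr 0 g = 1.
Proof. exact: lmon0. Qed.

Lemma chrN chi (g : torus) : chr (- chi) g = (chr chi g)^-1.
Proof. by rewrite !chrE lmonN //; exact: torus_neq0. Qed.

Lemma chrMn chi (g : torus) k : chr (chi *+ k) g = chr chi g ^+ k.
Proof. by elim: k => [|k IHk]; rewrite ?mulr0n ?chr0 // mulrS chrD IHk exprS. Qed.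

Definition mk_torus (g : 'I_r -> C) (g0 : forall k, g k != 0) : torus.
Proof.
by exists (\row_k g k); apply/forallP => k; rewrite mxE.
Defined.

Lemma chr_mk_torus g (g0 : forall k, g k != 0) chi :
  chr chi (mk_torus g0) = lmon g chi.
Proof. by rewrite chrE; apply: eq_lmon => k; rewrite mxE. Qed.

Lemma co_act g v k : co (act g v) k = chr (bvec k) g * co v k.
Proof.
rewrite /co /aff_val /= /act_pt; case: (coordP k) => i.
  by rewrite row_mxEl mxE bvec_l mxE.
by rewrite row_mxEr mxE bvec_r mxE chrN.
Qed.

Lemma V_eq (u v : V) : (forall k, co u k = co v k) -> u = v.
Proof. by move=> h; apply: val_inj; apply/rowP => k; exact: h. Qed.

Definition wt (e : 'I_(n + n) -> nat) : 'rV[int]_r := \sum_k bvec k *+ e k.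

Definition mon (e : 'I_(n + n) -> nat) (v : V) : C := \prod_k co v k ^+ e k.

Lemma meval_mon (m : multinom (n + n)) (v : V) :
  mpeval (mpolyX C m) (aff_val v) = mon m v.
Proof. exact: mevalX. Qed.

Lemma chr_wt e (g : torus) : chr (wt e) g = \prod_k chr (bvec k) g ^+ e k.
Proof.
rewrite /wt (big_morph (fun x => chr x g) (id1 := 1) (op1 := *%R)) ?chr0 //.
  by apply: eq_bigr => k _; rewrite chrMn.
by move=> x y; rewrite chrD.
Qed.

Lemma mon_act e g v : mon e (act g v) = chr (wt e) g * mon e v.
Proof.
by rewrite chr_wt -big_split; apply: eq_bigr => k _; rewrite co_act exprMn.
Qed.

Lemma mon_semi e : semi_invariant (wt e) (mon e).
Proof.
split; last exact: mon_act.
exists (mpolyX C (Multinom (mktuple e))) => v; rewrite meval_mon.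
by apply: eq_bigr => k _; rewrite mnmE.
Qed.

Lemma mon_neq0 e v : (forall k, e k != 0%N -> co v k != 0) -> mon e v != 0.
Proof.
move=> h; apply/prodf_neq0 => k _.
by have [->|/h] := eqVneq (e k) 0%N; [rewrite expr0 oner_neq0|exact: expf_neq0].
Qed.

Lemma mon_neq0_inv e v k : mon e v != 0 -> e k != 0%N -> co v k != 0.
Proof.
move=> /prodf_neq0 h ek; have := h k isT; rewrite expf_eq0 negb_and.
by rewrite -leqNgt leqn0 (negPf ek).
Qed.

Lemma wtMn e j : wt (fun k => j * e k)%N = wt e *+ j.
Proof. by rewrite -sumrMnl; apply: eq_bigr => k _; rewrite mulnC mulrnA. Qed.

Definition wtm (m : multinom (n + n)) := wt m.

(* By independence of characters, only the monomials of the right weight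
   contribute to a semi-invariant. *)
Lemma semi_invariant_monomials chi (f : V -> C) : semi_invariant chi f -> exists2 p,
  forall v, f v = mpeval p (aff_val v) & forall m, m \in msupp p -> wtm m = chi.
Proof.
move=> [[p fE] finv].
pose s := [seq m <- msupp p | wtm m == chi].
pose q := \sum_(m <- s) (mcoeff m p) *: mpolyX C m.
have us : uniq s by rewrite filter_uniq // msupp_uniq.
have cq m : mcoeff m q = if m \in s then mcoeff m p else 0.
  rewrite /q raddf_sum /=.
  under eq_bigr => m' _ do rewrite mcoeffZ mcoeffX.
  case: ifP => ms.
    rewrite (bigD1_seq m) //= eqxx mulr1 big1 ?addr0 // => m' /negPf.
    by rewrite eq_sym => ->; rewrite mulr0.
  rewrite big1_seq // => m' /= m's; case: eqP => [e|]; last by rewrite mulr0.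
  by rewrite -e m's in ms.
exists q; last first.
  move=> m; rewrite mcoeff_msupp cq; case: ifP => [|_]; last by rewrite eqxx.
  by rewrite mem_filter => /andP[/eqP].
move=> v.
have pE u : mpeval p (aff_val u) = \sum_(m <- msupp p) mcoeff m p * mon m u.
  by rewrite /mpeval mevalE.
rewrite (@lmon_coefficient C r _ (msupp p) wtm (fun m => mcoeff m p * mon m v) chi (f v)).
  rewrite /mpeval /q raddf_sum big_filter.
  by apply: eq_bigr => m _; rewrite /= mevalZ -[meval _ _]/(mpeval _ _) meval_mon.
move=> g g0; pose G : torus := mk_torus g0.
have := finv G v; rewrite fE pE chr_mk_torus => E.
rewrite [RHS]mulrC -[RHS]E; apply: eq_bigr => m _.
by rewrite mon_act chr_mk_torus mulrA mulrAC.
Qed.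

Definition bQ k : 'rV[rat]_r := map_mx intr (bvec k).

Lemma bQ_bar k : bQ (bar k) = - bQ k.
Proof. by rewrite /bQ bvec_bar map_mxN. Qed.

Lemma wtQ e : map_mx intr (wt e) = \sum_k (e k)%:R *: bQ k :> 'rV[rat]_r.
Proof.
rewrite /wt (raddf_sum (map_mx intr)); apply: eq_bigr => k _ /=.
by rewrite raddfMn /= scaler_nat.
Qed.

End Weights.

Lemma clear_denominators s (x : 'I_s -> rat) : exists2 D : nat, (0 < D)%N &
  exists m : 'I_s -> int, forall k, x k * D%:R = (m k)%:~R.
Proof.
pose D := (\prod_k `|denq (x k)|)%N.
exists D; first by rewrite prodn_gt0 // => k; rewrite absz_gt0 denq_neq0.
exists (fun k => numq (x k) * (\prod_(l | l != k) `|denq (x l)|)%N%:Z) => k.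
rewrite /D (bigD1 k) //= natrM mulrA intrM -pmulrn; congr (_ * _).
have -> : (`|denq (x k)|%:R : rat) = (denq (x k))%:~R.
  by rewrite pmulrn gez0_abs ?denq_ge0.
by rewrite -{1}(divq_num_den (x k)) divfK // intr_eq0 denq_neq0.
Qed.

(** * The numerical criterion for semistability, and separation of orbits *)

Section Semistability.
Variables (R : realType) (r n : nat) (A : 'M[int]_(r, n)).
Local Notation C := R[i].
Local Notation V := (V R A).
Local Notation torus := (torus R r).
Local Notation I2 := 'I_(n + n).
Local Notation b := (bQ A).
Local Notation wpart := (@weight_part R r n A).
Implicit Types (theta eta : 'rV[rat]_r) (u v : V).

Lemma int_combination (e : I2 -> int) :
  \sum_k (e k)%:~R *: b k = map_mx intr (\sum_k e k *: bvec A k) :> 'rV[rat]_r.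
Proof.
rewrite (raddf_sum (map_mx intr)); apply: eq_bigr => k _.
by apply/rowP => i; rewrite /= !mxE intrM.
Qed.

Lemma int_combination0 (e : I2 -> int) :
  \sum_k (e k)%:~R *: b k = 0 -> \sum_k e k *: bvec A k = 0.
Proof.
by rewrite int_combination => h; apply: intr_mx_inj; rewrite h map_mx0.
Qed.

Definition in_cone theta (P : I2 -> Prop) := exists x : I2 -> rat,
  [/\ forall k, 0 <= x k, forall k, x k != 0 -> P k & \sum_k x k *: b k = theta].

Lemma weight_part_mon theta e j : map_mx intr (wt A e) = theta *+ j ->
  wpart theta j (mon e).
Proof. by move=> h; exists (wt A e) => //; exact: mon_semi. Qed.

Lemma cone_monomial theta (x : I2 -> rat) : (forall k, 0 <= x k) ->
  \sum_k x k *: b k = theta -> exists2 D, (0 < D)%N & exists E : I2 -> nat,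
    map_mx intr (wt A E) = theta *+ D /\ forall k, (E k == 0%N) = (x k == 0).
Proof.
move=> x0 xE; have [D D0 [m mE]] := clear_denominators x.
have DQ : (D%:R : rat) != 0 by rewrite pnatr_eq0 -lt0n.
have mabs k : (`|m k|%N%:R : rat) = x k * D%:R.
  rewrite mE pmulrn gez0_abs // -(ler0z rat) -mE mulr_ge0 // ler0n //.
exists D => //; exists (fun k => `|m k|%N); split.
  rewrite wtQ -xE -sumrMnl; apply: eq_bigr => k _.
  by rewrite mabs -scaler_nat scalerA mulrC.
by move=> k; rewrite -(pnatr_eq0 rat) mabs mulf_eq0 (negPf DQ) orbF.
Qed.

(** A semi-invariant that is nonzero at [v] contains a monomial that is nonzero at [v], whose
    exponents divided by the degree give the combination; conversely a combination with cleared
    denominators is the exponent of such a monomial. *)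
Lemma Vss_cone theta v : Vss theta v <-> in_cone theta (fun k => co v k != 0).
Proof.
split=> [[j [f [j0 [chi e /semi_invariant_monomials[p fE pw]] fv]]]|[x [x0 xP xE]]].
  have [m mp mv] : exists2 m, m \in msupp p & mon m v != 0.
    apply: contrapT => h; move: fv; rewrite fE /mpeval mevalE big1_seq ?eqxx // => m /= mp.
    rewrite -[\prod_i _]/(mon m v); apply/eqP; rewrite mulf_eq0; apply/orP; right.
    by apply: contrapT => /negP mv; apply: h; exists m.
  have jQ : (j%:R : rat) != 0 by rewrite pnatr_eq0 -lt0n.
  exists (fun k => (m k)%:R / j%:R); split.
  - by move=> k; rewrite divr_ge0 ?ler0n.
  - move=> k; rewrite mulf_eq0 negb_or pnatr_eq0 => /andP[mk _].
    exact: mon_neq0_inv mv mk.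
  - have := wtQ A m; rewrite -[wt A m]/(wtm A m) (pw m mp) e => h.
    apply: (scalerI jQ); rewrite [in RHS]scaler_nat h scaler_sumr.
    by apply: eq_bigr => k _; rewrite scalerA mulrC divfK.
have [D D0 [E [wE zE]]] := cone_monomial x0 xE.
exists D, (mon E); split=> //; first exact: weight_part_mon.
by apply: mon_neq0 => k ek; apply: xP; rewrite -zE.
Qed.

Definition spans_by (P : I2 -> Prop) := forall y : 'rV[rat]_r,
  exists2 c : I2 -> rat, forall k, c k != 0 -> P k & \sum_k c k *: b k = y.

(** Says that [theta] is interior to the cone generated by the weights of the nonzero coordinates of
    [v]: positive coefficients on a spanning set leave room for every small perturbation. *)
Definition interior_point theta v := exists x : I2 -> rat,
  [/\ forall k, 0 <= x k, forall k, x k != 0 -> co v k != 0,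
      \sum_k x k *: b k = theta & spans_by (fun k => x k != 0)].

Lemma interior_Vss theta v : interior_point theta v -> Vss theta v.
Proof. by move=> [x [? ? ? _]]; apply/Vss_cone; exists x. Qed.

Definition same_ideal theta u v :=
  forall j f, wpart theta j f -> f u = 0 <-> f v = 0.

(** The combination [f(u) g - g(u) f] has degree [j] and vanishes at [u], hence at [v]. *)
Lemma same_ideal_ratio theta u v j f g : same_ideal theta u v ->
  wpart theta j f -> wpart theta j g -> f u * g v = f v * g u.
Proof.
move=> h wf wg.
have := h j (fun x => f u * g x + - g u * f x) _.
have S := semi_invariants R A theta.
have w : wpart theta j (fun x => f u * g x + - g u * f x).
  exact: (@gr_add _ _ (semi_invariants R A theta) j _ _
    (@gr_scale _ _ (semi_invariants R A theta) j _ _ wg)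
    (@gr_scale _ _ (semi_invariants R A theta) j _ _ wf)).
move=> /(_ w)[+ _]; rewrite mulNr mulrC subrr => /(_ erefl) /eqP.
by rewrite mulNr subr_eq0 => /eqP ->; rewrite mulrC.
Qed.

(** Clear denominators in an expression of the weight of [k] by the weights in [P], and move
    everything to one side. *)
Lemma relation_through (P : I2 -> Prop) k : spans_by P -> exists rho : I2 -> int,
  [/\ \sum_l rho l *: bvec A l = 0, forall l, rho l != 0 -> P l \/ l = k &
      ~ P k -> 0 < rho k].
Proof.
move=> sp; have [c cP cE] := sp (b k).
have [D D0 [m mE]] := clear_denominators c.
exists (fun l => (if l == k then D%:Z else 0) - m l); split.
- apply: int_combination0; transitivity (D%:R *: (b k - \sum_l c l *: b l)); last first.
    by rewrite cE subrr scaler0.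
  rewrite scalerBr scaler_sumr [X in X - _](_ : _ = \sum_l (if l == k then D%:R else 0) *: b l).
    rewrite -sumrB; apply: eq_bigr => l _.
    rewrite scalerA mulrC mE -scalerBl; congr (_ *: _).
    by case: ifP => _; rewrite intrB ?mulr0z // -pmulrn.
  rewrite (bigD1 k) //= eqxx big1 ?addr0 // => l /negPf ->; by rewrite scale0r.
- move=> l; have [->|lk] := eqVneq l k; first by right.
  rewrite sub0r oppr_eq0 -(intr_eq0 rat) -mE mulf_eq0 negb_or => /andP[/cP ? _].
  by left.
- move=> nP; rewrite eqxx; suff -> : m k = 0 by rewrite subr0 ltz_nat.
  apply/eqP; rewrite -(intr_eq0 rat) -mE mulf_eq0; apply/orP; left.
  by apply/negPn/negP => /cP.
Qed.

(* Monomials of a common degree separate the orbits of points over which [eta]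
   is interior to the cone of weights. *)
Lemma same_ideal_orbit eta u v : interior_point eta u -> Vss eta v ->
  same_ideal eta u v -> exists g, v = act g u.
Proof.
move=> [x [x0 xu xE sp]] _ si.
have [J J0 [E [wE zE]]] := cone_monomial x0 xE.
have uE : mon E u != 0 by apply: mon_neq0 => k ek; apply: xu; rewrite -zE.
have vE : mon E v != 0.
  by apply: contra uE => /eqP h; apply/eqP; apply/(si J (mon E) (weight_part_mon wE)).
have vP k : x k != 0 -> co v k != 0 by rewrite -zE; exact: mon_neq0_inv.
(* [N e] copies of the monomial [E] absorb the negative exponents of [e], all of which lie in the
   support of [E]; [F e] is the resulting honest exponent. *)
pose N (e : I2 -> int) := (\sum_k `|e k|)%N.
have leN e k : (`|e k| <= N e)%N by rewrite /N (bigD1 k) //= leq_addr.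
pose F (e : I2 -> int) k := absz ((N e * E k)%N%:Z + e k).
have FE e : (forall k, e k < 0 -> x k != 0) ->
    forall k, (F e k)%:Z = (N e * E k)%N%:Z + e k.
  move=> neg k; rewrite /F gez0_abs //; have := leN e k.
  have [ek|ek] := ltP (e k) 0; last by lia.
  have : E k != 0%N by rewrite zE; exact: neg.
  by rewrite -lt0n => ? ?; nia.
have ratio e : (forall k, e k < 0 -> x k != 0) -> \sum_k e k *: bvec A k = 0 ->
    mon (F e) u * mon (fun k => N e * E k)%N v = mon (F e) v * mon (fun k => N e * E k)%N u.
  move=> neg e0; have wNE : map_mx intr (wt A (fun k => N e * E k)%N) = eta *+ (J * N e).
    by rewrite wtMn raddfMn /= wE mulrnA.
  apply: (same_ideal_ratio si (j := (J * N e)%N)); apply: weight_part_mon => //.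
  suff -> : wt A (F e) = wt A (fun k => N e * E k)%N by [].
  have wz (G : I2 -> nat) : wt A G = \sum_k (G k)%:Z *: bvec A k.
    by apply: eq_bigr => k _; rewrite -[(G k)%:Z]natz scaler_nat.
  rewrite !wz -[RHS]addr0 -[X in _ = _ + X]e0 -big_split /=; apply: eq_bigr => k _.
  by rewrite -scalerDl FE.
have /choice[rho rhoP] : forall k, exists rho : I2 -> int,
    [/\ \sum_l rho l *: bvec A l = 0, forall l, rho l != 0 -> x l != 0 \/ l = k &
      ~ (x k != 0) -> 0 < rho k].
  by move=> k; exact: relation_through.
have rneg k l : ~ (x k != 0) -> rho k l < 0 -> x l != 0.
  move=> nk neg; have [_ h pos] := rhoP k.
  have [|//|e] := h l; first by rewrite lt_eqF.
  by move: neg; rewrite e ltNge ltW // pos.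
have nz_mon G (w : V) : (forall k, x k != 0 -> co w k != 0) ->
    (forall k, G k != 0%N -> x k != 0 \/ co w k != 0) -> mon G w != 0.
  by move=> hw h; apply: mon_neq0 => k /h[/hw|].
have supp k : (co u k == 0) = (co v k == 0).
  have [xk|/negP nk] := boolP (x k != 0).
    by rewrite (negPf (xu k xk)) (negPf (vP k xk)).
  have [r0 rs pos] := rhoP k; have := ratio (rho k) (fun l => rneg k l nk) r0.
  have Fk : F (rho k) k != 0%N.
    have := FE (rho k) (fun l => rneg k l nk) k; have := pos nk.
    by lia.
  have Fl l : F (rho k) l != 0%N -> x l != 0 \/ l = k.
    move=> h; have [xl|xl] := boolP (x l != 0); first by left.
    have rl : rho k l != 0.
      have := FE (rho k) (fun l => rneg k l nk) l; move: xl; rewrite negbK -zE => /eqP ->.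
      by rewrite muln0 add0r => <-.
    case: (rs l rl) => [h1|->]; last by right.
    by rewrite h1 in xl.
  have NE (w : V) : (forall l, x l != 0 -> co w l != 0) -> mon (fun l => N (rho k) * E l)%N w != 0.
    by move=> hw; apply: nz_mon => // l; rewrite muln_eq0 negb_or zE => /andP[_ ?]; left.
  have z (w : V) : co w k = 0 -> mon (F (rho k)) w = 0.
    move=> wk; apply/eqP; apply: contraT => /mon_neq0_inv/(_ Fk).
    by rewrite wk eqxx.
  have nzF (w : V) : (forall l, x l != 0 -> co w l != 0) -> co w k != 0 -> mon (F (rho k)) w != 0.
    by move=> hw wk; apply: nz_mon => // l /Fl[?|->]; [left|right].
  move=> e; apply/idP/idP => /eqP k0; apply: contraT => k1.
    move: e; rewrite (z u k0) mul0r => /esym/eqP; rewrite mulf_eq0.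
    by rewrite (negPf (nzF v vP k1)) (negPf (NE u xu)).
  move: e; rewrite (z v k0) mul0r => /eqP; rewrite mulf_eq0.
  by rewrite (negPf (nzF u xu k1)) (negPf (NE v vP)).
pose t k : C := if co u k == 0 then 1 else co v k / co u k.
have t0 k : t k != 0.
  rewrite /t; case: ifPn => [_|uk]; first exact: oner_neq0.
  by rewrite mulf_neq0 ?invr_eq0 // -supp.
have tE k : co v k = t k * co u k.
  rewrite /t; case: ifPn => [uk|uk]; last by rewrite divfK.
  by rewrite mul1r (eqP uk); apply/eqP; rewrite -supp.
have monE G : mon G v = (\prod_k t k ^+ G k) * mon G u.
  by rewrite -big_split; apply: eq_bigr => k _; rewrite tE exprMn.
have lt1 (e : I2 -> int) : (forall k, e k < 0 -> x k != 0) -> (forall k, e k != 0 -> co u k != 0) ->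
    \sum_k e k *: bvec A k = 0 -> lmon t (\row_k e k) = 1.
  move=> neg sup e0; have := ratio e neg e0; rewrite !monE.
  have mu : mon (F e) u != 0.
    apply: mon_neq0 => k; have [ek|/sup//] := eqVneq (e k) 0.
    move=> h; apply: xu; rewrite -zE; apply: contraNneq h => Ek.
    by rewrite /F ek Ek muln0.
  have mE : mon (fun k => N e * E k)%N u != 0.
    by apply: mon_neq0 => k; rewrite muln_eq0 negb_or zE => /andP[_ /xu].
  rewrite mulrA => /(mulIf mE); rewrite [X in X = _]mulrC => /(mulIf mu) h.
  have : \prod_k t k ^+ (N e * E k) * lmon t (\row_k e k) = \prod_k t k ^+ (N e * E k) * 1.
    rewrite mulr1 [RHS]h /lmon -big_split; apply: eq_bigr => k _ /=.
    by rewrite mxE !exprnP -expfzDr // FE.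
  by apply: mulfI; apply/prodf_neq0 => k _; rewrite expf_neq0.
have rho1 k : ~ (x k != 0) -> co u k != 0 -> lmon t (\row_l rho k l) = 1.
  move=> nk uk; apply: lt1.
  - by move=> l; exact: rneg.
  - by move=> l; have [_ h _] := rhoP k => /h[/xu|->].
  - by have [] := rhoP k.
pose M := \matrix_k (if co u k == 0 then 0 else bvec A k) : 'M[int]_(n + n, r).
have [e eM|g g0 gE] := @torus_solve C _ _ M t t0; last first.
  exists (mk_torus g0); apply: V_eq => k; rewrite co_act tE chr_mk_torus.
  have := gE k; rewrite rowK; case: ifPn => [/eqP-> _|_ ->//].
  by rewrite !mulr0.
pose S k := (co u k != 0) && (x k == 0).
pose e1 k : int := if co u k == 0 then 0 else e 0 k.
(* The relation [e1] may be negative outside the support of [x], where [lt1] does not apply. Adding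
   [N e1] times the relation through each slot of [S] makes these exponents nonnegative, and by
   [rho1] it does not change the value of the monomial in [t]. *)
pose e2 k := e1 k + \sum_(l | S l) (N e1)%:Z * rho l k.
have e1E : lmon t e = lmon t (\row_k e1 k).
  apply: eq_bigr => k _; rewrite mxE /e1; case: ifPn => // uk.
  by rewrite /t uk exp1rz expr0z.
have s1 : \sum_k e1 k *: bvec A k = 0.
  rewrite -[RHS]eM mulmx_sum_row; apply: eq_bigr => k _; rewrite rowK /e1.
  by case: ifPn => // _; rewrite scale0r scaler0.
have : lmon t (\row_k e2 k) = 1.
  apply: lt1.
  - move=> k; apply: contraTT; rewrite negbK => xk; rewrite -leNgt /e2.
    have le0 l : S l -> 0 <= (N e1)%:Z * rho l k.
      move=> /andP[ul /eqP xl]; rewrite mulr_ge0 // leNgt; apply/negP => /(rneg l k).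
      by rewrite xl eqxx xk => /(_ notF).
    have [uk|uk] := boolP (co u k == 0).
      by rewrite /e1 uk add0r sumr_ge0.
    have Sk : S k by rewrite /S uk xk.
    rewrite (bigD1 k) //= addrA addr_ge0 ?sumr_ge0 // => [|l /andP[/le0]//].
    have [_ _ pos] := rhoP k; have := pos; rewrite (eqP xk) eqxx => /(_ notF).
    by have := leN e1 k; nia.
  - move=> k; apply: contraTneq => uk.
    rewrite negbK /e2 /e1 uk eqxx add0r big1 // => l /andP[ul _].
    have [_ h _] := rhoP l; suff -> : rho l k = 0 by rewrite mulr0.
    apply/eqP; apply: contraT => /h[/xu|e']; first by rewrite uk eqxx.
    by move: ul; rewrite -e' uk eqxx.
  - rewrite (eq_bigr _ (fun k _ => scalerDl _ _ _)) big_split /= s1 add0r.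
    under eq_bigr => k _ do rewrite scaler_suml.
    rewrite exchange_big big1 // => l _ /=.
    have [h _ _] := rhoP l; rewrite -[RHS](scaler0 _ (N e1)%:Z) -[in RHS]h scaler_sumr.
    by apply: eq_bigr => k _; rewrite scalerA.
have -> : \row_k e2 k = \row_k e1 k + \sum_(l | S l) (N e1)%:Z *: \row_k rho l k.
  by apply/rowP => k; rewrite !mxE summxE; congr (_ + _); apply: eq_bigr => l _; rewrite !mxE.
rewrite lmonD // lmon_sum // e1E big1 ?mulr1 // => l /andP[ul /eqP xl].
by rewrite lmonZ rho1 ?exp1rz // xl eqxx.
Qed.

End Semistability.

Section Stability.
Variables (R : realType) (r n : nat) (A : 'M[int]_(r, n)).
Local Notation C := R[i].
Local Notation V := (V R A).
Local Notation torus := (torus R r).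
Local Notation I2 := 'I_(n + n).
Local Notation b := (bQ A).
Local Notation wpart := (@weight_part R r n A).
Implicit Types (theta eta : 'rV[rat]_r) (u v y : V).

Definition pv (p : mpoly (n + n) C) v : C := mpeval p (aff_val v).

Lemma pv_nonzero_open p : open [set v : V | pv p v != 0].
Proof.
change (@aff_open C (n + n) [set v | moment A v = 0] [set v : V | pv p v != 0]).
by move=> v pvv; exists p; split.
Qed.

Lemma closure_vanish p u y : (forall g, pv p (act g u) = 0) -> closure (Defs.orbit u) y ->
  pv p y = 0.
Proof.
move=> h cy; apply/eqP; apply: contraT => py.
have [|_ [[g _ <-]]] := cy [set v : V | pv p v != 0].
  by apply: open_nbhs_nbhs; split=> //; exact: pv_nonzero_open.
by rewrite /= h eqxx.
Qed.

Lemma weight_part_act theta j f : wpart theta j f -> exists2 chi,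
  map_mx intr chi = theta *+ j & forall g v, f (act g v) = chr chi g * f v.
Proof. by move=> [chi e [_ h]]; exists chi. Qed.

Lemma weight_part_poly theta j f : wpart theta j f -> exists p, forall v, f v = pv p v.
Proof. by move=> [chi e [[p h] _]]; exists p. Qed.

Lemma pvM p q v : pv (p * q) v = pv p v * pv q v. Proof. exact: mevalM. Qed.
Lemma pvB p q v : pv (p - q) v = pv p v - pv q v. Proof. exact: mevalB. Qed.
Lemma pvC c v : pv (mpolyC _ c) v = c. Proof. exact: mevalC. Qed.
Lemma pvX p k v : pv (p ^+ k) v = pv p v ^+ k. Proof. exact: (rmorphXn (meval _)). Qed.

(** With [f] of degree [j] and [h] of degree [k], the powers [f ^+ k] and [h ^+ j] have the same
    weight. Hence [h(u)^j f^k = f(u)^k h^j] holds on the orbit of [u] and so at [y], where [h] is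
    nonzero. *)
Lemma closure_same_ideal eta u y : closure (Defs.orbit u) y -> Vss eta y ->
  same_ideal eta u y.
Proof.
move=> cy [k [h [k0 wh hy]]] j f wf.
have [p pE] := weight_part_poly wf; have [q qE] := weight_part_poly wh.
have [chi ce fact] := weight_part_act wf; have [psi pe hact] := weight_part_act wh.
have ee : chi *+ k = psi *+ j.
  by apply: intr_mx_inj; rewrite !raddfMn /= ce pe -!mulrnA mulnC.
have : pv (p ^+ k * mpolyC _ (h u ^+ j) - q ^+ j * mpolyC _ (f u ^+ k)) y = 0.
  apply: (@closure_vanish _ u) => // g.
  rewrite pvB !pvM !pvX !pvC -pE -qE fact hact !exprMn -!chrMn ee; ring.
rewrite pvB !pvM !pvX !pvC -pE -qE => /eqP; rewrite subr_eq0 => /eqP e.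
have hu : h u != 0.
  apply: contra hy => /eqP hu; rewrite qE; apply/eqP; apply: (@closure_vanish _ u) => // g.
  by rewrite -qE hact hu mulr0.
have k1 : (0 < k)%N := k0.
split=> [fu|fy].
  move: e; rewrite fu [0 ^+ k]expr0n gtn_eqF // mulr0 => /eqP.
  by rewrite mulf_eq0 !expf_eq0 k0 (negPf hu) andbF orbF /= => /eqP.
move: e; rewrite fy [0 ^+ k]expr0n gtn_eqF // mul0r => /esym/eqP.
by rewrite mulf_eq0 !expf_eq0 k0 (negPf hy) andbF /= => /eqP.
Qed.

Lemma same_ideal_act theta g u : same_ideal theta u (act g u).
Proof.
move=> j f /weight_part_act[chi _ h]; rewrite h; split=> [->|/eqP]; first by rewrite mulr0.
by rewrite mulf_eq0 (negPf (chr_neq0 _ _)) => /eqP.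
Qed.

Lemma Vss_act theta g u : Vss theta u -> Vss theta (act g u).
Proof.
move=> [j [f [j0 wf fu]]]; exists j, f; split=> //.
by apply: contra fu => /eqP h; apply/eqP; apply/(same_ideal_act g u wf).
Qed.

(** An element fixing [u] has character value 1 on the weights of nonzero coordinates. These span
    rationally, so each torus coordinate is a root of unity of bounded order. *)
Lemma finite_stabiliser u : spans_by A (fun k => co u k != 0) ->
  finite_set [set g : torus | act g u = u].
Proof.
move=> sp.
have /choice[D DP] : forall i : 'I_r, exists D : nat, (0 < D)%N /\
    forall g : torus, act g u = u -> \val g 0 i ^+ D = 1.
  move=> i; have [c cP cE] := sp (delta_mx 0 i).
  have [D D0 [m mE]] := clear_denominators c.
  exists D; split=> // g gu.
  have e : delta_mx 0 i *+ D = \sum_k m k *: bvec A k :> 'rV[int]_r.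
    apply: intr_mx_inj; rewrite -int_combination raddfMn /=.
    have -> : map_mx intr (delta_mx 0 i : 'rV[int]_r) = delta_mx 0 i :> 'rV[rat]_r.
      by apply/rowP => j; rewrite !mxE; case: (_ && _).
    rewrite -cE -sumrMnl; apply: eq_bigr => k _.
    by rewrite -mE -scaler_nat scalerA mulrC.
  have : chr (delta_mx 0 i *+ D) g = 1.
    rewrite e chrE (lmon_sum (torus_neq0 g)) big1 // => k _.
    rewrite lmonZ -chrE.
    have [mk|mk] := eqVneq (m k) 0; first by rewrite mk expr0z.
    have uk : co u k != 0.
      by apply: cP; apply: contraNneq mk => ck; rewrite -(intr_eq0 rat) -mE ck mul0r.
    have -> : chr (bvec A k) g = 1.
      by apply: (mulIf uk); rewrite -co_act gu mul1r.
    by rewrite exp1rz.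
  by rewrite chrMn chrE lmon_delta.
have /choice[s sP] : forall i : 'I_r, exists s : seq C, forall z, z ^+ D i = 1 -> z \in s.
  move=> i; have [D0 _] := DP i.
  have p0 : 'X^(D i) - 1 != 0 :> {poly C}.
    by rewrite -size_poly_gt0 size_XnsubC.
  have [s es] := closed_field_poly_normal ('X^(D i) - 1 : {poly C}).
  exists s => z zD; have : root ('X^(D i) - 1) z by rewrite /root !hornerE zD subrr.
  rewrite es rootZ ?root_prod_XsubC //.
  by rewrite lead_coef_eq0.
pose T := {dffun forall i : 'I_r, 'I_(size (s i))}.
pose dec (x : T) : 'rV[C]_r := \row_i (s i)`_(x i).
(* Elements of the stabiliser are recovered from tuples of indices in the lists of roots; [insub]
   needs a default, here the identity, for tuples with a zero entry. *)
apply: (@sub_finite_set _ _ ((fun v : 'rV[C]_r => if insub v is Some g then g else mk_torus (fun=> oner_neq0 C)) @` (dec @` setT))).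
  move=> g gu.
  have idx (i : 'I_r) : (index (\val g 0%R i) (s i) < size (s i))%N.
    by rewrite index_mem; apply: sP; have [_ ->] := DP i.
  exists (\val g); last by rewrite valK.
  exists [ffun i => Ordinal (idx i)] => //.
  by apply/rowP => i; rewrite mxE ffunE /= nth_index // -index_mem.
by do 2 apply: finite_image; exact: finite_finset.
Qed.

Lemma interior_spans theta u : interior_point theta u -> spans_by A (fun k => co u k != 0).
Proof.
move=> [x [_ xu _ sp]] y; have [c cP cE] := sp y.
by exists c => // k /cP/xu.
Qed.

Lemma interior_stable eta u : interior_point eta u -> stable eta u.
Proof.
move=> iu; split; first exact: interior_Vss.
  by apply: finite_stabiliser; exact: interior_spans iu.
move=> y [cy yss]; have [g ->] := same_ideal_orbit iu yss (closure_same_ideal cy yss).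
by exists g.
Qed.

Definition qpt theta u (uss : Vss theta u) : X R A theta :=
  quot_map (SigSub (mem_set uss) : set_type (Vss theta)).

Lemma qpt_eq theta u v (uss : Vss theta u) (vss : Vss theta v) :
  qpt uss = qpt vss <-> same_ideal theta u v.
Proof.
split=> [e j f wf|h].
  have := congr1 (fun p => proj_ideal p j f) e; rewrite /proj_ideal /= /hideal /= => E.
  split=> h; [have : wpart theta j f /\ f u = 0 by []|have : wpart theta j f /\ f v = 0 by []].
    by rewrite E => -[].
  by rewrite -E => -[].
apply: val_inj => /=; apply/funext => j; apply/seteqP.
by split=> f [wf f0]; split=> //; apply/(h j f wf).
Qed.

Lemma quot_qpt theta (u : set_type (Vss theta)) : quot_map u = qpt (set_valP u).
Proof. by congr quot_map; apply: val_inj. Qed.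

Lemma qpt_surj theta (x : X R A theta) : exists u, exists uss : Vss theta u, x = qpt uss.
Proof.
by have [v ->] := proj_piP x; exists (\val v), (set_valP v); rewrite -quot_qpt.
Qed.

Lemma qpt_act theta u g (uss : Vss theta u) (guss : Vss theta (act g u)) :
  qpt uss = qpt guss.
Proof. by apply/qpt_eq; exact: same_ideal_act. Qed.

Lemma qpt_interior theta u v (uss : Vss theta u) (vss : Vss theta v) :
  interior_point theta u -> qpt uss = qpt vss -> exists g, v = act g u.
Proof. by move=> iu /qpt_eq; exact: same_ideal_orbit. Qed.

Lemma basic_qpt theta j f u (uss : Vss theta u) : wpart theta j f ->
  proj_basic j f (qpt uss : proj_point (semi_invariants R A theta)) <-> f u != 0.
Proof. by move=> wf; apply: (@proj_basicE _ _ (semi_invariants R A theta)). Qed.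

Lemma basic_open theta j f : (0 < j)%N -> wpart theta j f ->
  open (proj_basic (S := semi_invariants R A theta) j f : set (X R A theta)).
Proof.
move=> j0 wf.
change (@Defs.proj_open _ _ (semi_invariants R A theta) (proj_basic j f)) => p fp.
by exists j, f; split.
Qed.

Lemma X_openP theta (O : set (X R A theta)) : open O -> forall x, O x ->
  exists j f, [/\ (0 < j)%N, wpart theta j f, proj_basic (S := semi_invariants R A theta) j f x &
     proj_basic (S := semi_invariants R A theta) j f `<=` O].
Proof. by move=> oO x Ox; exact: (oO : @Defs.proj_open _ _ (semi_invariants R A theta) O). Qed.

End Stability.

Local Close Scope classical_set_scope.

(** * Bases of columns *)

Section Bases.
Variables (r n : nat) (A : 'M[int]_(r, n)).
Implicit Types (x y z : 'rV[rat]_n) (eta theta : 'rV[rat]_r) (J E P : {set 'I_n}).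

Definition At : 'M[rat]_(n, r) := map_mx intr A^T.
Definition aQ i : 'rV[rat]_r := row i At.

Lemma mulAt x : x *m At = \sum_j x 0 j *: aQ j.
Proof. exact: mulmx_sum_row. Qed.

Definition supp_in x J := forall j, x 0 j != 0 -> j \in J.
Definition indep J := forall x, supp_in x J -> x *m At = 0 -> x = 0.
Definition spanning J := forall eta, exists2 x, supp_in x J & x *m At = eta.
Definition base J := indep J /\ spanning J.

Lemma supp_in0 J : supp_in 0 J.
Proof. by move=> j; rewrite mxE eqxx. Qed.

Lemma supp_inD x y J : supp_in x J -> supp_in y J -> supp_in (x + y) J.
Proof.
move=> hx hy j; apply: contraNT => nj; rewrite mxE.
have /eqP-> : x 0 j == 0 by rewrite -[_ == _]negbK; apply: contra nj; exact: hx.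
have /eqP-> : y 0 j == 0 by rewrite -[_ == _]negbK; apply: contra nj; exact: hy.
by rewrite addr0.
Qed.

Lemma supp_inZ a x J : supp_in x J -> supp_in (a *: x) J.
Proof. by move=> hx j; rewrite mxE mulf_eq0 negb_or => /andP[_ /hx]. Qed.

Lemma supp_inB x y J : supp_in x J -> supp_in y J -> supp_in (x - y) J.
Proof. by move=> hx hy; rewrite -scaleN1r; apply: supp_inD => //; exact: supp_inZ. Qed.

Lemma supp_inS x J E : J \subset E -> supp_in x J -> supp_in x E.
Proof. by move=> /fintype.subsetP s h j /h/s. Qed.

Lemma supp_out x J j : supp_in x J -> j \notin J -> x 0 j = 0.
Proof. by move=> h nj; apply/eqP; apply: contraNT nj; exact: h. Qed.

Lemma supp_in_delta j J : j \in J -> supp_in (delta_mx 0 j) J.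
Proof. by move=> jJ l; rewrite mxE; case: (_ =P j) => [->//|_]; rewrite andbF eqxx. Qed.

Lemma delta_At j : delta_mx 0 j *m At = aQ j.
Proof. by rewrite -rowE. Qed.

(** The coordinates of [eta] in the base [J], extended by 0 off [J], so that the coordinate vectors
    for different bases live in one space. *)
Definition sol J eta : 'rV[rat]_n := xget 0 [set x | supp_in x J /\ x *m At = eta].

Lemma sol_uniq J eta x : base J -> supp_in x J -> x *m At = eta -> sol J eta = x.
Proof.
move=> [iJ sJ] hx ex; rewrite /sol; case: xgetP => [y _ [hy ey]|/(_ x)[]//].
apply/eqP; rewrite -subr_eq0; apply/eqP; apply: iJ; first exact: supp_inB.
by rewrite mulmxBl ey ex subrr.
Qed.

Lemma sol_spec J eta : base J -> supp_in (sol J eta) J /\ sol J eta *m At = eta.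
Proof.
by move=> bJ; have [_ sJ] := bJ; have [x hx ex] := sJ eta; rewrite (sol_uniq bJ hx ex).
Qed.

Lemma sol_out J eta j : base J -> j \notin J -> sol J eta 0 j = 0.
Proof. by move=> bJ; apply: supp_out; have [] := sol_spec eta bJ. Qed.

Lemma sol_sum J eta : base J -> eta = \sum_j sol J eta 0 j *: aQ j.
Proof. by move=> bJ; rewrite -mulAt; have [_ ->] := sol_spec eta bJ. Qed.

Lemma solD J eta theta : base J -> sol J (eta + theta) = sol J eta + sol J theta.
Proof.
move=> bJ; have [h1 e1] := sol_spec eta bJ; have [h2 e2] := sol_spec theta bJ.
by apply: sol_uniq => //; [exact: supp_inD|rewrite mulmxDl e1 e2].
Qed.

Lemma solZ J a eta : base J -> sol J (a *: eta) = a *: sol J eta.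
Proof.
move=> bJ; have [h1 e1] := sol_spec eta bJ.
by apply: sol_uniq => //; [exact: supp_inZ|rewrite -scalemxAl e1].
Qed.

Lemma solB J eta theta : base J -> sol J (eta - theta) = sol J eta - sol J theta.
Proof. by move=> bJ; rewrite -scaleN1r solD // solZ // scaleN1r. Qed.

Lemma sol0 J : base J -> sol J 0 = 0.
Proof. by move=> bJ; apply: sol_uniq => //; [exact: supp_in0|rewrite mul0mx]. Qed.

Lemma sol_aQ J j : base J -> j \in J -> sol J (aQ j) = delta_mx 0 j.
Proof. by move=> bJ jJ; apply: sol_uniq => //; [exact: supp_in_delta|exact: delta_At]. Qed.

(* The vector of coordinates after [j] has been exchanged for [k]. *)
Definition pivot (x d : 'rV[rat]_n) (j k : 'I_n) : 'rV[rat]_n := x - (x 0 j / d 0 j) *: (d - delta_mx 0 k).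

Lemma pivot_At J eta j k : base J ->
  pivot (sol J eta) (sol J (aQ k)) j k *m At = eta.
Proof.
move=> bJ; have [_ e1] := sol_spec eta bJ; have [_ e2] := sol_spec (aQ k) bJ.
by rewrite /pivot mulmxBl e1 -scalemxAl mulmxBl e2 delta_At subrr scaler0 subr0.
Qed.

Lemma pivot_supp J x (d : 'rV[rat]_n) j k : supp_in x J -> supp_in d J -> d 0 j != 0 ->
  supp_in (pivot x d j k) (k |: J :\ j).
Proof.
move=> hx hd dj l; rewrite !inE !mxE eqxx /=.
have [//|lk] := eqVneq l k; rewrite subr0.
have [->|lj] := eqVneq l j; first by rewrite divfK // subrr eqxx.
by apply: contraNT => nl; rewrite (supp_out hx nl) (supp_out hd nl) mulr0 subr0.
Qed.

Lemma base_exchange J j k : base J -> k \notin J -> sol J (aQ k) 0 j != 0 ->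
  base (k |: J :\ j).
Proof.
move=> bJ kJ dj; have [iJ sJ] := bJ; have [hd ed] := sol_spec (aQ k) bJ.
have jJ : j \in J by exact: hd.
have jk : j != k by apply: contraNneq kJ => <-.
split=> [x hx ex|eta]; last first.
  exists (pivot (sol J eta) (sol J (aQ k)) j k); last exact: pivot_At.
  by apply: pivot_supp => //; have [] := sol_spec eta bJ.
have x'0 : x - x 0 k *: (delta_mx 0 k - sol J (aQ k)) = 0.
  apply: iJ; last first.
    by rewrite mulmxBl ex -scalemxAl mulmxBl delta_At ed subrr scaler0 subr0.
  move=> l; rewrite !mxE eqxx /=; have [->|lk] := eqVneq l k.
    by rewrite mulrBr mulr1 opprB addrCA subrr addr0 (supp_out hd kJ) mulr0 eqxx.
  rewrite sub0r mulrN opprK; apply: contraNT => nl.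
  rewrite (supp_out hd nl) mulr0 addr0; apply/eqP; apply: (supp_out hx).
  by rewrite !inE (negPf lk) (negPf nl) andbF.
have := congr1 (fun y : 'rV[rat]_n => y 0 j) x'0; rewrite !mxE eqxx (negPf jk) /= sub0r mulrN opprK.
rewrite (supp_out hx) ?add0r => [/eqP|]; last by rewrite !inE eqxx (negPf jk).
rewrite mulf_eq0 (negPf dj) orbF => /eqP xk.
by move: x'0; rewrite xk scale0r subr0.
Qed.

Lemma sol_exchange J eta j k : base J -> k \notin J -> sol J (aQ k) 0 j != 0 ->
  sol (k |: J :\ j) eta = pivot (sol J eta) (sol J (aQ k)) j k.
Proof.
move=> bJ kJ dj; apply: sol_uniq.
- exact: base_exchange.
- by apply: pivot_supp => //; [have [] := sol_spec eta bJ|have [] := sol_spec (aQ k) bJ].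
- exact: pivot_At.
Qed.

(** Take a minimal spanning set between [P] and [E]. A column outside [P] that occurred in a
    relation could be discarded, so relations are supported in [P] and vanish. *)
Lemma extend_base P E : indep P -> spanning E -> P \subset E ->
  exists J, [/\ base J, P \subset J & J \subset E].
Proof.
move=> iP sE PE.
pose Q J := `[< spanning J /\ P \subset J /\ J \subset E >].
have QE : Q E by apply/asboolP.
have [J /minsetP[/asboolP[sJ [PJ JE]] mJ] _] := minset_exists QE.
exists J; split=> //; split=> // x hx ex.
have xP : supp_in x P.
  move=> j xj; apply: contraT => nj; have jJ := hx j xj.
  have : J :\ j = J.
    apply: mJ; last exact: finset.subsetDl.
    apply/asboolP; split; last first.
      by split; [rewrite finset.subsetD1 PJ nj|rewrite (fintype.subset_trans (finset.subsetDl _ _))].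
    move=> eta; have [y hy ey] := sJ eta.
    exists (y - (y 0 j / x 0 j) *: x); last by rewrite mulmxBl -scalemxAl ex scaler0 subr0.
    move=> l; rewrite !inE => nz; apply/andP; split.
      by apply: contraNneq nz => ->; rewrite !mxE divfK // subrr.
    by move: l nz; apply: supp_inB hy _; exact: supp_inZ.
  by move/finset.setP/(_ j); rewrite !inE eqxx jJ.
exact: iP.
Qed.

Lemma indep0 : indep finset.set0.
Proof. by move=> x hx _; apply/rowP => j; rewrite mxE (supp_out hx) // inE. Qed.

Lemma base_sub_eq J J' : base J -> base J' -> J' \subset J -> J' = J.
Proof.
move=> bJ bJ' sub; apply/eqP; rewrite finset.eqEsubset sub; apply/fintype.subsetP => j jJ.
apply: contraT => nj; have [h e] := sol_spec (aQ j) bJ'.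
have : delta_mx 0 j - sol J' (aQ j) = 0 :> 'rV[rat]_n.
  case: bJ => iJ _; apply: iJ; last by rewrite mulmxBl delta_At e subrr.
  by apply: supp_inB; [exact: supp_in_delta|exact: supp_inS h].
move/(congr1 (fun y : 'rV[rat]_n => y 0 j)); rewrite !mxE !eqxx (supp_out h nj) subr0 => /eqP.
by rewrite oner_eq0.
Qed.

Lemma exchange_towards J J' k : base J -> base J' -> k \in J' -> k \notin J ->
  exists j, [/\ j \in J, j \notin J' & sol J (aQ k) 0 j != 0].
Proof.
move=> bJ bJ' kJ' kJ; have [h e] := sol_spec (aQ k) bJ.
apply: contrapT => no; have : delta_mx 0 k - sol J (aQ k) = 0 :> 'rV[rat]_n.
  case: bJ' => iJ' _; apply: iJ'; last by rewrite mulmxBl delta_At e subrr.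
  apply: supp_inB; first exact: supp_in_delta.
  move=> j dj; apply: contraT => nj; case: no; exists j; split=> //; exact: h.
move/(congr1 (fun y : 'rV[rat]_n => y 0 k)); rewrite !mxE !eqxx (supp_out h kJ) subr0 => /eqP.
by rewrite oner_eq0.
Qed.

(* By [generic_gen] and [gen_generic], this is genericity. *)
Definition gen theta := forall J, base J -> forall j, j \in J -> sol J theta 0 j != 0.

(** Sign-preserving Caratheodory argument: while the support carries a relation, subtract the
    multiple of it that first annihilates a coordinate. *)
Lemma conformal_support y theta : y *m At = theta -> exists z,
  [/\ z *m At = theta, forall j, z 0 j != 0 -> 0 < z 0 j * y 0 j &
      indep [set j | z 0 j != 0]].
Proof.
pose S z := [set j | z 0 j != 0]; rewrite -/(S _).
have yy z : z = y -> forall j, z 0 j != 0 -> 0 < z 0 j * y 0 j.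
  by move=> -> j yj; rewrite -expr2 exprn_even_gt0.
move=> ey; have {yy} : exists z, z *m At = theta /\ forall j, z 0 j != 0 -> 0 < z 0 j * y 0 j.
  by exists y; split=> //; exact: yy.
case=> z; have [m] := ubnP #|S z|; elim: m z => // m IHm z; rewrite ltnS => le_m [ez cz].
have [iS|/existsNP[x /not_implyP[hx /not_implyP[ex /eqP x0]]]] := pselect (indep (S z)).
  by exists z.
have [j0 xj0] : exists j, x 0 j != 0.
  apply: contrapT => /forallNP h; case/eqP: x0; apply/rowP => j; rewrite mxE.
  by apply/eqP; apply: contraT => /(h j).
pose F j := `|z 0 j / x 0 j|.
(* With the ratio of least absolute value, [t * x] is bounded by [z] in every coordinate, so no
   coordinate changes sign while that of [j1] becomes zero. *)
have [j1 xj1 mj1] := @Order.TotalTheory.arg_minP _ _ _ j0 (fun j => x 0 j != 0) F xj0.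
pose t := z 0 j1 / x 0 j1.
have bound j : `|t * x 0 j| <= `|z 0 j|.
  have [->|xj] := eqVneq (x 0 j) 0; first by rewrite mulr0 normr0.
  have : `|z 0 j1 / x 0 j1| <= `|z 0 j / x 0 j| := mj1 j xj.
  by rewrite -/t [X in _ <= X]normf_div ler_pdivlMr ?normr_gt0 // -normrM.
apply: (IHm (z - t *: x)); last split.
- rewrite (leq_trans _ le_m) //; apply: proper_card; apply/fintype.properP; split.
    apply/fintype.subsetP => j; rewrite !inE !mxE; apply: contraNN => /eqP zj.
    by have := bound j; rewrite zj normr0 normr_le0 => /eqP->; rewrite subr0.
  exists j1; first by have := hx j1 xj1; rewrite inE.
  by rewrite inE !mxE /t divfK // subrr eqxx.
- by rewrite mulmxBl ez -scalemxAl ex scaler0 subr0.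
- move=> j; rewrite !mxE => nz; have zj : z 0 j != 0.
    by apply: contraNneq nz => zj; have := bound j; rewrite zj normr0 normr_le0 => /eqP->; rewrite subr0.
  have := cz j zj; have := bound j; move: nz; set a := z 0 j; set c := t * x 0 j; set d := y 0 j.
  move=> ac le ad; have : 0 < (a - c) * a.
    rewrite mulrBl subr_gt0; case: (ltgtP a 0) le zj => [a0|a0|->]; rewrite ?eqxx // -/a => le _.
      rewrite ltr_nM2r //; move: le; rewrite (ltr0_norm a0) ler_norml opprK => /andP[le _].
      by rewrite lt_neqAle le andbT; move: ac; rewrite subr_eq0.
    rewrite ltr_pM2r //; move: le; rewrite (gtr0_norm a0) ler_norml => /andP[_ le].
    by rewrite lt_neqAle le andbT eq_sym; move: ac; rewrite subr_eq0.
  move=> h; have : 0 < ((a - c) * a) * (a * d) by rewrite mulr_gt0.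
  have -> : (a - c) * a * (a * d) = (a ^+ 2) * ((a - c) * d) by ring.
  by rewrite pmulr_rgt0 // exprn_even_gt0.
Qed.

Lemma caratheodory y theta : spanning [set: 'I_n] -> gen theta -> y *m At = theta ->
  exists2 J, base J & forall j, j \in J -> 0 < sol J theta 0 j * y 0 j.
Proof.
move=> sT gt ey; have [z [ez cz iz]] := conformal_support ey.
have [J [bJ zJ _]] := extend_base iz sT (finset.subsetT _).
have sE : sol J theta = z.
  by apply: sol_uniq => // j zj; apply: (fintype.subsetP zJ); rewrite inE.
by exists J => // j jJ; have := gt J bJ j jJ; rewrite sE; exact: cz.
Qed.

(** The sign condition makes both bases normalise the same coordinates at their common columns, so
    that their slices differ in a single column. *)
Definition edge theta J J' := base J /\ base J' /\ exists i k,
  [/\ i \in J, k \notin J, J' = k |: J :\ i &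
   forall j, j \in J -> j != i -> 0 < sol J theta 0 j * sol J' theta 0 j].

Lemma same_side (a c e y : rat) : y != 0 -> (a - e) * y != 0 -> (c - e) * y != 0 ->
  ~~ ((a < e < c) || (c < e < a)) -> 0 < (a - e) * y * ((c - e) * y).
Proof.
move=> y0; rewrite !mulf_eq0 !negb_or !subr_eq0 => /andP[ta _] /andP[tc _] nb.
rewrite mulrACA -expr2 pmulr_lgt0; last by rewrite exprn_even_gt0.
case: (ltgtP a e) ta => // ha _; case: (ltgtP c e) tc => // hc _.
- by rewrite nmulr_lgt0 subr_lt0.
- by move: nb; rewrite ha hc ?andbF.
- by move: nb; rewrite ha hc ?andbF.
- by rewrite mulr_gt0 // subr_gt0.
Qed.

Section Connected.
Variables (theta : 'rV[rat]_r) (E : {set 'I_n}) (Q : {set 'I_n} -> {set 'I_n} -> Prop).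
Hypotheses (gt : gen theta).
Hypothesis Qrefl : forall J, Q J J.
Hypothesis Qtrans : forall J J' J'', base J' -> Q J J' -> Q J' J'' -> Q J J''.
Hypothesis Qedge : forall J J', J \subset E -> J' \subset E -> edge theta J J' -> Q J J'.

Let between (a b c : rat) := (a < c < b) || (b < c < a).

(* The bases inside [k |: J] are the points where the coordinates vanish along
   the line of solutions of [x *m At = theta] carried by [k |: J]; consecutive
   ones form an edge. *)
Lemma line_connected J k : base J -> k \notin J -> k |: J \subset E ->
  forall j, sol J (aQ k) 0 j != 0 -> Q J (k |: J :\ j).
Proof.
move=> bJ kJ kE; set d := sol J (aQ k); have [hd ed] := sol_spec (aQ k) bJ.
pose g : 'rV[rat]_n := delta_mx 0 k - d; pose x0 := sol J theta.
have [hx ex] := sol_spec theta bJ.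
have gA : g *m At = 0 by rewrite mulmxBl delta_At ed subrr.
have gk : g 0 k = 1 by rewrite !mxE !eqxx (supp_out hd kJ) subr0.
have gj j : j != k -> g 0 j = - d 0 j by rewrite !mxE => /negPf->; rewrite andbF sub0r.
pose t j := - x0 0 j / g 0 j; pose x s := x0 + s *: g.
pose V j := (k |: J) :\ j.
have xE s j : x s 0 j = x0 0 j + s * g 0 j by rewrite !mxE.
have VE j : j \in J -> V j = k |: J :\ j.
  move=> jJ; apply/finset.setP => l; rewrite !inE.
  have [->|lk] := eqVneq l k; last by [].
  by rewrite andbT; apply: contraNneq kJ => ->.
have Vk : V k = J.
  apply/finset.setP => l; rewrite !inE; have [->|//] := eqVneq l k.
  by rewrite (negPf kJ).
have VP j : g 0 j != 0 -> base (V j) /\ sol (V j) theta = x (t j).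
  move=> gj0; have [jk|jk] := eqVneq j k.
    rewrite jk Vk; split=> //; rewrite /t /x -/x0 (supp_out hx kJ) oppr0 mul0r.
    by rewrite scale0r addr0.
  have dj : d 0 j != 0 by rewrite -oppr_eq0 -gj.
  have jJ := hd j dj; rewrite VE //; split; first exact: base_exchange.
  rewrite sol_exchange // /pivot /x /t -/x0 -/d /g gj // invrN mulrNN.
  by rewrite -scalerN opprB.
have xV j : g 0 j != 0 -> forall l, l \in V j -> x (t j) 0 l != 0.
  by move=> /VP[bV <-] l; exact: gt.
pose mid a c := [set e | (g 0 e != 0) && between (t a) (t c) (t e)].
have claim m a c : g 0 a != 0 -> g 0 c != 0 ->
    (#|mid a c| < m)%N -> Q (V a) (V c).
  elim: m a c => // m IHm a c ga gc; rewrite ltnS => le_m.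
  have [->|ac] := eqVneq a c; first exact: Qrefl.
  have [[e /andP[ge be]]|no] := pselect (exists e, (g 0 e != 0) && between (t a) (t c) (t e)).
    have [bVe _] := VP e ge.
    apply: (Qtrans bVe); apply: IHm => //; apply: leq_trans le_m;
      apply: proper_card; apply/fintype.properP; split.
    - apply/fintype.subsetP => f; rewrite ![_ \in mid _ _]inE => /andP[-> /=]; move: be.
      by rewrite /between => /orP[/andP[? ?]|/andP[? ?]] /orP[/andP[? ?]|/andP[? ?]]; lra.
    - exists e; first by rewrite inE ge.
      by rewrite inE negb_and /between !ltxx ?andbF ?orbT.
    - apply/fintype.subsetP => f; rewrite ![_ \in mid _ _]inE => /andP[-> /=]; move: be.
      by rewrite /between => /orP[/andP[? ?]|/andP[? ?]] /orP[/andP[? ?]|/andP[? ?]]; lra.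
    - exists e; first by rewrite inE ge.
      by rewrite inE negb_and /between !ltxx ?andbF ?orbT.
  have [bVa sa] := VP a ga; have [bVc sc] := VP c gc.
  have inkJ l : g 0 l != 0 -> l \in k |: J.
    rewrite !inE; have [//|lk] := eqVneq l k.
    by rewrite gj // oppr_eq0 => /hd.
  apply: Qedge.
  - by apply: fintype.subset_trans kE; exact: finset.subsetDl.
  - by apply: fintype.subset_trans kE; exact: finset.subsetDl.
  split=> //; split=> //; exists c, a; split.
  - by rewrite in_setD1 eq_sym ac inkJ.
  - by rewrite in_setD1 eqxx.
  - apply/finset.setP => l; rewrite !in_setU1 !in_setD1 in_setU1.
    have [->|la] := eqVneq l a; last by [].
    by rewrite ac -in_setU1 inkJ.
  move=> j jVa jc; have jVc : j \in V c by move: jVa; rewrite !in_setD1 jc => /andP[_ ->].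
  have ja : j != a by move: jVa; rewrite in_setD1 => /andP[].
  have nza := xV a ga j jVa; have nzc := xV c gc j jVc.
  rewrite sa sc; have [g0|g0] := eqVneq (g 0 j) 0.
    move: nza; rewrite !xE g0 !mulr0 !addr0 => nza.
    by rewrite -expr2 exprn_even_gt0.
  have tE : x0 0 j = - (t j * g 0 j) by rewrite /t divfK // opprK.
  have fE s : x s 0 j = (s - t j) * g 0 j by rewrite xE tE mulrBl addrC.
  rewrite (fE (t a)) in nza *; rewrite (fE (t c)) in nzc *.
  refine (@same_side (t a) (t c) (t j) (g 0 j) g0 nza nzc _).
  by apply/negP => h; apply: no; exists j; rewrite g0.
move=> j dj; have jJ := hd j dj.
have jk : j != k by apply: contraNneq kJ => <-.
rewrite -VE // -Vk; apply: (claim _ _ _ _ _ (leqnn _)).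
- by rewrite gk.
- by rewrite gj // oppr_eq0.
Qed.

(** Steinitz exchanges towards [J'] only use columns of [J] and [J'], so they stay inside [E]. With
    [E] the complement of one column, this connects the bases avoiding it among themselves. *)
Lemma base_connected J J' : base J -> base J' -> J \subset E -> J' \subset E -> Q J J'.
Proof.
have [m] := ubnP #|J' :\: J|; elim: m J => // m IHm J; rewrite ltnS => le_m bJ bJ' JE J'E.
have [sub|/subsetPn[k kJ' kJ]] := boolP (J' \subset J).
  by rewrite (base_sub_eq bJ bJ' sub); exact: Qrefl.
have [j [jJ jJ' dj]] := exchange_towards bJ bJ' kJ' kJ.
have bJ1 := base_exchange bJ kJ dj.
have kE : k |: J \subset E by rewrite finset.subUset finset.sub1set (fintype.subsetP J'E).
apply: (Qtrans bJ1); first exact: line_connected.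
apply: IHm => //.
  apply: leq_trans le_m; apply: proper_card; apply/fintype.properP; split.
    apply/fintype.subsetP => l; rewrite !inE; have [//|lk] := eqVneq l k.
    have [->|lj] := eqVneq l j; first by rewrite (negPf jJ').
    by rewrite /=.
  by exists k; rewrite !inE ?kJ ?kJ' // eqxx.
apply: fintype.subset_trans kE; rewrite finset.subUset finset.subsetUl /=.
by rewrite (fintype.subset_trans (finset.subsetDl _ _)) // finset.subsetUr.
Qed.

End Connected.

(** Points of the moment curve: with [a i = t ^+ i] each linear form becomes a nonzero polynomial in
    [t], and a positive integer [t] avoids the finitely many roots. *)
Lemma avoid_rows (m : nat) (T : finType) (P : pred T) (c : T -> 'rV[rat]_m) :
  (forall s, P s -> c s != 0) -> exists a : 'I_m -> rat,
    (forall i, 0 < a i) /\ forall s, P s -> \sum_i c s 0 i * a i != 0.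
Proof.
move=> c0; pose p : {poly rat} := \prod_(s | P s) rVpoly (c s).
have p0 : p != 0.
  apply/prodf_neq0 => s /c0; apply: contraNneq => e.
  by rewrite -[c s]rVpolyK e linear0.
have [t t0 pt] : exists2 t : rat, 0 < t & p.[t] != 0.
  pose s : seq rat := [seq i.+1%:R | i <- iota 0 (size p)].
  have us : uniq s.
    by rewrite map_inj_uniq ?iota_uniq // => i j /eqP; rewrite eqr_nat => /eqP[].
  have : ~~ all (root p) s.
    by apply/negP => h; have := max_poly_roots p0 h us; rewrite size_map size_iota ltnn.
  by move=> /allPn[t /mapP[i _ ->] ri]; exists i.+1%:R => //; rewrite ltr0n.
exists (fun i => t ^+ i); split=> [i|s Ps]; first by rewrite exprn_gt0.
apply: contraNneq pt => e; rewrite /p (bigD1 s) //= hornerM.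
suff -> : (rVpoly (c s)).[t] = 0 by rewrite mul0r.
rewrite -[RHS]e horner_poly; apply: eq_bigr => i _.
by rewrite insubT //= => lt; congr (c s 0 _ * _); exact: val_inj.
Qed.

(** No column is a coloop of the matroid of columns; in terms of the Gale dual, no row is zero. *)
Definition nocoloop := forall i, exists2 x : 'rV[rat]_n, x *m At = 0 & x 0 i != 0.

Lemma nocoloop_kernel : nocoloop ->
  exists2 x : 'rV[rat]_n, x *m At = 0 & forall i, x 0 i != 0.
Proof.
move=> nc; have /choice[y yP] : forall i, exists y : 'rV[rat]_n, y *m At = 0 /\ y 0 i != 0.
  by move=> i; have [y ? ?] := nc i; exists y.
have [|a [_ aE]] := @avoid_rows n 'I_n xpredT (fun j => \row_i y i 0 j).
  move=> j _; apply/eqP => /rowP/(_ j); rewrite !mxE => e.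
  by have [_] := yP j; rewrite e eqxx.
exists (\sum_i a i *: y i).
  by rewrite mulmx_suml big1 // => i _; rewrite -scalemxAl; have [-> _] := yP i; rewrite scaler0.
move=> j; have := aE j isT; apply: contraNneq => e; apply/eqP; rewrite -[RHS]e summxE.
by apply: eq_bigr => i _; rewrite !mxE mulrC.
Qed.

(** In the unknown sizes of the coordinates on [J], with signs prescribed by [s], each coordinate in
    each base is a nonzero linear form, and [avoid_rows] avoids the zeros of all of them at once. *)
Lemma gen_exists J (s : 'I_n -> rat) : base J -> (forall j, s j != 0) ->
  exists2 eta, gen eta & forall j, j \in J -> 0 < sol J eta 0 j * s j.
Proof.
move=> bJ s0.
pose c (Kk : {set 'I_n} * 'I_n) : 'rV[rat]_n :=
  \row_j (if j \in J then s j * sol Kk.1 (aQ j) 0 Kk.2 else 0).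
have [|a [a0 aE]] := @avoid_rows n _ (fun Kk => `[< base Kk.1 >] && (Kk.2 \in Kk.1)) c.
  move=> [K k] /andP[/asboolP bK /= kK]; apply/eqP => c0.
  have : sol K (aQ k) 0 k = 0.
    rewrite [aQ k](sol_sum _ bJ).
    have -> : sol K (\sum_j sol J (aQ k) 0 j *: aQ j) = \sum_j sol J (aQ k) 0 j *: sol K (aQ j).
      rewrite (big_morph (sol K) (id1 := 0) (op1 := +%R)); last exact: sol0.
        by apply: eq_bigr => j _; rewrite solZ.
      by move=> ? ?; rewrite solD.
    rewrite summxE big1 // => j _; rewrite mxE.
    have [jJ|nj] := boolP (j \in J); last by rewrite sol_out // mul0r.
    have := congr1 (fun y : 'rV[rat]_n => y 0 j) c0; rewrite !mxE jJ => /eqP.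
    by rewrite mulf_eq0 (negPf (s0 j)) /= => /eqP ->; rewrite mulr0.
  by rewrite sol_aQ // mxE !eqxx => /eqP; rewrite oner_eq0.
pose y : 'rV[rat]_n := \row_j (if j \in J then a j * s j else 0).
have yJ : supp_in y J by move=> j; rewrite mxE; case: ifP => //; rewrite eqxx.
have sy : sol J (y *m At) = y by apply: sol_uniq.
exists (y *m At); last first.
  move=> j jJ; rewrite sy mxE jJ -mulrA mulr_gt0 //.
  by rewrite -expr2 exprn_even_gt0 //= s0.
move=> K bK k kK; have := aE (K, k); rewrite /= asboolT // kK => /(_ isT).
apply: contraNneq => e; apply/eqP; rewrite -[RHS]e mulAt.
rewrite (big_morph (sol K) (id1 := 0) (op1 := +%R)) ?sol0 //; last by move=> ? ?; rewrite solD.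
rewrite summxE; apply: eq_bigr => j _; rewrite solZ // !mxE.
by case: ifP => _; rewrite ?mul0r //; ring.
Qed.

Lemma nocoloop_spanning i : nocoloop -> spanning [set: 'I_n] -> spanning (finset.setC [set i]).
Proof.
move=> nc sT eta; have [x _ ex] := sT eta; have [z ez zi] := nc i.
exists (x - (x 0 i / z 0 i) *: z); last by rewrite mulmxBl -scalemxAl ez scaler0 subr0.
by move=> j; rewrite !inE; apply: contraNneq => ->; rewrite !mxE divfK // subrr.
Qed.

Lemma base_avoiding i : nocoloop -> spanning [set: 'I_n] ->
  exists2 J, base J & J \subset finset.setC [set i].
Proof.
move=> nc sT; have [J [bJ _ sJ]] := extend_base indep0 (nocoloop_spanning i nc sT) (finset.sub0set (finset.setC [set i])).
by exists J.
Qed.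

End Bases.

Local Open Scope classical_set_scope.

Lemma meval_subst (K : fieldType) m N (q : 'I_m -> mpoly N K) (p : mpoly m K) v :
  meval v (mmap (@mpolyC N K) q p) = meval (fun k => meval v (q k)) p.
Proof.
elim/mpoly_ind: p => [c|k|p p' ep ep'|p p' ep ep'].
- by rewrite mmapC !mevalC.
- by rewrite mmapX mmap1U mevalXU.
- by rewrite mmapD !mevalD ep ep'.
- by rewrite rmorphM !mevalM ep ep'.
Qed.

(** * Slices *)

Section SignedCone.
Variables (R : realType) (r n : nat) (A : 'M[int]_(r, n)).
Local Notation C := R[i].
Local Notation V := (V R A).
Local Notation torus := (torus R r).
Local Notation I2 := 'I_(n + n).
Local Notation b := (bQ A).
Implicit Types (theta eta : 'rV[rat]_r) (u v : V) (J : {set 'I_n}) (y : 'rV[rat]_n).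

Lemma bQ_l i : b (lshift n i) = aQ A i.
Proof. by rewrite /bQ bvec_l /aQ /At; apply/rowP => k; rewrite !mxE. Qed.

Lemma bQ_r i : b (rshift n i) = - aQ A i.
Proof. by rewrite /bQ bvec_r /aQ /At; apply/rowP => k; rewrite !mxE rmorphN. Qed.

Lemma sum_coord (M : zmodType) (F : I2 -> M) :
  \sum_k F k = \sum_i (F (lshift n i) + F (rshift n i)).
Proof. by rewrite big_split_ord big_split. Qed.

(** The weights of [z_i] and [w_i] are opposite, so a single signed coefficient [y_i] replaces the
    two nonnegative ones; its sign tells which coordinate must be nonzero. *)
Definition adm v y := forall i,
  (0 < y 0 i -> co v (lshift n i) != 0) /\ (y 0 i < 0 -> co v (rshift n i) != 0).

Definition posx y (k : I2) : rat :=
  match fintype.split k with inl i => Num.max (y 0 i) 0 | inr i => Num.max (- y 0 i) 0 end.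

Lemma posx_l y i : posx y (lshift n i) = Num.max (y 0 i) 0.
Proof. by rewrite /posx (unsplitK (inl i)). Qed.

Lemma posx_r y i : posx y (rshift n i) = Num.max (- y 0 i) 0.
Proof. by rewrite /posx (unsplitK (inr i)). Qed.

Lemma posx_ge0 y k : 0 <= posx y k.
Proof. by rewrite /posx; case: fintype.split => i; rewrite le_max lexx orbT. Qed.

Lemma posx_sum y : \sum_k posx y k *: b k = y *m At A.
Proof.
rewrite sum_coord mulAt; apply: eq_bigr => i _.
rewrite posx_l posx_r bQ_l bQ_r scalerN -scalerBl; congr (_ *: _).
have [h|/ltW h] := leP 0 (y 0 i).
  by rewrite max_r ?oppr_le0 // subr0.
by rewrite max_l ?oppr_ge0 // sub0r opprK.
Qed.

Lemma posx_adm y v : adm v y -> forall k, posx y k != 0 -> co v k != 0.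
Proof.
move=> h k; case: (coordP k) => i; have [hl hr] := h i.
  by rewrite posx_l; have [/hl//|le] := ltP 0 (y 0 i); rewrite eqxx.
rewrite posx_r; have [/hr//|le] := ltP (y 0 i) 0.
by rewrite max_r ?oppr_le0 // eqxx.
Qed.

Lemma Vss_adm theta v : Vss theta v <-> exists2 y, y *m At A = theta & adm v y.
Proof.
split=> [/Vss_cone[x [x0 xP xE]]|[y ey h]]; last first.
  apply/Vss_cone; exists (posx y); split; [exact: posx_ge0|exact: posx_adm|].
  by rewrite posx_sum.
exists (\row_i (x (lshift n i) - x (rshift n i))).
  rewrite -xE mulAt sum_coord; apply: eq_bigr => i _.
  by rewrite mxE bQ_l bQ_r scalerN -scalerBl.
move=> i; rewrite mxE; split=> h; apply: xP; apply: contraTneq h => ->.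
  by rewrite sub0r oppr_gt0 -leNgt x0.
by rewrite subr0 -leNgt x0.
Qed.

Lemma interior_adm theta v y : y *m At A = theta -> adm v y ->
  spanning A [set i | y 0 i != 0]%SET -> interior_point theta v.
Proof.
move=> ey h sp; exists (posx y); split; [exact: posx_ge0|exact: posx_adm|by rewrite posx_sum|].
move=> eta; have [x hx ex] := sp eta.
exists (fun k => match fintype.split k with inl i => if 0 < y 0 i then x 0 i else 0
  | inr i => if y 0 i < 0 then - x 0 i else 0 end).
  move=> k; case: (coordP k) => i; rewrite ?posx_l ?posx_r.
    rewrite (unsplitK (inl i)); case: ifP; rewrite ?eqxx // => h0 _.
    by rewrite max_l ?gt_eqF // ltW.
  rewrite (unsplitK (inr i)); case: ifP; rewrite ?eqxx // => h0 _.
  by rewrite max_l ?oppr_ge0 ?(ltW h0) // oppr_eq0 lt_eqF.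
rewrite sum_coord -ex mulAt; apply: eq_bigr => i _.
rewrite (unsplitK (inl i)) (unsplitK (inr i)) bQ_l bQ_r scalerN -scalerBl; congr (_ *: _).
have := hx i; rewrite inE; case: (ltgtP (y 0 i) 0) => [h0|h0|e]; rewrite ?sub0r ?opprK ?subr0 //.
by move=> hx0; rewrite oppr0; apply/esym/eqP; apply: contraT => /hx0.
Qed.

(** Of the two coordinates at [j], the one whose weight enters [theta] with a positive coefficient,
    provided that the j-th coordinate of [theta] is nonzero. *)
Definition sidx theta J j := if 0 < sol A J theta 0 j then lshift n j else rshift n j.

Lemma sol_adm theta J v : base A J ->
  (forall j, j \in J -> sol A J theta 0 j != 0 -> co v (sidx theta J j) != 0) ->
  adm v (sol A J theta).
Proof.
move=> bJ h j; have [jJ|nj] := boolP (j \in J); last by rewrite sol_out // ltxx.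
have := h j jJ; rewrite /sidx; case: ltgtP => [h0|h0|_]; split=> //; exact.
Qed.

Lemma sol_Vss theta J v : base A J ->
  (forall j, j \in J -> sol A J theta 0 j != 0 -> co v (sidx theta J j) != 0) ->
  Vss theta v.
Proof.
move=> bJ h; apply/Vss_adm; exists (sol A J theta); last exact: sol_adm.
by have [] := sol_spec theta bJ.
Qed.

Lemma spanningS J J' : J \subset J' -> spanning A J -> spanning A J'.
Proof. by move=> s sp eta; have [x hx ex] := sp eta; exists x => //; exact: supp_inS hx. Qed.

Lemma sidx_interior theta J v : base A J -> (forall j, j \in J -> sol A J theta 0 j != 0) ->
  (forall j, j \in J -> co v (sidx theta J j) != 0) -> interior_point theta v.
Proof.
move=> bJ s0 h; apply: (interior_adm (y := sol A J theta)).
- by have [] := sol_spec theta bJ.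
- by apply: sol_adm => // j jJ _; exact: h.
- have [_ sJ] := bJ; apply: spanningS sJ; apply/fintype.subsetP => j jJ.
  by rewrite inE s0.
Qed.

(** Semistability gives a signed solution compatible with [v]; by genericity [caratheodory] replaces
    it by one supported on a whole base, with the same signs there. *)
Lemma gen_cover theta v : spanning A [set: 'I_n]%SET -> gen A theta -> Vss theta v ->
  exists2 J, base A J & forall j, j \in J -> co v (sidx theta J j) != 0.
Proof.
move=> sT gt /Vss_adm[y ey h]; have [J bJ yJ] := caratheodory sT gt ey.
exists J => // j jJ; have := yJ j jJ; have [hl hr] := h j; rewrite /sidx.
have [h0|h0] := ltP 0 (sol A J theta 0 j) => yj; first by apply: hl; rewrite -(pmulr_rgt0 _ h0).
by apply: hr; rewrite -(nmulr_rgt0 _ (_ : sol A J theta 0 j < 0)) // lt_neqAle gt.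
Qed.

Lemma gen_interior theta v : spanning A [set: 'I_n]%SET -> gen A theta -> Vss theta v ->
  interior_point theta v.
Proof.
move=> sT gt /(gen_cover sT gt)[J bJ h]; apply: (sidx_interior bJ) => //; exact: gt.
Qed.

Lemma sol_sumZ J (I : Type) (s : seq I) (P : pred I) (F : I -> 'rV[rat]_r) (c : I -> rat) : base A J ->
  sol A J (\sum_(i <- s | P i) c i *: F i) = \sum_(i <- s | P i) c i *: sol A J (F i).
Proof.
move=> bJ; rewrite (big_morph (sol A J) (id1 := 0) (op1 := +%R)) ?sol0 //.
  by apply: eq_bigr => i _; rewrite solZ.
by move=> ? ?; rewrite solD.
Qed.

Definition lamb J j : 'cV[rat]_r := \col_k sol A J (delta_mx 0 k) 0 j.

Lemma lambE J j eta : base A J -> (eta *m lamb J j) 0 0 = sol A J eta 0 j.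
Proof.
move=> bJ; rewrite [eta in RHS]row_sum_delta sol_sumZ // mxE summxE.
by apply: eq_bigr => k _; rewrite !mxE.
Qed.

Lemma moment_coord (v : 'rV[C]_(n + n)) : moment A v = 0 <-> forall k,
  \sum_i v 0 (lshift n i) * v 0 (rshift n i) * (A k i)%:~R = 0.
Proof.
have E k : moment A v k 0 = \sum_i v 0 (lshift n i) * v 0 (rshift n i) * (A k i)%:~R.
  by rewrite /moment summxE; apply: eq_bigr => i _; rewrite !mxE.
split=> [h k|h]; first by rewrite -E h mxE.
by apply/matrixP => k l; rewrite ord1 E h mxE.
Qed.

Lemma moment_functional (v : 'rV[C]_(n + n)) (l : 'cV[rat]_r) : moment A v = 0 ->
  \sum_i v 0 (lshift n i) * v 0 (rshift n i) * ratr ((aQ A i *m l) 0 0) = 0.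
Proof.
move=> /moment_coord h.
transitivity (\sum_k (\sum_i v 0 (lshift n i) * v 0 (rshift n i) * (A k i)%:~R) * ratr (l k 0)).
  under [RHS]eq_bigr => k _ do rewrite mulr_suml.
  rewrite exchange_big; apply: eq_bigr => i _ /=.
  rewrite mxE (raddf_sum (@ratr C)) mulr_sumr; apply: eq_bigr => k _ /=.
  by rewrite !mxE rmorphM /= ratr_int mulrA.
by rewrite big1 // => k _; rewrite h mul0r.
Qed.

Lemma moment_base J (v : 'rV[C]_(n + n)) : base A J -> (forall j, j \in J ->
  \sum_i v 0 (lshift n i) * v 0 (rshift n i) * ratr (sol A J (aQ A i) 0 j) = 0) ->
  moment A v = 0.
Proof.
move=> bJ h; apply/moment_coord => k.
transitivity (\sum_j (\sum_i v 0 (lshift n i) * v 0 (rshift n i) *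
   ratr (sol A J (aQ A i) 0 j)) * ratr ((A k j)%:~R) : C).
  under [RHS]eq_bigr => j _ do rewrite mulr_suml.
  rewrite exchange_big; apply: eq_bigr => i _ /=.
  have : aQ A i 0 k = (A k i)%:~R by rewrite !mxE.
  rewrite {1}[aQ A i](sol_sum (aQ A i) bJ) summxE => /(congr1 (@ratr C)).
  rewrite ratr_int => <-; rewrite (raddf_sum (@ratr C)) mulr_sumr; apply: eq_bigr => j _ /=.
  by rewrite !mxE rmorphM /= mulrA.
rewrite big1 // => j _; have [jJ|nj] := boolP (j \in J); first by rewrite h // mul0r.
rewrite big1 ?mul0r // => i _; by rewrite sol_out // rmorph0 mulr0.
Qed.

Definition mkV (x : I2 -> C) (x0 : moment A (\row_k x k) = 0) : V := SigSub (mem_set x0).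

Lemma co_mkV x (x0 : moment A (\row_k x k) = 0) k : co (mkV x0) k = x k.
Proof. by rewrite /co /aff_val /= mxE. Qed.

Lemma moment_disjoint (x : I2 -> C) : (forall i, x (lshift n i) * x (rshift n i) = 0) ->
  moment A (\row_k x k) = 0.
Proof.
by move=> h; apply/moment_coord => k; rewrite big1 // => i _; rewrite !mxE h mul0r.
Qed.

(** The value at [t] of the one-parameter subgroup with exponents [l]. *)
Definition ps (l : 'cV[int]_r) (t : C) (t0 : t != 0) : torus :=
  mk_torus (fun k => expfz_neq0 (l k 0) t0).

Lemma chr_ps l t (t0 : t != 0) chi : chr chi (ps l t0) = t ^ (chi *m l) 0 0.
Proof.
rewrite chr_mk_torus /lmon mxE (big_morph (fun x => t ^ x) (id1 := 1) (op1 := *%R)) //.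
  by apply: eq_bigr => k _; rewrite exprz_exp mulrC.
by move=> x y; rewrite expfzDr.
Qed.

Lemma integral_functional (l : 'cV[rat]_r) : exists2 D : nat, (0 < D)%N &
  exists m : 'cV[int]_r, forall chi : 'rV[int]_r,
    ((chi *m m) 0 0)%:~R = D%:R * (map_mx intr chi *m l) 0 0.
Proof.
have [D D0 [m mE]] := clear_denominators (fun k => l k 0).
exists D => //; exists (\col_k m k) => chi; rewrite !mxE (raddf_sum (intr : int -> rat)) mulr_sumr.
by apply: eq_bigr => k _; rewrite /= !mxE intrM -mE; ring.
Qed.

(** If the j-th coordinate of [theta] in the base [J] vanished, the point whose nonzero coordinates
    are those selected by the nonzero coordinates of [theta] would be semistable, yet fixed by the
    one-parameter subgroup dual to [j]. *)
Lemma generic_gen theta : generic R A theta -> gen A theta.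
Proof.
move=> [_ st] J bJ j jJ; apply/eqP => s0.
pose x k : C := if [exists i in J, (sol A J theta 0 i != 0) && (sidx theta J i == k)] then 1 else 0.
have x0 : moment A (\row_k x k) = 0.
  apply: moment_disjoint => i; rewrite /x; case: ifP; rewrite ?mul0r //.
  case/exists_inP => i1 _ /andP[n1 /eqP e1]; case: ifP; rewrite ?mulr0 //.
  case/exists_inP => i2 _ /andP[n2 /eqP e2].
  have ii1 : i1 = i.
    move: e1; rewrite /sidx; case: ifP => _ /(congr1 val) /= e; first exact: val_inj.
    by have := ltn_ord i; rewrite -e ltnNge leq_addr.
  have ii2 : i2 = i.
    move: e2; rewrite /sidx; case: ifP => _ /(congr1 val) /= e; last by apply: val_inj; apply: (@addnI n).
    by have := ltn_ord i2; rewrite e ltnNge leq_addr.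
  move: e1 e2; rewrite ii1 ii2 => -> /(congr1 val) /= e.
  by have := ltn_ord i; rewrite e ltnNge leq_addr.
pose v := mkV x0.
have vss : Vss theta v.
  apply: (sol_Vss bJ) => i iJ si; rewrite co_mkV /x; case: ifPn; first by rewrite oner_neq0.
  by case/exists_inP; exists i => //; rewrite si eqxx.
have [_ fin _] := st v vss.
have [D D0 [m mE]] := integral_functional (lamb J j).
(* The powers of 2 give infinitely many distinct elements of that subgroup: they act on the weight
   of column [j] by the powers of [2 ^ D]. *)
have two0 : (2 : C) != 0 by rewrite pnatr_eq0.
have t0 k : (2 ^+ k : C) != 0 by rewrite expf_neq0.
have fixv k : act (ps m (t0 k)) v = v.
  apply: V_eq => l; rewrite co_act co_mkV /x; case: ifPn; last by rewrite mulr0.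
  case/exists_inP => i iJ /andP[si /eqP <-]; rewrite chr_ps mulr1.
  suff -> : (bvec A (sidx theta J i) *m m) 0 0 = 0 by rewrite expr0z.
  have ij : i != j by apply: contraNneq si => ->; rewrite s0.
  have a0 : (aQ A i *m lamb J j) 0 0 = 0.
    by rewrite lambE // sol_aQ // !mxE eq_sym (negPf ij) andbF.
  apply/eqP; rewrite -(intr_eq0 rat) mE mulf_eq0; apply/orP; right.
  rewrite -[map_mx _ _]/(b _) /sidx; case: ifP => _; rewrite ?bQ_l ?bQ_r ?mulNmx; last rewrite mxE oppr_eq0.
    by rewrite a0.
  by rewrite a0.
have inj : injective (fun k => ps m (t0 k)).
  move=> k1 k2 /(congr1 (chr (col j A)^T)); rewrite !chr_ps => e.
  have mj : ((col j A)^T *m m) 0 0 = D%:Z.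
    apply: (@intr_inj rat); rewrite mE -bvec_l -[map_mx _ _]/(b _) bQ_l lambE // sol_aQ //.
    by rewrite !mxE !eqxx mulr1.
  move: e; rewrite mj -!exprnP -!exprM -!natrX => /eqP; rewrite eqr_nat eqn_exp2l // => /eqP e.
  by move: D0; move: e; clear; nia.
have /eq_finite_set e := @inj_card_eq _ _ [set: nat] _ (in2W inj).
by apply: infinite_nat; rewrite -e; apply: sub_finite_set fin => _ [k _ <-]; exact: fixv.
Qed.

End SignedCone.

Section Slice.
Variables (R : realType) (r n : nat) (A : 'M[int]_(r, n)) (theta : 'rV[rat]_r) (J : {set 'I_n}).
Local Notation C := R[i].
Local Notation V := (V R A).
Local Notation I2 := 'I_(n + n).
Local Notation sl := (sol A J).
Implicit Types (u v : V).

Definition idx (k : I2) : 'I_n := match fintype.split k with inl i => i | inr i => i end.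

Lemma idx_l i : idx (lshift n i) = i.
Proof. by rewrite /idx (unsplitK (inl i)). Qed.

Lemma idx_r i : idx (rshift n i) = i.
Proof. by rewrite /idx (unsplitK (inr i)). Qed.

Lemma idx_bar k : idx (bar k) = idx k.
Proof. by case: (coordP k) => i; rewrite ?bar_l ?bar_r idx_l idx_r. Qed.

Definition free : {set I2} := [set k | idx k \notin J]%SET.
Definition sdim := #|free|.
Local Notation N := sdim.

Definition fcoord (i : 'I_N) : I2 := enum_val i.

Definition sc j := sidx A theta J j.

Lemma idx_sc j : idx (sc j) = j.
Proof. by rewrite /sc /sidx; case: ifP; rewrite ?idx_l ?idx_r. Qed.

Lemma idx_eq k l : idx k = idx l -> k = l \/ k = bar l.
Proof.
by case: (coordP k) => i; case: (coordP l) => j; rewrite ?idx_l ?idx_r ?bar_l ?bar_r => ->; auto.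
Qed.

Variant slot_spec (k : I2) : Prop :=
| SlotFree i of k = fcoord i & idx k \notin J
| SlotOne j of j \in J & k = sc j
| SlotBar j of j \in J & k = bar (sc j).

Lemma slotP k : slot_spec k.
Proof.
have [kJ|kJ] := boolP (idx k \in J); last first.
  have kf : k \in free by rewrite inE.
  by apply: (@SlotFree _ (enum_rank_in kf k)) => //; rewrite /fcoord enum_rankK_in.
have [e|e] : k = sc (idx k) \/ k = bar (sc (idx k)) by apply: idx_eq; rewrite idx_sc.
  exact: SlotOne kJ e.
exact: SlotBar kJ e.
Qed.

Lemma fcoord_free i : idx (fcoord i) \notin J.
Proof. by have := enum_valP i; rewrite inE. Qed.

Lemma fcoord_inj : injective fcoord.
Proof. exact: enum_val_inj. Qed.

Section Values.
Variables (S : comPzRingType) (x : 'I_N -> S) (h : rat -> S).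

Definition ext k : S := \sum_(i | fcoord i == k) x i.

Lemma ext_free i : ext (fcoord i) = x i.
Proof.
rewrite /ext (big_pred1 i) // => j; apply/eqP/eqP => [/fcoord_inj|->//]; exact.
Qed.

Lemma ext_out k : idx k \in J -> ext k = 0.
Proof.
move=> kJ; rewrite /ext big1 // => i /eqP e.
by have := fcoord_free i; rewrite e kJ.
Qed.

(* Up to sign, the value that the moment equation forces on the coordinate
   opposite to the one normalised to 1 at [j]. *)
Definition quad j : S := \sum_i ext (lshift n i) * ext (rshift n i) * h (sl (aQ A i) 0 j).

(** Defined over any ring, so that one formula gives both the points of the slice and, over
    polynomials, the substitution restricting functions to it. *)
Definition slc k : S :=
  if idx k \notin J then ext k else if k == sc (idx k) then 1 else - quad (idx k).

Lemma slc_free i : slc (fcoord i) = x i.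
Proof. by rewrite /slc fcoord_free ext_free. Qed.

Lemma slc_one j : j \in J -> slc (sc j) = 1.
Proof. by move=> jJ; rewrite /slc idx_sc jJ eqxx. Qed.

Lemma slc_bar j : j \in J -> slc (bar (sc j)) = - quad j.
Proof. by move=> jJ; rewrite /slc idx_bar idx_sc jJ (negPf (bar_neq _)). Qed.

Lemma slc_pair j : j \in J -> slc (lshift n j) * slc (rshift n j) = - quad j.
Proof.
move=> jJ; have := slc_one jJ; have := slc_bar jJ; rewrite /sc /sidx.
by case: ifP => _; rewrite ?bar_l ?bar_r => -> ->; rewrite ?mul1r ?mulr1.
Qed.

End Values.

Lemma slc_morph (S S' : comPzRingType) (f : {rmorphism S -> S'}) (x : 'I_N -> S)
  (h : rat -> S) k : f (slc x h k) = slc (fun i => f (x i)) (fun q => f (h q)) k.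
Proof.
have fe l : f (ext x l) = ext (fun i => f (x i)) l by rewrite /ext rmorph_sum.
rewrite /slc; case: ifP => _; first exact: fe.
case: ifP => _; first exact: rmorph1.
rewrite rmorphN rmorph_sum; congr (- _); apply: eq_bigr => i _.
by rewrite !rmorphM !fe.
Qed.

Hypothesis bJ : base A J.

Lemma slc_moment (c : 'I_N -> C) : moment A (\row_k slc c ratr k) = 0.
Proof.
apply: (moment_base bJ) => j jJ; rewrite (bigID (mem J)) /=.
rewrite (bigD1 j) //= big1 ?addr0 => [|i /andP[iJ ij]]; last first.
  by rewrite sol_aQ // [delta_mx _ _ _ _]mxE eq_sym (negPf ij) andbF rmorph0 mulr0.
rewrite sol_aQ // !mxE !eqxx rmorph1 mulr1 slc_pair //.
apply/eqP; rewrite addrC subr_eq0; apply/eqP.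
rewrite /quad [RHS](bigID (mem J)) /= [X in _ = X + _]big1 ?add0r => [|i iJ]; last first.
  by rewrite ext_out ?idx_l // !mul0r.
by apply: eq_bigr => i iJ; rewrite !mxE /slc idx_l idx_r iJ.
Qed.

Definition slice (c : 'I_N -> C) : V := mkV (slc_moment c).

Lemma co_slice c k : co (slice c) k = slc c ratr k.
Proof. exact: co_mkV. Qed.

Lemma slice_free c i : co (slice c) (fcoord i) = c i.
Proof. by rewrite co_slice slc_free. Qed.

Lemma slice_one c j : j \in J -> co (slice c) (sc j) = 1.
Proof. by move=> jJ; rewrite co_slice slc_one. Qed.

Lemma eq_slice c c' : c =1 c' -> slice c = slice c'.
Proof. by move=> /funext ->. Qed.

Lemma sliceP v : (forall j, j \in J -> co v (sc j) = 1) ->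
  v = slice (fun i => co v (fcoord i)).
Proof.
move=> h; apply: V_eq => k; rewrite co_slice; set c := fun i => _.
have fc l : idx l \notin J -> co v l = ext c l.
  by case: (slotP l) => [i -> _|j jJ ->|j jJ ->] //=;
    rewrite ?ext_free // ?idx_bar idx_sc jJ.
case: (slotP k) => [i -> _|j jJ ->|j jJ ->]; first by rewrite slc_free.
  by rewrite slc_one // h.
rewrite slc_bar //; have := moment_functional (lamb A J j) (set_valP v : moment A (aff_val v) = 0).
rewrite (bigID (mem J)) /= (bigD1 j) //= big1 ?addr0 => [|i /andP[iJ ij]]; last first.
  by rewrite lambE // sol_aQ // mxE eq_sym (negPf ij) andbF rmorph0 mulr0.
rewrite lambE // sol_aQ // mxE !eqxx rmorph1 mulr1.
have -> : aff_val v 0 (lshift n j) * aff_val v 0 (rshift n j) = co v (bar (sc j)).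
  have := h j jJ; rewrite /sc /sidx /co; case: ifP => _ e; rewrite ?bar_l ?bar_r e ?mul1r ?mulr1 //.
move/eqP; rewrite addr_eq0 => /eqP ->; congr (- _).
rewrite /quad [RHS](bigID (mem J)) /= [X in _ = X + _]big1 ?add0r => [|i iJ]; last first.
  by rewrite ext_out ?idx_l // !mul0r.
by apply: eq_bigr => i iJ; rewrite lambE // -!fc ?idx_l ?idx_r.
Qed.

Lemma bvec_indep (e : 'rV[int]_n) : supp_in (map_mx intr e) J ->
  \sum_j e 0 j *: bvec A (sc j) = 0 -> e = 0.
Proof.
move=> hs h; pose x : 'rV[rat]_n := \row_j (if 0 < sl theta 0 j then (e 0 j)%:~R else - (e 0 j)%:~R).
have : x = 0.
  case: bJ => iJ _; apply: iJ.
    move=> j; rewrite mxE => xj; apply: hs; rewrite mxE; move: xj.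
    by case: ifP => _ //; rewrite oppr_eq0.
  have := congr1 (map_mx (intr : int -> rat)) h; rewrite map_mx0 (raddf_sum (map_mx intr)) => <-.
  rewrite mulAt; apply: eq_bigr => j _ /=; rewrite mxE /sc /sidx.
  have -> k : map_mx intr (e 0 j *: bvec A k) = (e 0 j)%:~R *: bQ A k :> 'rV[rat]_r.
    by apply/rowP => l; rewrite !mxE intrM.
  by case: ifP => _; rewrite ?bQ_l ?bQ_r // scalerN scaleNr.
move/rowP => x0; apply/rowP => j; have := x0 j; rewrite !mxE => h0; apply/eqP.
by rewrite -(intr_eq0 rat); move: h0; case: ifP => _ /eqP; rewrite ?oppr_eq0.
Qed.

(** Independence of the columns of [J] makes the compatibility condition of [torus_solve] vacuous,
    so the selected coordinates can all be scaled to 1. *)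
Lemma slice_transversal v : (forall j, j \in J -> co v (sc j) != 0) ->
  exists g c, act g v = slice c.
Proof.
move=> v0; pose M := \matrix_j (if j \in J then bvec A (sc j) else 0) : 'M[int]_(n, r).
pose t j : C := if j \in J then (co v (sc j))^-1 else 1.
have t0 j : t j != 0.
  by rewrite /t; case: ifP => [/v0|_]; rewrite ?invr_eq0 // oner_neq0.
have [e eM|g g0 gE] := @torus_solve C _ _ M t t0.
  pose e' : 'rV[int]_n := \row_j (if j \in J then e 0 j else 0).
  have e'0 : e' = 0.
    apply: bvec_indep; first by move=> j; rewrite !mxE; case: ifP => //; rewrite eqxx.
    rewrite -[RHS]eM mulmx_sum_row; apply: eq_bigr => j _; rewrite rowK mxE.
    by case: ifP => _; rewrite ?scale0r ?scaler0.
  rewrite /lmon big1 // => j _; rewrite /t; case: ifP => jJ; last by rewrite exp1rz.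
  by have /rowP/(_ j) := e'0; rewrite !mxE jJ => ->; rewrite expr0z.
exists (mk_torus g0), (fun i => co (act (mk_torus g0) v) (fcoord i)).
apply: sliceP => j jJ; rewrite co_act chr_mk_torus.
by have := gE j; rewrite rowK jJ /t jJ => ->; rewrite mulVf ?v0.
Qed.

Hypothesis s0 : forall j, j \in J -> sl theta 0 j != 0.

Lemma slice_interior c : interior_point theta (slice c).
Proof.
by apply: (sidx_interior bJ s0) => j jJ; rewrite (slice_one c jJ) oner_neq0.
Qed.

Lemma slice_Vss c : Vss theta (slice c).
Proof. exact: interior_Vss (slice_interior c). Qed.

Definition spt c : X R A theta := qpt (slice_Vss c).

(** A semi-invariant involving exactly the normalised coordinates: it equals 1 on the slice, and its
    nonvanishing locus is the open set of the chart. *)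
Lemma pivot_monomial : exists2 D, (0 < D)%N & exists E : I2 -> nat,
  map_mx intr (wt A E) = theta *+ D /\ forall k, (E k != 0%N) <-> exists2 j, j \in J & k = sc j.
Proof.
have [|D D0 [E [wE zE]]] := @cone_monomial r n A theta (posx (sl theta)) (@posx_ge0 n _).
  by rewrite posx_sum; have [] := sol_spec theta bJ.
exists D => //; exists E; split=> // k; rewrite zE; case: (coordP k) => i.
  rewrite posx_l; have [h|h] := ltP 0 (sl theta 0 i).
    split=> _; last by rewrite gt_eqF.
    exists i; first by apply: contraT => iJ; rewrite sol_out // ltxx in h.
    by rewrite /sc /sidx h.
  rewrite eqxx; split=> // -[j jJ]; rewrite /sc /sidx; case: ifP => // hj /(congr1 val) /= e.
    by have : i = j by [exact: val_inj]; move=> ij; move: h; rewrite ij leNgt hj.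
  by have := ltn_ord i; rewrite e ltnNge leq_addr.
rewrite posx_r; have [h|h] := ltP (sl theta 0 i) 0.
  rewrite max_l ?oppr_ge0 ?ltW //; split=> _; last by rewrite oppr_eq0 lt_eqF.
  exists i; first by apply: contraT => iJ; rewrite sol_out // ltxx in h.
  by rewrite /sc /sidx ltNge ltW.
rewrite max_r ?oppr_le0 // eqxx; split=> // -[j jJ]; rewrite /sc /sidx; case: ifP => // hj /(congr1 val) /= e.
  by have := ltn_ord j; rewrite -e ltnNge leq_addr.
have : i = j by apply: val_inj; apply: (@addnI n).
by move=> ij; move: h; rewrite ij le_eqVlt hj orbF eq_sym (negPf (s0 jJ)).
Qed.

Definition slice_open : set (X R A theta) := range spt.

Lemma slice_openE v (vss : Vss theta v) :
  slice_open (qpt vss) <-> forall j, j \in J -> co v (sc j) != 0.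
Proof.
have [D D0 [E [wE zE]]] := pivot_monomial.
split=> [[c _ /qpt_eq si] j jJ|v0].
  have : mon E v != 0.
    have sE : mon E (slice c) != 0.
      by apply: mon_neq0 => k /zE[i iJ ->]; rewrite slice_one // oner_neq0.
    by apply: contra sE => /eqP h; apply/eqP; apply/(si D (mon E) (weight_part_mon R wE)).
  by move=> /mon_neq0_inv; apply; apply/zE; exists j.
have [g [c e]] := slice_transversal v0; exists c => //; rewrite /spt.
apply/qpt_eq; rewrite -e => j f wf; have h := @same_ideal_act R r n A theta g v j f wf.
by split=> /h.
Qed.

Lemma slice_open_basic : exists D E, [/\ (0 < D)%N, map_mx intr (wt A E) = theta *+ D,
  forall c, mon E (slice c) = 1 & slice_open = proj_basic (S := semi_invariants R A theta) D (mon E)].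
Proof.
have [D D0 [E [wE zE]]] := pivot_monomial; exists D, E; split=> //.
  move=> c; rewrite /mon big1 // => k _; have [->|/zE[j jJ ->]] := eqVneq (E k) 0%N.
    by rewrite expr0.
  by rewrite slice_one // expr1n.
apply/seteqP; split=> x; have [v [vss ->]] := qpt_surj x.
  move=> /slice_openE h; apply/(basic_qpt vss (weight_part_mon R wE)).
  by apply: mon_neq0 => k /zE[j jJ ->]; exact: h.
move=> /(basic_qpt vss (weight_part_mon R wE)) h; apply/slice_openE => j jJ.
by apply: (mon_neq0_inv h); apply/zE; exists j.
Qed.

Lemma slice_open_open : open slice_open.
Proof. by have [D [E [D0 wE _ ->]]] := slice_open_basic; apply: basic_open => //; exact: weight_part_mon. Qed.

Definition rest (p : mpoly (n + n) C) : mpoly N C :=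
  mmap (@mpolyC N C) (slc (fun i => mpolyX C (mnm1 i)) (fun q => mpolyC N (ratr q : C))) p.

Lemma ev_rest p (x : affine_space C N) : ev (rest p) x = pv p (slice (fun i => aff_val x 0 i)).
Proof.
rewrite /ev /rest /pv /mpeval meval_subst; apply: meval_eq => k.
rewrite -[RHS]/(co _ k) co_slice (slc_morph (meval (fun i => aff_val x 0 i))).
congr slc; apply/funext => q; first exact: mevalXU.
exact: mevalC.
Qed.

End Slice.

(** * Dimension and smoothness *)

Section RegularOnQuotient.
Variables (R : realType) (r n : nat) (A : 'M[int]_(r, n)) (theta : 'rV[rat]_r).
Local Notation C := R[i].
Local Notation V := (V R A).
Local Notation wpart := (@weight_part R r n A theta).
Local Notation basic j F := (proj_basic (S := semi_invariants R A theta) j F : set (X R A theta)).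

Lemma wpartM i j F G : wpart i F -> wpart j G -> wpart (i + j)%N (fun v => F v * G v).
Proof. exact: (@gr_mul _ _ (semi_invariants R A theta)). Qed.

Lemma wpartZ j c F : wpart j F -> wpart j (fun v => c * F v).
Proof. exact: (@gr_scale _ _ (semi_invariants R A theta)). Qed.

Lemma wpartD j F G : wpart j F -> wpart j G -> wpart j (fun v => F v + G v).
Proof. exact: (@gr_add _ _ (semi_invariants R A theta)). Qed.

Lemma wpartX j F k : wpart j F -> wpart (k.+1 * j)%N (fun v => F v ^+ k.+1).
Proof.
move=> wF; elim: k => [|k IHk].
  by rewrite mul1n; rewrite [X in wpart _ X](_ : _ = F) //; apply/funext => v; rewrite expr1.
rewrite mulSn; have := wpartM wF IHk; congr wpart; by apply/funext => v.
Qed.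

Lemma X_regP (W : set (X R A theta)) f : open W -> reg W f -> forall x, W x ->
  exists j F G, [/\ (0 < j)%N, wpart j F, wpart j G, basic j F x /\ basic j F `<=` W &
    forall v (vss : Vss theta v), F v != 0 -> f (qpt vss) = G v / F v].
Proof.
move=> oW rf x Wx; have [i [h [i0 wh hx hW]]] := X_openP oW Wx.
have [j [F [G [j0 wF wG Fx fE]]]] := (rf : @proj_reg _ _ (semi_invariants R A theta) W f) x Wx.
exists (i + j)%N, (fun v => h v * F v), (fun v => h v * G v).
split; [by rewrite addn_gt0 i0|exact: wpartM|exact: wpartM| |].
  rewrite (proj_basicM (S := semi_invariants R A theta) wh wF); split=> // y [hy _]; exact: hW.
move=> v vss; rewrite mulf_eq0 negb_or => /andP[hv Fv].
rewrite -mulf_div divff // mul1r; apply: (fE (SigSub (mem_set vss) : set_type (Vss theta))) => //.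
by apply: hW; exact/(basic_qpt vss wh).
Qed.

Lemma X_frac j F G : (0 < j)%N -> wpart j F -> wpart j G -> exists f : X R A theta -> C,
  reg (basic j F) f /\ forall v (vss : Vss theta v), F v != 0 -> f (qpt vss) = G v / F v.
Proof.
move=> j0 wF wG.
have /choice[f fP] : forall x : X R A theta, exists y, forall v (vss : Vss theta v),
    x = qpt vss -> F v != 0 -> y = G v / F v.
  move=> x; have [v [vss ->]] := qpt_surj x; exists (G v / F v) => u uss /qpt_eq si Fu.
  have Fv : F v != 0 by apply: contra Fu => /eqP h; apply/eqP; apply/(si j F wF).
  by apply/eqP; rewrite eqr_div // (same_ideal_ratio si wG wF) mulrC.
have fE v (vss : Vss theta v) : F v != 0 -> f (qpt vss) = G v / F v by move=> ?; apply: fP.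
exists f; split=> // x Fx; exists j, F, G; split=> // v _ Fv.
have -> : v = SigSub (mem_set (set_valP v)) by exact: val_inj.
exact: (fE _ (set_valP v)).
Qed.

End RegularOnQuotient.

(** * Chains of closed sets and algebraic independence *)

Section AlgebraicIndependence.
Variable K : closedFieldType.

Lemma reg_meval (X : fspace K) (W : set X) d (f : 'I_d -> X -> K) (p : mpoly d K) :
  (forall i, reg W (f i)) -> reg W (fun x => meval (fun i => f i x) p).
Proof.
move=> rf; elim/mpoly_ind: p => [c|k|p q rp rq|p q rp rq].
- by apply: reg_ext (reg_cst W c) => x _; rewrite mevalC.
- by apply: reg_ext (rf k) => x _; rewrite mevalXU.
- by apply: reg_ext (reg_add rp rq) => x _; rewrite mevalD.
- by apply: reg_ext (reg_mul rp rq) => x _; rewrite mevalM.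
Qed.

Lemma poly_low_order (S : idomainType) (p : {poly S}) : p != 0 ->
  exists m q, p = q * 'X^m /\ q`_0 != 0.
Proof.
move=> p0; have ex : exists i, p`_i != 0.
  by exists (size p).-1; rewrite -lead_coefE lead_coef_eq0.
have [m pm min] := ex_minnP ex; exists m, (drop_poly m p); split; last first.
  by rewrite coef_drop_poly add0n.
rewrite -[LHS](poly_take_drop m p) [X in X + _](_ : _ = 0) ?add0r //.
apply/polyP => i; rewrite coef_take_poly coef0; case: ifP => // im.
by apply/eqP; apply: contraTT im => /min; rewrite -leqNgt.
Qed.

(** Each [f i] vanishes on [Z i] but not on [Z i.+1]. In a relation on the largest member, the
    highest power of the last function can be divided out; restricting to the next smaller member,
    where that function is zero, leaves a nontrivial relation between the others. *)
Lemma chain_independent (X : fspace K) (W : set X) (Z : nat -> set X) (f : nat -> X -> K) d :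
  open W -> (forall i, (i <= d)%N -> irreducible_set (Z i)) ->
  (forall i, (i < d)%N -> Z i `<=` Z i.+1) -> Z 0%N `&` W !=set0 ->
  (forall i, (i < d)%N -> reg W (f i)) ->
  (forall i, (i < d)%N -> forall x, Z i x -> W x -> f i x = 0) ->
  (forall i, (i < d)%N -> exists x, [/\ Z i.+1 x, W x & f i x != 0]) ->
  forall p : mpoly d K, (forall x, Z d x -> W x -> meval (fun i : 'I_d => f i x) p = 0) -> p = 0.
Proof.
move=> oW; elim: d => [|d IHd] irr sub meet rf fz fnz p pz.
  have [x [Zx Wx]] := meet; apply: mpoly_value0 => v; rewrite -[RHS](pz x Zx Wx).
  by apply: meval_eq => -[].
apply/eqP; apply: contraT => p0.
have P0 : uni p != 0.
  apply: contraNneq p0 => u0; rewrite -(uniK p) u0; apply/eqP.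
  exact: (raddf0 (@multi K d)).
have [m [q [qE q0]]] := poly_low_order P0.
have ev x : meval (fun i : 'I_d.+1 => f i x) p =
    (map_poly (meval (fun i : 'I_d => f i x)) q).[f d x] * f d x ^+ m.
  transitivity (meval (rcons_fun (fun i : 'I_d => f i x) (f d x)) p).
    apply: meval_eq => i; have [->|[j ->]] := ord_S_case i; first by rewrite rcons_fun_max.
    by rewrite rcons_fun_widen.
  by rewrite meval_uni qE rmorphM /= map_polyXn hornerM hornerXn.
have evq x : (map_poly (meval (fun i : 'I_d => f i x)) q).[f d x] =
    meval (fun i : 'I_d.+1 => f i x) (multi q).
  rewrite -[q in LHS](@multiK K d) -meval_uni; apply: meval_eq => i.
  have [->|[j ->]] := ord_S_case i; first by rewrite rcons_fun_max.
  by rewrite rcons_fun_widen.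
have [y [Zy Wy fy]] := fnz d (ltnSn d).
have qz : forall x, Z d.+1 x -> W x -> meval (fun i : 'I_d.+1 => f i x) (multi q) = 0.
  have oO : open (W `&` [set x | f d x != 0]) by apply: reg_open => //; exact: rf.
  apply: (@reg_agree K X (Z d.+1) (W `&` [set x | f d x != 0]) W
    (fun x => meval (fun i : 'I_d.+1 => f i x) (multi q)) (fun=> 0)) => //.
  - exact: irr.
  - by exists y.
  - by apply: reg_meval => i; exact: rf.
  - exact: reg_cst.
  - move=> x Zx [Wx fx] _; have := pz x Zx Wx; rewrite ev evq => /eqP.
    by rewrite mulf_eq0 expf_eq0 (negPf fx) andbF orbF => /eqP.
case/eqP: q0; apply: IHd.
- by move=> i le; apply: irr; exact: leqW.
- by move=> i lt; apply: sub; exact: ltnW.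
- exact: meet.
- by move=> i lt; apply: rf; exact: ltnW.
- by move=> i lt; apply: fz; exact: ltnW.
- by move=> i lt; apply: fnz; exact: ltnW.
- move=> x Zx Wx; have := qz x (sub d (ltnSn d) x Zx) Wx.
  by rewrite -evq fz // horner_coef0 coef_map.
Qed.

Lemma msize_mul N (p q : mpoly N K) : (msize (p * q) <= (msize p + msize q).-1)%N.
Proof.
have [->|p0] := eqVneq p 0; first by rewrite mul0r msize0.
have [->|q0] := eqVneq q 0; first by rewrite mulr0 msize0.
by rewrite msizeM.
Qed.

Lemma msize_exp N (p : mpoly N K) D k : (msize p <= D.+1)%N -> (msize (p ^+ k) <= (k * D).+1)%N.
Proof.
move=> h; elim: k => [|k IHk]; first by rewrite expr0 mul0n msize1.
rewrite exprS; have := msize_mul p (p ^+ k); rewrite mulSn.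
move: (msize _) (msize _) (msize _) h IHk => a b c; lia.
Qed.

Lemma msize_prod_exp N d (p : 'I_d -> mpoly N K) D (k : 'I_d -> nat) L :
  (forall i, (msize (p i) <= D.+1)%N) -> (forall i, (k i <= L)%N) ->
  (msize (\prod_i p i ^+ k i) <= (d * (L * D)).+1)%N.
Proof.
move=> hp hk; have : (msize (\prod_(i <- enum 'I_d) p i ^+ k i) <= (size (enum 'I_d) * (L * D)).+1)%N.
  elim: (enum 'I_d) => [|i s IHs]; first by rewrite big_nil msize1.
  rewrite big_cons /= mulSn.
  have := msize_mul (p i ^+ k i) (\prod_(j <- s) p j ^+ k j).
  have := msize_exp (k i) (hp i); have := leq_mul (hk i) (leqnn D).
  set a := msize _; set b := msize _; set c := msize _ => h1 h2 h3.
  have {}h1 : (a <= (L * D).+1)%N by apply: leq_trans h2 _; rewrite ltnS.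
  have {}IHs : (c <= (size s * (L * D)).+1)%N by [].
  apply: leq_trans h3 _; have := leq_add h1 IHs; rewrite addSn addnS.
  by case: (a + c)%N.
by rewrite size_enum_ord big_enum.
Qed.

(* Products of [d] polynomials in [N < d] variables outnumber the monomials
   that can occur in them. *)
Lemma algebraic_dependence N d (phi : 'I_d -> mpoly N K) : (N < d)%N ->
  exists2 P : mpoly d K, P != 0 & forall v, meval (fun i => meval v (phi i)) P = 0.
Proof.
move=> Nd; pose D := (\max_i msize (phi i))%N.
have hD i : (msize (phi i) <= D.+1)%N by apply: leqW; exact: leq_bigmax.
(* Exponents range below [L], which bounds every exponent in a product by [E - 1], and
   [E <= L * (d * D).+1]. The choice of [L] gives [E ^ N < L ^ N.+1 <= L ^ d], fewer monomials than
   products. *)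
pose L := ((d * D).+1 ^ N).+1; pose E := (d * (L * D)).+1.
pose T1 := {ffun 'I_d -> 'I_L}; pose T2 := {ffun 'I_N -> 'I_E}.
have card_lt : (#|T2| < #|T1|)%N.
  rewrite !card_ffun !card_ord.
  have le1 : (E <= L * (d * D).+1)%N by rewrite /E mulnS mulnCA; nia.
  have le2 : (E ^ N <= L ^ N * (d * D).+1 ^ N)%N.
    by rewrite -expnMn; case: (N) => // N'; rewrite leq_exp2r.
  apply: leq_ltn_trans le2 _; apply: leq_trans (_ : L ^ N.+1 <= _)%N; last by rewrite leq_pexp2l.
  by rewrite expnSr ltn_pmul2l ?expn_gt0 // /L.
pose T (k : T1) := \prod_i phi i ^+ (k i : nat).
pose mm2 (m : T2) : multinom N := Multinom (mktuple (fun i => m i : nat)).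
pose mm1 (k : T1) : multinom d := Multinom (mktuple (fun i => k i : nat)).
pose M := \matrix_(a < #|T1|, b < #|T2|) mcoeff (mm2 (enum_val b)) (T (enum_val a)) : 'M[K]_(_, _).
have /rowV0Pn[u uM u0] : kermx M != 0.
  rewrite -mxrank_eq0 mxrank_ker subn_eq0 -ltnNge.
  exact: leq_ltn_trans (rank_leq_col M) card_lt.
move/sub_kermxP in uM.
pose P : mpoly d K := \sum_(k : T1) u 0 (enum_rank k) *: mpolyX K (mm1 k).
have mm1_inj : injective mm1.
  move=> k l /(congr1 (fun m : multinom d => fun i => m i)) e; apply/ffunP => i.
  by apply: val_inj; have := congr1 (fun h => h i) e; rewrite /= !mnmE.
exists P.
  have [a ua] : exists a, u 0 a != 0.
    apply/existsP; apply: contraNT u0; rewrite negb_exists => /forallP h.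
    by apply/eqP/rowP => a; rewrite mxE; apply/eqP; rewrite -[_ == _]negbK h.
  apply: contraNneq ua => P0; have := congr1 (mcoeff (mm1 (enum_val a))) P0.
  rewrite mcoeff0 /P raddf_sum /= (bigD1 (enum_val a)) //= mcoeffZ mcoeffX eqxx mulr1 enum_valK.
  rewrite big1 ?addr0 => [->//|k ne]; rewrite mcoeffZ mcoeffX (inj_eq mm1_inj).
  by rewrite (negPf ne) mulr0.
move=> v; have T0 : \sum_(k : T1) u 0 (enum_rank k) *: T k = 0.
  apply/mpolyP => m; rewrite mcoeff0 raddf_sum /=.
  have [lt|ge] := boolP [forall i, m i < E]%N; last first.
    rewrite big1 // => k _; rewrite mcoeffZ; apply/eqP; rewrite mulf_eq0; apply/orP; right.
    rewrite mcoeff_eq0; case: (fintype.forallPn ge) => i; rewrite -leqNgt => le.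
    apply: contraL le => /msize_mdeg_lt h; rewrite -ltnNge.
    have hT : (msize (T k) <= E)%N.
      by apply: (@msize_prod_exp N d phi D (fun j => k j : nat) L hD) => j; exact: ltnW.
    have hm : (m i <= mdeg m)%N by rewrite mdegE (bigD1 i) //= leq_addr.
    exact: leq_ltn_trans hm (leq_trans h hT).
  pose b := enum_rank ([ffun i => inord (m i)] : T2).
  have mb : mm2 (enum_val b) = m.
    apply/mnmP => i; rewrite /mm2 mnmE /b enum_rankK ffunE /= inordK //.
    exact: (forallP lt).
  have := congr1 (fun x : 'rV_#|T2| => x 0 b) uM; rewrite !mxE => e0; rewrite -[RHS]e0.
  rewrite (reindex (@enum_val T1 T1)) /=; last first.
    by exists enum_rank => k _; rewrite ?enum_valK ?enum_rankK.
  by apply: eq_bigr => a _; rewrite enum_valK mcoeffZ mxE mb.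
rewrite -[RHS](meval0 v) -T0 /P !raddf_sum; apply: eq_bigr => k _ /=.
rewrite !mevalZ mevalX rmorph_prod; congr (_ * _); apply: eq_bigr => i _.
by rewrite mnmE rmorphXn.
Qed.

End AlgebraicIndependence.

Section SliceDimension.
Variables (R : realType) (r n : nat) (A : 'M[int]_(r, n)) (theta : 'rV[rat]_r) (J : {set 'I_n}).
Hypothesis bJ : base A J.
Hypothesis s0 : forall j, j \in J -> sol A J theta 0 j != 0.
Local Notation C := R[i].
Local Notation V := (V R A).
Local Notation I2 := 'I_(n + n).
Local Notation N := (sdim J).
Local Notation wpart := (@weight_part R r n A theta).
Local Notation basic j F := (proj_basic (S := semi_invariants R A theta) j F : set (X R A theta)).
Local Notation AN := (affine_space C N).
Local Notation U := (@slice_open R r n A theta J bJ s0).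

Definition cv (x : AN) (i : 'I_N) : C := aff_val x 0 i.

Definition cpt (x : AN) : X R A theta := spt bJ s0 (cv x).

Lemma slice_openP x : U x -> exists y, x = cpt y.
Proof.
move=> [c _ <-]; exists (apt (\row_i c i)); rewrite /cpt; congr (spt bJ s0 _).
by apply/funext => i; rewrite /cv /aff_val /= mxE.
Qed.

Lemma cpt_open y : U (cpt y).
Proof. by exists (cv y). Qed.

Lemma wpart_poly j F : wpart j F -> exists p, forall y, F (slice theta bJ (cv y)) = ev p y.
Proof.
move=> /weight_part_poly[p pE]; exists (rest A theta J p) => y.
by rewrite (ev_rest theta bJ) pE.
Qed.

Lemma wpart_pow j F k : (0 < k)%N -> wpart j F -> wpart (k * j)%N (fun v => F v ^+ k).
Proof. by case: k => // k _; exact: wpartX. Qed.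

Lemma basic_pow j F k : (0 < k)%N -> wpart j F -> basic (k * j)%N (fun v => F v ^+ k) = basic j F.
Proof.
move=> k0 wF; apply/seteqP; split=> x; have [v [vss ->]] := qpt_surj x.
  move=> /(basic_qpt vss (wpart_pow k0 wF)) h; apply/(basic_qpt vss wF).
  by apply: contra h => /eqP ->; rewrite expr0n gtn_eqF.
move=> /(basic_qpt vss wF) h; apply/(basic_qpt vss (wpart_pow k0 wF)).
exact: expf_neq0.
Qed.

(** A chain of length [d] provides [d] algebraically independent functions on its top member; pulled
    back to the parameters they are [d] polynomials in [M] variables. The case [M = 1] later bounds
    the dimension of the contracted curve. *)
Lemma parametrised_dim_bound M (l : 'I_N -> mpoly M C) d Z : irr_chain Z d -> Z 0%N `&` U !=set0 ->
  (forall x, Z d x -> U x -> exists t, x = cpt (apt (\row_k meval t (l k)))) -> (d <= M)%N.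
Proof.
move=> [irr inc] meet par; rewrite leqNgt; apply/negP => Nd.
have [D [E [D0 wE mE1 UE]]] := slice_open_basic R bJ s0.
have wM : wpart D (mon E) by apply: weight_part_mon.
have Z0 i : (i <= d)%N -> Z 0%N `<=` Z i.
  elim: i => [|i IHi] lt x; first by [].
  move=> /(IHi (ltnW lt)) Zx.
  by have [+ _] := inc i lt; apply.
have oU : open U := @slice_open_open R r n A theta J bJ s0.
have step i : (i < d)%N -> exists (f : X R A theta -> C) (q : mpoly N C),
  [/\ reg U f, forall x, Z i x -> U x -> f x = 0,
      exists x, [/\ Z i.+1 x, U x & f x != 0] & forall y, f (cpt y) = ev q y].
  move=> lt; have [_ /existsNP[x /not_implyP[Zx nZx]]] := inc i lt.
  have [cZ _] := irr i (ltnW lt).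
  have oZ : open (~` Z i) by rewrite openC.
  have [j [F [j0 wF Fx FZ]]] := X_openP oZ nZx.
  have wFD := wpart_pow D0 wF; have wMj := wpart_pow j0 wM; rewrite mulnC in wMj.
  have [|f [rf fE]] := X_frac (F := fun v => mon E v ^+ j) (G := fun v => F v ^+ D) _ wMj wFD.
    by rewrite muln_gt0 D0.
  have rfU : reg U f by move: rf; rewrite mulnC basic_pow // -UE.
  have [p pE] := wpart_poly wF.
  have fF v (vss : Vss theta v) : U (qpt vss) -> f (qpt vss) = F v ^+ D / mon E v ^+ j.
    rewrite UE => /(basic_qpt vss wM) h; apply: fE; exact: expf_neq0.
  exists f, (p ^+ D); split; first exact: rfU.
  - move=> y; have [v [vss ->]] := qpt_surj y => Zv Uv; rewrite fF //.
    suff -> : F v = 0 by rewrite expr0n gtn_eqF // mul0r.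
    apply/eqP; apply/negPn/negP => Fv; have : basic j F (qpt vss) by apply/basic_qpt.
    by move/FZ.
  - have [_ iZ] := irr i.+1 lt.
    have [||y [Zy [Uy Fy]]] := irreducible_open iZ oU (basic_open j0 wF).
    + by have [z [Zz Uz]] := meet; exists z; split=> //; exact: Z0 Zz.
    + by exists x.
    exists y; split=> //; move: Uy Fy; have [v [vss ->]] := qpt_surj y => Uy /(basic_qpt vss wF) Fy.
    rewrite (fF v vss Uy); apply: mulf_neq0; first exact: expf_neq0.
    apply: invr_neq0; apply: expf_neq0.
    by move: Uy; rewrite UE => /(basic_qpt vss wM).
  - move=> y; rewrite fE ?mE1 ?expr1n ?oner_neq0 // divr1 pE.
    by rewrite evX.
have /choice[fq fqP] : forall i, exists fq : (X R A theta -> C) * mpoly N C, (i < d)%N ->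
  [/\ reg U fq.1, forall x, Z i x -> U x -> fq.1 x = 0,
      exists x, [/\ Z i.+1 x, U x & fq.1 x != 0] & forall y, fq.1 (cpt y) = ev fq.2 y].
  move=> i; have [lt|ge] := boolP (i < d)%N; last by exists (fun=> 0, 0).
  by have [f [q h]] := step i lt; exists (f, q).
have [P P0 PE] := algebraic_dependence (fun i : 'I_d => mmap (@mpolyC M C) l (fq i).2) Nd.
case/eqP: P0; apply: (@chain_independent _ (X R A theta) U Z (fun i => (fq i).1) d).
- exact: oU.
- by move=> i /irr[].
- by move=> i /inc[].
- exact: meet.
- by move=> i /fqP[].
- by move=> i /fqP[].
- by move=> i /fqP[].
move=> x Zx Ux; have [t ->] := par x Zx Ux; rewrite -[RHS](PE t); apply: meval_eq => i.
have [_ _ _ ->] := fqP i (ltn_ord i); rewrite meval_subst /ev /mpeval; apply: meval_eq => k.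
by rewrite /aff_val /= mxE.
Qed.

Lemma dim_bound d Z : irr_chain Z d -> Z 0%N `&` U !=set0 -> (d <= N)%N.
Proof.
move=> ch meet; apply: (parametrised_dim_bound (l := fun k => mpolyX C (mnm1 k)) ch meet) => x _ /slice_openP[y ->].
exists (cv y); rewrite -[in LHS](apt_val y); congr (cpt (apt _)).
by apply/rowP => k; rewrite mxE mevalXU.
Qed.

Definition mw (e : 'I_N -> nat) : 'rV[rat]_r := \sum_i (e i)%:R *: bQ A (fcoord i).

(** Membership in the lattice spanned by the columns in [J]. Monomials on the slice with such a
    weight are those invariant under its finite stabiliser. *)
Definition iw (w : 'rV[rat]_r) := forall j, sol A J w 0 j \is a Num.int.

Lemma iwD w w' : iw w -> iw w' -> iw (w + w').
Proof. by move=> h h' j; rewrite solD // mxE rpredD. Qed.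

Lemma iwB w w' : iw w -> iw w' -> iw (w - w').
Proof. by move=> h h' j; rewrite solB // !mxE rpredB. Qed.

Lemma iw0 : iw 0.
Proof. by move=> j; rewrite sol0 // mxE rpred0. Qed.

Lemma iwMn w k : iw w -> iw (w *+ k).
Proof. by move=> h; elim: k => [|k IHk]; rewrite ?mulr0n ?mulrS; [exact: iw0|exact: iwD]. Qed.

Lemma iw_aQ j : j \in J -> iw (aQ A j).
Proof. by move=> jJ i; rewrite sol_aQ // mxE; case: (_ && _). Qed.

Lemma bQ_sc j : bQ A (sc A theta J j) = (if 0 < sol A J theta 0 j then 1 else -1) *: aQ A j.
Proof. by rewrite /sc /sidx; case: ifP => _; rewrite ?bQ_l ?bQ_r ?scale1r ?scaleN1r. Qed.

Lemma iw_sc j : j \in J -> iw (bQ A (sc A theta J j)).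
Proof.
move=> jJ; rewrite bQ_sc; case: ifP => _; first by rewrite scale1r; exact: iw_aQ.
by rewrite scaleN1r -sub0r; apply: iwB; [exact: iw0|exact: iw_aQ].
Qed.

Lemma mwD e e' : mw (fun i => e i + e' i)%N = mw e + mw e'.
Proof. by rewrite -big_split; apply: eq_bigr => i _; rewrite natrD scalerDl. Qed.

Lemma sum_slots (M : zmodType) (F : I2 -> M) : \sum_k F k =
  \sum_(i < N) F (fcoord i) + \sum_(j in J) (F (sc A theta J j) + F (bar (sc A theta J j))).
Proof.
rewrite sum_coord (bigID (mem J)) /= addrC; congr (_ + _); last first.
  by apply: eq_bigr => j jJ; rewrite /sc /sidx; case: ifP => _; rewrite ?bar_l ?bar_r // addrC.
transitivity (\sum_(k in free J) F k); last by rewrite big_enum_val.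
rewrite [RHS]big_mkcond sum_coord [LHS]big_mkcond /=.
by apply: eq_bigr => i _; rewrite !inE idx_l idx_r; case: ifP => _ //; rewrite addr0.
Qed.

(** Multiplying by a high power of the pivot monomial, which is 1 on the slice, makes the exponents
    of the normalised coordinates nonnegative. Every large multiple of [D] is reached. *)
Lemma monomial_lift D E (e : 'I_N -> nat) : map_mx intr (wt A E) = theta *+ D ->
  (forall k, (E k != 0%N) <-> exists2 j, j \in J & k = sc A theta J j) -> iw (mw e) ->
  exists K0, forall K, (K0 <= K)%N -> exists2 F, wpart (K * D) F &
    forall c, F (slice theta bJ c) = \prod_i c i ^+ e i.
Proof.
move=> wE zE iwe.
have /choice[x xE] : forall j, exists x : int, sol A J (mw e) 0 j = x%:~R.
  by move=> j; apply/intrP; exact: iwe.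
pose s j : int := if 0 < sol A J theta 0 j then 1 else -1.
exists (\sum_j `|x j|)%N => K leK.
pose G k : nat := if idx k \notin J then (\sum_(i < N | fcoord i == k) e i)%N
  else if k == sc A theta J (idx k) then absz ((K * E k)%N%:Z - s (idx k) * x (idx k))%R else 0%N.
have Gfree i : G (fcoord i) = e i.
  rewrite /G fcoord_free (big_pred1 i) // => j.
  by apply/eqP/eqP => [/fcoord_inj|->].
have Gbar j : j \in J -> G (bar (sc A theta J j)) = 0%N.
  by move=> jJ; rewrite /G idx_bar idx_sc jJ /= (negPf (bar_neq _)).
have Gsc j : j \in J -> (G (sc A theta J j))%:Z = (K * E (sc A theta J j))%N%:Z - s j * x j.
  move=> jJ; rewrite /G idx_sc jJ eqxx gez0_abs //.
  have : (`|x j| <= K)%N by apply: leq_trans leK; rewrite (bigD1 j) //= leq_addr.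
  have : (0 < E (sc A theta J j))%N by rewrite lt0n; apply/zE; exists j.
  by rewrite /s; case: ifP => _; nia.
exists (mon G).
  apply: weight_part_mon; rewrite mulnC mulrnA -wE -raddfMn /= -wtMn wtQ wtQ !sum_slots.
  have Ef (i : 'I_N) : E (fcoord i) = 0%N.
    apply/eqP; apply: contraT => /zE[j jJ e1]; have := @fcoord_free n J i.
    by rewrite e1 idx_sc jJ.
  have Eb j : j \in J -> E (bar (sc A theta J j)) = 0%N.
    move=> jJ; apply/eqP; apply: contraT => /zE[j' j'J e1].
    have := congr1 (@idx n) e1; rewrite idx_bar !idx_sc => jj; move: e1; rewrite -jj => /eqP.
    by rewrite (negPf (bar_neq _)).
  rewrite [X in _ = X + _]big1 ?add0r => [|i _]; last by rewrite Ef muln0 scale0r.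
  have -> : \sum_(i < N) (G (fcoord i))%:R *: bQ A (fcoord i) = mw e.
    by apply: eq_bigr => i _; rewrite Gfree.
  rewrite [mw e](sol_sum (mw e) bJ) (bigID (mem J)) /= [X in _ + X + _]big1 ?addr0 => [|j nj]; last first.
    by rewrite sol_out // scale0r.
  rewrite -big_split /=; apply: eq_bigr => j jJ.
  rewrite Gbar // Eb // muln0 !scale0r !addr0 xE bQ_sc !scalerA -scalerDl; congr (_ *: _).
  have -> : (G (sc A theta J j))%:R = ((K * E (sc A theta J j))%N%:Z - s j * x j)%:~R :> rat.
    by rewrite -Gsc // -pmulrn.
  rewrite rmorphB rmorphM /= -pmulrn /s; case: ifP => _; rewrite ?rmorph1 ?rmorphN1; ring.
move=> c; rewrite /mon (bigID (mem (free J))) /= [X in _ * X]big1 ?mulr1 => [|k].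
  rewrite big_enum_val /=; apply: eq_bigr => i _.
  by rewrite -[enum_val i]/(fcoord i) slice_free Gfree.
case: (slotP A theta J k) => [i -> nJ|j jJ ->|j jJ ->].
- by rewrite inE nJ.
- by rewrite slice_one // expr1n.
- by rewrite Gbar // expr0.
Qed.

Lemma eq_leq_l a c e : (a + c)%N = e -> (a <= e)%N. Proof. by move=> <-; rewrite leq_addr. Qed.
Lemma eq_leq_r a c e : (a + c)%N = e -> (c <= e)%N. Proof. by move=> <-; rewrite leq_addl. Qed.

(** * The cotangent space of a finite quotient at the origin *)

Section Graded.
Implicit Types (p q : mpoly N C) (w : 'rV[rat]_r).

(** Homogeneity for the grading of the slice by weights modulo the lattice of [J]; degree 0 means
    invariance under the finite stabiliser. *)
Definition hom w p := forall m : multinom N, m \in msupp p -> iw (mw m - w).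

Lemma homC c : hom 0 (mpolyC N c).
Proof.
move=> m; rewrite msuppC; case: ifP => // _; rewrite inE => /eqP ->.
rewrite subr0 (_ : mw _ = 0); first exact: iw0.
by rewrite /mw big1 // => i _; rewrite mnm0E scale0r.
Qed.

Lemma homX i : hom (bQ A (fcoord i)) (mpolyX C (mnm1 i)).
Proof.
move=> m; rewrite msuppX inE => /eqP ->; rewrite (_ : mw _ = bQ A (fcoord i)) ?subrr; first exact: iw0.
rewrite /mw (bigD1 i) //= mnm1E eqxx scale1r big1 ?addr0 // => k ki.
by rewrite mnm1E eq_sym (negPf ki) scale0r.
Qed.

Lemma homD w p q : hom w p -> hom w q -> hom w (p + q).
Proof. by move=> hp hq m /msuppD_le; rewrite mem_cat => /orP[/hp|/hq]. Qed.

Lemma homM w w' p q : hom w p -> hom w' q -> hom (w + w') (p * q).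
Proof.
move=> hp hq m /msuppM_le /allpairsP[[m1 m2] /= [m1p m2q ->]].
have -> : mw (mnm_add m1 m2) - (w + w') = (mw m1 - w) + (mw m2 - w').
  rewrite addrACA -opprD -mwD; congr (_ - _).
  by apply: eq_bigr => i _; rewrite mnmDE.
by apply: iwD; [exact: hp|exact: hq].
Qed.

Lemma hom_congr w w' p : iw (w - w') -> hom w p -> hom w' p.
Proof. by move=> h hp m /hp hm; rewrite -[mw m](subrK w) -addrA; apply: iwD. Qed.

Lemma hom0 w : hom w 0.
Proof. by move=> m; rewrite msupp0. Qed.

Lemma hom_sum w (I : Type) (s : seq I) (P : pred I) (F : I -> mpoly N C) :
  (forall i, P i -> hom w (F i)) -> hom w (\sum_(i <- s | P i) F i).
Proof. by move=> h; elim/big_ind: _ => //; [exact: hom0|exact: homD]. Qed.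

Lemma hom_sum_seq w (I : eqType) (s : seq I) (F : I -> mpoly N C) :
  (forall i, i \in s -> hom w (F i)) -> hom w (\sum_(i <- s) F i).
Proof. by move=> h; rewrite big_seq; exact: hom_sum. Qed.

Lemma homMn w p k : hom w p -> hom (w *+ k) (p ^+ k).
Proof.
move=> hp; elim: k => [|k IHk]; first by rewrite expr0 mulr0n -mpolyC1; exact: homC.
by rewrite exprS mulrS; exact: homM.
Qed.

Lemma hom_prod (I : finType) (w : I -> 'rV[rat]_r) (F : I -> mpoly N C) :
  (forall i, hom (w i) (F i)) -> hom (\sum_i w i) (\prod_i F i).
Proof.
move=> h; elim/big_rec2: _ => [|i y x _ hy]; last exact: homM.
by rewrite -mpolyC1; exact: homC.
Qed.

Lemma iwN w : iw w -> iw (- w).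
Proof. by move=> h; rewrite -sub0r; apply: iwB => //; exact: iw0. Qed.

Lemma hom_scal c w p : hom w p -> hom w (mpolyC N c * p).
Proof. by move=> hp; rewrite -[w]add0r; apply: homM => //; exact: homC. Qed.

Lemma hom_slot k : hom (bQ A k) (slc A theta (fun i => mpolyX C (mnm1 i)) (fun a : rat => mpolyC N (ratr a : C)) k).
Proof.
have he l : hom (bQ A l) (ext (fun i : 'I_N => mpolyX C (mnm1 i)) l).
  by apply: hom_sum => i /eqP <-; exact: homX.
case: (slotP A theta J k) => [i -> _|j jJ ->|j jJ ->].
- by rewrite slc_free; exact: homX.
- rewrite slc_one // -mpolyC1; apply: hom_congr (@homC 1).
  by rewrite sub0r; apply: iwN; exact: iw_sc.
rewrite slc_bar // -mulN1r -mpolyC1 -mpolyCN /quad; apply: hom_scal.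
apply: hom_sum => i _; rewrite mulrC; apply: hom_scal.
apply: hom_congr (homM (he (lshift n i)) (he (rshift n i))).
by rewrite bQ_l bQ_r subrr sub0r bQ_bar opprK; exact: iw_sc.
Qed.

Lemma wpart_hom j F : wpart j F -> exists2 p,
  forall y, F (slice theta bJ (cv y)) = ev p y & hom (theta *+ j) p.
Proof.
move=> [chi ce /semi_invariant_monomials[p pE pw]]; exists (rest A theta J p).
  by move=> y; rewrite (ev_rest theta bJ) pE.
rewrite /rest /mmap; apply: hom_sum_seq => m mp.
apply: hom_scal; rewrite -ce -(pw m mp) wtQ; apply: hom_prod => k.
by rewrite scaler_nat; apply: homMn; exact: hom_slot.
Qed.

Definition origin : AN := apt 0.

Lemma mcoeff_sum m p : mcoeff m p = \sum_(l <- msupp p) mcoeff l p * (l == m)%:R.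
Proof.
rewrite {1}[p]mpolyE raddf_sum /=; apply: eq_bigr => l _.
by rewrite mcoeffZ mcoeffX.
Qed.

Lemma ev_origin p : ev p origin = mcoeff (@mnm0 N) p.
Proof.
rewrite /ev /mpeval mevalE [RHS]mcoeff_sum; apply: eq_bigr => m _; congr (_ * _).
have [->|m0] := eqVneq m (@mnm0 N); first by rewrite big1 // => i _; rewrite mnm0E expr0.
have [i mi] : exists i, m i != 0%N.
  apply: contrapT => /forallNP h; case/negP: m0; apply/eqP/mnmP => i; rewrite mnm0E.
  by apply/eqP; apply/negPn/negP => /(h i).
by rewrite (bigD1 i) //= /aff_val /= mxE expr0n (negPf mi) mul0r.
Qed.

Lemma weight_denominator : exists2 D : nat, (0 < D)%N &
  forall chi : 'rV[int]_r, iw (map_mx intr chi *+ D).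
Proof.
have [D D0 [m mE]] := clear_denominators (fun a : 'I_#|{: 'I_r * 'I_n}| =>
  sol A J (delta_mx 0 (enum_val a).1) 0 (enum_val a).2).
exists D => // chi j; rewrite -scaler_nat solZ // mxE.
rewrite [map_mx intr chi]row_sum_delta sol_sumZ // summxE mulr_sumr; apply: rpred_sum => k _.
rewrite mxE mulrCA; have := mE (enum_rank (k, j)); rewrite enum_rankK /= mulrC => ->.
by rewrite !mxE rpredM // intr_int.
Qed.

(** Numerator and denominator are multiplied by [q ^+ D.-1], which brings their common weight to a
    multiple of [D], hence into the lattice of [J]. *)
Lemma local_fraction W f : open W -> reg W f -> W (cpt origin) -> exists p q,
  [/\ ev q origin != 0, hom 0 p, hom 0 q &
   forall y, ev q y != 0 -> W (cpt y) /\ f (cpt y) * ev q y = ev p y].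
Proof.
move=> oW rf Wo; have [j [F [G [j0 wF wG [Fo FW] fE]]]] := X_regP oW rf Wo.
have [q qE hq] := wpart_hom wF; have [p pE hp] := wpart_hom wG.
have [D D0 hD] := weight_denominator.
have [chi ce _] := wF.
exists (p * q ^+ D.-1), (q ^+ D).
have e0 s : hom (theta *+ j *+ D) s -> hom 0 s.
  by move=> h; apply: hom_congr h; rewrite subr0 -ce; exact: hD.
have Fq y : (F (slice theta bJ (cv y)) != 0) = (ev q y != 0) by rewrite qE.
split.
- by rewrite evX expf_neq0 // -Fq; move/(basic_qpt _ wF): Fo.
- apply: e0; rewrite -(prednK D0) mulrS; apply: homM => //; exact: homMn.
- by apply: e0; exact: homMn.
move=> y; rewrite evX expf_eq0 D0 /= => qy; rewrite -Fq in qy; split.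
  by apply: FW; apply/(basic_qpt _ wF).
rewrite fE // qE pE evM evX -[in _ ^+ D](prednK D0) exprS mulrA divfK //.
by rewrite -Fq.
Qed.

Lemma local_fractions (T : finType) (W : T -> set (X R A theta)) f :
  (forall t, [/\ open (W t), reg (W t) (f t) & W t (cpt origin)]) -> exists q (p : T -> mpoly N C),
  [/\ ev q origin != 0, hom 0 q, forall t, hom 0 (p t) &
   forall t y, ev q y != 0 -> W t (cpt y) /\ f t (cpt y) * ev q y = ev (p t) y].
Proof.
move=> h; have /choice[pq pqP] : forall t, exists pq : mpoly N C * mpoly N C,
  [/\ ev pq.2 origin != 0, hom 0 pq.1, hom 0 pq.2 &
   forall y, ev pq.2 y != 0 -> W t (cpt y) /\ f t (cpt y) * ev pq.2 y = ev pq.1 y].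
  move=> t; have [oW rf Wo] := h t; have [p [q H]] := local_fraction oW rf Wo.
  by exists (p, q).
have hprod (P : pred T) : hom 0 (\prod_(t | P t) (pq t).2).
  elim/big_ind: _ => [|x y hx hy|t _]; first by rewrite -mpolyC1; exact: homC.
    by rewrite -[0]addr0; exact: homM.
  by have [] := pqP t.
exists (\prod_t (pq t).2), (fun t => (pq t).1 * \prod_(s | s != t) (pq s).2); split.
- by rewrite ev_prod; apply/prodf_neq0 => t _; have [] := pqP t.
- exact: hprod.
- by move=> t; rewrite -[0]addr0; apply: homM => //; have [] := pqP t.
move=> t y; rewrite (bigD1 t) //= !evM mulf_eq0 negb_or => /andP[qy _].
by have [_ _ _ /(_ y qy)[Wy fE]] := pqP t; split=> //; rewrite mulrA fE.
Qed.

(** The minimal monomial generators of the ring of invariants of the finite stabiliser; they give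
    independent cotangent vectors at the origin. *)
Definition indecomposable (e : multinom N) := e != @mnm0 N /\
  forall a b : multinom N, mnm_add a b = e -> iw (mw a) -> iw (mw b) -> a = @mnm0 N \/ b = @mnm0 N.

(** Extracting the coefficient of an indecomposable monomial is a derivation at the origin: in a
    product, only a constant term times the monomial itself contributes to it. *)
Lemma coeff_derivation e p q : indecomposable e -> hom 0 p -> hom 0 q ->
  mcoeff e (p * q) = ev p origin * mcoeff e q + mcoeff e p * ev q origin.
Proof.
move=> [e0 ind] hp hq; rewrite !ev_origin mpolyME raddf_sum /=.
rewrite big_allpairs /= !(mcoeff_sum _ p) !(mcoeff_sum _ q) !mulr_suml -big_split /=.
apply: eq_big_seq => a ap; rewrite !mulr_sumr -big_split /=; apply: eq_big_seq => c cq.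
rewrite mcoeffZ mcoeffX; have ha := hp a ap; have hc := hq c cq; rewrite !subr0 in ha hc.
have [E|ne] := eqVneq (mnm_add a c) e.
  have [a0|c0] := ind a c E ha hc.
    have ce : c = e by rewrite -E a0 add0m.
    by rewrite a0 ce !eqxx (negPf e0) !mulr1 !mulr0 addr0.
  have ae : a = e by rewrite -E c0 addm0.
  by rewrite c0 ae !eqxx (negPf e0) !mulr1 mulr0 mul0r add0r.
rewrite mulr0; have [a0|_] := eqVneq a (@mnm0 N).
  have ce : c != e by apply: contraNneq ne => <-; rewrite a0 add0m.
  have ae : a != e by rewrite a0 eq_sym.
  by rewrite (negPf ce) (negPf ae) !mulr0 ?mul0r addr0.
have [c0|_] := eqVneq c (@mnm0 N); last by rewrite !mulr0 ?mul0r addr0.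
have ae : a != e by apply: contraNneq ne => <-; rewrite c0 addm0.
by rewrite (negPf ae) !mulr0 ?mul0r addr0.
Qed.


Lemma hom_mpolyX (e : multinom N) : iw (mw e) -> hom 0 (mpolyX C e).
Proof. by move=> h m; rewrite msuppX inE => /eqP ->; rewrite subr0. Qed.

Lemma monomial_function (e : multinom N) : iw (mw e) -> exists f,
  reg U f /\ forall y, f (cpt y) = ev (mpolyX C e) y.
Proof.
move=> iwe; have [D D0 [E [wE zE]]] := pivot_monomial bJ s0.
have wM : wpart D (mon E) by apply: weight_part_mon.
have mE1 c : mon E (slice theta bJ c) = 1.
  rewrite /mon big1 // => k _; have [->|/zE[j jJ ->]] := eqVneq (E k) 0%N; first by rewrite expr0.
  by rewrite slice_one // expr1n.
have [K0 H] := monomial_lift wE zE iwe; have [F wF FE] := H K0.+1 (leqnSn K0).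
have wMK : wpart (K0.+1 * D) (fun v => mon E v ^+ K0.+1) by apply: wpart_pow.
have [|f [rf fE]] := X_frac _ wMK wF; first by rewrite muln_gt0.
exists f; split.
  apply: reg_res rf => x; have [v [vss ->]] := qpt_surj x => /slice_openE h.
  rewrite basic_pow //; apply/(basic_qpt vss wM); apply: mon_neq0 => k /zE[j jJ ->]; exact: h.
move=> y; rewrite fE mE1 ?expr1n ?oner_neq0 // divr1 FE /ev /mpeval mevalX.
by apply: eq_bigr.
Qed.

(** Each monomial is a combination of the [t i]. Applying the coefficient derivations yields
    [K *m G], a nonzero scalar matrix of size [s] that factors through dimension [d]. *)
Lemma cotangent_bound d s (W : set (X R A theta)) (t : 'I_d -> X R A theta -> C)
    (e : 'I_s -> multinom N) : open W -> W (cpt origin) ->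
  (forall i, reg W (t i) /\ t i (cpt origin) = 0) ->
  (forall O f, open O -> O (cpt origin) -> reg O f -> f (cpt origin) = 0 ->
     exists (W' : set (X R A theta)) (h : 'I_d -> X R A theta -> C),
       [/\ open W', W' (cpt origin), W' `<=` O `&` W, forall i, reg W' (h i) &
           forall y, W' y -> f y = \sum_i h i y * t i y]) ->
  injective e -> (forall a, iw (mw (e a))) -> (forall a, indecomposable (e a)) -> (s <= d)%N.
Proof.
move=> oW Wo tP gen_t e_inj iwe ind.
have Xo a : ev (mpolyX C (e a)) origin = 0.
  by rewrite ev_origin mcoeffX; have [/negPf->] := ind a.
have /choice[f fP] : forall a, exists f, reg U f /\ forall y, f (cpt y) = ev (mpolyX C (e a)) y.
  by move=> a; exact: monomial_function.
have /choice[Wh WhP] : forall a, exists Wh : set (X R A theta) * ('I_d -> X R A theta -> C),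
   [/\ open Wh.1, Wh.1 (cpt origin), forall i, reg Wh.1 (Wh.2 i) &
           forall y, Wh.1 y -> f a y = \sum_i Wh.2 i y * t i y].
  move=> a; have [rf fE] := fP a.
  have [||//||W' [h [oW' W'o _ rh hE]]] := gen_t U (f a).
  - exact: @slice_open_open R r n A theta J bJ s0.
  - exact: cpt_open.
  - by rewrite fE Xo.
  by exists (W', h).
(* The index [inr (a, None)] carries the constant function 1; it only ensures that the common
   denominator is supported where the a-th relation is valid. *)
pose T := ('I_d + 'I_s * option 'I_d)%type.
have [|q [p [q0 hq hp pE]]] := @local_fractions T
  (fun x => match x with inl _ => W | inr ai => (Wh ai.1).1 end)
  (fun x => match x with inl i => t i
     | inr ai => if ai.2 is Some i then (Wh ai.1).2 i else fun=> 1 end).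
  case=> [i|[a [i|]]] /=; first by have [? _] := tP i.
    by have [? ? rh _] := WhP a; split=> //; exact: rh.
  by have [? ? _ _] := WhP a; split=> //; exact: (@reg_cst _ (X R A theta)).
have id a : mpolyX C (e a) * (q * q) = \sum_i p (inr (a, Some i)) * p (inl i).
  apply/eqP; rewrite -subr_eq0; apply/eqP; apply: (@ev_zero_on_open _ N (nonzero q)).
  - exact: nonzero_open.
  - by exists origin.
  move=> y qy; rewrite evB ev_sum; apply/eqP; rewrite subr_eq0; apply/eqP.
  have [_ fE] := fP a; have [_ _ _ hE] := WhP a.
  have [Wy _] := pE (inr (a, None)) y qy.
  rewrite !evM -fE hE // mulr_suml; apply: eq_bigr => i _.
  have [_ e1] := pE (inr (a, Some i)) y qy; have [_ e2] := pE (inl i) y qy.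
  by rewrite evM -e1 -e2 /=; ring.
have po i : ev (p (inl i)) origin = 0.
  by have [_ <-] := pE (inl i) origin q0; have [_ /= ->] := tP i; rewrite mul0r.
pose K := \matrix_(a, i) ev (p (inr (a, Some i))) origin : 'M[C]_(s, d).
pose G := \matrix_(i, a) mcoeff (e a) (p (inl i)) : 'M[C]_(d, s).
have KG : K *m G = (ev q origin ^+ 2)%:M.
  apply/matrixP => a a'; rewrite !mxE.
  have hqq : hom 0 (q * q) by rewrite -[0]addr0; exact: homM.
  transitivity (mcoeff (e a') (mpolyX C (e a) * (q * q))).
    rewrite id raddf_sum /=; apply: eq_bigr => i _; rewrite !mxE.
    by rewrite coeff_derivation // po mulr0 addr0.
  rewrite coeff_derivation //; last exact: hom_mpolyX.
  by rewrite Xo mul0r add0r mcoeffX (inj_eq e_inj) evM -expr2 mulrC mulr_natr.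
have : \rank (K *m G) = s by rewrite KG -scalemx1 mxrank_scale_nz ?mxrank1 // expf_neq0.
by move=> <-; apply: leq_trans (mxrankM_maxr _ _) (rank_leq_row _).
Qed.

Lemma mwDm (a b : multinom N) : mw (mnm_add a b) = mw a + mw b.
Proof. by rewrite -mwD; apply: eq_bigr => i _; rewrite mnmDE. Qed.

Lemma mw_single k m : mw (mnm_muln (mnm1 k) m) = bQ A (fcoord k) *+ m.
Proof.
rewrite /mw (bigD1 k) //= big1 ?addr0 => [|i ik].
  by rewrite mulmnE mnm1E eqxx mul1n scaler_nat.
by rewrite mulmnE mnm1E eq_sym (negPf ik) mul0n scale0r.
Qed.

(** If [aQ A i] were not in the lattice of [J], neither [z_i] nor [w_i] would be invariant, so
    [z_i w_i] would be indecomposable. With the least invariant power of each of the N coordinates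
    this makes N + 1 cotangent directions, against dimension at most N. *)
Lemma nonsingular_integral i : nonsingular (X R A theta) -> iw (aQ A i).
Proof.
move=> ns; apply: contrapT => niw.
have iJ : i \notin J by apply: contra_notN niw; exact: iw_aQ.
have mem_free k : idx k = i -> k \in free J by rewrite inE => ->.
pose k0 : 'I_N := enum_rank_in (mem_free _ (idx_l i)) (lshift n i).
pose k1 : 'I_N := enum_rank_in (mem_free _ (idx_l i)) (rshift n i).
have k0E : fcoord k0 = lshift n i by rewrite /fcoord enum_rankK_in // mem_free ?idx_l.
have k1E : fcoord k1 = rshift n i by rewrite /fcoord enum_rankK_in // mem_free ?idx_r.
have k01 : k0 != k1.
  by apply: contraTneq isT => /(congr1 (@fcoord n J)); rewrite k0E k1E -bar_l => /esym/eqP; rewrite (negPf (bar_neq _)).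
have [D D0 hD] := weight_denominator.
(* The order of the k-th weight modulo the lattice, finite because [D] clears all denominators. *)
have /choice[o oP] : forall k : 'I_N, exists o, [/\ (0 < o)%N, iw (bQ A (fcoord k) *+ o) &
    forall m, (0 < m)%N -> iw (bQ A (fcoord k) *+ m) -> (o <= m)%N].
  move=> k; have ex : exists m, (0 < m)%N && `[< iw (bQ A (fcoord k) *+ m) >].
    by exists D; rewrite D0; apply/asboolP; exact: hD.
  case: (ex_minnP ex) => m /andP[m0 /asboolP iwm] min; exists m; split=> // l l0 iwl.
  by apply: min; rewrite l0; apply/asboolP.
have n0 : ~ iw (bQ A (fcoord k0)) by rewrite k0E bQ_l.
have n1 : ~ iw (bQ A (fcoord k1)).
  by rewrite k1E bQ_r => h; apply: niw; rewrite -[aQ A i]opprK; exact: iwN.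
pose single k := mnm_muln (mnm1 k) (o k) : multinom N.
pose pair_ := mnm_add (mnm1 k0) (mnm1 k1) : multinom N.
(* The last index stands for [z_i w_i], the others for the least invariant powers. *)
pose e (a : 'I_N.+1) := if unlift ord_max a is Some k then single k else pair_.
have sE k l : single k l = if k == l then o k else 0%N.
  by rewrite mulmnE mnm1E; case: (k == l); rewrite ?mul1n.
have pE l : pair_ l = ((k0 == l) + (k1 == l))%N by rewrite mnmDE !mnm1E.
have single_neq k : single k <> pair_.
  move=> h; have := congr1 (fun m : multinom N => m k0) h; have := congr1 (fun m : multinom N => m k1) h.
  rewrite !sE !pE !eqxx [k1 == k0]eq_sym (negPf k01) addn0 add0n.
  by case: eqP => // -> _; case: eqP => // h'; move: k01; rewrite h' eqxx.
have e_inj : injective e.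
  move=> a a'; rewrite /e; case: unliftP => [k ->|->]; case: unliftP => [k' ->|->] //.
  - move=> h; congr (lift _ _); have [o0 _ _] := oP k.
    have := congr1 (fun m : multinom N => m k) h; rewrite !sE eqxx.
    by case: eqP => // _ h'; rewrite h' in o0.
  - by move/single_neq.
  - by move/esym/single_neq.
have iwe a : iw (mw (e a)).
  rewrite /e; case: unliftP => [k _|_]; first by rewrite mw_single; have [] := oP k.
  have -> : pair_ = mnm_add (mnm_muln (mnm1 k0) 1) (mnm_muln (mnm1 k1) 1).
    by apply/mnmP => l; rewrite [RHS]mnmDE !mulmnE !mnm1E !muln1 pE.
  rewrite mwDm !mw_single !mulr1n k0E k1E bQ_l bQ_r subrr; exact: iw0.
have e_ind a : indecomposable (e a).
  rewrite /e; case: unliftP => [k _|_]; split.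
  - apply/eqP => h; have := congr1 (fun m : multinom N => m k) h.
    by rewrite sE eqxx mnm0E => h'; have [] := oP k; rewrite h'.
  - move=> x y xy iwx iwy; have [o0 _ omin] := oP k.
    have xyl l : (x l + y l)%N = single k l by rewrite -xy mnmDE.
    have supp (z : multinom N) : (forall l, (z l <= single k l)%N) -> z = mnm_muln (mnm1 k) (z k).
      move=> hz; apply/mnmP => l; rewrite mulmnE mnm1E; have := hz l; rewrite sE.
      by case: eqP => [<-|_]; rewrite ?mul1n // leqn0 => /eqP.
    have xs : x = mnm_muln (mnm1 k) (x k) by apply: supp => l; rewrite -xyl leq_addr.
    have ys : y = mnm_muln (mnm1 k) (y k) by apply: supp => l; rewrite -xyl leq_addl.
    have [xk|xk] := posnP (x k); first by left; apply/mnmP => l; rewrite mnm0E xs mulmnE xk muln0.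
    right; have h : (o k <= x k)%N by apply: omin => //; rewrite -mw_single -xs.
    have := xyl k; rewrite sE eqxx => hk; have yk : y k = 0%N by lia.
    by apply/mnmP => l; rewrite mnm0E ys mulmnE yk muln0.
  - apply/eqP => h; have := congr1 (fun m : multinom N => m k0) h.
    by rewrite pE eqxx mnm0E.
  - move=> x y xy iwx iwy.
    have xyl l : (x l + y l)%N = ((k0 == l) + (k1 == l))%N by rewrite -pE -xy mnmDE.
    have out (z : multinom N) : (forall l, (z l <= (k0 == l) + (k1 == l))%N) ->
        z = mnm_add (mnm_muln (mnm1 k0) (z k0)) (mnm_muln (mnm1 k1) (z k1)).
      move=> hz; apply/mnmP => l; rewrite mnmDE !mulmnE !mnm1E; have := hz l.
      have [<-|n0l] := eqVneq k0 l; first by rewrite [k1 == _]eq_sym (negPf k01) mul1n mul0n addn0.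
      by have [<-|n1l] := eqVneq k1 l; rewrite ?mul1n ?mul0n ?leqn0 // => /eqP.
    have xs := out x (fun l => eq_leq_l (xyl l)).
    have ys := out y (fun l => eq_leq_r (xyl l)).
    have := xyl k0; have := xyl k1; rewrite !eqxx [k1 == k0]eq_sym (negPf k01) addn0 add0n => h1 h0.
    have wz (z : multinom N) : z = mnm_add (mnm_muln (mnm1 k0) (z k0)) (mnm_muln (mnm1 k1) (z k1)) ->
        mw z = bQ A (fcoord k0) *+ z k0 + bQ A (fcoord k1) *+ z k1.
      by move=> hz; rewrite {1}hz mwDm !mw_single.
    have z0 (z : multinom N) : z = mnm_add (mnm_muln (mnm1 k0) (z k0)) (mnm_muln (mnm1 k1) (z k1)) ->
        z k0 = 0%N -> z k1 = 0%N -> z = @mnm0 N.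
      by move=> hz z1 z2; apply/mnmP => l; rewrite mnm0E hz mnmDE !mulmnE z1 z2 !muln0.
    move: iwx (z0 x xs) (z0 y ys); rewrite (wz x xs).
    case: (x k0) h0 => [|[|//]]; case: (x k1) h1 => [|[|//]].
    + by move=> _ _ _ h _; left; apply: h.
    + by rewrite mulr0n mulr1n add0r => _ _ /n1.
    + by rewrite mulr0n mulr1n addr0 => _ _ /n0.
    + by rewrite !add1n => -[y1] [y0] _ _ h; right; apply: h.
have [d [W [t [[Z [chainZ Z0]] _ [oW Wo] tP gen_t]]]] := ns (cpt origin).
have dN : (d <= N)%N by apply: (dim_bound chainZ); exists (cpt origin); split=> //; exact: cpt_open.
have := cotangent_bound oW Wo tP gen_t e_inj iwe e_ind; lia.
Qed.



End Graded.

End SliceDimension.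

Lemma X_reg_intro (R : realType) (r n : nat) (A : 'M[int]_(r, n)) theta
    (W : set (X R A theta)) (f : X R A theta -> R[i]) :
  (forall x, W x -> exists j F G, [/\ (0 < j)%N, weight_part theta j F, weight_part theta j G,
     proj_basic (S := semi_invariants R A theta) j F x &
     forall v (vss : Vss theta v), W (qpt vss) -> F v != 0 -> f (qpt vss) = G v / F v]) ->
  reg W f.
Proof.
move=> h; change (@proj_reg _ _ (semi_invariants R A theta) W f) => x Wx.
have [j [F [G [j0 wF wG Fx fE]]]] := h x Wx; exists j, F, G; split=> // v.
have -> : v = SigSub (mem_set (set_valP v)) by exact: val_inj.
exact: (fE _ (set_valP v)).
Qed.

(** * The quotient as a variety *)

Section UnimodularChart.
Variables (R : realType) (r n : nat) (A : 'M[int]_(r, n)) (theta : 'rV[rat]_r) (J : {set 'I_n}).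
Hypothesis bJ : base A J.
Hypothesis s0 : forall j, j \in J -> sol A J theta 0 j != 0.
Hypothesis uJ : forall chi : 'rV[int]_r, iw A J (map_mx intr chi).
Local Notation C := R[i].
Local Notation V := (V R A).
Local Notation N := (sdim J).
Local Notation wpart := (@weight_part R r n A theta).
Local Notation basic j F := (proj_basic (S := semi_invariants R A theta) j F : set (X R A theta)).
Local Notation AN := (affine_space C N).
Local Notation U := (@slice_open R r n A theta J bJ s0).
Local Notation cpt := (@cpt R r n A theta J bJ s0).
Local Notation sj j := (sc A theta J j).

(** By unimodularity every character is an integral combination of the weights normalised on the
    slice, so points of the slice have trivial stabiliser. *)
Lemma chr_base (g : torus R r) : (forall j, j \in J -> chr (bvec A (sj j)) g = 1) ->
  forall chi, chr chi g = 1.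
Proof.
move=> h chi; have /choice[m mE] : forall j, exists m : int, sol A J (map_mx intr chi) 0 j = m%:~R.
  by move=> j; apply/intrP; exact: uJ.
have -> : chi = \sum_(j in J) (m j * (if 0 < sol A J theta 0 j then 1 else -1)) *: bvec A (sj j).
  apply: intr_mx_inj; rewrite (raddf_sum (map_mx intr)) [LHS](sol_sum _ bJ) (bigID (mem J)) /=.
  rewrite [X in _ + X]big1 ?addr0 => [|j nj]; last by rewrite sol_out // scale0r.
  apply: eq_bigr => j jJ; rewrite mE.
  have -> a k : map_mx intr (a *: bvec A k) = a%:~R *: bQ A k :> 'rV[rat]_r.
    by apply/rowP => l; rewrite !mxE intrM.
  rewrite bQ_sc scalerA; congr (_ *: _).
  by case: ifP => _; rewrite ?mulr1 // mulrN1 mulrN1 mulrNz opprK.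
rewrite chrE lmon_sum; last exact: torus_neq0.
by rewrite big1 // => j jJ; rewrite lmonZ -chrE h // exp1rz.
Qed.

Lemma cpt_inj : injective cpt.
Proof.
move=> y y' e; have [g gE] := qpt_interior (slice_interior bJ s0 (cv y)) e.
have g1 : forall chi, chr chi g = 1.
  apply: chr_base => j jJ; have := congr1 (fun v => co v (sj j)) gE.
  by rewrite co_act !slice_one // mulr1.
rewrite -(apt_val y) -(apt_val y'); congr apt; apply/rowP => i.
have := congr1 (fun v => co v (fcoord i)) gE.
by rewrite co_act g1 mul1r !slice_free => /esym.
Qed.

Lemma iw_mw (e : 'I_N -> nat) : iw A J (mw A e).
Proof.
rewrite /mw; elim/big_ind: _ => [|x y hx hy|i _]; first exact: iw0.
  exact: iwD.
by rewrite scaler_nat; apply: iwMn => //; exact: uJ.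
Qed.

(** All large multiples of [D] are allowed as degrees, so that the two summands of a sum can be
    lifted in a common degree. *)
Lemma poly_lift D E (p : mpoly N C) : map_mx intr (wt A E) = theta *+ D ->
  (forall k, (E k != 0%N) <-> exists2 j, j \in J & k = sj j) ->
  exists K0, forall K, (K0 <= K)%N -> exists2 F, wpart (K * D) F &
    forall y, F (slice theta bJ (cv y)) = ev p y.
Proof.
move=> wE zE; elim/mpoly_ind: p => [c|i|p q [K1 h1] [K2 h2]|p q [K1 h1] [K2 h2]].
- have [K0 h] := monomial_lift R bJ wE zE (iw_mw (fun=> 0%N)); exists K0 => K /h[F wF FE].
  exists (fun v => c * F v); first exact: wpartZ.
  by move=> y; rewrite FE evC big1 ?mulr1 // => i _; rewrite expr0.
- have [K0 h] := monomial_lift R bJ wE zE (iw_mw (fun l => (i == l) : nat)); exists K0 => K /h[F wF FE].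
  exists F => // y; rewrite FE /ev /mpeval mevalXU (bigD1 i) //= eqxx expr1 big1 ?mulr1 // => l.
  by rewrite eq_sym => /negPf->; rewrite expr0.
- exists (maxn K1 K2) => K; rewrite geq_max => /andP[/h1[F wF FE] /h2[G wG GE]].
  exists (fun v => F v + G v); first exact: wpartD.
  by move=> y; rewrite evD FE GE.
exists (K1 + K2)%N => K le; have [F wF FE] := h1 K1 (leqnn _).
have [|G wG GE] := h2 (K - K1)%N; first by rewrite leq_subRL ?(leq_trans (leq_addr _ _) le).
exists (fun v => F v * G v); last by move=> y; rewrite evM FE GE.
have := wpartM wF wG; rewrite -mulnDl subnKC //; exact: leq_trans (leq_addr _ _) le.
Qed.

Lemma cpt_continuous W : open W -> open (cpt @^-1` W).
Proof.
move=> oW; change (@aff_open C N (zeros set0) (cpt @^-1` W)) => y Wy.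
have [j [F [j0 wF Fy FW]]] := X_openP oW Wy; have [p pE] := wpart_poly bJ wF.
exists p; split; first by move/(basic_qpt _ wF): Fy; rewrite pE.
by move=> y' py; apply: FW; apply/(basic_qpt _ wF); rewrite pE.
Qed.

Lemma chart_iso : iso_on cpt setT U.
Proof.
have [D D0 [E [wE zE]]] := pivot_monomial bJ s0.
have wM : wpart D (mon E) by apply: weight_part_mon.
have mE1 c : mon E (slice theta bJ c) = 1.
  rewrite /mon big1 // => k _; have [->|/zE[j jJ ->]] := eqVneq (E k) 0%N; first by rewrite expr0.
  by rewrite slice_one // expr1n.
have UM v (vss : Vss theta v) : mon E v != 0 -> U (qpt vss).
  by move=> h; apply/slice_openE => j jJ; apply: (mon_neq0_inv h); apply/zE; exists j.
split.
- exact: openT.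
- exact: @slice_open_open R r n A theta J bJ s0.
- split=> [y _|y y' _ _|x /slice_openP[y ->]]; [exact: cpt_open|exact: cpt_inj|by exists y].
- move=> O _; split=> oO; last first.
    rewrite (_ : O = cpt @^-1` (cpt @` O)); first exact: cpt_continuous.
    by apply/seteqP; split=> [y Oy|y [y' Oy' /cpt_inj <-]]; [exists y|].
  change (@Defs.proj_open _ _ (semi_invariants R A theta) (cpt @` O)) => _ [y Oy <-].
  have [p py pO] := affine_openP oO Oy.
  have [K h] := poly_lift p wE zE; have [F wF FE] := h K (leqnn K).
  have wFM := wpartM wF wM.
  exists (K * D + D)%N, (fun v => F v * mon E v); split=> //.
  + by rewrite addn_gt0 D0 orbT.
  + by apply/(basic_qpt _ wFM); rewrite mE1 mulr1 FE.
  move=> x; have [v [vss ->]] := qpt_surj x => Fx.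
  have /slice_openP[y' e] : U (qpt vss).
    by apply: UM; move/(basic_qpt vss wFM): Fx; rewrite mulf_eq0 negb_or => /andP[].
  rewrite e in Fx *; exists y' => //; apply: pO.
  by move/(basic_qpt _ wFM): Fx; rewrite mE1 mulr1 FE.
move=> O psi OU oO; split=> [rpsi|rpsi].
  apply: fraction_reg => y [_ Oy].
  have [j [F [G [j0 wF wG [Fy FO] fE]]]] := X_regP oO rpsi Oy.
  have [q qE] := wpart_poly bJ wF; have [p pE] := wpart_poly bJ wG.
  exists p, q; split; first by rewrite /nonzero /= -qE; move/(basic_qpt _ wF): Fy.
  move=> y' _ qy; have Fy' : F (slice theta bJ (cv y')) != 0 by rewrite qE.
  by rewrite fE // pE qE divfK.
apply: X_reg_intro => x Ox.
have [y xy] := slice_openP (OU _ Ox).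
have opre : open (setT `&` cpt @^-1` O) by rewrite setTI; exact: cpt_continuous.
have [|p [q [qy qO pqE]]] := reg_fraction opre rpsi (x := y); first by split=> //; rewrite /preimage /= -xy.
have [K1 h1] := poly_lift p wE zE; have [K2 h2] := poly_lift q wE zE.
have [G wG GE] := h1 _ (leq_maxl K1 K2); have [F wF FE] := h2 _ (leq_maxr K1 K2).
have wGM := wpartM wG wM; have wFM := wpartM wF wM.
exists (maxn K1 K2 * D + D)%N, (fun v => F v * mon E v), (fun v => G v * mon E v); split=> //.
- by rewrite addn_gt0 D0 orbT.
- by rewrite xy; apply/(basic_qpt _ wFM); rewrite mE1 mulr1 FE.
move=> v vss Ov nz; move: (nz); rewrite mulf_eq0 negb_or => /andP[Fv Mv].
have /slice_openP[y' e] := UM _ vss Mv.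
have si := (qpt_eq vss (slice_Vss bJ s0 (cv y'))).1 e.
have Fy' : F (slice theta bJ (cv y')) != 0.
  by apply: contra Fv => /eqP h; apply/eqP; apply/(si _ _ wF).
rewrite -mulf_div divff // mulr1 e.
have qy' : nonzero q y' by rewrite /nonzero /= -FE.
have -> : G v / F v = ev p y' / ev q y'.
  apply/eqP; rewrite eqr_div -?FE // -GE.
  by rewrite (same_ideal_ratio si wG wF) mulrC.
by rewrite -(pqE _ qy') mulfK // -FE.
Qed.


End UnimodularChart.

Lemma inverse_fractions (K : fieldType) (a b : K) : a != 0 -> b != 0 -> b / a * (a / b) = 1.
Proof. by move=> a0 b0; rewrite mulrA divfK // divff. Qed.

Section Variety.
Variables (R : realType) (r n : nat) (A : 'M[int]_(r, n)) (theta : 'rV[rat]_r).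
Hypothesis sT : spanning A [set: 'I_n]%SET.
Hypothesis nc : nocoloop A.
Hypothesis uni : forall J, base A J -> forall chi : 'rV[int]_r, iw A J (map_mx intr chi).
Hypothesis gt : gen A theta.
Local Notation C := R[i].
Local Notation V := (V R A).
Local Notation X := (X R A theta).

Definition gU J (bJ : base A J) : set X := slice_open bJ (gt bJ).
Definition gcpt J (bJ : base A J) : affine_space C (sdim J) -> X := cpt bJ (gt bJ).

Lemma g_iso J (bJ : base A J) : iso_on (gcpt bJ) setT (gU bJ).
Proof. exact: chart_iso (uni bJ). Qed.

Lemma gU_open J (bJ : base A J) : open (gU bJ).
Proof. exact: @slice_open_open R r n A theta J bJ (gt bJ). Qed.

Lemma g_cover x : exists J, exists bJ : base A J, gU bJ x.
Proof.
have [v [vss ->]] := qpt_surj x; have [J bJ h] := gen_cover sT gt vss.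
by exists J, bJ; apply/slice_openE.
Qed.

(** All [z_i] equal to 1 and [w] a relation between the columns without zero entry solve the moment
    equation. Such a point lies in every chart, which makes the charts meet. *)
Lemma full_point : exists v : V, forall k, co v k != 0.
Proof.
have [x xA x0] := nocoloop_kernel nc.
pose f (k : 'I_(n + n)) : C := match fintype.split k with inl _ => 1 | inr i => ratr (x 0 i) end.
have fm : moment A (\row_k f k) = 0.
  apply/moment_coord => k; transitivity (ratr ((x *m At A) 0 k) : C); last by rewrite xA mxE rmorph0.
    rewrite [in RHS]mxE (raddf_sum (@ratr C)); apply: eq_bigr => i _ /=.
    by rewrite !mxE /f (unsplitK (inl i)) (unsplitK (inr i)) mul1r rmorphM /= ratr_int.
exists (mkV fm) => k; rewrite co_mkV /f; case: fintype.split => i; first exact: oner_neq0.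
by rewrite fmorph_eq0.
Qed.

Lemma full_Vss (v : V) : (forall k, co v k != 0) -> Vss theta v.
Proof.
move=> h; have [x _ ex] := sT theta; apply/Vss_adm; exists x => // i; split=> _; exact: h.
Qed.

Lemma gU_full J (bJ : base A J) v (vss : Vss theta v) : (forall k, co v k != 0) -> gU bJ (qpt vss).
Proof. by move=> h; apply/slice_openE => j _; exact: h. Qed.

Lemma X_irreducible : irreducible_set [set: X].
Proof.
have [v0 v00] := full_point; have x0 := full_Vss v00.
have irrU J (bJ : base A J) : irreducible_set (gU bJ).
  have -> : gU bJ = gcpt bJ @` setT.
    apply/seteqP; split=> x; first by move=> /slice_openP[y ->]; exists y.
    by move=> [y _ <-]; exact: cpt_open.
  apply: irreducible_image; last exact: affine_irreducible.
  by move=> O oO; apply: cpt_continuous.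
apply: irreducibleP; first by exists (qpt x0).
move=> O1 O2 o1 o2 [x1 [_ Ox1]] [x2 [_ Ox2]]; rewrite setTI.
have [J1 [b1 U1]] := g_cover x1; have [J2 [b2 U2]] := g_cover x2.
have [||y [U1y [O1y U2y]]] := irreducible_open (irrU _ b1) o1 (@gU_open J2 b2).
- by exists x1.
- by exists (qpt x0); split; exact: gU_full.
have [||z [_ ?]] := irreducible_open (irrU _ b2) o1 o2.
- by exists y.
- by exists x2.
by exists z.
Qed.

(** A semi-invariant vanishing at exactly one of the two points provides functions [a] and [b] that
    are inverse to each other on the overlap although [a x * b y] is zero. *)
Lemma X_separation (x y : X) : x <> y -> exists (Ox Oy : set X) (a b : X -> C),
  [/\ open Ox /\ open Oy, Ox x /\ Oy y, reg Ox a /\ reg Oy b, a x * b y = 0 &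
   forall w, Ox w -> Oy w -> a w * b w = 1].
Proof.
have half u v (uss : Vss theta u) (vss : Vss theta v) j F : weight_part theta j F ->
    F u = 0 -> F v != 0 -> exists (Ox Oy : set X) (a b : X -> C),
  [/\ open Ox /\ open Oy, Ox (qpt uss) /\ Oy (qpt vss), reg Ox a /\ reg Oy b,
     a (qpt uss) = 0 & forall w, Ox w -> Oy w -> a w * b w = 1].
  move=> wF Fu Fv; have [i [H [i0 wH Hu]]] := uss; have [k [G [k0 wG Gv]]] := vss.
  have w1 := wpartM wF wG; have d1 : (0 < j + k)%N by rewrite addn_gt0 k0 orbT.
  have wP := wpart_pow i0 w1; have wQ := wpart_pow d1 wH; rewrite mulnC in wQ.
  have d2 : (0 < i * (j + k))%N by rewrite muln_gt0 i0.
  have [a [ra aE]] := X_frac d2 wQ wP; have [b [rb bE]] := X_frac d2 wP wQ.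
  have Qu : H u ^+ (j + k) != 0 by exact: expf_neq0.
  have Pv : (F v * G v) ^+ i != 0 by rewrite expf_neq0 // mulf_neq0.
  exists (proj_basic (S := semi_invariants R A theta) (i * (j + k)) (fun v => H v ^+ (j + k))),
    (proj_basic (S := semi_invariants R A theta) (i * (j + k)) (fun v => (F v * G v) ^+ i)), a, b.
  split; [exact (conj (basic_open d2 wQ) (basic_open d2 wP))
    |exact (conj ((basic_qpt uss wQ).2 Qu) ((basic_qpt vss wP).2 Pv))|exact (conj ra rb)| |].
    by rewrite (aE u uss Qu) Fu mul0r expr0n gtn_eqF // mul0r.
  move=> w; have [v' [v'ss ->]] := qpt_surj w => /(basic_qpt _ wQ) q0 /(basic_qpt _ wP) p0.
  rewrite (aE v' v'ss q0) (bE v' v'ss p0).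
  exact: inverse_fractions q0 p0.
have [u [uss ->]] := qpt_surj x; have [v [vss ->]] := qpt_surj y => ne.
have : ~ same_ideal theta u v by move=> h; apply: ne; apply/qpt_eq.
move=> /existsNP[j /existsNP[F /not_implyP[wF nF]]].
have [Fu|Fu] := eqVneq (F u) 0; have [Fv|Fv] := eqVneq (F v) 0.
- by case: nF.
- have [Ox [Oy [a [b [h1 h2 h3 a0 h4]]]]] := half u v uss vss j F wF Fu Fv.
  by exists Ox, Oy, a, b; rewrite a0 mul0r.
- have [Oy [Ox [b [a [[h1 h1'] [h2 h2'] [h3 h3'] b0 h4]]]]] := half v u vss uss j F wF Fv Fu.
  exists Ox, Oy, a, b; split; [exact (conj h1' h1)|exact (conj h2' h2)|exact (conj h3' h3)|by rewrite b0 mulr0|].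
  by move=> w ox oy; rewrite mulrC; exact: h4.
- by case: nF; split=> h; [rewrite h eqxx in Fu|rewrite h eqxx in Fv].
Qed.

(** Near a point where [f] and [g] differ, [a (f z) * b (g z) - 1] is regular, equals -1 at the
    point, and would vanish wherever [f z = g z]. *)
Lemma X_separated N (S : set (mpoly N C)) (f g : morphism (aff (zeros S)) X) :
  closed [set z | f z = g z].
Proof.
rewrite -openC; change (@aff_open C N (zeros S) (~` [set z | f z = g z])) => z nfg.
have [Ox [Oy [a [b [[oX oY] [fz gz] [ra rb] ab0 ab1]]]]] := X_separation nfg.
pose W : set (aff (zeros S)) := f @^-1` Ox `&` g @^-1` Oy.
have oW : open W.
  by apply: openI; [have /continuousP := @mfun_continuous _ _ _ f|have /continuousP := @mfun_continuous _ _ _ g]; apply.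
have rW : reg W (fun z => a (f z) * b (g z) - 1).
  apply: reg_sub; last exact: reg_cst.
  by apply: reg_mul; [apply: reg_res (mfun_reg f oX ra)|apply: reg_res (mfun_reg g oY rb)] => y [].
have [|p [pz pO]] := (reg_open oW rW : aff_open _) z.
  by split=> //=; rewrite ab0 sub0r oppr_eq0 oner_neq0.
exists p; split=> // y /pO[[fy gy] /= /negP h1] /= fg; apply: h1.
by rewrite fg ab1 ?subrr // -fg.
Qed.

Lemma X_variety : variety X.
Proof.
split; [exact: X_irreducible| |exact: X_separated].
have [v0 v00] := full_point; have [J0 [b0 _]] := g_cover (qpt (full_Vss v00)).
(* The finite cover is indexed by all subsets; those that are not bases repeat the chart of [J0]. *)
pose T := {set 'I_n}; pose pick (J : T) : {J | base A J} :=
  if pselect (base A J) is left h then exist _ J h else exist _ J0 b0.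
exists #|T|, (fun i => gU (proj2_sig (pick (enum_val i)))); split.
  move=> i; exists (sdim (proj1_sig (pick (enum_val i)))), set0, (gcpt (proj2_sig (pick (enum_val i)))).
  exact (g_iso (proj2_sig (pick (enum_val i)))).
move=> x; have [J [bJ Ux]] := g_cover x; exists (enum_rank J).
rewrite enum_rankK /pick; case: pselect => [h|//]; rewrite /=.
by move: Ux; rewrite (Prop_irrelevance bJ h).
Qed.

Lemma X_normal : normal X.
Proof.
split=> [|x U f oU U0 rf h]; first exact: X_irreducible.
have [J [bJ Ux]] := g_cover x.
exact: (chart_normal (g_iso bJ) X_irreducible Ux oU U0 rf h).
Qed.

Lemma X_Qfactorial : Qfactorial X.
Proof.
move=> D wD; exists 1%N => // x; have [J [bJ Ux]] := g_cover x.
have [W [a [b [oW Wx ra rb h]]]] := chart_cartier (g_iso bJ) X_irreducible Ux wD.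
exists W, a, b; split=> // E pE mE; have [k [l [? ? e]]] := h E pE mE.
by exists k, l; rewrite mul1r.
Qed.

End Variety.

Lemma ratio_transition (K : fieldType) (s t l m : K) : t != 0 -> m != 0 ->
  s / t * l = m * (l * s / (m * t)).
Proof. by move=> t0 m0; field; rewrite t0. Qed.

Lemma ratio_cocycle (K : fieldType) (a b c : K) : b != 0 -> b / a * (c / b) = c / a.
Proof. by move=> b0; rewrite mulrC mulrA divfK. Qed.

(** * Line bundles *)

Section Descent.
Variables (R : realType) (r n : nat) (A : 'M[int]_(r, n)) (theta : 'rV[rat]_r).
Hypothesis sT : spanning A [set: 'I_n]%SET.
Hypothesis uni : forall J, base A J -> forall chi : 'rV[int]_r, iw A J (map_mx intr chi).
Hypothesis gt : gen A theta.
Local Notation C := R[i].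
Local Notation V := (V R A).
Local Notation X := (X R A theta).
Implicit Types (W : set X) (F : V -> C) (psi : 'rV[int]_r) (L : line_bundle X).

Definition over W : set V := [set u | exists uss : Vss theta u, W (qpt uss)].

Lemma overE W : [set u : V | exists2 v : set_type (Vss theta), u = \val v & W (quot_map v)] = over W.
Proof.
apply/seteqP; split=> u; first by move=> [v -> Wv]; exists (set_valP v); rewrite -quot_qpt.
by move=> [uss Wu]; exists (SigSub (mem_set uss)).
Qed.

Definition desc F (x : X) : C := F (projT1 (cid (qpt_surj x))).

Lemma desc_qpt W F u (uss : Vss theta u) : (forall g v, over W v -> F (act g v) = F v) ->
  W (qpt uss) -> desc F (qpt uss) = F u.
Proof.
move=> inv Wu; rewrite /desc; case: cid => v [vss e] /=.
have [g ->] := qpt_interior (gen_interior sT gt uss) e.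
by rewrite inv //; exists uss.
Qed.

Lemma slice_reg J (bJ : base A J) O F : reg O F ->
  reg ((fun y : affine_space C (sdim J) => slice theta bJ (cv y)) @^-1` O)
      (fun y => F (slice theta bJ (cv y))).
Proof.
move=> rF; apply: fraction_reg => y Oy; have [p [q [qy fE]]] := rF _ Oy.
have E s (y' : affine_space C (sdim J)) : ev (rest A theta J s) y' = pv s (slice theta bJ (cv y')) := ev_rest theta bJ s y'.
exists (rest A theta J p), (rest A theta J q); split; first by rewrite /nonzero /= E.
move=> y' Oy' qy'; have qy2 : pv q (slice theta bJ (cv y')) != 0 by rewrite -(E q y'); exact: qy'.
have e := fE _ Oy' qy2.
refine (etrans (congr2 *%R e (E q y')) (etrans _ (esym (E p y')))).
exact: divfK qy2 _.
Qed.

Lemma desc_reg W F : open W -> (forall g v, over W v -> F (act g v) = F v) ->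
  reg (over W) F -> reg W (desc F).
Proof.
move=> oW inv rF; apply: reg_glue => x Wx; have [J [bJ Ux]] := g_cover sT gt x.
exists (gU gt bJ); split=> //; first exact: (@gU_open R r n A theta gt J bJ).
have oO : open (W `&` gU gt bJ) by apply: openI => //; exact: (@gU_open R r n A theta gt J bJ).
apply/(chart_reg (g_iso R uni gt bJ) _ oO); first by move=> ? [].
apply: (@reg_ext _ _ _ (fun y => F (slice theta bJ (cv y)))) => [y [Wy _]|].
  by rewrite (@desc_qpt W).
refine (@reg_res _ (affine_space C (sdim J)) _ _ _ _ (@slice_reg J bJ (over W) F rF)) => y [Wy _].
by exists (slice_Vss bJ (gt bJ) (cv y)).
Qed.

Lemma reg_exprz (Z : fspace C) (O : set Z) (f : Z -> C) (m : int) : reg O f ->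
  (forall z, O z -> f z != 0) -> reg O (fun z => f z ^ m).
Proof.
move=> rf f0; case: m => m; first exact: (reg_exp m rf).
apply: (@reg_ext _ _ _ (fun z => (f z ^+ m.+1)^-1)) => // .
by apply: reg_inv => [z Oz|]; [rewrite expf_neq0 ?f0|exact: reg_exp].
Qed.

Lemma reg_prod (Z : fspace C) (O : set Z) (I : Type) (s : seq I) (P : pred I) (f : I -> Z -> C) :
  (forall i, P i -> reg O (f i)) -> reg O (fun z => \prod_(i <- s | P i) f i z).
Proof.
move=> rf; elim: s => [|i s IHs].
  by apply: reg_ext (reg_cst O 1) => z _; rewrite big_nil.
have [Pi|nPi] := boolP (P i).
  by apply: reg_ext (reg_mul (rf i Pi) IHs) => z _; rewrite big_cons Pi.
by apply: reg_ext IHs => z _; rewrite big_cons (negPf nPi).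
Qed.

Lemma reg_co O k : reg O (fun v : V => co v k).
Proof.
move=> v Ov; exists (mpolyX C (mnm1 k)), 1; rewrite {1}/mpeval meval1 oner_neq0; split=> // u _ _.
by rewrite /mpeval meval1 divr1 mevalXU.
Qed.

(** The floor only changes the type, the coordinates being integers by unimodularity; the sign turns
    the coefficient of column [j] into that of the weight of its selected coordinate. *)
Definition expo J psi j : int :=
  Num.floor (sol A J (map_mx intr psi) 0 j) * (if 0 < sol A J theta 0 j then 1 else -1).

Lemma expoE J psi j : base A J -> (expo J psi j)%:~R =
  sol A J (map_mx intr psi) 0 j * (if 0 < sol A J theta 0 j then 1 else -1).
Proof.
move=> bJ; rewrite /expo rmorphM /= floorK ?uni //.
by case: ifP.
Qed.

Lemma expo_sum J psi : base A J -> psi = \sum_(j in J) expo J psi j *: bvec A (sc A theta J j).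
Proof.
move=> bJ; apply: intr_mx_inj; rewrite (raddf_sum (map_mx intr)) [LHS](sol_sum _ bJ) (bigID (mem J)) /=.
rewrite [X in _ + X]big1 ?addr0 => [|j nj]; last by rewrite sol_out // scale0r.
apply: eq_bigr => j jJ.
have -> a k : map_mx intr (a *: bvec A k) = a%:~R *: bQ A k :> 'rV[rat]_r.
  by apply/rowP => l; rewrite !mxE intrM.
rewrite bQ_sc expoE // scalerA; congr (_ *: _).
by case: ifP => _; rewrite ?mulr1 // mulrN1 mulrN1 opprK.
Qed.

(** The Laurent monomial of weight [psi] in the coordinates normalised by [J]: the frame of the
    linearised trivial bundle over the chart of [J]. *)
Definition fr (J : {set 'I_n}) psi (v : V) : C := \prod_(j in J) co v (sc A theta J j) ^ expo J psi j.

Lemma fr_act (J : {set 'I_n}) psi g v : base A J -> fr J psi (act g v) = chr psi g * fr J psi v.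
Proof.
move=> bJ; rewrite {2}[psi](expo_sum psi bJ) chrE lmon_sum; last exact: torus_neq0.
rewrite -big_split /=; apply: eq_bigr => j jJ.
by rewrite co_act expfzMl lmonZ.
Qed.

Lemma fr_neq0 (J : {set 'I_n}) psi v : (forall j, j \in J -> co v (sc A theta J j) != 0) -> fr J psi v != 0.
Proof. by move=> h; apply/prodf_neq0 => j jJ; apply: expfz_neq0; exact: h. Qed.

Lemma reg_fr O (J : {set 'I_n}) psi : (forall v, O v -> forall j, j \in J -> co v (sc A theta J j) != 0) ->
  reg O (fr J psi).
Proof.
move=> h; apply: reg_prod => j jJ; apply: reg_exprz; first exact: reg_co.
by move=> v Ov; exact: h.
Qed.

Definition charted (x : X) : {J | base A J} :=
  let: exist J h := cid (g_cover sT gt x) in exist _ J (projT1 (cid h)).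

Definition cJ x := proj1_sig (charted x).
Definition cb x : base A (cJ x) := proj2_sig (charted x).
Definition cU x : set X := gU gt (cb x).

Lemma cU_self x : cU x x.
Proof. by rewrite /cU /cb /cJ /charted; case: cid => J h; case: cid => bJ. Qed.

Lemma cU_open x : open (cU x).
Proof. exact: (@gU_open R r n A theta gt (cJ x) (cb x)). Qed.

Lemma over_gU J (bJ : base A J) v : over (gU gt bJ) v ->
  forall j, j \in J -> co v (sc A theta J j) != 0.
Proof. by move=> [vss /slice_openE]. Qed.

Lemma over_cU x v : over (cU x) v -> forall j, j \in cJ x -> co v (sc A theta (cJ x) j) != 0.
Proof. exact: over_gU. Qed.

Lemma fr_over x psi v : over (cU x) v -> fr (cJ x) psi v != 0.
Proof. by move=> h; apply: fr_neq0; exact: over_cU. Qed.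

Lemma overI W W' v : over (W `&` W') v -> over W v /\ over W' v.
Proof. by move=> [vss [h h']]; split; exists vss. Qed.

Lemma fr_ratio_inv J J' psi g v : base A J -> base A J' ->
  fr J' psi (act g v) / fr J psi (act g v) = fr J' psi v / fr J psi v.
Proof.
by move=> bJ bJ'; rewrite !fr_act // -mulf_div divff ?mul1r // chr_neq0.
Qed.

Lemma ratio_desc x y psi v (vss : Vss theta v) :
  desc (fun v => fr (cJ y) psi v / fr (cJ x) psi v) (qpt vss) = fr (cJ y) psi v / fr (cJ x) psi v.
Proof.
apply: (@desc_qpt setT); last by [].
by move=> g u _; exact: fr_ratio_inv (cb x) (cb y).
Qed.

Definition lbof psi : line_bundle X.
Proof.
refine (@LineBundle _ X cU (fun x y => desc (fun v => fr (cJ y) psi v / fr (cJ x) psi v)) _ _ _ _ _).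
- exact: cU_open.
- exact: cU_self.
- move=> x y; apply: desc_reg; first by apply: openI; exact: cU_open.
    by move=> g v _; exact: fr_ratio_inv (cb x) (cb y).
  apply: reg_mul; first by apply: reg_fr => v /overI[_]; exact: over_cU.
  apply: reg_inv; first by move=> v /overI[h _]; exact: fr_over.
  by apply: reg_fr => v /overI[h _]; exact: over_cU h.
- move=> x p; have [v [vss ->]] := qpt_surj p => Ux.
  by rewrite ratio_desc divff // fr_over //; exists vss.
- move=> x y z p; have [v [vss ->]] := qpt_surj p => Ux Uy Uz.
  rewrite (ratio_desc x y psi vss) (ratio_desc y z psi vss) (ratio_desc x z psi vss).
  by apply: ratio_cocycle; apply: (@fr_over y); exists vss.
Defined.

Lemma lbof_descends psi : descends_to psi (lbof psi).
Proof.
exists (fun x => fr (cJ x) psi); split=> [x|x y v].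
  rewrite overE; split.
  - by apply: reg_fr => v; exact: (@over_cU x).
  - by move=> v h; exact: (@fr_over x).
  - by move=> g v _; exact: fr_act (cb x).
rewrite quot_qpt => Ux Uy; rewrite [ltr _ _ _ _]ratio_desc divfK //.
by apply: (@fr_over x); exists (set_valP v).
Qed.

(** The quotient of the two systems of frames is invariant under the torus, so it descends to [X]
    and gives the isomorphism. *)
Lemma descends_iso psi L M : descends_to psi L -> descends_to psi M -> lb_iso L M.
Proof.
move=> [s [sP sE]] [t [tP tE]].
have oW x : open (ldom L x `&` ldom M x) by apply: openI; exact: ldom_open.
have {}sP x : [/\ reg (over (ldom L x)) (s x), forall v, over (ldom L x) v -> s x v != 0 &
           forall g v, over (ldom L x) v -> s x (act g v) = chr psi g * s x v].
  by rewrite -overE; exact: sP.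
have {}tP x : [/\ reg (over (ldom M x)) (t x), forall v, over (ldom M x) v -> t x v != 0 &
           forall g v, over (ldom M x) v -> t x (act g v) = chr psi g * t x v].
  by rewrite -overE; exact: tP.
have inv x g v : over (ldom L x `&` ldom M x) v -> s x (act g v) / t x (act g v) = s x v / t x v.
  move=> /overI[Lv Mv]; have [_ _ ->//] := sP x; have [_ _ ->//] := tP x.
  by rewrite -mulf_div divff ?mul1r // chr_neq0.
have dE x v (vss : Vss theta v) : (ldom L x `&` ldom M x) (qpt vss) ->
    desc (fun v => s x v / t x v) (qpt vss) = s x v / t x v.
  by move=> h; apply: (desc_qpt _ h); exact: inv.
exists (fun x => ldom L x `&` ldom M x), (fun x => desc (fun v => s x v / t x v)).
split=> [x|x y p].
  split=> //; first by split; exact: ldom_self.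
    apply: desc_reg => //; first exact: inv.
    apply: reg_mul; first by have [h _ _] := sP x; apply: reg_res h => v /overI[].
    apply: reg_inv; first by have [_ h _] := tP x; move=> v /overI[_]; exact: h.
    by have [h _ _] := tP x; apply: reg_res h => v /overI[].
  move=> p; have [v [vss ->]] := qpt_surj p => Wp; rewrite dE //.
  have [_ h _] := sP x; have [_ h' _] := tP x; have [Lp Mp] := Wp.
  by rewrite mulf_neq0 ?invr_neq0 //; [apply: h|apply: h']; exists vss.
have [v [vss ->]] := qpt_surj p => Wx Wy; rewrite !dE //.
have [Lx Mx] := Wx; have [Ly My] := Wy.
have := sE x y (SigSub (mem_set vss)) Lx Ly; have := tE x y (SigSub (mem_set vss)) Mx My.
rewrite /= -[quot_map _]/(qpt vss) => e1 e2.
have [_ s_neq _] := sP x; have [_ s_neq' _] := sP y; have [_ t_neq _] := tP x; have [_ t_neq' _] := tP y.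
have sx : s x v != 0 by apply: s_neq; exists vss.
have tx : t x v != 0 by apply: t_neq; exists vss.
have ty : t y v != 0 by apply: t_neq'; exists vss.
rewrite -e1 -e2; apply: ratio_transition => //.
by apply: contraNneq ty => m0; rewrite -e1 m0 mul0r.
Qed.

Lemma descends_tensor psi psi' L M : descends_to psi L -> descends_to psi' M ->
  descends_to (psi + psi') (lb_tensor L M).
Proof.
move=> [s [sP sE]] [t [tP tE]]; exists (fun x v => s x v * t x v); split=> [x|x y v [? ?] [? ?]]; last first.
  by rewrite /= mulrACA sE // tE.
have := sP x; have := tP x; rewrite !overE => -[rt nt at_] [rs ns as_]; split.
- by apply: reg_mul; [apply: reg_res rs => v /overI[]|apply: reg_res rt => v /overI[]].
- by move=> v /overI[h h']; rewrite mulf_neq0 ?ns ?nt.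
- by move=> g v /overI[h h']; rewrite as_ // at_ // chrD mulrACA.
Qed.

End Descent.

(** * Units on affine space and off a coordinate hyperplane *)

Section UnitsOfAffineSpace.
Variables (K : closedFieldType) (N : nat).
Local Notation MP := (mpoly N K).
Local Notation AN := (affine_space K N).

Definition kill (i : 'I_N) (p : MP) : MP :=
  mmap (@mpolyC N K) (fun k => if k == i then 0 else mpolyX K (mnm1 k)) p.

Lemma killM i p q : kill i (p * q) = kill i p * kill i q.
Proof. exact: rmorphM. Qed.

Lemma kill_divides i p : divides (mpolyX K (mnm1 i)) (p - kill i p).
Proof.
elim/mpoly_ind: p => [c|k|p q hp hq|p q hp hq].
- by rewrite /kill mmapC subrr; exact: divides0.
- rewrite /kill mmapX mmap1U; have [->|_] := eqVneq k i; last by rewrite subrr; exact: divides0.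
  by rewrite subr0; exact: divides_refl.
- have -> : p + q - kill i (p + q) = (p - kill i p) + (q - kill i q).
    by rewrite /kill mmapD; ring.
  exact: divides_add.
have -> : p * q - kill i (p * q) = p * (q - kill i q) + kill i q * (p - kill i p).
  by rewrite killM; ring.
by apply: divides_add; exact: divides_mull.
Qed.

Lemma killX i : kill i (mpolyX K (mnm1 i)) = 0.
Proof. by rewrite /kill mmapX mmap1U eqxx. Qed.

Lemma evX_coord i (x : AN) : ev (mpolyX K (mnm1 i)) x = aff_val x 0 i.
Proof. exact: mevalXU. Qed.

Lemma mpolyX_neq0 i : mpolyX K (mnm1 i) != 0 :> MP.
Proof.
apply/eqP => e; have := evX_coord i (apt (const_mx 1)); rewrite e ev0 /aff_val /= mxE => /esym/eqP.
by rewrite oner_eq0.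
Qed.

Lemma divides_kill i p : divides (mpolyX K (mnm1 i)) p -> kill i p = 0.
Proof. by move=> [q ->]; rewrite killM killX mulr0. Qed.

Lemma prime_mpolyX i : prime_elt (mpolyX K (mnm1 i) : MP).
Proof.
split; first exact: mpolyX_neq0.
  apply/negP => /unitrP[q [qX _]]; have := congr1 (fun s => ev s (apt 0)) qX.
  by rewrite evM evX_coord ev1 /aff_val /= mxE mulr0 => /esym/eqP; rewrite oner_eq0.
have zero_div q : kill i q = 0 -> divides (mpolyX K (mnm1 i)) q.
  by move=> q0; have := kill_divides i q; rewrite q0 subr0.
move=> b c /divides_kill; rewrite killM => /eqP; rewrite mulf_eq0 => /orP[]/eqP/zero_div; auto.
Qed.

Lemma unit_mpoly (p : MP) : p \is a GRing.unit -> exists2 c, c != 0 & p = mpolyC N c.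
Proof.
move=> /andP[/eqP pE u]; exists (mcoeff (@mnm0 N) p) => //.
by apply: contraTneq u => ->; rewrite unitr0.
Qed.

Lemma no_prime_const (p : MP) : p != 0 -> (forall g, prime_elt g -> ~ divides g p) ->
  exists2 c, c != 0 & p = mpolyC N c.
Proof.
move=> p0 h; apply: unit_mpoly; apply: contraT => nu.
by have [g pg gp] := ufd_prime_divisor (@ufd_mpoly K N) p0 nu; case: (h g).
Qed.

Lemma msize_cofactor (p g : MP) : p * g != 0 -> prime_elt g -> (msize p < msize (p * g))%N.
Proof.
move=> pg0 pg; have p0 : p != 0 by apply: contraNneq pg0 => ->; rewrite mul0r.
have g0 := prime_neq0 pg; rewrite msizeM //.
have : (1 < msize g)%N.
  rewrite ltnNge; apply/negP => /msize1_polyC gE; have [_ nu _] := pg.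
  move: g0 nu; rewrite gE mpolyC_eq0 => c0; rewrite /= => /negP; apply.
  apply/unitrP; exists (mpolyC N (mcoeff (@mnm0 N) g)^-1).
  by rewrite -!mpolyCM mulVf // divff // mpolyC1.
have : (0 < msize p)%N by rewrite lt0n msize_poly_eq0.
by move: (msize p) (msize g) => a c; lia.
Qed.

(** A prime not dividing [s] has a zero where [s] is nonzero, hence where [f] is a unit; it then
    occurs equally in numerator and denominator and can be cancelled. The size of the denominator
    decreases. *)
Lemma units_on (s : MP) (f : AN -> K) : s != 0 -> reg (nonzero s) f ->
  (forall x, nonzero s x -> f x != 0) -> exists p q, [/\ p != 0, q != 0,
    forall g, prime_elt g -> divides g p \/ divides g q -> divides g s &
    forall x, nonzero s x -> f x * ev q x = ev p x].
Proof.
move=> s0 rf f0; have oS := nonzero_open s.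
have [x0 sx0] := ev_neq0 s0.
have ext p q O : open O -> O !=set0 -> O `<=` nonzero s ->
    (forall x, O x -> f x * ev q x = ev p x) -> forall x, nonzero s x -> f x * ev q x = ev p x.
  move=> oO [z Oz] Os e x sx.
  apply: (@reg_agree K AN setT O (nonzero s) (fun x => f x * ev q x) (ev p)) => //.
  - exact: affine_irreducible.
  - by exists z.
  - by apply: reg_mul => //; exact: reg_ev.
  - exact: reg_ev.
  - by move=> y _ Oy _; exact: e.
have [p [q [qx0 qs e]]] := reg_fraction oS rf sx0.
have {}e : forall x, nonzero s x -> f x * ev q x = ev p x.
  by apply: (ext p q (nonzero q)) => //; [exact: nonzero_open|exists x0].
have q0 : q != 0 by apply: contraTneq qx0 => ->; rewrite /nonzero /= ev0 eqxx.
have [m] := ubnP (msize q); elim: m p q {qx0 qs} q0 e => // m IHm p q q0 e; rewrite ltnS => le_m.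
have p0 : p != 0.
  apply/eqP => p0; have nz : nonzero q `&` nonzero s !=set0.
    rewrite -nonzeroM; have [|x ?] := @ev_neq0 K N (q * s); first exact: mulf_neq0.
    by exists x.
  have [x [qx sx]] := nz; have := e x sx; rewrite p0 ev0 => /eqP.
  by rewrite mulf_eq0 (negPf (f0 x sx)) (negPf qx).
have [h|/existsNP[g /not_implyP[pg /not_implyP[gpq gs]]]] :=
    pselect (forall g, prime_elt g -> divides g p \/ divides g q -> divides g s).
  by exists p, q.
have [w gw sw] : exists2 w, hypersurface g w & nonzero s w.
  apply: contrapT => no; apply: gs; apply: hypersurface_divides => // w gw.
  apply/eqP; apply: contraT => sw; case: no; exists w => //.
have mE : mult g p = mult g q.
  by apply: (@mult_regular_unit K N (nonzero s) f w g p q (nonzero s)) => //;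
    [exact: f0|exists x0|move=> y sy _; exact: e].
have fM := @ufd_mpoly K N.
have [gp gq] : divides g p /\ divides g q.
  have pos a : a != 0 -> (0 < mult g a)%N -> divides g a.
    by move=> a0 ma; have := mult_divides (k := 1) fM pg ma a0; rewrite expr1.
  case: gpq => h; have := mult_gt0 fM pg (_ : _ != 0) h; [move=> /(_ p0) hp|move=> /(_ q0) hq].
    by split=> //; apply: pos => //; rewrite -mE.
  by split=> //; apply: pos => //; rewrite mE.
have [p' pE] := gp; have [q' qE] := gq.
have g0 := prime_neq0 pg.
have q'0 : q' != 0 by apply: contraNneq q0 => h; rewrite qE h mul0r.
apply: (IHm p' q') => //; last first.
  by rewrite (leq_trans _ le_m) // qE; apply: msize_cofactor => //; rewrite -qE.
have [|x gsx] := @ev_neq0 K N (g * s); first exact: mulf_neq0.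
apply: (ext p' q' (nonzero (g * s))); first exact: nonzero_open.
- by exists x.
- by rewrite nonzeroM => y [].
rewrite nonzeroM => y [gy sy]; apply: (mulIf gy); rewrite -mulrA -!evM -qE -pE; exact: e.
Qed.

Lemma unit_constant (f : AN -> K) : reg setT f -> (forall x, f x != 0) -> forall x y, f x = f y.
Proof.
move=> rf f0; have e1 : nonzero (1 : MP) = setT.
  by apply/seteqP; split=> // x _; rewrite /nonzero /= ev1 oner_neq0.
have [||p [q [p0 q0 h e]]] := @units_on 1 f (oner_neq0 _); [by rewrite e1|by move=> x _|].
have no (g : MP) : prime_elt g -> ~ divides g 1.
  by move=> [_ nu _]; apply: contra_not (negP nu) => /divides_unit; apply; exact: unitr1.
have [a a0 pE] : exists2 c, c != 0 & p = mpolyC N c.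
  by apply: no_prime_const => // g pg gp; apply: (no g pg); apply: h => //; left.
have [b b0 qE] : exists2 c, c != 0 & q = mpolyC N c.
  by apply: no_prime_const => // g pg gp; apply: (no g pg); apply: h => //; right.
move=> x y; apply: (mulIf b0); have := e x; have := e y.
by rewrite pE qE !evC e1 => -> // ->.
Qed.

Lemma unit_monomial i (f : AN -> K) : reg (nonzero (mpolyX K (mnm1 i))) f ->
  (forall x, nonzero (mpolyX K (mnm1 i)) x -> f x != 0) -> exists c (m : int), c != 0 /\
    forall x, nonzero (mpolyX K (mnm1 i)) x -> f x = c * aff_val x 0 i ^ m.
Proof.
move=> rf f0; have [p [q [p0 q0 h e]]] := units_on (mpolyX_neq0 i) rf f0.
have pX := prime_mpolyX i; have fM := @ufd_mpoly K N.
have shape a : a != 0 -> (forall g, prime_elt g -> divides g a -> divides g (mpolyX K (mnm1 i))) ->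
    exists2 c, c != 0 & exists k, a = mpolyC N c * mpolyX K (mnm1 i) ^+ k.
  move=> a0 ha; have [b bE nb] := mult_decomp fM pX a0.
  have b0 : b != 0 by apply: contraNneq a0 => b0; rewrite bE b0 mul0r.
  have [c c0 cE] : exists2 c, c != 0 & b = mpolyC N c.
    apply: no_prime_const => // g pg gb; apply: nb.
    have gX : divides g (mpolyX K (mnm1 i)) by apply: ha => //; rewrite bE; exact: divides_mulr.
    have [u uu uE] := prime_divides_prime pg pX gX.
    have [d dE] := gb; exists (d * u^-1); by rewrite uE dE mulrA -[d / u * u]mulrA mulVr // mulr1.
  by exists c => //; exists (mult (mpolyX K (mnm1 i)) a); rewrite -cE.
have [a a0 [k pE]] := shape p p0 (fun g pg gp => h g pg (or_introl gp)).
have [b b0 [l qE]] := shape q q0 (fun g pg gp => h g pg (or_intror gp)).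
exists (a / b), (k%:Z - l%:Z); split=> [|x sx]; first by rewrite mulf_neq0 ?invr_neq0.
have x0 : aff_val x 0 i != 0 by rewrite -evX_coord.
have := e x sx; rewrite pE qE !evM !evC !evX !evX_coord expfzDr // -invr_expz -!exprnP.
set y := aff_val x 0 i ^+ l; set z := aff_val x 0 i ^+ k => ee.
have y0 : y != 0 by exact: expf_neq0.
by apply: (mulIf (mulf_neq0 b0 y0)); rewrite ee; field; rewrite b0 y0.
Qed.

End UnitsOfAffineSpace.

Section Families.
Variables (R : realType) (r n : nat) (A : 'M[int]_(r, n)) (theta : 'rV[rat]_r).
Local Notation C := R[i].
Local Notation V := (V R A).
Local Notation I2 := 'I_(n + n).
Local Notation X := (X R A theta).
Variables (N : nat) (pi : I2 -> mpoly N C) (ga : affine_space C N -> V).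
Local Notation AN := (affine_space C N).
Hypothesis gaE : forall y k, co (ga y) k = ev (pi k) y.

Lemma family_pv q y : pv q (ga y) = ev (mmap (@mpolyC N C) pi q) y.
Proof. by rewrite /ev /pv /mpeval meval_subst; apply: meval_eq => k; exact: gaE. Qed.

Lemma family_regV O F : reg O F -> reg (ga @^-1` O) (fun y => F (ga y)).
Proof.
move=> rF; apply: fraction_reg => y Oy; have [p [q [qy fE]]] := rF _ Oy.
exists (mmap (@mpolyC N C) pi p), (mmap (@mpolyC N C) pi q).
split; first by rewrite /nonzero /= -family_pv.
move=> y' Oy' qy'; have qy2 : pv q (ga y') != 0 by rewrite family_pv; exact: qy'.
have e := fE _ Oy' qy2.
refine (etrans (congr2 *%R e (esym (family_pv q y'))) (etrans _ (family_pv p y'))).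
exact: divfK qy2 _.
Qed.

Hypothesis gass : forall y, Vss theta (ga y).

Definition fam (y : AN) : X := qpt (gass y).

Lemma fam_wpart j F : weight_part theta j F -> exists p, forall y, F (ga y) = ev p y.
Proof.
move=> /weight_part_poly[p pE]; exists (mmap (@mpolyC N C) pi p) => y.
by rewrite pE family_pv.
Qed.

Lemma fam_continuous W : open W -> open (fam @^-1` W).
Proof.
move=> oW; change (@aff_open C N (zeros set0) (fam @^-1` W)) => y Wy.
have [j [F [j0 wF Fy FW]]] := X_openP oW Wy; have [p pE] := fam_wpart wF.
exists p; split; first by move/(basic_qpt _ wF): Fy; rewrite pE.
by move=> y' py; apply: FW; apply/(basic_qpt _ wF); rewrite pE.
Qed.

Lemma fam_reg W F : open W -> reg W F -> reg (fam @^-1` W) (fun y => F (fam y)).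
Proof.
move=> oW rF; apply: fraction_reg => y Wy.
have [j [H [G [j0 wH wG [Hy HW] fE]]]] := X_regP oW rF Wy.
have [q qE] := fam_wpart wH; have [p pE] := fam_wpart wG.
exists p, q; split; first by rewrite /nonzero /= -qE; move/(basic_qpt _ wH): Hy.
move=> y' _ qy; have Hy' : H (ga y') != 0 by rewrite qE.
by rewrite /fam fE // -pE -qE divfK.
Qed.

End Families.

Section SupportPoints.
Variables (R : realType) (r n : nat) (A : 'M[int]_(r, n)).
Local Notation C := R[i].
Local Notation V := (V R A).
Local Notation I2 := 'I_(n + n).
Variable sg : 'I_n -> I2.
Hypothesis sgK : forall l, idx (sg l) = l.

(** Only one coordinate of each pair may be nonzero, so the moment equation holds automatically. *)
Definition supv (S : comPzRingType) (x : 'I_n -> S) (k : I2) : S :=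
  if sg (idx k) == k then x (idx k) else 0.

Lemma supv_moment (x : 'I_n -> C) : moment A (\row_k supv x k) = 0.
Proof.
apply: moment_disjoint => l; rewrite /supv idx_l idx_r; case: eqP => [->|_]; last by rewrite mul0r.
by case: eqP => [e|_]; rewrite ?mulr0 //; have := bar_neq (lshift n l); rewrite bar_l -e eqxx.
Qed.

Definition suppt (x : 'I_n -> C) : V := mkV (supv_moment x).

Lemma co_sup x k : co (suppt x) k = supv x k.
Proof. exact: co_mkV. Qed.

Lemma sup_sg x l : co (suppt x) (sg l) = x l.
Proof. by rewrite co_sup /supv sgK eqxx. Qed.

Lemma sup_neq0 x k : co (suppt x) k != 0 -> k = sg (idx k) /\ x (idx k) != 0.
Proof.
by rewrite co_sup /supv; case: (sg (idx k) =P k) => [e|_]; [rewrite e|rewrite eqxx].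
Qed.

Lemma sum_sg (M : zmodType) (F : I2 -> M) : (forall q, q <> sg (idx q) -> F q = 0) ->
  \sum_q F q = \sum_l F (sg l).
Proof.
move=> h; rewrite sum_coord; apply: eq_bigr => l _.
have [e|e] : sg l = lshift n l \/ sg l = bar (lshift n l) by apply: idx_eq; rewrite sgK idx_l.
  rewrite e (h (rshift n l)) ?addr0 // idx_r e -bar_l => e'.
  by have := bar_neq (lshift n l); rewrite e' eqxx.
rewrite e bar_l (h (lshift n l)) ?add0r // idx_l e => e'.
by have := bar_neq (lshift n l); rewrite -e' eqxx.
Qed.

Lemma sup_act g x : act g (suppt x) = suppt (fun l => chr (bvec A (sg l)) g * x l).
Proof.
apply: V_eq => k; rewrite co_act !co_sup /supv; case: eqP => [e|_]; last by rewrite mulr0.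
by rewrite -{1}e.
Qed.

Lemma eq_sup x x' : x =1 x' -> suppt x = suppt x'.
Proof. by move=> h; apply: V_eq => k; rewrite !co_sup /supv h. Qed.

Lemma sup_family N (x : 'I_n -> mpoly N C) (y : affine_space C N) k :
  co (suppt (fun l => ev (x l) y)) k = ev (supv x k) y.
Proof. by rewrite co_sup /supv; case: ifP => _ //; rewrite ev0. Qed.

End SupportPoints.

Section WeightZero.
Variables (R : realType) (r n : nat) (A : 'M[int]_(r, n)).
Local Notation C := R[i].
Local Notation V := (V R A).
Implicit Types (u v : V).

(* Only constant invariants survive at such a point: it is contracted to the
   image of the origin. *)
Definition null_point v := forall e : 'I_(n + n) -> nat, wt A e = 0 ->
  (forall k, e k != 0%N -> co v k != 0) -> forall k, e k = 0%N.

Lemma null_same_ideal u v : null_point u -> null_point v -> same_ideal 0 u v.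
Proof.
move=> nu nv j f [chi ce /semi_invariant_monomials[p pE pw]].
have chi0 : chi = 0 by apply: intr_mx_inj; rewrite ce mul0rn map_mx0.
suff -> : f u = f v by [].
rewrite !pE /mpeval !mevalE; apply: eq_big_seq => m mp; congr (_ * _).
rewrite -![\prod_i _]/(mon m _).
have mE w : null_point w -> mon m w = [forall k, m k == 0%N]%:R.
  move=> nw; case: forallP => [h|h].
    by rewrite /mon big1 // => k _; rewrite (eqP (h k)) expr0.
  apply/eqP; apply: contraT => mw0; case: h => k; apply/eqP; apply: nw.
    by have := pw m mp; rewrite chi0.
  by move=> l; exact: mon_neq0_inv mw0.
by rewrite !mE.
Qed.

Lemma null_image theta u v (uss : Vss theta u) (vss : Vss theta v) : null_point u -> null_point v ->
  aff_quot R A theta (qpt uss) = aff_quot R A theta (qpt vss).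
Proof.
move=> nu nv; rewrite /aff_quot /= !aff_quot_funE !quot_qpt.
by apply/qpt_eq; exact: null_same_ideal.
Qed.

End WeightZero.

Lemma combE n (a c : rat) (u v : 'rV[rat]_n) l : (a *: u - c *: v) 0 l = a * u 0 l - c * v 0 l.
Proof. by rewrite !mxE. Qed.

(** * The projective line joining two adjacent charts *)

Section Edge.
Variables (R : realType) (r n : nat) (A : 'M[int]_(r, n)) (theta : 'rV[rat]_r).
Hypothesis uni : forall J, base A J -> forall chi : 'rV[int]_r, iw A J (map_mx intr chi).
Hypothesis gt : gen A theta.
Local Notation C := R[i].
Local Notation V := (V R A).
Local Notation X := (X R A theta).
Local Notation sol := (sol A).
Variables (J : {set 'I_n}) (i k : 'I_n).
Hypothesis bJ : base A J.
Hypothesis iJ : i \in J.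
Hypothesis kJ : k \notin J.
Local Notation J' := (k |: J :\ i)%SET.
Hypothesis bJ' : base A J'.
Hypothesis same_sign : forall j, j \in J -> j != i -> 0 < sol J theta 0 j * sol J' theta 0 j.

Definition esg l := if l == k then sc A theta J' k else sc A theta J l.

Lemma esgK l : idx (esg l) = l.
Proof. by rewrite /esg; case: eqP => [->|_]; rewrite idx_sc. Qed.

Lemma ik : i != k.
Proof. by apply: contraNneq kJ => <-. Qed.

Lemma esg_J j : j \in J -> esg j = sc A theta J j.
Proof. by move=> jJ; rewrite /esg; case: eqP => // e; rewrite e (negPf kJ) in jJ. Qed.

Lemma in_J' j : j \in J' -> j = k \/ [/\ j \in J, j != i & j != k].
Proof.
rewrite !inE; have [->|jk] := eqVneq j k; first by left.
by move=> /andP[ji jJ]; right.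
Qed.

Lemma esg_J' j : j \in J' -> esg j = sc A theta J' j.
Proof.
move=> /in_J'[->|[jJ ji jk]]; first by rewrite /esg eqxx.
rewrite esg_J // /sc /sidx; have := same_sign jJ ji.
have [h|h] := ltP 0 (sol J theta 0 j); first by rewrite pmulr_rgt0 // => ->.
have h' : sol J theta 0 j < 0 by rewrite lt_neqAle gt.
by rewrite nmulr_rgt0 // => /ltW; rewrite leNgt => /negPf->.
Qed.

(** A cone over the projective line: the entries at [i] and [k] serve as homogeneous coordinates,
    one for each of the two charts. *)
Definition ept (u w : C) : V := suppt A esg (fun l => if l == i then u else if l == k then w
  else if l \in J then 1 else 0).

Lemma ept_Vss u w : u != 0 \/ w != 0 -> Vss theta (ept u w).
Proof.
case=> h.
  apply: (sol_Vss bJ) => j jJ _; rewrite -[sidx _ _ _ _]/(sc A theta J j) -esg_J // /ept sup_sg; last exact: esgK.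
  have [//|_] := eqVneq j i; have [e|_] := eqVneq j k; first by rewrite e (negPf kJ) in jJ.
  by rewrite jJ oner_neq0.
apply: (sol_Vss bJ') => j jJ' _; rewrite -[sidx _ _ _ _]/(sc A theta J' j) -esg_J' // /ept sup_sg; last exact: esgK.
have [->|[jJ ji jk]] := in_J' jJ'; first by rewrite (eq_sym k i) (negPf ik) eqxx.
by rewrite (negPf ji) (negPf jk) jJ oner_neq0.
Qed.

(** A monomial of weight 0 supported on the line gives a relation between the columns of [k |: J].
    These relations form one line, along which the signed coefficients at [i] and [k] have opposite
    signs, so nonnegative exponents must vanish. *)
Lemma ept_null u w : null_point (ept u w).
Proof.
move=> e e0 esupp.
pose s l : rat := if esg l == lshift n l then 1 else -1.
have esE l : bQ A (esg l) = s l *: aQ A l.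
  rewrite /s; have := esgK l; case: (coordP (esg l)) => l'.
    by rewrite idx_l => ->; rewrite eqxx bQ_l scale1r.
  rewrite idx_r => ->; rewrite bQ_r -[rshift n l]bar_l (negPf (bar_neq _)) scaleN1r //.
have out q : e q != 0%N -> q = esg (idx q) /\ idx q \in (k |: J)%SET.
  move=> /esupp /sup_neq0[qE xq]; split=> //; rewrite !inE; move: xq.
  have [->|_] := eqVneq (idx q) i; first by rewrite iJ orbT.
  by have [//|_] := eqVneq (idx q) k; case: ifP => // _; rewrite eqxx.
pose y : 'rV[rat]_n := \row_l (s l * (e (esg l))%:R).
have yA : y *m At A = 0.
  rewrite -[RHS](map_mx0 (intr : int -> rat)) -e0 wtQ (sum_sg esgK) => [|q nq].
    by rewrite mulAt; apply: eq_bigr => l _; rewrite mxE [s l * _]mulrC -scalerA esE.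
  suff -> : e q = 0%N by rewrite scale0r.
  by apply/eqP; apply: contraT => /out[].
have ys l : y 0 l != 0 -> l \in (k |: J)%SET.
  rewrite mxE mulf_eq0 negb_or pnatr_eq0 => /andP[_ /out[_]].
  by rewrite esgK.
have spos j : j \in J -> 0 < s j * sol J theta 0 j.
  move=> jJ; rewrite /s esg_J // /sc /sidx; have [h|h] := ltP 0 (sol J theta 0 j).
    by rewrite eqxx mul1r.
  by rewrite -bar_l (negPf (bar_neq _)) mulN1r oppr_gt0 lt_neqAle gt.
have kJ' : k \in J' by rewrite !inE eqxx.
have skpos : 0 < s k * sol J' theta 0 k.
  rewrite /s /esg eqxx /sc /sidx; have [h|h] := ltP 0 (sol J' theta 0 k).
    by rewrite eqxx mul1r.
  by rewrite -bar_l (negPf (bar_neq _)) mulN1r oppr_gt0 lt_neqAle gt.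
(* A generator of the relations on [k |: J]: after the signs [s], its entry at [k] is positive and
   that at [i] negative. *)
pose d := sol J' theta - sol J theta.
have dA : d *m At A = 0.
  have [_ e1] := sol_spec theta bJ; have [_ e2] := sol_spec theta bJ'.
  by rewrite mulmxBl e1 e2 subrr.
have dk : d 0 k = sol J' theta 0 k by rewrite !mxE (sol_out _ bJ kJ) subr0.
have di : d 0 i = - sol J theta 0 i.
  by rewrite !mxE (sol_out _ bJ') ?sub0r // !inE eqxx (negPf ik).
have comb : d 0 k *: y - y 0 k *: d = 0.
  have [iJ0 _] := bJ; apply: iJ0; last by rewrite mulmxBl -!scalemxAl yA dA !scaler0 subr0.
  move=> l; rewrite combE.
  have [->|lk] := eqVneq l k; first by rewrite mulrC subrr eqxx.
  move=> nz; apply: contraT => lJ; move: nz.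
  have -> : y 0 l = 0 by apply/eqP; apply: contraT => /ys; rewrite !inE (negPf lk) (negPf lJ).
  have -> : d 0 l = 0.
    by rewrite /d !mxE (sol_out _ bJ lJ) (sol_out _ bJ') ?subrr // !inE (negPf lk) (negPf lJ) andbF.
  by rewrite !mulr0 subrr eqxx.
have ek0 : e (esg k) = 0%N.
  have := congr1 (fun x : 'rV[rat]_n => x 0 i) comb.
  rewrite combE [RHS]mxE dk di mulrN opprK.
  have sq l : s l * s l = 1 by rewrite /s; case: ifP => _; rewrite ?mulr1 // mulrNN mulr1.
  rewrite !mxE => h; apply/eqP; rewrite -(pnatr_eq0 rat).
  have : (s k * sol J' theta 0 k) * (e (esg i))%:R + (e (esg k))%:R * (s i * sol J theta 0 i) = 0.
    have := congr1 (fun q => s k * s i * q) h; rewrite mulr0 mulrDr => <-.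
    by rewrite -[in LHS](mulr1 (sol J' theta 0 k)) -(sq i) -[in LHS](mul1r (sol J theta 0 i)) -(sq k); ring.
  have p1 : 0 <= s k * sol J' theta 0 k * (e (esg i))%:R by rewrite mulr_ge0 ?ler0n // ltW.
  have p2 : 0 <= (e (esg k))%:R * (s i * sol J theta 0 i) by rewrite mulr_ge0 ?ler0n // ltW // spos.
  move/eqP; rewrite paddr_eq0 // => /andP[_].
  by rewrite mulf_eq0 (gt_eqF (spos i iJ)) orbF.
have y00 : y = 0.
  have [iJ0 _] := bJ; apply: iJ0 => // l yl; have := ys l yl; rewrite !inE.
  case/predU1P => // lk; move: yl; by rewrite lk mxE ek0 mulr0 eqxx.
move=> q; apply/eqP; apply: contraT => eq0; have [qE _] := out q eq0.
have := congr1 (fun x : 'rV[rat]_n => x 0 (idx q)) y00; rewrite !mxE -qE => /eqP.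
rewrite mulf_eq0 pnatr_eq0 (negPf eq0) orbF /s.
by case: ifP => _; rewrite ?oppr_eq0 oner_eq0.
Qed.


Lemma torus_scaling (t : C) : t != 0 -> exists g : torus R r,
  chr (bvec A (esg i)) g = t /\ forall j, j \in J -> j != i -> chr (bvec A (esg j)) g = 1.
Proof.
move=> t0; pose M := \matrix_j (if j \in J then bvec A (sc A theta J j) else 0) : 'M[int]_(n, r).
have tn0 j : (if j == i then t else 1) != 0 by case: ifP => // _; exact: oner_neq0.
have [e eM|g g0 gE] := @torus_solve C _ _ M (fun j => if j == i then t else 1) tn0.
  pose e' : 'rV[int]_n := \row_j (if j \in J then e 0 j else 0).
  have e'0 : e' = 0.
    apply: (bvec_indep (theta := theta) bJ); first by move=> j; rewrite !mxE; case: ifP => //; rewrite eqxx.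
    rewrite -[RHS]eM mulmx_sum_row; apply: eq_bigr => j _; rewrite rowK mxE.
    by case: ifP => _; rewrite ?scale0r ?scaler0.
  rewrite /lmon big1 // => j _; case: eqP => [->|_]; last by rewrite exp1rz.
  by have /rowP/(_ i) := e'0; rewrite !mxE iJ => ->; rewrite expr0z.
have gJ j : j \in J -> chr (bvec A (esg j)) (mk_torus g0) = if j == i then t else 1.
  by move=> jJ; rewrite chr_mk_torus esg_J // -(gE j) rowK jJ.
exists (mk_torus g0); split; first by rewrite gJ // eqxx.
by move=> j jJ /negPf ji; rewrite gJ // ji.
Qed.

Section NowhereVanishing.
Variables (psi : 'rV[int]_r) (t : V -> C).
Hypothesis t_neq0 : forall u w, u != 0 \/ w != 0 -> t (ept u w) != 0.
Hypothesis t_act : forall g u w, u != 0 \/ w != 0 -> t (act g (ept u w)) = chr psi g * t (ept u w).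
Hypothesis t_reg1 : reg setT (fun y : affine_space C 1 => t (ept 1 (aff_val y 0 0))).
Hypothesis t_reg2 : reg setT (fun y : affine_space C 1 => t (ept (aff_val y 0 0) 1)).

(* A nowhere vanishing section is constant on both affine charts of the
   projective line, so the torus acts trivially on it. *)
Lemma edge_trivial : sol J (map_mx intr psi) 0 i = 0.
Proof.
have val (a : C) : aff_val (apt (const_mx a) : affine_space C 1) 0 0 = a by rewrite /aff_val /= mxE.
have c1 w : t (ept 1 w) = t (ept 1 1).
  have := unit_constant t_reg1 (fun y => t_neq0 (or_introl (oner_neq0 _))) (apt (const_mx w)) (apt (const_mx 1)).
  by rewrite /= !val.
have c2 u : t (ept u 1) = t (ept 1 1).
  have := unit_constant t_reg2 (fun y => t_neq0 (or_intror (oner_neq0 _))) (apt (const_mx u)) (apt (const_mx 1)).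
  by rewrite /= !val.
apply/eqP; apply: contraT => s0; pose m := expo A theta J psi i.
have m0 : const_mx m != 0 :> 'rV[int]_1.
  apply: contraNneq s0 => /rowP/(_ 0); rewrite !mxE => m0.
  have := expoE theta uni psi i bJ; rewrite -/m m0 => /esym/eqP; rewrite mulf_eq0.
  by case: ifP => _; rewrite ?oppr_eq0 oner_eq0 orbF.
have [h h0] := lmon_separates C m0; rewrite /lmon big_ord1 mxE; case/negP; apply/eqP.
have [g [gi gj]] := torus_scaling (h0 0).
have w0 := chr_neq0 (bvec A (esg k)) g.
have eg : act g (ept 1 (chr (bvec A (esg k)) g)^-1) = ept (h 0) 1.
  rewrite /ept sup_act; apply: eq_sup => l.
  have [->|li] := eqVneq l i; first by rewrite gi mulr1.
  have [->|lk] := eqVneq l k; first by rewrite divff.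
  by have [lJ|_] := boolP (l \in J); rewrite ?mulr0 // mulr1 gj.
have := t_act g (u := 1) (w := (chr (bvec A (esg k)) g)^-1) (or_introl (oner_neq0 _)).
rewrite eg c1 c2 -[LHS]mul1r => /(mulIf (t_neq0 (or_introl (oner_neq0 _)))).
rewrite {1}[psi](expo_sum theta uni psi bJ) chrE lmon_sum; last exact: torus_neq0.
rewrite (bigD1 i) //= big1 ?mulr1 => [|j /andP[jJ ji]]; last first.
  by rewrite lmonZ -chrE -esg_J // gj // exp1rz.
by rewrite lmonZ -chrE -esg_J // gi.
Qed.

End NowhereVanishing.

End Edge.

Lemma section_identity (K : fieldType) (a b c : K) :
  a != 0 -> b != 0 -> c != 0 -> a / (c * (a / b)) = b / c.
Proof. by move=> a0 b0 c0; field; rewrite a0 b0 c0. Qed.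

Section PicardInjective.
Variables (R : realType) (r n : nat) (A : 'M[int]_(r, n)) (theta : 'rV[rat]_r).
Hypothesis sT : spanning A [set: 'I_n]%SET.
Hypothesis nc : nocoloop A.
Hypothesis uni : forall J, base A J -> forall chi : 'rV[int]_r, iw A J (map_mx intr chi).
Hypothesis gt : gen A theta.
Local Notation C := R[i].
Local Notation V := (V R A).
Local Notation X := (X R A theta).
Local Notation lb := (lbof R sT uni gt).
Local Notation f := (aff_quot R A theta).
Local Notation cU := (@cU R r n A theta sT gt).
Local Notation cJ := (@cJ R r n A theta sT gt).
Local Notation sol := (sol A).

Section Trivial.
Variables (psi : 'rV[int]_r) (M : line_bundle (Defs.X R A 0)).
Variables (W : X -> set X) (h : X -> X -> C).
Hypothesis Wh : forall x, [/\ open (W x), W x x, W x `<=` cU x, reg (W x) (h x) & forall p, W x p -> h x p != 0].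
Hypothesis hE : forall x y p, W x p -> W y p ->
  h x p * ltr (lb psi) x y p = ltr M (f x) (f y) (f p) * h y p.

(** The frame of [psi] divided by the isomorphism with the pullback of [M]. Along fibres of [f],
    where the pullback is trivial, this is a nowhere vanishing section; the value 1 off the
    semistable locus is arbitrary. *)
Definition tsec (v : V) : C :=
  if pselect (Vss theta v) is left vss then fr theta (cJ (qpt vss)) psi v / h (qpt vss) (qpt vss) else 1.

Lemma tsecE v (vss : Vss theta v) : tsec v = fr theta (cJ (qpt vss)) psi v / h (qpt vss) (qpt vss).
Proof. by rewrite /tsec; case: pselect => // vss'; rewrite (Prop_irrelevance vss' vss). Qed.

Lemma fr_cU x v (vss : Vss theta v) : cU x (qpt vss) -> fr theta (cJ x) psi v != 0.
Proof. by move=> Ux; apply: (@fr_over R r n A theta sT gt x); exists vss. Qed.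

Lemma tsec_neq0 v (vss : Vss theta v) : tsec v != 0.
Proof.
rewrite (tsecE vss); have [_ Wp WU _ h0] := Wh (qpt vss).
by rewrite mulf_neq0 ?invr_neq0 ?h0 //; apply: fr_cU; exact: WU.
Qed.

Lemma tsec_act g v (vss : Vss theta v) : tsec (act g v) = chr psi g * tsec v.
Proof.
rewrite (tsecE (Vss_act g vss)) (tsecE vss) -(qpt_act vss).
by rewrite (fr_act theta uni psi g v (cb sT gt (qpt vss))) mulrA.
Qed.

(** Along a fibre of [f] the transition functions of [M] between the two points equal 1, so the
    expression based at a nearby [x] gives the same value. *)
Lemma tsec_local x v (vss : Vss theta v) : W x (qpt vss) -> f x = f (qpt vss) ->
  tsec v = fr theta (cJ x) psi v / h x (qpt vss).
Proof.
move=> Wx fx; rewrite (tsecE vss); have [_ Wp WU _ h0] := Wh (qpt vss).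
have [_ _ WUx _ hx0] := Wh x.
have := hE Wx Wp; rewrite -fx ltr_id ?mul1r; last exact: ldom_self.
have -> : ltr (lb psi) x (qpt vss) (qpt vss) = fr theta (cJ (qpt vss)) psi v / fr theta (cJ x) psi v.
  exact: (ratio_desc sT uni gt x (qpt vss) psi vss).
move=> <-; have a0 := fr_cU (WU _ Wp); have b0 := fr_cU (WUx _ Wx); have c0 := hx0 _ Wx.
exact: (section_identity a0 b0 c0).
Qed.

Lemma tsec_regular (pi : 'I_(n + n) -> mpoly 1 C) (ga : affine_space C 1 -> V) :
  (forall y k, co (ga y) k = ev (pi k) y) -> forall gass : (forall y, Vss theta (ga y)),
  (forall y y', f (fam gass y) = f (fam gass y')) -> reg setT (fun y => tsec (ga y)).
Proof.
move=> gaE gass fE; apply: reg_glue => y0 _.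
have [oW Wp WU rh h0] := Wh (fam gass y0).
exists (fam gass @^-1` W (fam gass y0)); split=> //; first exact: (fam_continuous gaE).
rewrite setTI; apply: (@reg_ext _ _ _ (fun y => fr theta (cJ (fam gass y0)) psi (ga y) / h (fam gass y0) (fam gass y))).
  move=> y Wy; rewrite (@tsec_local (fam gass y0) (ga y) (gass y)) //; exact: fE.
apply: reg_mul; last first.
  apply: reg_inv; first by move=> y Wy; exact: h0.
  exact: (@fam_reg _ _ _ _ _ _ _ _ gaE gass (W (fam gass y0)) (h (fam gass y0)) oW rh).
have rfr : reg (over (cU (fam gass y0))) (fr theta (cJ (fam gass y0)) psi).
  by apply: reg_fr => v; exact: (@over_cU R r n A theta sT gt).
apply: (@reg_res _ (affine_space C 1) _ _ _ _ (@family_regV _ _ _ _ _ _ _ gaE _ _ rfr)) => y Wy.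
by exists (gass y); exact: WU.
Qed.

(** The contracted line forces the i-th coordinate of [psi] in [J] to vanish; its coordinate vector
    is then supported in [J'] as well. *)
Lemma edge_equal J J' : edge A theta J J' -> sol J (map_mx intr psi) = sol J' (map_mx intr psi).
Proof.
move=> [bJ [bJ' [i [k [iJ kJ eJ ss]]]]]; subst J'.
pose P := @ept R r n A theta J i k.
have Pss u w (h0 : u != 0 \/ w != 0) : Vss theta (P u w) := ept_Vss gt bJ iJ kJ bJ' ss h0.
have fP u w u' w' (a : Vss theta (P u w)) (b : Vss theta (P u' w')) : f (qpt a) = f (qpt b).
  by apply: null_image; exact: (ept_null gt bJ iJ kJ bJ').
have Pfam (pu pw : mpoly 1 C) (y : affine_space C 1) q : co (P (ev pu y) (ev pw y)) q =
    ev (supv (esg A theta J i k) (fun l => if l == i then pu else if l == k then pw else if l \in J then 1 else 0) q) y.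
  rewrite -(sup_family A); congr (co _ q); apply: eq_sup => l.
  by case: ifP => // _; case: ifP => // _; case: ifP => _; rewrite ?ev1 ?ev0.
have ev1n (y : affine_space C 1) : ev 1 y != 0 by rewrite ev1; exact: oner_neq0.
pose x0 : mpoly 1 C := mpolyX C (mnm1 0).
have si0 : sol J (map_mx intr psi) 0 i = 0.
  apply: (edge_trivial uni bJ iJ kJ (t := tsec)).
  - by move=> u w h0; exact: tsec_neq0 (Pss u w h0).
  - by move=> g u w h0; exact: tsec_act (Pss u w h0).
  - apply: (@reg_ext _ _ _ (fun y : affine_space C 1 => tsec (P (ev 1 y) (ev x0 y)))).
      by move=> y _; rewrite ev1 evX_coord.
    have ss1 y : Vss theta (P (ev 1 y) (ev x0 y)) by exact: (Pss _ _ (or_introl (ev1n y))).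
    by apply: (tsec_regular (Pfam 1 x0) (gass := ss1)) => y y'; exact: fP.
  - apply: (@reg_ext _ _ _ (fun y : affine_space C 1 => tsec (P (ev x0 y) (ev 1 y)))).
      by move=> y _; rewrite ev1 evX_coord.
    have ss1 y : Vss theta (P (ev x0 y) (ev 1 y)) by exact: (Pss _ _ (or_intror (ev1n y))).
    by apply: (tsec_regular (Pfam x0 1) (gass := ss1)) => y y'; exact: fP.
have [hs es] := sol_spec (map_mx intr psi) bJ.
apply/esym; apply: (sol_uniq bJ') => // j sj.
rewrite !inE (hs j sj) andbT; apply/orP; right.
by apply: contraNneq sj => ->; rewrite si0.
Qed.

(** Connectedness makes the coordinate vector of [psi] the same in all bases, and each of its
    entries is zero in a base avoiding that index. *)
Lemma pullback_trivial : psi = 0.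
Proof.
have all_eq J J' : base A J -> base A J' -> sol J (map_mx intr psi) = sol J' (map_mx intr psi).
  move=> bJ bJ'; apply: (@base_connected r n A theta [set: 'I_n]%SET
    (fun J J' => sol J (map_mx intr psi) = sol J' (map_mx intr psi)) gt) => //.
  - by move=> ? ? ? _ -> .
  - by move=> ? ? _ _; exact: edge_equal.
have [J0 [b0 _ _]] := extend_base (@indep0 r n A) sT (finset.sub0set _).
have s0 : sol J0 (map_mx intr psi) = 0.
  apply/rowP => j; have [J bJ sJ] := base_avoiding j nc sT.
  rewrite (all_eq _ _ b0 bJ) mxE sol_out //.
  by apply/negP => /(fintype.subsetP sJ); rewrite !inE eqxx.
have [_] := sol_spec (map_mx intr psi) b0; rewrite s0 mul0mx => e.
by apply: intr_mx_inj; rewrite -e map_mx0.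
Qed.

End Trivial.

Lemma lb_pullback_trivial psi (M : line_bundle (Defs.X R A 0)) :
  lb_iso (lb psi) (lb_pullback f M) -> psi = 0.
Proof.
move=> [W [h [Wh hE]]]; apply: (@pullback_trivial psi M W h) => // x.
have [oW Wx WLM rh h0] := Wh x; split=> // p Wp; by have [] := WLM p Wp.
Qed.

End PicardInjective.

Section LinearExtension.
Variables (U W : lmodType rat) (g : U -> W) (lg : linear g).
HB.instance Definition _ := GRing.isLinear.Build rat U W *:%R g lg.
Definition linear_of : {linear U -> W} := g.
End LinearExtension.

Section LinearisationMap.
Local Open Scope quotient_scope.
Variables (R : realType) (r n : nat) (A : 'M[int]_(r, n)) (theta : 'rV[rat]_r).
Hypothesis sT : spanning A [set: 'I_n]%SET.
Hypothesis nc : nocoloop A.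
Hypothesis uni : forall J, base A J -> forall chi : 'rV[int]_r, iw A J (map_mx intr chi).
Hypothesis gt : gen A theta.
Local Notation lb := (lbof R sT uni gt).
Local Notation f := (aff_quot R A theta).
Local Notation Q := (Quotient.quot (pullback_class f)).
Local Notation PQ := (PicQ R A theta).

Definition cls psi : Q := \pi_Q (pic (lb psi)).

Lemma pic_lbD psi psi' : pic (lb (psi + psi')) = pic (lb psi) + pic (lb psi').
Proof.
rewrite [RHS](_ : _ = pic_add (pic (lb psi)) (pic (lb psi'))) // pic_tensor; apply/picP.
apply: (descends_iso sT uni gt (lbof_descends R sT uni gt (psi + psi'))).
by apply: descends_tensor; exact: lbof_descends.
Qed.

Lemma clsD psi psi' : cls (psi + psi') = cls psi + cls psi'.
Proof. by rewrite /cls pic_lbD; exact: raddfD. Qed.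

Lemma cls0 : cls 0 = 0.
Proof. by apply: (addrI (cls 0)); rewrite -clsD !addr0. Qed.

Lemma clsN psi : cls (- psi) = - cls psi.
Proof. by apply: (addrI (cls psi)); rewrite -clsD !subrr cls0. Qed.

Lemma clsMn psi k : cls (psi *+ k) = cls psi *+ k.
Proof. by elim: k => [|k IHk]; rewrite ?mulr0n ?cls0 // !mulrS clsD IHk. Qed.

Lemma clsMz psi (z : int) : cls (psi *~ z) = cls psi *~ z.
Proof. by case: z => k; rewrite ?NegzE ?mulrNz ?clsN -!pmulrn clsMn. Qed.

Lemma integral_multiple (chi : 'rV[rat]_r) : exists D, (0 < D)%N /\
  exists psi : 'rV[int]_r, map_mx intr psi = chi *+ D.
Proof.
have [D D0 [m mE]] := clear_denominators (fun k => chi 0 k); exists D; split=> //.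
exists (\row_k m k); apply/rowP => k.
by rewrite -scaler_nat !mxE -mE mulrC.
Qed.

Definition lmap (chi : 'rV[rat]_r) : PQ :=
  let: exist D h := cid (integral_multiple chi) in let: exist psi _ := cid h.2 in Defs.frac (cls psi) D.

Lemma lmapE chi j psi : (0 < j)%N -> map_mx intr psi = chi *+ j -> lmap chi = Defs.frac (cls psi) j.
Proof.
move=> j0 e; rewrite /lmap; case: cid => D [D0 h] /=; case: cid => psi' e' /=.
apply: Defs.eq_frac => //; rewrite -!clsMn; congr cls; apply: intr_mx_inj.
by rewrite !raddfMn /= e e' -!mulrnA mulnC.
Qed.

Lemma lmap_linear : linear lmap.
Proof.
move=> a chi chi'; have [j [j0 [psi e]]] := integral_multiple chi.
have [k [k0 [psi' e']]] := integral_multiple chi'.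
have d0 : (0 < `|denq a|)%N by rewrite absz_gt0 denq_neq0.
rewrite (lmapE j0 e) (lmapE k0 e').
have -> : a *: Defs.frac (cls psi) j = Defs.frac (cls psi *~ numq a) (j * `|denq a|) := Defs.frac_scale a (cls psi) j0.
rewrite Defs.fracD ?muln_gt0 ?j0 ?d0 //.
rewrite -clsMz -!clsMn -clsD; apply: lmapE; first by rewrite !muln_gt0 j0 d0 k0.
rewrite raddfD !raddfMn /= raddfMz /= e e' mulrnDl; congr (_ + _); last first.
  by rewrite -!mulrnA; congr (_ *+ _); ring.
rewrite -!scaler_nat -scaler_int !scalerA; congr (_ *: _).
have E : a * `|denq a|%:R = (numq a)%:~R.
  rewrite pmulrn gez0_abs ?denq_ge0 // -[a in LHS]divq_num_den.
  by rewrite divq_num_den -{1}(divq_num_den a) divfK // intr_eq0 denq_neq0.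
by rewrite !natrM -E; ring.
Qed.

Lemma lmap_inj chi : lmap chi = 0 -> chi = 0.
Proof.
have [j [j0 [psi e]]] := integral_multiple chi; rewrite (lmapE j0 e) => h.
have /Defs.fracP : Defs.frac (cls psi) j = Defs.frac 0 1 by rewrite h.
case=> // c c0; rewrite mul1n mul0rn -clsMn => h0.
have h1 : \pi_Q (pic (lb (psi *+ c))) = \pi_Q 0 by rewrite -[LHS]/(cls _) h0 raddf0.
move/eqmodP: h1; rewrite /= Quotient.equivE subr0 => /asboolP[M /picP /(lb_pullback_trivial nc) p0].
have := congr1 (map_mx (intr : int -> rat)) p0; rewrite map_mx0 raddfMn /= e -mulrnA -scaler_nat.
move/eqP; rewrite scaler_eq0 pnatr_eq0 muln_eq0 gtn_eqF // gtn_eqF //= => /eqP->; by [].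
Qed.

Lemma lmap_linearisation : linearisation_map lmap.
Proof.
move=> chi; split.
  have [j [j0 [psi e]]] := integral_multiple chi; exists j, psi, (lb psi); split=> //.
  exact: lbof_descends.
move=> j psi L j0 e dL; rewrite (lmapE j0 e) /pic_fraction /cls.
congr (Defs.frac (\pi_Q _) j); apply/picP.
exact: (descends_iso sT uni gt (lbof_descends R sT uni gt psi) dL).
Qed.

Lemma linearisation_bijective : (forall L, exists psi, lb_iso L (lb psi)) ->
  exists L_C : {linear 'rV[rat]_r -> PQ}, linearisation_map L_C /\ bijective L_C.
Proof.
move=> surj; exists (linear_of lmap_linear); split; first exact: lmap_linearisation.
have inj : injective lmap.
  move=> chi chi' e; apply/eqP; rewrite -subr_eq0; apply/eqP; apply: lmap_inj.
  have := linearB (linear_of lmap_linear) chi chi'; rewrite /= => ->.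
  by rewrite e subrr.
have /choice[g gE] : forall x : PQ, exists chi, lmap chi = x.
  move=> x; have [m [a [a0 ->]]] := ratmodP x.
  have [L eL] := picW (repr m); have [psi iso] := surj L.
  have aQ0 : (a%:R : rat) != 0 by rewrite pnatr_eq0 -lt0n.
  exists (a%:R^-1 *: map_mx intr psi); rewrite (lmapE a0 (psi := psi)).
    congr (Defs.frac _ a); rewrite /cls -[m in RHS]reprK; congr (\pi_Q _).
    by rewrite eL; apply/picP; exact: lb_iso_sym.
  by rewrite -scaler_nat scalerA divff // scale1r.
exists g => [chi|x]; last exact: gE.
by apply: inj; rewrite gE.
Qed.


End LinearisationMap.

(** * Every line bundle comes from a character *)

Section TorusWeights.
Variables (R : realType) (r n : nat) (A : 'M[int]_(r, n)).
Local Notation C := R[i].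
Local Notation V := (V R A).
Local Notation I2 := 'I_(n + n).
Implicit Types (v : V) (ka : 'rV[int]_n) (t : 'I_n -> C).

(** Weights of the coordinates for the full n-dimensional torus, which scales [z_i] and [w_i]
    inversely and so preserves [V]; their images under [A] are the weights of the coordinates for
    the acting torus. *)
Definition wT (k : I2) : 'rV[int]_n :=
  match fintype.split k with inl i => delta_mx 0 i | inr i => - delta_mx 0 i end.

Lemma wT_l i : wT (lshift n i) = delta_mx 0 i.
Proof. by rewrite /wT (unsplitK (inl i)). Qed.

Lemma wT_r i : wT (rshift n i) = - delta_mx 0 i.
Proof. by rewrite /wT (unsplitK (inr i)). Qed.

Lemma wT_At k : map_mx intr (wT k) *m At A = bQ A k.
Proof.
have d i : map_mx intr (delta_mx 0 i : 'rV[int]_n) = delta_mx 0 i :> 'rV[rat]_n.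
  by apply/rowP => j; rewrite !mxE; case: (_ && _).
by case: (coordP k) => i; rewrite ?wT_l ?wT_r ?map_mxN d ?mulNmx delta_At ?bQ_l ?bQ_r.
Qed.

Lemma tact_moment t (tn : forall i, t i != 0) v : moment A (\row_k (lmon t (wT k) * co v k)) = 0.
Proof.
apply/moment_coord => l; have /moment_coord := (set_valP v : moment A (aff_val v) = 0).
move=> h; rewrite -[RHS](h l); apply: eq_bigr => i _.
rewrite !mxE wT_l wT_r mulrACA -lmonD // subrr lmon0 mul1r; by [].
Qed.

Definition tact t tn v : V := mkV (@tact_moment t tn v).

Lemma co_tact t tn v k : co (@tact t tn v) k = lmon t (wT k) * co v k.
Proof. exact: co_mkV. Qed.

Section Signed.
Variable sg : 'I_n -> I2.
Hypothesis sgK : forall l, idx (sg l) = l.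

Definition ssgn l : int := if sg l == lshift n l then 1 else -1.

Lemma ssgnM l : ssgn l * ssgn l = 1.
Proof. by rewrite /ssgn; case: ifP. Qed.

Lemma wT_sg l : wT (sg l) = ssgn l *: delta_mx 0 l.
Proof.
rewrite /ssgn; have := sgK l; case: (coordP (sg l)) => i; rewrite ?idx_l ?idx_r => ->.
  by rewrite eqxx wT_l scale1r.
by rewrite -bar_l (negPf (bar_neq _)) bar_l wT_r scaleN1r.
Qed.

Definition mo ka v : C := \prod_l co v (sg l) ^ (ssgn l * ka 0 l).

Lemma mo_neq0 ka v : (forall k, co v k != 0) -> mo ka v != 0.
Proof. by move=> h; apply/prodf_neq0 => l _; apply: expfz_neq0. Qed.

Lemma moD ka ka' v : (forall k, co v k != 0) -> mo (ka + ka') v = mo ka v * mo ka' v.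
Proof.
move=> h; rewrite -big_split; apply: eq_bigr => l _.
by rewrite mxE mulrDr expfzDr.
Qed.

Lemma moB ka ka' v : (forall k, co v k != 0) -> mo (ka - ka') v = mo ka v / mo ka' v.
Proof.
move=> h; apply: (mulIf (mo_neq0 ka' h)); rewrite divfK ?mo_neq0 //.
by rewrite -moD // subrK.
Qed.

Lemma moZ m ka v : mo (m *: ka) v = mo ka v ^ m.
Proof.
rewrite /mo; elim/big_rec2: _ => [|l y x _ ->]; first by rewrite exp1rz.
by rewrite expfzMl exprz_exp mxE; congr (_ ^ _ * _); ring.
Qed.

Lemma mo_wT l v : mo (wT (sg l)) v = co v (sg l).
Proof.
rewrite wT_sg /mo (bigD1 l) //= big1 ?mulr1 => [|j jl].
  by rewrite !mxE !eqxx mulr1 ssgnM expr1z.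
by rewrite !mxE (negPf jl) andbF !mulr0 expr0z.
Qed.

Lemma mo_tact t tn ka v : mo ka (@tact t tn v) = lmon t ka * mo ka v.
Proof.
rewrite /lmon -big_split; apply: eq_bigr => l _ /=.
rewrite co_tact expfzMl wT_sg lmonZ lmon_delta exprz_exp mulrA ssgnM mul1r; by [].
Qed.

End Signed.

End TorusWeights.

Section FramesAsMonomials.
Variables (R : realType) (r n : nat) (A : 'M[int]_(r, n)) (theta : 'rV[rat]_r).
Hypothesis uni : forall J, base A J -> forall chi : 'rV[int]_r, iw A J (map_mx intr chi).
Local Notation V := (V R A).

Definition isol J (psi : 'rV[int]_r) : 'rV[int]_n := \row_j Num.floor (sol A J (map_mx intr psi) 0 j).

Lemma isolE J psi : base A J -> map_mx intr (isol J psi) = sol A J (map_mx intr psi).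
Proof. by move=> bJ; apply/rowP => j; rewrite !mxE floorK // uni. Qed.

Lemma fr_mo J psi (sg : 'I_n -> 'I_(n + n)) (v : V) : base A J ->
  (forall j, j \in J -> sg j = sc A theta J j) -> fr theta J psi v = mo sg (isol J psi) v.
Proof.
move=> bJ sJ; rewrite /mo (bigID (mem J)) /= [X in _ * X]big1 ?mulr1 => [|l nl].
  apply: eq_bigr => j jJ; rewrite sJ // /expo /ssgn sJ // mxE mulrC; congr (_ ^ (_ * _)).
  by rewrite /sc /sidx; case: ifP => _; rewrite ?eqxx // -bar_l (negPf (bar_neq _)).
by rewrite mxE sol_out // floor0 mulr0 expr0z.
Qed.

End FramesAsMonomials.

Lemma linearised_identity (K : fieldType) (kx ky f0 f1 f2 a c l : K) :
  a != 0 -> c != 0 -> l != 0 -> f0 != 0 -> f1 != 0 -> f2 != 0 ->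
  kx * (f1 / f0) * (c / a) = ky * (f2 / f0) -> kx / (l * a) * l = f2 / f1 * (ky / c).
Proof.
move=> a0 c0 l0 f00 f10 f20 e.
have -> : ky = kx * (f1 / f0) * (c / a) * (f0 / f2) by rewrite e; field; rewrite f20 f00.
by field; rewrite a0 c0 l0 f00 f10 f20.
Qed.

Lemma linearised_identityC (R : realType) (kx ky f0 f1 f2 a c l : R[i]) :
  a != 0 -> c != 0 -> l != 0 -> f0 != 0 -> f1 != 0 -> f2 != 0 ->
  kx * (f1 / f0) * (c / a) = ky * (f2 / f0) -> kx / (l * a) * l = f2 / f1 * (ky / c).
Proof. exact: linearised_identity. Qed.

Section PicardSurjective.
Variables (R : realType) (r n : nat) (A : 'M[int]_(r, n)) (theta : 'rV[rat]_r).
Hypothesis sT : spanning A [set: 'I_n]%SET.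
Hypothesis nc : nocoloop A.
Hypothesis uni : forall J, base A J -> forall chi : 'rV[int]_r, iw A J (map_mx intr chi).
Hypothesis gt : gen A theta.
Local Notation C := R[i].
Local Notation V := (V R A).
Local Notation X := (X R A theta).
Local Notation gU := (@gU R r n A theta gt).
Local Notation full v := (forall k, co v k != 0).
Local Notation fq hv := (qpt (full_Vss theta sT hv)).

Lemma full_open : exists O : set X, [/\ open O, O !=set0 &
  forall p, O p -> exists v : V, exists hv : full v, p = fq hv].
Proof.
have [v0 h0] := full_point R nc; have [J [bJ _]] := g_cover sT gt (fq h0).
pose P : mpoly (sdim J) C := \prod_k rest A theta J (mpolyX C (mnm1 k)).
have PE y : (ev P y != 0) = [forall k, co (slice theta bJ (cv y)) k != 0].
  rewrite /P ev_prod; have E k : ev (rest A theta J (mpolyX C (mnm1 k))) y = co (slice theta bJ (cv y)) k.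
    by rewrite (ev_rest theta bJ); exact: mevalXU.
  apply/prodf_neq0/forallP => h k; first by rewrite -E; exact: h.
  by move=> _; rewrite E; exact: h.
exists (gcpt gt bJ @` nonzero P); split.
- exact: (chart_image_open (g_iso R uni gt bJ) (nonzero P)).1 (nonzero_open P).
- have [g [c e]] := slice_transversal bJ (theta := theta) (v := v0) (fun j _ => h0 _).
  pose y := apt (\row_i c i) : affine_space C (sdim J).
  exists (gcpt gt bJ y), y => //; rewrite /nonzero /= PE; apply/forallP => k.
  have -> : slice theta bJ (cv y) = act g v0.
    by rewrite e; apply: eq_slice => i; rewrite /cv /aff_val /= mxE.
  by rewrite co_act mulf_neq0 ?chr_neq0.
move=> p [y /= Py <-]; have hv : full (slice theta bJ (cv y)).
  by move: Py; rewrite /nonzero /= PE => /forallP.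
by exists (slice theta bJ (cv y)), hv; apply/qpt_eq.
Qed.

Variable L : line_bundle X.
Variable u : {set 'I_n} -> X -> X -> C.
Hypothesis uP : forall J (bJ : base A J),
  [/\ forall x, reg (ldom L x `&` gU bJ) (u J x),
      forall x p, ldom L x p -> gU bJ p -> u J x p != 0 &
      forall x y p, ldom L x p -> ldom L y p -> gU bJ p -> ltr L x y p * u J y p = u J x p].

Definition rho J J' (p : X) : C := u J' p p / u J p p.

Lemma rho_local J J' (bJ : base A J) (bJ' : base A J') x p : ldom L x p -> gU bJ p -> gU bJ' p ->
  rho J J' p = u J' x p / u J x p.
Proof.
move=> Lx Up Up'; have [_ u0 uE] := uP bJ; have [_ u0' uE'] := uP bJ'.
have Lp := ldom_self L p.
rewrite -(uE x p p) // -(uE' x p p) // -mulf_div divff ?mul1r //; exact: ltr_neq0.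
Qed.

Lemma rho_neq0 J J' (bJ : base A J) (bJ' : base A J') p : gU bJ p -> gU bJ' p -> rho J J' p != 0.
Proof.
move=> Up Up'; have [_ u0 _] := uP bJ; have [_ u0' _] := uP bJ'.
by rewrite mulf_neq0 ?invr_neq0 ?u0 ?u0' //; exact: ldom_self.
Qed.

Lemma rho_trans J J' J'' (bJ' : base A J') p : gU bJ' p -> rho J J' p * rho J' J'' p = rho J J'' p.
Proof.
move=> Up; have [_ u0 _] := uP bJ'; apply: ratio_cocycle; apply: u0 => //; exact: ldom_self.
Qed.

Lemma rho_reg J J' (bJ : base A J) (bJ' : base A J') : reg (gU bJ `&` gU bJ') (rho J J').
Proof.
apply: reg_glue => p [Up Up']; have [ru u0 _] := uP bJ; have [ru' u0' _] := uP bJ'.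
exists (ldom L p); split; [exact: ldom_open|exact: ldom_self|].
apply: (@reg_ext _ _ _ (fun q => u J' p q / u J p q)) => [q [[Uq Uq'] Lq]|].
  by rewrite (rho_local Lq Uq Uq').
apply: reg_mul; first by apply: reg_res (ru' p) => q [[Uq Uq'] Lq].
apply: reg_inv; first by move=> q [[Uq Uq'] Lq]; exact: u0.
by apply: reg_res (ru p) => q [[Uq Uq'] Lq].
Qed.

(** In the chart of [J] the overlap is the complement of the hyperplane of the free coordinate
    [sg k]. A unit there is a constant times a power of that coordinate, which is then rewritten as
    a monomial on [V]. *)
Lemma edge_rho J J' : edge A theta J J' -> exists (c : C) (ka : 'rV[int]_n) (sg : 'I_n -> 'I_(n + n)),
  [/\ [/\ c != 0, forall l, idx (sg l) = l & map_mx intr ka *m At A = 0 :> 'rV[rat]_r],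
      forall l, ka 0 l != 0 -> (l \in J) || (l \in J'),
      (forall j, j \in J -> sg j = sc A theta J j) /\ (forall j, j \in J' -> sg j = sc A theta J' j) &
      forall v (hv : full v), rho J J' (fq hv) = c * mo sg ka v].
Proof.
move=> [bJ [bJ' [i [k [iJ kJ eJ ss]]]]]; subst J'.
pose sg := esg A theta J i k.
have sgJ := esg_J A theta i kJ; have sgJ' := esg_J' gt bJ kJ ss.
have kf : sg k \in free J by rewrite inE /sg esgK.
pose k0 : 'I_(sdim J) := enum_rank_in kf (sg k).
have k0E : fcoord k0 = sg k by rewrite /fcoord enum_rankK_in.
pose pk : mpoly (sdim J) C := mpolyX C (mnm1 k0).
have U'E y : gU bJ' (gcpt gt bJ y) <-> nonzero pk y.
  rewrite /nonzero /= evX_coord; split.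
    move=> /slice_openE/(_ k); rewrite !inE eqxx => /(_ isT).
    by rewrite -sgJ' ?inE ?eqxx // -[esg _ _ _ _ _ _]/(sg k) -k0E slice_free.
  move=> y0; apply/slice_openE => j jJ'; have [->|[jJ ji jk]] := in_J' jJ'.
    by rewrite -sgJ' ?inE ?eqxx // -[esg _ _ _ _ _ _]/(sg k) -k0E slice_free.
  by rewrite -sgJ' // sgJ // slice_one // oner_neq0.
have Ucpt y : gU bJ (gcpt gt bJ y) by exact: cpt_open.
have preE : gcpt gt bJ @^-1` (gU bJ `&` gU bJ') = nonzero pk.
  by apply/seteqP; split=> y; [move=> [_ /U'E]|move=> /U'E; split].
have oUU : open (gU bJ `&` gU bJ').
  by apply: openI; [exact: (@gU_open R r n A theta gt J bJ)|exact: (@gU_open R r n A theta gt _ bJ')].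
have rF : reg (nonzero pk) (fun y => rho J (k |: J :\ i)%SET (gcpt gt bJ y)).
  rewrite -preE; apply/(chart_reg (g_iso R uni gt bJ) _ oUU); first by move=> ? [].
  exact: rho_reg.
have [|c [m [c0 cE]]] := unit_monomial rF.
  by move=> y /U'E h; exact: rho_neq0 (Ucpt y) h.
pose psi := bvec A (sg k).
have moE (v : V) : full v -> fr theta J psi v = mo sg (isol A J psi) v.
  by move=> _; apply: fr_mo => // j jJ; exact: sgJ.
(* After normalisation to the slice, the free coordinate of [v] becomes its coordinate at [sg k]
   divided by the frame of the same weight: this is the exponent inside the parentheses. *)
exists c, (m *: (wT (sg k) - isol A J psi)), sg; split.
- split=> //; first by move=> l; exact: esgK.
  have -> : map_mx intr (m *: (wT (sg k) - isol A J psi)) = m%:~R *: (map_mx intr (wT (sg k)) - map_mx intr (isol A J psi)) :> 'rV[rat]_n.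
    by apply/rowP => l; rewrite !mxE intrM intrB.
  rewrite -scalemxAl mulmxBl wT_At isolE //.
  by have [_ ->] := sol_spec (map_mx intr psi) bJ; rewrite subrr scaler0.
- move=> l; rewrite !inE; have [->|lk] := eqVneq l k; first by rewrite orbT.
  have [//|nl] := boolP (l \in J); rewrite wT_sg; last by move=> l'; exact: esgK.
  by rewrite !mxE (negPf lk) andbF mulr0 sol_out // floor0 subr0 mulr0 eqxx.
- by split=> j; [exact: sgJ|exact: sgJ'].
move=> v hv; have [g [c' e]] := slice_transversal bJ (theta := theta) (v := v) (fun j _ => hv _).
pose y := apt (\row_i c' i) : affine_space C (sdim J).
have ye : slice theta bJ (cv y) = act g v.
  by rewrite e; apply: eq_slice => l; rewrite /cv /aff_val /= mxE.
have -> : fq hv = gcpt gt bJ y.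
  apply/qpt_eq; rewrite ye; exact: same_ideal_act.
have yk : aff_val y 0 k0 = chr psi g * co v (sg k).
  by have := slice_free theta bJ (cv y) k0; rewrite k0E ye co_act => /esym.
have y0 : nonzero pk y.
  by rewrite /nonzero /= evX_coord yk mulf_neq0 ?chr_neq0.
rewrite cE // yk moZ; congr (_ * _ ^ _).
rewrite moB // mo_wT; last by move=> l; exact: esgK.
rewrite -moE // mulrC; congr (_ * _).
have := fr_act theta uni psi g v bJ; rewrite -ye.
have -> : fr theta J psi (slice theta bJ (cv y)) = 1.
  by rewrite /fr big1 // => j jJ; rewrite slice_one // exp1rz.
have f0 : fr theta J psi v != 0 by apply: fr_neq0 => j _; exact: hv.
by move=> h; apply: (mulIf f0); rewrite -h mulVf.
Qed.

Lemma tact_full t (tn : forall i : 'I_n, t i != 0 :> C) (v : V) : full v -> full (@tact R r n A t tn v).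
Proof. by move=> hv k; rewrite co_tact mulf_neq0 // lmon_neq0. Qed.

(** Transition functions as eigenfunctions of the n-dimensional torus. The weight is unique and
    additive along paths of bases, so it records the exponent without a choice of coordinates. *)
Definition rho_weight J J' (ka : 'rV[int]_n) := forall t (tn : forall i, t i != 0) (v : V) (hv : full v),
  rho J J' (fq (tact_full tn hv)) = lmon t ka * rho J J' (fq hv).

Lemma edge_weight J J' c ka sg : (forall l, idx (sg l) = l) ->
  (forall v (hv : full v), rho J J' (fq hv) = c * mo sg ka v) -> rho_weight J J' ka.
Proof. by move=> sgK E t tn v hv; rewrite !E mo_tact // mulrCA. Qed.

Lemma weight_trans J J' J'' ka ka' (bJ' : base A J') : rho_weight J J' ka -> rho_weight J' J'' ka' ->
  rho_weight J J'' (ka + ka').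
Proof.
move=> h h' t tn v hv.
have U w (hw : full w) : gU bJ' (fq hw) := gU_full gt bJ' _ hw.
have e1 := @rho_trans J J' J'' bJ' _ (U _ hv); have e2 := @rho_trans J J' J'' bJ' _ (U _ (tact_full tn hv)).
by rewrite -e1 -e2 h h' lmonD // mulrACA.
Qed.

Lemma weight_unique J J' ka ka' (bJ : base A J) (bJ' : base A J') :
  rho_weight J J' ka -> rho_weight J J' ka' -> ka = ka'.
Proof.
move=> h h'; apply/eqP; rewrite -subr_eq0; apply: contraT => /(lmon_separates C)[t tn].
have [v hv] := full_point R nc; case/negP; apply/eqP.
have U0 J1 (b1 : base A J1) : gU b1 (fq hv) := gU_full gt b1 _ hv.
have r0 := rho_neq0 (U0 _ bJ) (U0 _ bJ').
have : lmon t ka = lmon t ka' by apply: (mulIf r0); rewrite -h -h'.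
by rewrite lmonD // lmonN // => ->; rewrite divff // lmon_neq0.
Qed.

(** The weights [kap J] of the transitions from a fixed base are all of the form
    [psit + isol A J psi]. Differences of such weights are those of the frames of [psi], so the two
    bundles have the same transitions up to constants, which are absorbed into the frames. *)
Lemma line_bundle_linearised : exists psi, lb_iso L (lbof R sT uni gt psi).
Proof.
have [J0 [b0 _ _]] := extend_base (@indep0 r n A) sT (finset.sub0set _).
have w0 J (bJ : base A J) : rho_weight J J 0.
  have rr v (hv : full v) : rho J J (fq hv) = 1.
    rewrite /rho; have [_ u0 _] := uP bJ; rewrite divff //.
    by apply: u0; [exact: ldom_self|exact: (@gU_full R r n A theta gt J bJ)].
  by move=> t tn v hv; rewrite lmon0 mul1r !rr.
pose null (ka : 'rV[int]_n) := map_mx intr ka *m At A = 0 :> 'rV[rat]_r.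
have connect (Q : {set 'I_n} -> {set 'I_n} -> Prop) : (forall J, Q J J) -> (forall J J' J'', base A J' -> Q J J' -> Q J' J'' -> Q J J'') ->
    (forall J J', edge A theta J J' -> Q J J') -> forall J J', base A J -> base A J' -> Q J J'.
  move=> q1 q2 q3 J J' bJ bJ'.
  by apply: (@base_connected r n A theta [set: 'I_n]%SET Q gt q1 q2 (fun _ _ _ _ => q3 _ _) J J') => //; exact: finset.subsetT.
have exw J J' : base A J -> base A J' -> exists ka, null ka /\ rho_weight J J' ka.
  move=> bJ bJ'; move: (bJ) (bJ').
  apply: (connect (fun J J' => base A J -> base A J' -> exists ka, null ka /\ rho_weight J J' ka)) => // {J J' bJ bJ'}.
  - by move=> J bJ _; exists 0; split; [rewrite /null map_mx0 mul0mx|exact: w0].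
  - move=> J J' J'' bJ' h h' bJ bJ''; have [k1 [n1 w1]] := h bJ bJ'; have [k2 [n2 w2]] := h' bJ' bJ''.
    exists (k1 + k2); split; first by rewrite /null map_mxD mulmxDl n1 n2 addr0.
    exact: (weight_trans bJ' w1 w2).
  - move=> J J' eJ _ _; have [c [ka [sg [[c0 sgK nk] _ _ E]]]] := edge_rho eJ.
    by exists ka; split=> //; exact: edge_weight sgK E.
have /choice[kap kapP] : forall J, exists ka, base A J -> null ka /\ rho_weight J0 J ka.
  move=> J; have [bJ|nb] := pselect (base A J); last by exists 0.
  by have [ka h] := exw J0 J b0 bJ; exists ka.
have kap_edge J J' c ka sg : base A J -> base A J' -> (forall l, idx (sg l) = l) ->
    (forall v (hv : full v), rho J J' (fq hv) = c * mo sg ka v) -> ka = kap J' - kap J.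
  move=> bJ bJ' sgK E; have [_ w1] := kapP J bJ; have [_ w2] := kapP J' bJ'.
  have := weight_unique b0 bJ' (weight_trans bJ w1 (edge_weight sgK E)) w2.
  by move=> <-; rewrite addrC addKr.
have /choice[Jb JbP] : forall i : 'I_n, exists J, base A J /\ J \subset finset.setC [set i]%SET.
  by move=> i; have [J] := base_avoiding i nc sT; exists J.
(* The i-th entry is read in any base avoiding [i]: an edge between two such bases involves no
   column [i], so the entry is constant on them. *)
pose psit : 'rV[int]_n := \row_i kap (Jb i) 0 i.
have kap_out J i : base A J -> i \notin J -> kap J 0 i = psit 0 i.
  move=> bJ iJ; rewrite mxE; have [bi si] := JbP i.
  have sJ : J \subset finset.setC [set i]%SET.
    by apply/fintype.subsetP => j jJ; rewrite !inE; apply: contraNneq iJ => <-.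
  apply: (@base_connected r n A theta (finset.setC [set i]%SET) (fun J J' => kap J 0 i = kap J' 0 i) gt) => //.
    by move=> ? ? ? _ -> .
  move=> J1 J2 s1 s2 eJ; have [c [ka [sg [[c0 sgK nk] sup _ E]]]] := edge_rho eJ.
  have [b1 [b2 _]] := eJ; have kE := kap_edge _ _ _ _ _ b1 b2 sgK E.
  have : ka 0 i = 0.
    apply/eqP; apply: contraT => /sup /orP[/(fintype.subsetP s1)|/(fintype.subsetP s2)];
      by rewrite !inE eqxx.
  by rewrite kE !mxE => /eqP; rewrite subr_eq0 => /eqP.
(* All [kap J] map to 0 under [A], so [kap J - psit], which is supported in [J], maps to [psi] and
   is its coordinate vector. *)
pose psi : 'rV[int]_r := - \sum_i psit 0 i *: (col i A)^T.
have psiE : map_mx intr psi = - (map_mx intr psit *m At A) :> 'rV[rat]_r.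
  apply/rowP => l; rewrite !mxE summxE rmorphN rmorph_sum; congr (- _); apply: eq_bigr => i _.
  by rewrite mxE rmorphM !mxE.
have kapE J : base A J -> kap J = psit + isol A J psi.
  move=> bJ; apply: intr_mx_inj; rewrite map_mxD isolE //.
  apply/eqP; rewrite addrC -subr_eq; apply/eqP/esym.
  have [nk _] := kapP J bJ; apply: (sol_uniq bJ); last by rewrite mulmxBl nk psiE sub0r.
  move=> j; rewrite !mxE; apply: contraNT => nj.
  by rewrite (kap_out J j bJ nj) mxE subrr.
exists psi.
pose frp J (v : V) := fr theta J psi v.
have frp0 J (v : V) : full v -> frp J v != 0 by move=> hv; apply: fr_neq0 => j _; exact: hv.
have exc J J' : base A J -> base A J' -> exists2 c, c != 0 &
    forall v (hv : full v), rho J J' (fq hv) = c * (frp J' v / frp J v).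
  move=> bJ bJ'; move: (bJ) (bJ').
  apply: (connect (fun J J' => base A J -> base A J' -> exists2 c, c != 0 &
    forall v (hv : full v), rho J J' (fq hv) = c * (frp J' v / frp J v))) => // {J J' bJ bJ'}.
  - move=> J bJ _; exists 1; first exact: oner_neq0.
    move=> v hv; rewrite mul1r /rho; have [_ u0 _] := uP bJ; rewrite !divff ?frp0 //.
    by apply: u0; [exact: ldom_self|exact: (@gU_full R r n A theta gt J bJ)].
  - move=> J J' J'' bJ' h h' bJ bJ''; have [c1 c10 E1] := h bJ bJ'; have [c2 c20 E2] := h' bJ' bJ''.
    exists (c1 * c2); first exact: mulf_neq0.
    move=> v hv; have e1 := @rho_trans J J' J'' bJ' _ (gU_full gt bJ' _ hv).
    by rewrite -e1 E1 E2 mulrACA ratio_cocycle // frp0.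
  - move=> J J' eJ bJ bJ'; have [c [ka [sg [[c0 sgK nk] _ [s1 s2] E]]]] := edge_rho eJ.
    exists c => // v hv; rewrite E; congr (_ * _).
    rewrite (kap_edge _ _ _ _ _ bJ bJ' sgK E) (kapE J) // (kapE J') // opprD addrACA subrr add0r.
    by rewrite moB // /frp (fr_mo psi v bJ s1) (fr_mo psi v bJ' s2).
have /choice[kp kpP] : forall J, exists c, base A J -> c != 0 /\
    forall v (hv : full v), rho J0 J (fq hv) = c * (frp J v / frp J0 v).
  move=> J; have [bJ|nb] := pselect (base A J); last by exists 0.
  by have [c c0 E] := exc J0 J b0 bJ; exists c.
pose cj (x : X) := cJ sT gt x; pose cu (x : X) := cU sT gt x.
pose bc (x : X) : base A (cj x) := cb sT gt x.
have cu_open x : open (cu x) by exact: cU_open.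
(* The frame of [L] over each chart is rescaled by its constant [kp]; compatibility is checked on
   the dense open set of points without zero coordinate. *)
exists (fun x => ldom L x `&` cu x), (fun x p => kp (cj x) / u (cj x) x p); split=> [x|x y p Wx Wy].
  have [ru u0 _] := uP (bc x); have [k0 _] := kpP _ (bc x); split.
  - by apply: openI => //; exact: ldom_open.
  - by split; [exact: ldom_self|exact: cU_self].
  - by [].
  - apply: reg_mul; first exact: reg_cst.
    by apply: reg_inv; [move=> q [Lq Uq]; exact: (u0 x q Lq Uq)|exact: (ru x)].
  - by move=> q [Lq Uq]; rewrite mulf_neq0 ?invr_neq0 //; exact: u0.
have [O [oO O0 Ofull]] := full_open.
have [rux u0x uEx] := uP (bc x); have [ruy u0y _] := uP (bc y).
pose W := (ldom L x `&` cu x) `&` (ldom L y `&` cu y).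
have oW : open W by exact: (openI (openI (ldom_open L x) (cu_open x)) (openI (ldom_open L y) (cu_open y))).
pose M := lbof R sT uni gt psi.
have rf : reg W (fun p => kp (cj x) / u (cj x) x p * ltr L x y p).
  apply: reg_mul; last by apply: reg_res (ltr_reg L x y) => q [[? _] [? _]].
  apply: reg_mul; first exact: reg_cst.
  apply: reg_inv; first by move=> q [[Lq Uq] _]; exact: (u0x x q Lq Uq).
  by apply: reg_res (rux x) => q [].
have rg : reg W (fun p => ltr M x y p * (kp (cj y) / u (cj y) y p)).
  apply: reg_mul; first by apply: reg_res (ltr_reg M x y) => q [[_ ?] [_ ?]].
  apply: reg_mul; first exact: reg_cst.
  apply: reg_inv; first by move=> q [_ [Lq Uq]]; exact: (u0y y q Lq Uq).
  by apply: reg_res (ruy y) => q [].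
have O0' : setT `&` O !=set0 by have [q Oq] := O0; exists q.
refine (@reg_agree _ X setT O W _ _ (X_irreducible R sT nc gt) oW oO O0' rf rg _ p I (conj Wx Wy)).
move=> q _ /Ofull[v [hv ->]] [[Lx Ux] [Ly Uy]].
have -> : ltr M x y (fq hv) = frp (cj y) v / frp (cj x) v by exact: (ratio_desc sT uni gt x y psi (full_Vss theta sT hv)).
have [kx0 Ex] := kpP _ (bc x); have [ky0 Ey] := kpP _ (bc y).
have := @rho_trans J0 (cj x) (cj y) (bc x) _ Ux; rewrite Ex Ey (rho_local Ly Ux Uy).
rewrite -(uEx x y) //.
have a0 := u0x y _ Ly Ux; have c0 := u0y y _ Ly Uy; have l0 := ltr_neq0 Lx Ly.
have f0 := frp0 J0 v hv; have f1 := frp0 (cj x) v hv; have f2 := frp0 (cj y) v hv.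
exact: (linearised_identityC a0 c0 l0 f0 f1 f2).
Qed.


End PicardSurjective.

Section Setup.
Variables (R : realType) (r n : nat) (A : 'M[int]_(r, n)) (B : 'M[int]_(n, n - r)).
Local Notation C := R[i].

Lemma map_ratr_col (x : 'cV[int]_n) : map_mx intr x^T *m At A = (map_mx intr (A *m x))^T :> 'rV[rat]_r.
Proof.
by rewrite /At map_mxM trmx_mul !map_trmx.
Qed.

Lemma lattice_spanning : spans_lattice A -> spanning A [set: 'I_n]%SET.
Proof.
move=> h eta; have /choice[x xP] : forall l : 'I_r, exists x : 'cV[int]_n, delta_mx l 0 = A *m x.
  by move=> l; exact: h.
exists (\sum_l eta 0 l *: map_mx intr (x l)^T); first by move=> j _; rewrite inE.
rewrite mulmx_suml [RHS](row_sum_delta eta); apply: eq_bigr => l _.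
rewrite -scalemxAl map_ratr_col -xP; congr (_ *: _); apply/rowP => j.
by rewrite !mxE !eqxx andbT /=; case: (j == l).
Qed.

Lemma gale_nocoloop : gale_dual A B -> (forall i, row i B != 0) -> nocoloop A.
Proof.
move=> [_ hB _] rB i; have /rV0Pn[c] := rB i; rewrite !mxE => Bic.
exists (map_mx intr (col c B)^T); last by rewrite !mxE intr_eq0.
have /hB e : exists x, col c B = B *m x by exists (delta_mx c 0); rewrite colE.
by rewrite map_ratr_col e map_mx0 trmx0.
Qed.

Lemma gen_generic eta : spanning A [set: 'I_n]%SET -> gen A eta -> generic R A eta.
Proof.
move=> sT ge; split.
  have [J [bJ _ _]] := extend_base (@indep0 r n A) sT (finset.sub0set _).
  by exists (slice eta bJ (fun=> 0)); exact: (slice_Vss bJ (ge J bJ)).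
by move=> v vss; apply: interior_stable; exact: (gen_interior sT ge vss).
Qed.

(** Each base [J] occurs in the chart at the origin of a slice for some generic [eta], and
    smoothness at that origin puts every column in the lattice of [J]. *)
Lemma smooth_unimodular : nocoloop A -> spans_lattice A ->
  (forall eta, generic R A eta -> nonsingular (X R A eta)) ->
  forall J, base A J -> forall chi : 'rV[int]_r, iw A J (map_mx intr chi).
Proof.
move=> nc sl sm J bJ chi; have sT := lattice_spanning sl.
have [eta ge _] := gen_exists (s := fun=> 1) bJ (fun _ => oner_neq0 _).
have ii i : iw A J (aQ A i).
  exact: (nonsingular_integral bJ (ge J bJ) i (sm _ (gen_generic sT ge))).
have [x ex] := sl chi^T.
have -> : map_mx intr chi = \sum_i (x i 0)%:~R *: aQ A i :> 'rV[rat]_r.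
  have := map_ratr_col x; rewrite -ex map_trmx trmxK => <-; rewrite mulAt.
  by apply: eq_bigr => i _; rewrite !mxE.
elim/big_rec: _ => [|i w _ hw]; first by move=> j; rewrite sol0 // mxE rpred0.
apply: (iwD bJ) => // j; rewrite solZ // mxE; apply: rpredM; first exact: intr_int.
exact: ii.
Qed.

End Setup.

Section Picard.
Variables (R : realType) (r n : nat) (A : 'M[int]_(r, n)) (theta : 'rV[rat]_r).
Hypothesis sT : spanning A [set: 'I_n]%SET.
Hypothesis nc : nocoloop A.
Hypothesis uni : forall J, base A J -> forall chi : 'rV[int]_r, iw A J (map_mx intr chi).
Hypothesis gt : gen A theta.
Local Notation X := (X R A theta).

Lemma linearisation_iso : exists L_C : {linear 'rV[rat]_r -> PicQ R A theta},
  linearisation_map L_C /\ bijective L_C.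
Proof.
apply: (linearisation_bijective (sT := sT) nc (uni := uni) (gt := gt)) => L.
have /choice[u uP] : forall J, exists u : X -> X -> R[i], forall bJ : base A J,
    [/\ forall x, reg (ldom L x `&` gU gt bJ) (u x),
      forall x p, ldom L x p -> gU gt bJ p -> u x p != 0 &
      forall x y p, ldom L x p -> ldom L y p -> gU gt bJ p -> ltr L x y p * u y p = u x p].
  move=> J; have [bJ|nb] := pselect (base A J); last by exists (fun _ _ => 0).
  have [u uP] := chart_frame (g_iso R uni gt bJ) (X_irreducible R sT nc gt) L.
  by exists u => bJ'; rewrite (Prop_irrelevance bJ' bJ).
exact: (line_bundle_linearised sT nc uni (u := u) (fun J bJ => uP J bJ)).
Qed.

End Picard.

Import numFieldTopology.Exports.

(** * Chambers and walls *)

Section RationalSpace.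
Variable r : nat.
Local Notation E := 'rV[rat]_r.
Local Notation ET := 'rV[rat^o]_r.
Implicit Types (x y d : E) (U : set ET).

Lemma rat_nbhsP x U : nbhs (x : ET) U <->
  exists2 e : rat, 0 < e & forall y, (forall j, `|x 0 j - y 0 j| < e) -> U y.
Proof.
split=> [[P xP PU]|[e e0 eU]].
  have /choice[e eP] : forall j, exists e : rat, 0 < e /\ forall a : rat, `|x 0 j - a| < e -> P 0 j a.
    by move=> j; have [e /= e0 h] := xP 0 j; exists e; split=> // a; exact: h.
  have s0 : 0 <= \sum_j (e j)^-1 by apply: sumr_ge0 => j _; rewrite invr_ge0 ltW //; have [] := eP j.
  (* A positive number below every [e j]; the summand 1 covers the empty sum. *)
  exists (1 + \sum_j (e j)^-1)^-1; first by rewrite invr_gt0 ltr_wpDr.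
  move=> y h; apply: PU => i j; rewrite (ord1 i); have [ej0 ej] := eP j; apply: ej.
  apply: lt_le_trans (h j) _; rewrite -[leRHS]invrK lef_pV2 ?posrE ?invr_gt0 ?ltr_wpDr //.
  rewrite (bigD1 j) //= addrCA ler_wpDr // addr_ge0 // sumr_ge0 // => l _.
  by rewrite invr_ge0 ltW //; have [] := eP l.
exists (fun i j => ball_ (fun a : rat => `|a|) (x i j) e) => [i j|y h]; first by exists e.
by apply: eU => j; exact: h.
Qed.

Definition linear_form (f : E -> rat) := (forall x y, f (x + y) = f x + f y) /\ forall a x, f (a *: x) = a * f x.

Variable f : E -> rat.
Hypothesis lf : linear_form f.

Lemma lf0 : f 0 = 0.
Proof. by have := lf.2 0 0; rewrite scale0r mul0r. Qed.

Lemma lfN x : f (- x) = - f x.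
Proof. by rewrite -scaleN1r lf.2 mulN1r. Qed.

Lemma lfB x y : f (x - y) = f x - f y.
Proof. by rewrite lf.1 lfN. Qed.

Lemma lf_sum (I : Type) (s : seq I) (g : I -> E) : f (\sum_(i <- s) g i) = \sum_(i <- s) f (g i).
Proof.
elim: s => [|i s IH]; first by rewrite !big_nil lf0.
by rewrite !big_cons lf.1 IH.
Qed.

Lemma lfE x : f x = \sum_j x 0 j * f (delta_mx 0 j).
Proof. by rewrite {1}(row_sum_delta x) lf_sum; apply: eq_bigr => j _; rewrite lf.2. Qed.

Lemma form_pos_nbhs x : 0 < f x -> nbhs (x : ET) [set y | 0 < f y].
Proof.
move=> fx; apply/rat_nbhsP; pose S := 1 + \sum_j `|f (delta_mx 0 j)|.
have S0 : 0 < S by rewrite ltr_wpDr // sumr_ge0.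
exists (f x / S); first by rewrite divr_gt0.
move=> y h /=; suff : f (x - y) < f x by rewrite lfB; lra.
apply: le_lt_trans (ler_norm _) _; rewrite lfE.
apply: le_lt_trans (ler_norm_sum _ _ _) _.
apply: (@le_lt_trans _ _ (\sum_j f x / S * `|f (delta_mx 0 j)|)).
  by apply: ler_sum => j _; rewrite normrM ler_wpM2r // ltW // !mxE; exact: h.
rewrite -mulr_sumr -[ltRHS](divfK (lt0r_neq0 S0)) ltr_pM2l ?divr_gt0 //.
by rewrite /S; lra.
Qed.

End RationalSpace.

Lemma nbhs_line r (x d : 'rV[rat]_r) (U : set 'rV[rat^o]_r) : nbhs (x : 'rV[rat^o]_r) U ->
  exists2 e : rat, 0 < e & U (x + e *: d) /\ U (x - e *: d).
Proof.
move=> /rat_nbhsP[e e0 eU]; pose S := 1 + \sum_j `|d 0 j|.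
have S0 : 0 < S by rewrite ltr_wpDr // sumr_ge0.
have dS j : `|d 0 j| < S.
  rewrite /S (bigD1 j) //= addrCA ltr_pwDr // ltr_wpDr // sumr_ge0 // => *; exact: normr_ge0.
have h j : `|e / S * d 0 j| < e.
  rewrite normrM gtr0_norm ?divr_gt0 // -[ltRHS](divfK (lt0r_neq0 S0)) ltr_pM2l ?divr_gt0 //.
exists (e / S); first by rewrite divr_gt0.
split; apply: eU => j; rewrite !mxE.
  by rewrite opprD addrA subrr add0r normrN; exact: h.
by rewrite opprB addrC subrK; exact: h.
Qed.

Section Cells.
Variables (r : nat) (T : finType) (ok : T -> Prop) (F : T -> 'rV[rat]_r -> rat).
Local Notation E := 'rV[rat]_r.
Local Notation ET := 'rV[rat^o]_r.
Hypothesis lF : forall t, linear_form (F t).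
Variable P : set E.
Hypothesis PE : forall x, P x <-> forall t, ok t -> 0 < F t x.
Variable theta : E.
Hypothesis Pt : P theta.

Lemma positive_nbhs (x : E) : nbhs (x : ET) [set y | forall t, ok t -> 0 < F t x -> 0 < F t y].
Proof.
refine (@filter_forall ET T (fun t => [set y | ok t -> 0 < F t x -> 0 < F t y]) (nbhs (x : ET)) _ _) => t; have [o|no] := pselect (ok t); last first.
  by apply: (filterS (P := setT)) => [y _ /no|]; [|exact: filterT].
have [p|np] := boolP (0 < F t x); last first.
  by apply: (filterS (P := setT)) => [y _ _|]; [|exact: filterT].
by apply: filterS (form_pos_nbhs (lF t) p) => y Fy _ _; exact: Fy.
Qed.

(** A point where the forms are only nonnegative enters the cell as soon as it is moved slightly in
    the direction of [theta]. *)
Lemma cell_closure : clQ P = [set x | forall t, ok t -> 0 <= F t x].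
Proof.
apply/seteqP; split=> x.
  move=> cx t ok_t; rewrite leNgt; apply/negP => neg.
  have lN : linear_form (fun y => - F t y).
    by split=> [y z|a y]; rewrite ?(lF t).1 ?(lF t).2 ?opprD ?mulrN.
  have p : 0 < - F t x by rewrite oppr_gt0.
  have [y [Py /= Fy]] := cx _ (form_pos_nbhs lN p).
  by have := (PE y).1 Py t ok_t; rewrite -oppr_lt0 ltNge (ltW Fy).
move=> h U xU; have [e e0 [Ue _]] := nbhs_line theta xU.
exists (x + e *: theta); split=> //; apply/PE => t ok_t.
by rewrite (lF t).1 (lF t).2 ltr_wpDl ?h // mulr_gt0 //; exact: (PE theta).1.
Qed.

Lemma cell_sub : P `<=` clQ P.
Proof. by move=> x Px; rewrite cell_closure => t /((PE x).1 Px)/ltW. Qed.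

Section Facet.
Variable W : set E.
Hypothesis fW : facet W (clQ P).

Lemma facet_basis : exists k (M : 'M[rat]_(k, r)), [/\ forall i, W (row i M), forall x, W x -> (x <= M)%MS,
  forall x, Defs.span W x <-> (x <= M)%MS, forall x, clQ P x -> (x <= M)%MS -> W x & (\rank M).+1 = r].
Proof.
have [[l [lP WE]] [k [M [WM sM rM]]]] := fW; exists k, M; split=> // x; last first.
  move=> cx /submxP[u e]; rewrite WE; split=> //; rewrite e -mulmxA.
  suff -> : M *m l = 0 by rewrite mulmx0.
  by apply/row_matrixP => i; rewrite row_mul row0; move: (WM i); rewrite WE => -[].
split=> [[k' [M' [WM' sx]]]|]; last by exists k, M.
by apply: submx_trans sx _; apply/row_subP => i; exact: sM.
Qed.

Lemma facet_pos y t : W y -> ok t -> 0 <= F t y.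
Proof. by move=> Wy; have [[l [lP WE]] _] := fW; move: Wy t; rewrite WE cell_closure => -[]. Qed.

Lemma facet_cl y : W y -> clQ P y.
Proof. by have [[l [lP WE]] _] := fW; rewrite WE => -[]. Qed.

(** The sum of a spanning family of [W] works: a form nonnegative on [W] that is zero at the sum is
    zero on each member, hence on the span. *)
Lemma facet_relint : exists x, relint W x.
Proof.
have [k [M [WM sM spM clM rM]]] := facet_basis.
pose x := \sum_i row i M; have xF t : F t x = \sum_i F t (row i M) by rewrite (lf_sum (lF t)).
have Wx : W x.
  apply: clM; last by apply: summx_sub => i _; exact: row_sub.
  rewrite cell_closure => t ok_t; rewrite xF sumr_ge0 // => i _; exact: facet_pos.
exists x; split=> //; have [U [oU Ux] Us] : exists2 U : set ET, open U /\ U x &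
    U `<=` [set y | forall t, ok t -> 0 < F t x -> 0 < F t y].
  by have := positive_nbhs x; rewrite nbhsE => -[U [oU Ux] h]; exists U.
exists U; split=> // y [Uy /spM My]; apply: (clM) => //; rewrite cell_closure => t ok_t.
have [z|nz] := eqVneq (F t x) 0; last by apply/ltW/(Us _ Uy) => //; rewrite lt_def nz facet_pos.
have [u ->] := submxP My; move: z; rewrite xF => /eqP; rewrite psumr_eq0 => [/allP z|i _]; last exact: facet_pos.
rewrite mulmx_sum_row (lf_sum (lF t)) big1 // => i _.
by rewrite (lF t).2 (eqP (z i (mem_index_enum i))) mulr0.
Qed.

Lemma facet_decomp k (M : 'M[rat]_(k, r)) (x d : E) : (\rank M).+1 = r -> ~~ (d <= M)%MS ->
  exists2 a : rat, (x - a *: d <= M)%MS & True.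
Proof.
move=> rM dM; have full : row_full (M + d)%MS.
  rewrite /row_full eqn_leq rank_leq_col leqNgt; apply: contra dM => h0.
  have h : (\rank (M + d)%MS <= \rank M)%N by rewrite -ltnS rM.
  have e : (M + d <= M)%MS.
    by have [_ <-] := mxrank_leqif_sup (addsmxSl M d); rewrite eqn_leq h mxrankS // addsmxSl.
  by apply: submx_trans e; exact: addsmxSr.
have := submx_full x full => /sub_addsmxP[[u v] /= ->].
exists (v 0 0) => //; have -> : v *m d = v 0 0 *: d by rewrite [v]mx11_scalar mul_scalar_mx mxE eqxx.
by rewrite addrK submxMl.
Qed.

Variable x0 : E.
Hypothesis rx0 : relint W x0.

Lemma relint_in : W x0. Proof. by have [] := rx0. Qed.

Lemma relint_zero_span t : ok t -> F t x0 = 0 -> forall w, Defs.span W w -> F t w = 0.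
Proof.
move=> ok_t z w /[dup] sw; have [k [M [_ sM spM _ _]]] := facet_basis => /spM Mw.
have [Wx0 [U [oU Ux UW]]] := rx0; have Mx0 := sM _ Wx0.
have [e e0 [U1 U2]] := nbhs_line w (open_nbhs_nbhs (conj oU Ux)).
have h1 : W (x0 + e *: w) by apply: UW; split=> //; apply/spM; rewrite addmx_sub // scalemx_sub.
have h2 : W (x0 - e *: w) by apply: UW; split=> //; apply/spM; rewrite addmx_sub // -scaleNr scalemx_sub.
have := facet_pos h1 ok_t; have := facet_pos h2 ok_t.
rewrite (lfB (lF t)) (lF t).1 (lF t).2 z => g1 g2.
have : e * F t w = 0 by lra.
by move/eqP; rewrite mulf_eq0 gt_eqF // => /eqP.
Qed.

(** If no form vanished at [x0], then [x0] would be interior to the cell, the supporting functional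
    would be zero and [W] would span everything. All forms vanishing at [x0] vanish on the
    hyperplane of [W], hence are proportional, positively so because of [theta]. *)
Lemma facet_form : exists t0, [/\ ok t0, F t0 x0 = 0,
  forall t, ok t -> F t x0 = 0 -> exists2 c, 0 < c & forall y, F t y = c * F t0 y &
  W = [set x | clQ P x /\ F t0 x = 0]].
Proof.
have [k [M [WM sM spM clM rM]]] := facet_basis; have Wx0 := relint_in.
have Fth t : ok t -> 0 < F t theta by exact: (PE theta).1.
have vM t : ok t -> F t x0 = 0 -> forall w, (w <= M)%MS -> F t w = 0.
  by move=> ot z w /spM; exact: relint_zero_span.
have [t0 [ot0 z0]] : exists t, ok t /\ F t x0 = 0.
  apply: contrapT => no; have Px0 : P x0.
    apply/PE => t ot; rewrite lt_def facet_pos // andbT; apply/eqP => z; by apply: no; exists t.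
  have nP : nbhs (x0 : ET) P.
    apply: filterS (positive_nbhs x0) => y h; apply/PE => t ot; apply: h => //; exact: (PE x0).1.
  have [[l [lP WE]] _] := fW.
  have l0 (d : E) : (d *m l) 0 0 = 0.
    have [e e0 [U1 U2]] := nbhs_line d nP; move: Wx0; rewrite WE => -[_ x0l].
    have := lP _ (cell_sub U1); have := lP _ (cell_sub U2).
    rewrite mulmxBl mulmxDl -scalemxAl x0l sub0r add0r !mxE => g1 g2.
    have z : e * \sum_j d 0 j * l j 0 = 0 by lra.
    by move/eqP: z; rewrite mulf_eq0 gt_eqF // => /eqP.
  have allM (d : E) : (d <= M)%MS.
    have [e e0 [U1 U2]] := nbhs_line d nP.
    have W1 : W (x0 + e *: d) by rewrite WE; split; [exact: cell_sub|apply/rowP => i; rewrite (ord1 i) l0 mxE].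
    have : (e *: d <= M)%MS by rewrite -[e *: d](addKr x0) addmx_sub ?eqmx_opp ?sM.
    by rewrite (eqmx_scale _ (lt0r_neq0 e0)).
  have : row_full M by rewrite -sub1mx; apply/row_subP.
  by rewrite /row_full => /eqP e; have := rM; rewrite e => /eqP; rewrite -[X in _ == X]addn0 -addn1 eqn_add2l.
have thM : ~~ (theta <= M)%MS.
  by apply/negP => /(vM _ ot0 z0) e; have := Fth _ ot0; rewrite e ltxx.
have dec t : ok t -> F t x0 = 0 -> forall y a, (y - a *: theta <= M)%MS -> F t y = a * F t theta.
  by move=> ot z y a /(vM _ ot z); rewrite (lfB (lF t)) (lF t).2 => /eqP; rewrite subr_eq0 => /eqP.
exists t0; split=> //.
  move=> t ot z; exists (F t theta / F t0 theta); first by rewrite divr_gt0 ?Fth.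
  move=> y; have [a Ma _] := facet_decomp y rM thM; rewrite (dec t ot z y a Ma) (dec t0 ot0 z0 y a Ma).
  by rewrite mulrCA divfK // lt0r_neq0 // Fth.
apply/seteqP; split=> x; first by move=> Wx; split; [exact: facet_cl|apply: vM => //; exact: sM].
move=> [cx zx]; apply: clM => //; have [a Ma _] := facet_decomp x rM thM.
have := dec t0 ot0 z0 x a Ma; rewrite zx => /esym/eqP; rewrite mulf_eq0 (gt_eqF (Fth _ ot0)) orbF => /eqP a0.
by move: Ma; rewrite a0 scale0r subr0.
Qed.

Lemma facet_transfer (Q : set E) (f : E -> rat) : linear_form f -> (forall x, Q x -> 0 <= f x) ->
  W = [set x | Q x /\ f x = 0] -> facet W Q.
Proof.
move=> lf fQ WQ; split; last by have [] := fW.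
exists (\col_j f (delta_mx 0 j)).
have e x : (x *m \col_j f (delta_mx 0 j)) 0 0 = f x.
  by rewrite (lfE lf) mxE; apply: eq_bigr => j _; rewrite mxE.
split=> [x /fQ|]; first by rewrite e.
rewrite WQ; apply/seteqP; split=> x [Qx z]; split=> //.
  by apply/rowP => i; rewrite (ord1 i) e z mxE.
by rewrite -e z mxE.
Qed.

End Facet.
End Cells.

Section Chambers.
Variables (R : realType) (r n : nat) (A : 'M[int]_(r, n)).
Hypothesis sT : spanning A [set: 'I_n]%SET.
Local Notation C := R[i].
Local Notation V := (V R A).
Local Notation sol := (sol A).
Local Notation gen := (gen A).
Local Notation base := (base A).
Implicit Types (theta eta : 'rV[rat]_r) (J K : {set 'I_n}).

Lemma gen_neq0 theta J j : gen theta -> base J -> j \in J -> sol J theta 0 j != 0.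
Proof. by move=> gt bJ; exact: gt. Qed.

Lemma sol_form J j : base J -> linear_form (fun y => sol J y 0 j).
Proof. by move=> bJ; split=> [x y|a x]; rewrite ?solD ?solZ // mxE. Qed.

Lemma sidx_same theta eta J j : 0 < sol J theta 0 j * sol J eta 0 j -> sidx A eta J j = sidx A theta J j.
Proof.
rewrite /sidx; have [h|h] := ltP 0 (sol J theta 0 j); first by rewrite pmulr_rgt0 // => ->.
move=> p; rewrite ltNge; suff -> : sol J eta 0 j <= 0 by [].
by rewrite leNgt; apply/negP => q; have := mulr_le0_ge0 h (ltW q); rewrite leNgt p.
Qed.

Lemma sidx_sign theta eta J j : sol J theta 0 j != 0 -> sol J eta 0 j != 0 ->
  sidx A eta J j = sidx A theta J j -> 0 < sol J theta 0 j * sol J eta 0 j.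
Proof.
rewrite /sidx; case: (ltgtP 0 (sol J theta 0 j)) => // h _; case: (ltgtP 0 (sol J eta 0 j)) => // h' _ e.
- exact: mulr_gt0.
- by have := bar_neq (lshift n j); rewrite bar_l e eqxx.
- by have := bar_neq (lshift n j); rewrite bar_l -e eqxx.
- by rewrite nmulr_rgt0.
Qed.

Definition same_signs theta eta := forall J j, base J -> j \in J -> 0 < sol J theta 0 j * sol J eta 0 j.

Lemma same_signs_gen theta eta : same_signs theta eta -> gen eta.
Proof. by move=> h J bJ j jJ; apply: contraTneq (h J j bJ jJ) => ->; rewrite mulr0 ltxx. Qed.

Lemma same_signs_sym theta eta : same_signs theta eta -> same_signs eta theta.
Proof. by move=> h J j bJ jJ; rewrite mulrC; exact: h. Qed.

Lemma same_signs_refl theta : gen theta -> same_signs theta theta.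
Proof. by move=> gt J j bJ jJ; rewrite -expr2 exprn_even_gt0 //= gt. Qed.

Lemma same_signs_Vss theta eta : same_signs theta eta -> (Vss theta : set V) `<=` Vss eta.
Proof.
move=> h v /(gen_cover sT (same_signs_gen (same_signs_sym h)))[J bJ hJ].
by apply: (sol_Vss bJ) => j jJ _; rewrite (sidx_same (h J j bJ jJ)); exact: hJ.
Qed.

Lemma sidxK theta J l : idx (sidx A theta J l) = l.
Proof. exact: idx_sc. Qed.

(** Test points: over [J] itself they detect the signs of the coordinates of a character, over [J]
    minus one index whether that coordinate is zero. *)
Definition basept theta J K : V := suppt A (sidx A theta J) (fun l => (l \in K)%:R).

Lemma basept_sidx theta J K l : co (basept theta J K) (sidx A theta J l) = (l \in K)%:R.
Proof. by rewrite sup_sg //; exact: sidxK. Qed.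

Lemma basept_neq0 theta J K k : co (basept theta J K) k != 0 -> k = sidx A theta J (idx k) /\ idx k \in K.
Proof. by move=> /sup_neq0[e h]; split=> //; move: h; case: (idx k \in K) => //; rewrite eqxx. Qed.

Lemma Vss_basept theta J K eta : base J -> K \subset J -> Vss eta (basept theta J K) <->
  forall j, sol J eta 0 j != 0 -> j \in K /\ sidx A eta J j = sidx A theta J j.
Proof.
move=> bJ KJ; split=> [/Vss_adm[y ey h] j|h]; last first.
  by apply: (sol_Vss bJ) => j jJ /h[jK e]; rewrite e basept_sidx jK oner_neq0.
have yK i : y 0 i != 0 -> i \in K /\ sidx A theta J i = if 0 < y 0 i then lshift n i else rshift n i.
  have [hl hr] := h i; case: (ltgtP 0 (y 0 i)) => // p _.
    by have [e iK] := basept_neq0 (hl p); rewrite idx_l in e iK.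
  by have [e iK] := basept_neq0 (hr p); rewrite idx_r in e iK.
have e : sol J eta = y by apply: sol_uniq => // i /yK[/(fintype.subsetP KJ)].
by rewrite e => /yK[iK ->]; split=> //; rewrite /sidx e.
Qed.

Lemma git_classE theta eta : gen theta -> git_class R A theta eta <-> same_signs theta eta.
Proof.
move=> gt; split=> [[_ eV] J j bJ jJ|h]; last first.
  have gs := same_signs_sym h; split.
    by have [] := gen_generic R sT (same_signs_gen h).
  by apply/seteqP; split; exact: same_signs_Vss.
have s0 := gen_neq0 gt bJ.
have sgn : forall i, sol J eta 0 i != 0 -> i \in J /\ sidx A eta J i = sidx A theta J i.
  apply/(Vss_basept theta eta bJ (fintype.subxx J)); rewrite eV.
  by apply/(Vss_basept theta theta bJ (fintype.subxx J)) => i hi; split=> //; apply: contraT => /(sol_out theta bJ) e; rewrite e eqxx in hi.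
have [z|nz] := eqVneq (sol J eta 0 j) 0; last by apply: sidx_sign => //; [exact: s0|have [] := sgn j nz].
have KJ : (J :\ j)%SET \subset J by exact: finset.subsetDl.
have : Vss eta (basept theta J (J :\ j)%SET).
  apply/(Vss_basept _ _ bJ KJ) => i hi; have [iJ e] := sgn i hi; split=> //.
  by rewrite !inE iJ andbT; apply: contraNneq hi => ->; rewrite z.
rewrite eV => /(Vss_basept _ _ bJ KJ)/(_ j (s0 j jJ))[].
by rewrite !inE eqxx.
Qed.

Lemma chamber_gen D theta : chamber R A D -> D theta -> gen theta /\ D = git_class R A theta.
Proof.
move=> [eta /generic_gen ge ->] h; have hs := (git_classE theta ge).1 h; split; first exact: same_signs_gen hs.
by rewrite /git_class; case: h => _ ->.
Qed.

Lemma chamber_ex D : chamber R A D -> exists2 theta, D theta & gen theta.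
Proof.
by move=> [eta /generic_gen ge ->]; exists eta => //; apply/(git_classE eta ge); exact: same_signs_refl.
Qed.

Lemma gen_chamber theta : gen theta -> chamber R A (git_class R A theta).
Proof. by move=> gt; exists theta => //; exact: gen_generic. Qed.

Definition cell_index : finType := ({set 'I_n} * 'I_n)%type.
Definition cell_ok (t : cell_index) := base t.1 /\ t.2 \in t.1.
(** Coordinates multiplied by their value at [theta], so that the chamber is where all are positive;
    the value 0 at sets that are not bases keeps the form linear for every index. *)
Definition cell_form theta (t : cell_index) y :=
  if pselect (base t.1) then sol t.1 theta 0 t.2 * sol t.1 y 0 t.2 else 0.

Lemma cell_formE theta t y : base t.1 -> cell_form theta t y = sol t.1 theta 0 t.2 * sol t.1 y 0 t.2.
Proof. by rewrite /cell_form; case: pselect. Qed.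

Lemma cell_linear theta t : linear_form (cell_form theta t).
Proof.
rewrite /cell_form; case: (pselect (base t.1)) => [b|nb]; last by split=> *; rewrite ?addr0 ?mulr0.
by have [fD fZ] := sol_form t.2 b; split=> [x y|a x]; rewrite ?fD ?fZ ?mulrDr // mulrCA.
Qed.

Lemma git_class_cell theta eta : gen theta ->
  git_class R A theta eta <-> forall t, cell_ok t -> 0 < cell_form theta t eta.
Proof.
move=> gt; rewrite git_classE //; split=> [h t [b jt]|h J j bJ jJ]; first by rewrite cell_formE //; exact: h.
by have := h (J, j) (conj bJ jJ); rewrite cell_formE.
Qed.

Lemma chamber_closure theta : gen theta ->
  clQ (git_class R A theta) = [set x | forall J j, base J -> j \in J -> 0 <= sol J theta 0 j * sol J x 0 j].
Proof.
move=> gt; rewrite (cell_closure (cell_linear theta) (fun x => git_class_cell x gt) (theta := theta)); last first.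
  by apply/git_classE => //; exact: same_signs_refl.
apply/seteqP; split=> x h; first by move=> J j bJ jJ; have := h (J, j) (conj bJ jJ); rewrite cell_formE.
by move=> t [b jt]; rewrite cell_formE //; exact: h.
Qed.

(** [theta0] is a general point of a wall of the chamber of [theta], on the hyperplane given by the
    coordinate [j0] in [J0]. Each coordinate in each base either defines this same hyperplane or has
    the same nonzero sign at both characters. *)
Record wall_point theta theta0 J0 j0 : Prop := WallPoint {
  wp_gen : gen theta;
  wp_base : base J0;
  wp_in : j0 \in J0;
  wp_zero : sol J0 theta0 0 j0 = 0;
  wp_dich : forall J j, base J -> j \in J ->
    (sol J theta0 0 j = 0 /\ exists2 c, c != 0 & forall y, sol J y 0 j = c * sol J0 y 0 j0) \/
    0 < sol J theta 0 j * sol J theta0 0 j }.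

Lemma wall_form D W : wall_of R A D W -> exists J0 j0,
  W = [set x | clQ D x /\ sol J0 x 0 j0 = 0] /\
  forall theta theta0, D theta -> relint W theta0 -> wall_point theta theta0 J0 j0.
Proof.
move=> [cD fW]; have [theta Dt gt] := chamber_ex cD; have [_ DE] := chamber_gen cD Dt; rewrite {}DE in fW *.
have lF := cell_linear theta; have PE x := git_class_cell x gt.
have Pt : git_class R A theta theta by apply/git_classE => //; exact: same_signs_refl.
have [x0 rx0] := facet_relint lF PE Pt fW.
have [[J0 j0] [[/= b0 jJ0] z0 pr WE]] := facet_form lF PE Pt fW rx0.
have sz x : cell_form theta (J0, j0) x = 0 <-> sol J0 x 0 j0 = 0.
  rewrite cell_formE //=; split=> [/eqP|->]; last by rewrite mulr0.
  by rewrite mulf_eq0 (negPf (gt _ b0 _ jJ0)) => /eqP.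
exists J0, j0; split; first by rewrite WE; apply/seteqP; split=> x [cx zx]; split=> //; apply/sz.
move=> theta' theta0 /(git_classE _ gt) st r0; have g' := same_signs_gen st.
have [[J1 j1] [[/= b1 jJ1] z1 pr1 _]] := facet_form lF PE Pt fW r0.
have W0 : W theta0 by have [] := r0.
have z00 : sol J0 theta0 0 j0 = 0 by apply/sz; move: W0; rewrite WE => -[].
split=> // J j bJ jJ; have [z|nz] := eqVneq (sol J theta0 0 j) 0; [left; split=> //|right].
  have zt : cell_form theta (J, j) theta0 = 0 by rewrite cell_formE //= z mulr0.
  have [c c0 cE] := pr1 (J, j) (conj bJ jJ) zt.
  have [d d0 dE] := pr1 (J0, j0) (conj b0 jJ0) ((sz _).2 z00).
  have s0 := gt _ b0 _ jJ0; have s1 := gt _ bJ _ jJ.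
  exists (c / d * sol J0 theta 0 j0 / sol J theta 0 j).
    by rewrite !mulf_neq0 ?invr_neq0 // gt_eqF.
  move=> y; have := cE y; have := dE y; rewrite !cell_formE //= => e1 e2.
  apply: (mulfI s1); rewrite e2 mulrCA; have d0' := lt0r_neq0 d0.
  have -> : sol J theta 0 j * (c / d * sol J0 theta 0 j0 / sol J theta 0 j * sol J0 y 0 j0) =
    c / d * (sol J0 theta 0 j0 * sol J0 y 0 j0) by field; rewrite s1 d0'.
  by rewrite e1; field.
have p : 0 <= sol J theta 0 j * sol J theta0 0 j.
  by have := facet_cl fW W0; rewrite chamber_closure // => h; exact: h.
have p' : 0 < sol J theta 0 j * sol J theta0 0 j.
  by rewrite lt_def p andbT mulf_neq0 ?gt.
have q := st J j bJ jJ; have s1 := gt _ bJ _ jJ.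
have : 0 < (sol J theta' 0 j * sol J theta0 0 j) * (sol J theta 0 j) ^+ 2.
  by rewrite expr2 mulrACA mulr_gt0 // mulrC.
by rewrite pmulr_lgt0 // exprn_even_gt0.
Qed.

End Chambers.

Lemma sign_trans (a b c : rat) : 0 < a * b -> 0 < a * c -> 0 < b * c.
Proof.
move=> h h'; have a0 : a != 0 by apply: contraTneq h => ->; rewrite mul0r ltxx.
have : 0 < a ^+ 2 * (b * c) by rewrite expr2 mulrACA mulr_gt0.
by rewrite pmulr_rgt0 // exprn_even_gt0.
Qed.

Section WallFunctional.
Variables (r n : nat) (A : 'M[int]_(r, n)).
Local Notation sol := (sol A).
Local Notation gen := (gen A).
Local Notation base := (base A).
Local Notation aQ := (aQ A).
Local Notation bQ := (bQ A).
Local Notation I2 := 'I_(n + n).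
Variables (theta theta0 : 'rV[rat]_r) (J0 : {set 'I_n}) (j0 : 'I_n).
Hypothesis wp : wall_point A theta theta0 J0 j0.
Implicit Types (J : {set 'I_n}) (i j : 'I_n) (k : I2).

(** The linear form of the wall, normalised to be positive at [theta]. *)
Definition lam y := sol J0 theta 0 j0 * sol J0 y 0 j0.
(* The columns off the hyperplane of the wall. *)
Definition wallE : {set 'I_n} := [set i | sol J0 (aQ i) 0 j0 != 0]%SET.

Lemma lam_form : linear_form lam.
Proof.
have [fD fZ] := sol_form (A := A) j0 (wp_base wp).
by split=> [x y|a x]; rewrite /lam ?fD ?fZ ?mulrDr // mulrCA.
Qed.

Lemma theta_j0 : sol J0 theta 0 j0 != 0.
Proof. by apply: (wp_gen wp); [exact: wp_base wp|exact: wp_in wp]. Qed.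

Lemma lam_theta : 0 < lam theta.
Proof. by rewrite /lam -expr2 exprn_even_gt0 //= theta_j0. Qed.

Lemma lam_theta0 : lam theta0 = 0.
Proof. by rewrite /lam (wp_zero wp) mulr0. Qed.

Lemma lam_aQ i : (lam (aQ i) != 0) = (i \in wallE).
Proof. by rewrite inE /lam mulf_eq0 (negPf theta_j0). Qed.

Lemma lam_bQ k : (lam (bQ k) != 0) = (idx k \in wallE).
Proof.
by case: (coordP k) => i; rewrite ?bQ_l ?bQ_r ?(lfN lam_form) ?oppr_eq0 ?idx_l ?idx_r -lam_aQ.
Qed.

Lemma lam_sum J y : base J -> lam y = \sum_j sol J y 0 j * lam (aQ j).
Proof.
by move=> bJ; rewrite {1}(sol_sum y bJ) (lf_sum lam_form); apply: eq_bigr => j _; rewrite lam_form.2.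
Qed.

Lemma wall_meet J : base J -> exists2 j, j \in J & j \in wallE.
Proof.
move=> bJ; have : lam theta != 0 by rewrite gt_eqF // lam_theta.
rewrite (lam_sum theta bJ) => /eqP ne; apply: contrapT => no; apply: ne; rewrite big1 // => j _.
have [jJ|nj] := boolP (j \in J); last by rewrite (sol_out _ bJ nj) mul0r.
by apply/eqP; rewrite mulf_eq0 orbC -[_ == 0]negbK lam_aQ; apply/orP; left; apply/negP => jE; apply: no; exists j.
Qed.

Lemma wall_dich J j : base J -> j \in J -> sol J theta0 0 j = 0 \/ 0 < sol J theta 0 j * sol J theta0 0 j.
Proof. by move=> bJ jJ; have [[z _]|p] := wp_dich wp bJ jJ; [left|right]. Qed.

Lemma wall_proportional J j : base J -> j \in J -> sol J theta0 0 j = 0 ->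
  exists2 c, c != 0 & forall y, sol J y 0 j = c * lam y.
Proof.
move=> bJ jJ z; have [[_ [c c0 cE]]|] := wp_dich wp bJ jJ; last by rewrite z mulr0 ltxx.
exists (c / sol J0 theta 0 j0); first by rewrite mulf_neq0 ?invr_neq0 ?theta_j0.
by move=> y; rewrite cE /lam mulrA divfK // theta_j0.
Qed.

(** The j-th coordinate is proportional to [lam], and it vanishes on the other columns of [J]. *)
Lemma wall_single J j i : base J -> j \in J -> sol J theta0 0 j = 0 -> i \in J -> (i \in wallE) = (i == j).
Proof.
move=> bJ jJ z iJ; have [c c0 cE] := wall_proportional bJ jJ z.
have := cE (aQ i); rewrite sol_aQ // mxE eqxx /= -lam_aQ [j == i]eq_sym; case: (i == j) => /= e.
  by apply/eqP => l0; move/eqP: e; rewrite l0 mulr0 oner_eq0.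
by apply: negbTE; rewrite negbK; move/esym/eqP: e; rewrite mulf_eq0 (negPf c0).
Qed.

Lemma wall_positive J j : base J -> j \in J -> sol J theta0 0 j = 0 -> 0 < lam (bQ (sidx A theta J j)).
Proof.
move=> bJ jJ z; have [c c0 cE] := wall_proportional bJ jJ z.
have e1 := cE (aQ j); rewrite sol_aQ // mxE !eqxx /= in e1.
have p : 0 < sol J theta 0 j * c.
  by rewrite cE mulrAC mulr_gt0 ?lam_theta // -expr2 exprn_even_gt0.
have q : 0 < c * lam (aQ j) by rewrite -e1.
have s0 : sol J theta 0 j != 0 by apply: (wp_gen wp).
rewrite /sidx; have [h|h] := ltP 0 (sol J theta 0 j).
  by rewrite bQ_l; move: p; rewrite pmulr_rgt0 // => c1; move: q; rewrite pmulr_rgt0.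
have h' : sol J theta 0 j < 0 by rewrite lt_neqAle s0.
rewrite bQ_r (lfN lam_form) oppr_gt0; move: p; rewrite nmulr_rgt0 // => c1.
by move: q; rewrite nmulr_rgt0.
Qed.

(** [theta0] is a positive combination of the selected weights and [lam theta0 = 0], while some
    column of [J] is off the hyperplane; so not all values of [lam] can be nonnegative. *)
Lemma wall_negative J : base J -> (forall j, j \in J -> sol J theta0 0 j != 0) ->
  exists2 j, j \in J & lam (bQ (sidx A theta J j)) < 0.
Proof.
move=> bJ h; apply: contrapT => no.
have term j : j \in J -> sol J theta0 0 j * lam (aQ j) = `|sol J theta0 0 j| * lam (bQ (sidx A theta J j)).
  move=> jJ; have [z|p] := wall_dich bJ jJ; first by have := h j jJ; rewrite z eqxx.
  rewrite -(sidx_same p) /sidx; have [q|q] := ltP 0 (sol J theta0 0 j); first by rewrite gtr0_norm // bQ_l.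
  by rewrite ler0_norm // bQ_r (lfN lam_form) mulrNN.
have ge j : 0 <= sol J theta0 0 j * lam (aQ j).
  have [jJ|nj] := boolP (j \in J); last by rewrite (sol_out _ bJ nj) mul0r.
  by rewrite term // mulr_ge0 // leNgt; apply/negP => neg; apply: no; exists j.
have [j jJ jE] := wall_meet bJ.
have := lam_theta0; rewrite (lam_sum _ bJ) => /eqP; rewrite psumr_eq0 // => /allP/(_ j (mem_index_enum j)).
by rewrite /= mulf_eq0 (negPf (h j jJ)) -[_ == 0]negbK lam_aQ jE.
Qed.

(** Apply [lam] to a relation between the columns with nonzero i-th coefficient. *)
Lemma wall_two i : nocoloop A -> i \in wallE -> exists2 k, k \in wallE & k != i.
Proof.
move=> nc iE; have [x x0 xi] := nc i; apply: contrapT => no.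
have := congr1 lam x0; rewrite mulAt (lf_sum lam_form) (lf0 lam_form) (bigD1 i) //= big1 ?addr0.
  by move=> /eqP; rewrite lam_form.2 mulf_eq0 (negPf xi) -[_ == 0]negbK lam_aQ iE.
move=> l li; rewrite lam_form.2; apply/eqP; rewrite mulf_eq0 -[lam _ == 0]negbK lam_aQ orbC.
by apply/orP; left; apply/negP => lE; apply: no; exists l.
Qed.

Definition negk i := if 0 < lam (aQ i) then rshift n i else lshift n i.

Lemma idx_negk i : idx (negk i) = i.
Proof. by rewrite /negk; case: ifP; rewrite ?idx_l ?idx_r. Qed.

Lemma lam_negk i : i \in wallE -> lam (bQ (negk i)) < 0.
Proof.
rewrite -lam_aQ /negk => n0; have [h|h] := ltP 0 (lam (aQ i)).
  by rewrite bQ_r (lfN lam_form) oppr_lt0.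
by rewrite bQ_l lt_neqAle n0.
Qed.

Lemma negkE k : lam (bQ k) < 0 -> k = negk (idx k).
Proof.
rewrite /negk; case: (coordP k) => i; rewrite ?bQ_l ?bQ_r ?(lfN lam_form) ?idx_l ?idx_r ?oppr_lt0.
  by move=> h; rewrite ltNge ltW.
by move=> ->.
Qed.

Lemma wall_in0 : j0 \in wallE.
Proof. by rewrite inE sol_aQ ?mxE ?eqxx ?oner_neq0 //; [exact: wp_base wp|exact: wp_in wp]. Qed.

Section Flop.
Variables (J : {set 'I_n}) (j i : 'I_n).
Hypothesis bJ : base J.
Hypothesis jJ : j \in J.
Hypothesis z : sol J theta0 0 j = 0.
Hypothesis iE : i \in wallE.
Hypothesis ij : i != j.

Lemma flop_out : i \notin J.
Proof. by apply: contra ij => iJ; rewrite -(wall_single bJ jJ z iJ). Qed.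

Lemma flop_coef : sol J (aQ i) 0 j != 0.
Proof.
by have [c c0 cE] := wall_proportional bJ jJ z; rewrite cE mulf_neq0 // lam_aQ.
Qed.

Lemma flop_base : base (i |: J :\ j)%SET.
Proof. exact: base_exchange bJ flop_out flop_coef. Qed.

Lemma flop_sol0 : sol (i |: J :\ j)%SET theta0 = sol J theta0.
Proof.
have [sJ eJ] := sol_spec theta0 bJ; apply: (sol_uniq flop_base) => // l ln; have lJ := sJ l ln.
by rewrite !inE lJ andbT orbC; apply/orP; left; apply: contraNneq ln => ->; rewrite z.
Qed.

Lemma flop_same_sign l : l \in J -> l != j -> 0 < sol J theta 0 l * sol (i |: J :\ j)%SET theta 0 l.
Proof.
move=> lJ lj; have lJ' : l \in (i |: J :\ j)%SET by rewrite !inE lJ lj orbT.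
have [z1|p] := wall_dich bJ lJ.
  by have := wall_single bJ lJ z1 jJ; rewrite eq_sym (negPf lj) (wall_single bJ jJ z jJ) eqxx.
have [z2|p2] := wall_dich flop_base lJ'; first by move: p; rewrite -flop_sol0 z2 mulr0 ltxx.
by move: p p2; rewrite flop_sol0 ![_ * sol J theta0 0 l]mulrC; exact: sign_trans.
Qed.

End Flop.
End WallFunctional.

Section Opposite.
Variables (r n : nat) (A : 'M[int]_(r, n)).
Local Notation sol := (sol A).
Local Notation base := (base A).

(** Take [theta0 - e *: theta] with [e] small: coordinates nonzero at [theta0] keep their sign,
    those vanishing there change it. *)
Lemma wall_opposite theta theta0 J0 j0 : wall_point A theta theta0 J0 j0 -> exists theta',
  [/\ wall_point A theta' theta0 J0 j0, sol J0 theta 0 j0 * sol J0 theta' 0 j0 < 0 &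
      forall J j, base J -> j \in J -> sol J theta0 0 j != 0 -> 0 < sol J theta 0 j * sol J theta' 0 j].
Proof.
move=> wp; have gt := wp_gen wp; have nb := @positive_nbhs r _ (cell_ok A) _ (@cell_linear r n A theta) theta0.
have [e e0 [_ U2]] := nbhs_line theta nb; pose theta' := theta0 - e *: theta; exists theta'.
have sE J j : base J -> sol J theta' 0 j = sol J theta0 0 j - e * sol J theta 0 j.
  by move=> bJ; have lf := sol_form (A := A) j bJ; rewrite (lfB lf) lf.2.
have pos J j : base J -> j \in J -> 0 < sol J theta 0 j * sol J theta0 0 j -> 0 < sol J theta 0 j * sol J theta' 0 j.
  by move=> bJ jJ p; have := U2 (J, j) (conj bJ jJ); rewrite !cell_formE //=; exact.
have neg J j : base J -> j \in J -> sol J theta0 0 j = 0 -> sol J theta 0 j * sol J theta' 0 j < 0.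
  move=> bJ jJ z; rewrite sE // z sub0r mulrN mulrCA oppr_lt0 mulr_gt0 // -expr2 exprn_even_gt0 //=.
  exact: gt.
split=> [|| J j bJ jJ n0].
- split; [|exact: wp_base wp|exact: wp_in wp|exact: wp_zero wp|].
    move=> J bJ j jJ; have [z|p] := wall_dich wp bJ jJ.
      by apply: contraTneq (neg J j bJ jJ z) => ->; rewrite mulr0 ltxx.
    by apply: contraTneq (pos J j bJ jJ p) => ->; rewrite mulr0 ltxx.
  move=> J j bJ jJ; have [|p] := wp_dich wp bJ jJ; first by left.
  by right; apply: sign_trans (pos J j bJ jJ p) p.
- by apply: neg (wp_zero wp); [exact: wp_base wp|exact: wp_in wp].
- by apply: pos => //; have [z|//] := wall_dich wp bJ jJ; rewrite z eqxx in n0.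
Qed.

End Opposite.

(** * Variation of the quotient *)

Section Coordinates.
Variables (R : realType) (r n : nat) (A : 'M[int]_(r, n)) (theta : 'rV[rat]_r).
Hypothesis sT : spanning A [set: 'I_n]%SET.
Hypothesis uni : forall J, base A J -> forall chi : 'rV[int]_r, iw A J (map_mx intr chi).
Hypothesis gt : gen A theta.
Local Notation C := R[i].
Local Notation V := (V R A).
Local Notation X := (X R A theta).
Local Notation I2 := 'I_(n + n).
Implicit Types (u v : V) (k : I2).

Lemma gen_orbit u v (uss : Vss theta u) (vss : Vss theta v) :
  qpt uss = qpt vss -> exists g, v = act g u.
Proof. by apply: qpt_interior; exact: gen_interior. Qed.

Lemma co_act_eq0 g v k : (co (act g v) k == 0) = (co v k == 0).
Proof. by rewrite co_act mulf_eq0 (negPf (chr_neq0 _ _)). Qed.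

Definition coord_open k : set X := [set x | exists v, exists2 vss : Vss theta v, x = qpt vss & co v k != 0].

Lemma coord_openE v (vss : Vss theta v) k : coord_open k (qpt vss) <-> co v k != 0.
Proof.
split=> [[u [uss e uk]]|]; last by exists v, vss.
by have [g ->] := gen_orbit (esym e); rewrite co_act_eq0.
Qed.

Lemma gcptE J (bJ : base A J) y : gcpt gt bJ y = qpt (slice_Vss bJ (gt bJ) (cv y)) :> X.
Proof. by apply/qpt_eq. Qed.

Lemma coord_open_chart J (bJ : base A J) k y :
  coord_open k (gcpt gt bJ y) <-> co (slice theta bJ (cv y)) k != 0.
Proof. by rewrite gcptE; exact: coord_openE. Qed.

Lemma ev_rest_coord J (bJ : base A J) k y :
  ev (rest A theta J (mpolyX C (mnm1 k))) y = co (slice theta bJ (cv y)) k.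
Proof. by rewrite (ev_rest theta bJ); exact: mevalXU. Qed.

Lemma coord_open_open k : open (coord_open k).
Proof.
have -> : coord_open k = \bigcup_(J in [set J | base A J])
    [set x | exists2 bJ : base A J, True & (gcpt gt bJ @` nonzero (rest A theta J (mpolyX C (mnm1 k)))) x].
  apply/seteqP; split=> x.
    move=> hx; have [J [bJ Ux]] := g_cover sT gt x; exists J => //; exists bJ => //.
    have [y ey] := slice_openP Ux; exists y => //; rewrite /nonzero /= (ev_rest_coord bJ).
    by apply/coord_open_chart; move: hx; rewrite ey.
  by move=> [J bJ [bJ' _ [y ny <-]]]; apply/coord_open_chart; rewrite -(ev_rest_coord bJ').
apply: bigcup_open => J bJ.
have -> : [set x | exists2 bJ : base A J, True & (gcpt gt bJ @` nonzero (rest A theta J (mpolyX C (mnm1 k)))) x] =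
    gcpt gt bJ @` nonzero (rest A theta J (mpolyX C (mnm1 k))).
  apply/seteqP; split=> x; last by exists bJ.
  by move=> [bJ' _]; rewrite (Prop_irrelevance bJ' bJ).
exact: (chart_image_open (g_iso R uni gt bJ) (nonzero _)).1 (nonzero_open _).
Qed.

End Coordinates.

Lemma interior_add (R : realType) r n (A : 'M[int]_(r, n)) eta (v : V R A) k e :
  interior_point eta v -> co v k != 0 -> 0 <= e -> interior_point (eta + e *: bQ A k) v.
Proof.
move=> [x [x0 xv xE sp]] vk e0; exists (fun q => x q + e * (q == k)%:R); split.
- by move=> q; rewrite addr_ge0 // mulr_ge0.
- move=> q; have [->//|_] := eqVneq q k; rewrite mulr0 addr0; exact: xv.
- under eq_bigr do rewrite scalerDl; rewrite big_split /= xE; congr (_ + _).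
  rewrite (bigD1 k) //= eqxx mulr1 big1 ?addr0 // => q /negPf->; by rewrite mulr0 scale0r.
- move=> y; have [c cx cE] := sp y; exists c => // q /cx xq.
  by rewrite gt_eqF // ltr_pwDl ?mulr_ge0 // lt_def xq x0.
Qed.

Section VariationOfQuotients.
Variables (R : realType) (r n : nat) (A : 'M[int]_(r, n)).
Hypothesis sT : spanning A [set: 'I_n]%SET.
Hypothesis uni : forall J, base A J -> forall chi : 'rV[int]_r, iw A J (map_mx intr chi).
Local Notation C := R[i].
Local Notation V := (V R A).
Local Notation I2 := 'I_(n + n).
Local Notation sol := (sol A).
Variables (theta theta0 : 'rV[rat]_r) (J0 : {set 'I_n}) (j0 : 'I_n).
Hypothesis wp : wall_point A theta theta0 J0 j0.
Local Notation gt := (wp_gen wp).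
Local Notation X := (X R A theta).
Local Notation X0 := (Defs.X R A theta0).
Local Notation lam := (@lam r n A theta J0 j0).
Local Notation b := (bQ A).
Implicit Types (u v : V) (k : I2).

Lemma Vss_wall v : Vss theta v -> Vss theta0 v.
Proof.
move=> /(gen_cover sT gt)[J bJ hJ]; apply: (sol_Vss bJ) => j jJ n0.
have [z|p] := wall_dich wp bJ jJ; first by rewrite z eqxx in n0.
by rewrite (sidx_same p); exact: hJ.
Qed.

Lemma vtau_ex (x : X) : exists y : X0, exists v, exists2 vss : Vss theta v, x = qpt vss & y = qpt (Vss_wall vss).
Proof. by have [v [vss e]] := qpt_surj x; exists (qpt (Vss_wall vss)), v, vss. Qed.

Definition vtau (x : X) : X0 := projT1 (cid (vtau_ex x)).


Lemma vtau_qpt v (vss : Vss theta v) (v0 : Vss theta0 v) : vtau (qpt vss) = qpt v0.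
Proof.
rewrite /vtau; have [u [uss e ->]] := projT2 (cid (vtau_ex (qpt vss))).
have [g eu] := gen_orbit sT gt e; apply/qpt_eq; rewrite eu => j f wf.
by have [h h'] := same_ideal_act (theta := theta0) g v wf; split.
Qed.

Lemma vtau_vgit : vgit_morphism vtau.
Proof.
split=> [v|v v0 e]; first exact: Vss_wall.
have v0ss : Vss theta0 (\val v) by rewrite e; exact: set_valP.
rewrite quot_qpt (vtau_qpt _ v0ss) (quot_qpt v0); apply/qpt_eq; rewrite -/(\val v) -/(\val v0).
by rewrite -e => j f _.
Qed.

Lemma vgit_unique (tau : X -> X0) : vgit_morphism tau -> tau = vtau.
Proof.
move=> [sub h]; apply/funext => x; have [v [vss ->]] := qpt_surj x.
have e := h (SigSub (mem_set vss)) (SigSub (mem_set (Vss_wall vss))) erefl.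
rewrite !quot_qpt in e; rewrite (vtau_qpt vss (Vss_wall vss)).
have -> : vss = set_valP (SigSub (mem_set vss)) by exact: Prop_irrelevance.
by rewrite e; apply/qpt_eq.
Qed.

(** For small [e], the character [theta0 - e *: b k] lies on the side of [theta], so it is interior
    to the cone of [v]; adding [e *: b k] along a nonzero coordinate keeps it interior. *)
Lemma wall_interior v k : Vss theta v -> lam (b k) < 0 -> co v k != 0 -> interior_point theta0 v.
Proof.
move=> vss neg vk; have [J bJ hJ] := gen_cover sT gt vss.
have nb := @positive_nbhs r _ (cell_ok A) _ (@cell_linear r n A theta) theta0.
have [e e0 [_ U2]] := nbhs_line (b k) nb; pose eta := theta0 - e *: b k.
have pos j : j \in J -> 0 < sol J theta 0 j * sol J eta 0 j.
  move=> jJ; have [z|p] := wall_dich wp bJ jJ; last first.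
    by have := U2 (J, j) (conj bJ jJ); rewrite !cell_formE //=; exact.
  have [c c0 cE] := wall_proportional wp bJ jJ z; have lf := lam_form wp.
  rewrite !cE (lfB lf) lf.2 (lam_theta0 wp) sub0r mulrACA mulr_gt0 //.
    by rewrite -expr2 exprn_even_gt0.
  by rewrite mulr_gt0 ?(lam_theta wp) // oppr_gt0 pmulr_rlt0.
have ieta : interior_point eta v.
  apply: (sidx_interior bJ) => j jJ; last by rewrite (sidx_same (pos j jJ)); exact: hJ.
  by apply: contraTneq (pos j jJ) => ->; rewrite mulr0 ltxx.
by have := interior_add ieta vk (ltW e0); rewrite subrK.
Qed.

(** Off this locus the VGIT morphism is injective and its image consists of stable points; it
    contains the exceptional locus and [Uns]. *)
Definition collapsed : set X := [set x | forall k, lam (b k) < 0 -> ~ coord_open k x].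

Lemma collapsedE v (vss : Vss theta v) : collapsed (qpt vss) <-> forall k, lam (b k) < 0 -> co v k = 0.
Proof.
split=> h k neg; first by apply/eqP; apply: contraT => vk; case: (h k neg); apply/(coord_openE sT gt).
by move=> /(coord_openE sT gt); rewrite h // eqxx.
Qed.

Lemma collapsed_closed : closed collapsed.
Proof.
rewrite -[collapsed]setCK; apply: open_closedC.
have -> : ~` collapsed = \bigcup_(k in [set k | lam (b k) < 0]) @coord_open R r n A theta k.
  apply/seteqP; split=> x; last by move=> [k neg kx] h; exact: h k neg kx.
  by move=> /existsNP[k /not_implyP[neg /contrapT kx]]; exists k.
by apply: bigcup_open => k _; exact: (@coord_open_open R r n A theta sT uni gt k).
Qed.

Lemma collapsed_fibre (x y : X) : ~ collapsed x -> vtau x = vtau y -> x = y.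
Proof.
have [v [vss ->]] := qpt_surj x; have [u [uss ->]] := qpt_surj y.
move=> /existsNP[k /not_implyP[neg /contrapT/(coord_openE sT gt) vk]].
rewrite (vtau_qpt vss (Vss_wall vss)) (vtau_qpt uss (Vss_wall uss)).
move=> /(qpt_interior (wall_interior vss neg vk))[g eu].
by apply/qpt_eq; rewrite eu; exact: same_ideal_act.
Qed.

Lemma Uns_collapsed : Uns vtau `<=` collapsed.
Proof.
move=> x [v0 nst e]; apply: contrapT => nx; apply: nst.
move: e nx; have [v [vss ->]] := qpt_surj x.
rewrite (vtau_qpt vss (Vss_wall vss)) quot_qpt => e /existsNP[k /not_implyP[neg /contrapT/(coord_openE sT gt) vk]].
have iv := wall_interior vss neg vk; have [g eu] := qpt_interior iv e.
apply: interior_stable; rewrite -/(\val v0) in eu *; rewrite eu.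
have [x0 [x00 xv xE sp]] := iv; exists x0; split=> // q /xv h; by rewrite co_act mulf_neq0 ?chr_neq0.
Qed.

(* A monomial of weight on the wall involving a positive coordinate involves a
   negative one as well. *)
Lemma wall_same_ideal u v : (forall k, lam (b k) < 0 -> co u k = 0) -> (forall k, lam (b k) < 0 -> co v k = 0) ->
  (forall k, lam (b k) = 0 -> co u k = co v k) -> same_ideal theta0 u v.
Proof.
move=> un vn uv; have lf := lam_form wp.
have main j f : weight_part theta0 j f -> f u = f v.
  move=> [chi echi /semi_invariant_monomials[p fE pm]]; rewrite !fE /mpeval !mevalE.
  apply: eq_big_seq => m mp; congr (_ * _).
  have lm : lam (map_mx intr (wtm A m)) = 0.
    by rewrite pm // echi -scaler_nat lf.2 (lam_theta0 wp) mulr0.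
  have ls : lam (map_mx intr (wtm A m)) = \sum_k (m k)%:R * lam (b k).
    rewrite /wtm /wt map_mx_sum (lf_sum lf); apply: eq_bigr => k _.
    by rewrite raddfMn /= -scaler_nat lf.2.
  have [[k [neg mk]]|no] := pselect (exists k, lam (b k) < 0 /\ m k != 0%N).
    have z w : co w k = 0 -> \prod_(i < n + n) aff_val w 0 i ^+ m i = 0 :> C.
      by move=> wk; rewrite (bigD1 k) //= -[aff_val w 0 k]/(co w k) wk expr0n (negPf mk) mul0r.
    by rewrite !z ?un ?vn.
  have ge k : 0 <= (m k)%:R * lam (b k).
    have [->|mk] := eqVneq (m k) 0%N; first by rewrite mul0r.
    by rewrite mulr_ge0 // leNgt; apply/negP => neg; apply: no; exists k.
  move: lm; rewrite ls => /eqP; rewrite psumr_eq0 // => /allP z.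
  apply: eq_bigr => k _; have := z k (mem_index_enum k); rewrite /= mulf_eq0 pnatr_eq0.
  case/orP => [/eqP->|/eqP/uv e]; first by rewrite !expr0.
  by rewrite -[aff_val u 0 k]/(co u k) -[aff_val v 0 k]/(co v k) e.
by move=> j f wf; rewrite (main j f wf).
Qed.

End VariationOfQuotients.

Lemma irreducible_connected (T : topologicalType) (S : set T) : irreducible_set S -> connected S.
Proof.
move=> [_ irr] B [x Bx] [O oO BO] [F cF BF].
have [||y Sy|h|h] := irr F (~` O) => //.
- exact: open_closedC.
- have [Oy|] := pselect (O y); last by right.
  by left; have : B y by [rewrite BO]; rewrite BF => -[].
- by rewrite BF; apply/seteqP; split=> y; [case|move=> Sy; split=> //; exact: h].
- by move: Bx; rewrite BO => -[Sx Ox]; case: (h x Sx Ox).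
Qed.

Section PolynomialMaps.
Variables (K : closedFieldType) (M N : nat) (l : 'I_N -> mpoly M K).

Definition polymap (t : affine_space K M) : affine_space K N := apt (\row_k ev (l k) t).

Lemma ev_polymap p t : ev p (polymap t) = ev (mmap (@mpolyC M K) l p) t.
Proof.
rewrite /ev /mpeval meval_subst; apply: meval_eq => k; by rewrite /aff_val /= mxE.
Qed.

Lemma polymap_coord t k : aff_val (polymap t) 0 k = ev (l k) t.
Proof. by rewrite /aff_val /= mxE. Qed.

Lemma polymap_continuous O : open O -> open (polymap @^-1` O).
Proof.
move=> oO; change (@aff_open K M (zeros set0) (polymap @^-1` O)) => t Ot.
have [p pt pO] := affine_openP oO Ot.
exists (mmap (@mpolyC M K) l p); rewrite -[mpeval _ _]/(ev _ _) -ev_polymap; split=> // y.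
by rewrite -[mpeval _ _]/(ev _ _) -ev_polymap => py; exact: pO.
Qed.

Lemma polymap_irreducible : irreducible_set (range polymap).
Proof. apply: irreducible_image; [exact: polymap_continuous|exact: affine_irreducible]. Qed.

End PolynomialMaps.

(** * Stein factorisation and exceptional loci *)

Section SteinFactorisation.
Variables (K : fieldType) (X Y : fspace K) (tau : X -> Y).
Local Notation S := (stein tau).
Local Notation pi := (stein_map tau : X -> S).
Local Notation cls := (fibre_component tau).

Lemma fibre_refl x : cls x x.
Proof. exact: connected_component_refl. Qed.

Lemma pi_eq x y : pi x = pi y <-> cls x = cls y.
Proof.
split=> [/(congr1 val)//|e]; exact: val_inj.
Qed.

Lemma fibre_connected (L : set X) x y : connected L -> (forall z, L z -> tau z = tau x) -> L x -> L y ->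
  pi x = pi y.
Proof.
move=> cL Lt Lx Ly; apply/pi_eq; rewrite /fibre_component (Lt y Ly).
by apply: same_connected_component; exists L => //; split.
Qed.

Variable Z : set X.
Hypothesis cZ : closed Z.
Hypothesis fib : forall x y, ~ Z x -> tau x = tau y -> x = y.

Lemma fibre_single x : ~ Z x -> cls x = [set x].
Proof.
move=> nZ; apply/seteqP; split=> y; last by move=> ->; exact: fibre_refl.
by move=> /connected_component_sub /= e; rewrite (fib nZ (esym e)).
Qed.

Lemma pi_inj x y : ~ Z x -> pi x = pi y -> x = y.
Proof.
move=> nZ /pi_eq e; have := fibre_refl y; rewrite -e fibre_single // => ->; by [].
Qed.

Lemma pi_saturated O : O `<=` ~` Z -> pi @^-1` (pi @` O) = O.
Proof.
move=> OZ; apply/seteqP; split=> x; last by move=> Ox; exists x.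
by move=> [y Oy /(pi_inj (OZ _ Oy)) <-].
Qed.

Lemma pi_open O : O `<=` ~` Z -> open O <-> open (pi @` O).
Proof.
move=> OZ; rewrite -[open (pi @` O)]/(quo_open (pi @` O)) /quo_open.
by rewrite (_ : quo_pi _ @^-1` _ = O) //; exact: pi_saturated.
Qed.

Lemma exceptional_sub : exceptional_locus tau `<=` Z.
Proof.
move=> x nex; apply: contrapT => nZ; apply: nex; exists (~` Z), (pi @` ~` Z); split=> //.
have oZ : open (~` Z) by exact: closed_openC.
split=> //.
- exact: (pi_open (subset_refl _)).1 oZ.
- split=> [y Zy|y z|s [y Zy <-]]; first by exists y.
    by rewrite !inE => Zy _; exact: pi_inj.
  by exists y.
- by move=> O OZ; exact: pi_open.
- move=> O phi OZ oO.
  suff -> : ~` Z `&` pi @^-1` O = pi @^-1` O by [].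
  apply/seteqP; split=> y; first by case.
  move=> Oy; split=> //; have [z Zz /(pi_inj Zz) e] := OZ _ Oy; by rewrite -e.
Qed.

Lemma exceptional_closed : closed (exceptional_locus tau).
Proof.
rewrite -[exceptional_locus tau]setCK; apply: open_closedC.
have -> : ~` exceptional_locus tau = \bigcup_(U in [set U | exists W, iso_on (stein_map tau) U W]) U.
  apply/seteqP; split=> x; first by move=> /contrapT[U [W [Ux h]]]; exists U => //; exists W.
  by move=> [U [W h] Ux] nex; apply: nex; exists U, W.
by apply: bigcup_open => U [W []].
Qed.

(** [L] is connected and lies in one fibre, so the Stein map sends it to a point. Were that map an
    isomorphism near [x], a nearby point of [L] outside the closed complement of [O] would have to
    coincide with [x]. *)
Lemma exceptional_line (L : set X) x : irreducible_set L -> L x -> (forall z, L z -> tau z = tau x) ->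
  (exists O, [/\ open O, ~ O x & O `&` L !=set0]) -> exceptional_locus tau x.
Proof.
move=> irr Lx Lt [O [oO nOx [y [Oy Ly]]]] [U [W [Ux [oU _ [_ inj _] _ _]]]].
have [||z [Lz [Uz Oz]]] := irreducible_open irr oU oO; [by exists x|by exists y|].
have e : pi x = pi z by apply: (fibre_connected (irreducible_connected irr)).
by have := inj x z (mem_set Ux) (mem_set Uz) e => xz; apply: nOx; rewrite xz.
Qed.

(** Closures of images stay strictly increasing because each strict inclusion is visible at a point
    off [Z], near which the Stein map is injective and open. *)
Lemma stein_chain (L : nat -> set X) d : (forall i, (i <= d)%N -> irreducible_set (L i)) ->
  (forall i, (i < d)%N -> L i `<=` L i.+1) ->
  (forall i, (i < d)%N -> exists2 p, L i.+1 p & ~ Z p /\ ~ closure (L i) p) -> dim_ge S d.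
Proof.
move=> irr inc pt; exists (fun i => closure (pi @` L i)); split=> i le.
  split; first exact: closed_closure.
  by apply: irreducible_closure; apply: irreducible_image; [move=> O oO|exact: irr].
have sub : pi @` L i `<=` pi @` L i.+1 by move=> _ [x Lx <-]; exists x => //; exact: inc.
split; first exact: closureS.
have [p Lp [nZ ncl]] := pt i le; move=> h.
pose O := ~` Z `&` ~` closure (L i).
have oO : open O by apply: openI; [exact: closed_openC|exact/closed_openC/closed_closure].
have OZ : O `<=` ~` Z by move=> y [].
have [||_ [[y Ly <-] [z [Zz nz] /(pi_inj Zz) e]]] := h (pi p) _ (pi @` O).
- by apply: subset_closure; exists p.
- by apply: open_nbhs_nbhs; split; [exact/(pi_open OZ)|exists p].
by apply: nz; rewrite e; exact: subset_closure.
Qed.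

End SteinFactorisation.

Section WallMorphism.
Variables (R : realType) (r n : nat) (A : 'M[int]_(r, n)).
Hypothesis sT : spanning A [set: 'I_n]%SET.
Hypothesis nc : nocoloop A.
Hypothesis uni : forall J, base A J -> forall chi : 'rV[int]_r, iw A J (map_mx intr chi).
Local Notation C := R[i].
Local Notation V := (V R A).
Local Notation I2 := 'I_(n + n).
Local Notation sol := (sol A).
Variables (theta theta0 : 'rV[rat]_r) (J0 : {set 'I_n}) (j0 : 'I_n).
Hypothesis wp : wall_point A theta theta0 J0 j0.
Local Notation gt := (wp_gen wp).
Local Notation X := (X R A theta).
Local Notation lam := (@lam r n A theta J0 j0).
Local Notation wallE := (@wallE r n A J0 j0).
Local Notation negk := (@negk r n A theta J0 j0).
Local Notation b := (bQ A).
Local Notation tau := (@vtau R r n A sT theta theta0 J0 j0 wp).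
Local Notation collapsed := (@collapsed R r n A theta J0 j0).
Local Notation chart bJ := (@gcpt R r n A theta gt _ bJ).
Local Notation sl bJ y := (slice theta bJ (cv y)).
Implicit Types (u v : V) (k : I2) (J : {set 'I_n}).

Lemma chart_qpt J (bJ : base A J) y : chart bJ y = qpt (slice_Vss bJ (gt bJ) (cv y)).
Proof. exact: gcptE. Qed.

Lemma chart_onto J (bJ : base A J) x : gU gt bJ x -> exists y, x = chart bJ y.
Proof. exact: slice_openP. Qed.

Lemma chart_cover x : exists J (bJ : base A J) y, x = chart bJ y.
Proof.
by have [J [bJ Ux]] := g_cover sT gt x; have [y e] := chart_onto Ux; exists J, bJ, y.
Qed.

Lemma chart_continuous J (bJ : base A J) O : open O -> open (chart bJ @^-1` O).
Proof. exact: (chart_preimage_open (g_iso R uni gt bJ)). Qed.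

Lemma chart_open_image J (bJ : base A J) O : open O -> open (chart bJ @` O).
Proof. exact: (chart_image_open (g_iso R uni gt bJ) O).1. Qed.

Lemma collapsed_chart J (bJ : base A J) y :
  collapsed (chart bJ y) <-> forall k, lam (b k) < 0 -> co (sl bJ y) k = 0.
Proof. by rewrite chart_qpt; exact: (collapsedE sT wp). Qed.

Lemma collapsed_single J (bJ : base A J) y : collapsed (chart bJ y) -> exists2 j, j \in J & sol J theta0 0 j = 0.
Proof.
move=> /collapsed_chart h; apply: contrapT => no.
have [|j jJ neg] := wall_negative wp bJ; first by move=> j jJ; apply/eqP => z; apply: no; exists j.
by have := h _ neg; rewrite slice_one // => /eqP; rewrite oner_eq0.
Qed.

Lemma free_slot J k : idx k \notin J -> exists a : 'I_(sdim J), fcoord a = k.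
Proof. by case: (slotP A theta J k) => [a -> _|j jJ ->|j jJ ->]; [exists a|rewrite idx_sc jJ|rewrite idx_bar idx_sc jJ]. Qed.

Lemma affine_ext J (y y' : affine_space C (sdim J)) : (forall k : 'I_(sdim J), cv y k = cv y' k) -> y = y'.
Proof. by move=> h; apply: val_inj; apply/rowP. Qed.

Lemma full_not_collapsed v (vss : Vss theta v) : (forall k, co v k != 0) -> ~ collapsed (qpt vss).
Proof.
move=> hv /(collapsedE sT wp)/(_ _ (lam_negk wp (wall_in0 wp)))/eqP; exact/negP.
Qed.

(** A flag of affine subspaces of a chart, through a point with no zero coordinate, is a chain whose
    members all leave the collapsed locus, so it survives in the Stein factorisation with any length
    attained in [X]. *)
Lemma wall_not_fibre : ~ fibre_type tau.
Proof.
move=> [d [[Z ch] nd]]; apply: nd; have [irr inc] := ch.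
have [_ [[x Zx] _]] := irr 0%N isT; have [J [bJ Ux]] := g_cover sT gt x.
have dN : (d <= sdim J)%N by apply: (dim_bound (bJ := bJ) (s0 := gt bJ) ch); exists x.
have [v hv] := full_point R nc; pose vss := full_Vss theta sT hv.
have [y0 ey0] := chart_onto (@gU_full R r n A theta gt J bJ v vss hv).
(* The i-th member of the flag: the first [i] coordinates are free and the others are those of
   [y0]. *)
pose l i (k : 'I_(sdim J)) : mpoly (sdim J) C := if (k < i)%N then mpolyX C (mnm1 k) else mpolyC _ (cv y0 k).
have lE i (k : 'I_(sdim J)) y : ev (l i k) y = if (k < i)%N then cv y k else cv y0 k.
  by rewrite /l; case: ifP => _; [exact: mevalXU|exact: evC].
have pE i (k : 'I_(sdim J)) y : cv (polymap (l i) y) k = if (k < i)%N then cv y k else cv y0 k.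
  by rewrite /cv polymap_coord lE.
pose L i := chart bJ @` range (polymap (l i)).
have L0 i : L i (chart bJ y0).
  exists y0 => //; exists y0 => //; apply: affine_ext => k; rewrite pE; by case: ifP.
have irrL i : irreducible_set (L i).
  by apply: irreducible_image; [move=> O; exact: chart_continuous|exact: polymap_irreducible].
have fib := @collapsed_fibre R r n A sT theta theta0 J0 j0 wp.
have cZ := @collapsed_closed R r n A sT uni theta theta0 J0 j0 wp.
apply: (stein_chain cZ fib (L := L)) => i le; first exact: irrL.
  move=> _ [_ [y _ <-] <-]; exists (polymap (l i) y) => //; exists (polymap (l i) y) => //.
  apply: affine_ext => k; rewrite !pE; case: (ltnP k i) => h; first by rewrite ltnS (ltnW h).
  by rewrite if_same.
pose a : 'I_(sdim J) := Ordinal (leq_trans le dN).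
pose f : mpoly (sdim J) C := mpolyX C (mnm1 a) - mpolyC _ (cv y0 a).
have fE y : ev f y = cv y a - cv y0 a by rewrite evB evC; congr (_ - _); exact: mevalXU.
have oO : open (chart bJ @` nonzero f) by apply: chart_open_image; exact: nonzero_open.
have [||p [Lp [nZ Op]]] := irreducible_open (irrL i.+1) (closed_openC cZ) oO.
- by exists (chart bJ y0); split=> //; rewrite -ey0; exact: full_not_collapsed.
- pose y := apt (\row_k (cv y0 k + (k == a)%:R)) : affine_space C (sdim J).
  exists (chart bJ y); split.
    exists y => //; exists y => //; apply: affine_ext => k; rewrite pE; case: ifP => // /negbT h.
    rewrite /cv /aff_val /= mxE -/(cv y0 k); case: eqP => [e|_]; last by rewrite addr0.
    by move: h; rewrite e /= ltnSn.
  exists y => //; rewrite /nonzero /= fE {1}/cv /aff_val /= mxE eqxx -/(cv y0 a).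
  by rewrite addrAC subrr add0r oner_neq0.
exists p => //; split=> // cl; have [_ [[_ [y _ <-] <-] [z nz e]]] := cl _ (open_nbhs_nbhs (conj oO Op)).
have {}e := chart_inj (g_iso R uni gt bJ) e; move: nz; rewrite e /nonzero /= fE pE ltnn subrr eqxx; by [].
Qed.

(** In a chart meeting the collapsed locus only one element of the base is off the hyperplane. Two
    further such columns contribute two free coordinates of negative weight, and both vanish on the
    collapsed locus. *)
Lemma wall_codim S : (2 < #|wallE|)%N -> S `<=` collapsed -> codim_ge S 2.
Proof.
move=> card sS D cD irD DS.
have DZ : D `<=` collapsed.
  apply: subset_trans DS _; rewrite (closure_id collapsed).1; first exact: closureS.
  exact: (@collapsed_closed R r n A sT uni theta theta0 J0 j0 wp).
have [[x Dx] _] := irD; have [J [bJ [y0 ex]]] := chart_cover x; rewrite {}ex in Dx.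
have [j jJ z] := collapsed_single (DZ _ Dx).
have [i1 [i2 [e1 e2 n1 n2 n12]]] : exists i1 i2, [/\ i1 \in wallE, i2 \in wallE, i1 != j, i2 != j & i1 != i2].
  have : (1 < #|wallE :\ j|)%N.
    move: card; rewrite (finset.cardsD1 j wallE); case: (j \in wallE); rewrite /= ?add1n ?add0n ?ltnS //.
    exact: ltnW.
  by case/card_gt1P => i1 [i2 []]; rewrite !inE => /andP[? ?] /andP[? ?] ?; exists i1, i2; rewrite !inE.
have out i : i \in wallE -> i != j -> i \notin J by move=> iE ij; exact: (flop_out wp bJ jJ z iE ij).
have [a ea] : exists a : 'I_(sdim J), fcoord a = negk i1 by apply: free_slot; rewrite idx_negk; exact: out.
have [c ec] : exists a : 'I_(sdim J), fcoord a = negk i2 by apply: free_slot; rewrite idx_negk; exact: out.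
have ac : a != c.
  by apply: contraNneq n12 => e; rewrite -(idx_negk A theta J0 j0 i1) -(idx_negk A theta J0 j0 i2) -ea -ec e.
have D0 (d : 'I_(sdim J)) i y : i \in wallE -> fcoord d = negk i -> D (chart bJ y) -> cv y d = 0.
  move=> iE ed Dy; have := (collapsed_chart bJ y).1 (DZ _ Dy) _ (lam_negk wp iE).
  by rewrite -ed slice_free.
pose F := closure (chart bJ @` hypersurface (mpolyX C (mnm1 a))).
have hE y : hypersurface (mpolyX C (mnm1 a)) y <-> cv y a = 0.
  by rewrite /hypersurface /= (_ : ev _ y = cv y a) //; exact: mevalXU.
have irrX := X_irreducible R sT nc gt; have iso := g_iso R uni gt bJ.
have pf : prime_elt (mpolyX C (mnm1 a) : mpoly (sdim J) C) by exact: prime_mpolyX.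
have cF : closed F by exact: closed_closure.
have DF : D `<=` F.
  apply: (closed_chart_sub iso irD cF); first by exists (chart bJ y0); split=> //; exact: cpt_open.
  move=> y Dy; rewrite /F /preimage /=; apply: subset_closure; exists y => //; apply/hE.
  exact: D0 e1 ea Dy.
have FT : F != setT by exact: (hypersurface_neqT iso pf).
have irF : irreducible_set F by exact: (irreducible_image_hypersurface iso pf).
have DFs : D `<` F.
  split=> // FD; pose y := apt (\row_k (k == c)%:R) : affine_space C (sdim J).
  have : F (chart bJ y).
    apply: subset_closure; exists y => //; apply/hE; by rewrite /cv /aff_val /= mxE (negPf ac).
  move=> /FD/(D0 c i2 y e2 ec)/eqP; by rewrite /cv /aff_val /= mxE eqxx oner_eq0.
have c2 : codim_ge D 2 by apply: codim_ge2 cD DFs cF irF FT.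
by apply: c2 => //; exact: subset_closure.
Qed.

Lemma wall_small : (2 < #|wallE|)%N -> small tau.
Proof.
move=> card; split; first exact: wall_not_fibre.
move=> [D [[cD irD _ nc2] sub]]; apply: nc2; apply: wall_codim => //; apply: subset_trans sub _.
apply: exceptional_sub; first exact: (@collapsed_closed R r n A sT uni theta theta0 J0 j0 wp).
exact: (@collapsed_fibre R r n A sT theta theta0 J0 j0 wp).
Qed.

End WallMorphism.

Section FlopChart.
Variables (R : realType) (r n : nat) (A : 'M[int]_(r, n)).
Hypothesis sT : spanning A [set: 'I_n]%SET.
Hypothesis nc : nocoloop A.
Hypothesis uni : forall J, base A J -> forall chi : 'rV[int]_r, iw A J (map_mx intr chi).
Local Notation C := R[i].
Local Notation V := (V R A).
Local Notation I2 := 'I_(n + n).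
Local Notation sol := (sol A).
Variables (theta theta0 : 'rV[rat]_r) (J0 : {set 'I_n}) (j0 : 'I_n).
Hypothesis wp : wall_point A theta theta0 J0 j0.
Local Notation gt := (wp_gen wp).
Local Notation X := (X R A theta).
Local Notation lam := (@lam r n A theta J0 j0).
Local Notation wallE := (@wallE r n A J0 j0).
Local Notation negk := (@negk r n A theta J0 j0).
Local Notation b := (bQ A).
Local Notation tau := (@vtau R r n A sT theta theta0 J0 j0 wp).
Local Notation collapsed := (@collapsed R r n A theta J0 j0).
Local Notation chart bJ := (@gcpt R r n A theta gt _ bJ).
Local Notation sl bJ y := (slice theta bJ (cv y)).
Implicit Types (u v : V) (k : I2).


Definition supported (S : {set I2}) : set X := [set x | forall k, k \notin S -> ~ coord_open k x].

Lemma supported_closed S : closed (supported S).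
Proof.
rewrite -[supported S]setCK; apply: open_closedC.
have -> : ~` supported S = \bigcup_(k in [set k | k \notin S]) @coord_open R r n A theta k.
  apply/seteqP; split=> x; last by move=> [k kS kx] h; exact: h k kS kx.
  by move=> /existsNP[k /not_implyP[kS /contrapT kx]]; exists k.
by apply: bigcup_open => k _; exact: (@coord_open_open R r n A theta sT uni gt k).
Qed.

Lemma supported_chart S J (bJ : base A J) y : supported S (chart bJ y) <-> forall k, k \notin S -> co (sl bJ y) k = 0.
Proof.
rewrite (chart_qpt wp); split=> h k kS.
  by apply/eqP; apply: contraT => vk; case: (h k kS); apply/(coord_openE sT gt).
by move=> /(coord_openE sT gt); rewrite h // eqxx.
Qed.

Section Chart.
Variables (J : {set 'I_n}) (j i : 'I_n).
Hypothesis bJ : base A J.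
Hypothesis jJ : j \in J.
Hypothesis z : sol J theta0 0 j = 0.
Hypothesis iE : i \in wallE.
Local Notation N := (sdim J).
Implicit Types (y : affine_space C N).

Lemma negk_pivot : negk j = bar (sc A theta J j).
Proof.
have jE : j \in wallE by rewrite (wall_single wp bJ jJ z jJ) eqxx.
have [e|//] : negk j = sc A theta J j \/ negk j = bar (sc A theta J j) by apply: idx_eq; rewrite idx_negk idx_sc.
by have := wall_positive wp bJ jJ z; rewrite -[sidx _ _ _ _]/(sc A theta J j) -e ltNge (ltW (lam_negk wp jE)).
Qed.

Lemma ext_negk y i' : i' \in wallE -> (forall d : 'I_N, lam (b (fcoord d)) < 0 -> cv y d = 0) ->
  ext (cv y) (negk i') = 0.
Proof.
move=> iE' h; rewrite /ext big1 // => d /eqP ed; apply: h; rewrite ed; exact: (lam_negk wp iE').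
Qed.

Lemma ext_pair y i' : ext (cv y) (negk i') = 0 ->
  ext (cv y) (lshift n i') * ext (cv y) (rshift n i') = 0.
Proof. by rewrite /negk; case: ifP => _ ->; rewrite ?mul0r ?mulr0. Qed.

(** The one remaining coordinate of negative weight, opposite to the pivot, is a sum of products of
    pairs. Only pairs off the hyperplane contribute, and each contains a negative coordinate that is
    already zero. *)
Lemma chart_collapsed y : collapsed (chart bJ y) <-> forall d : 'I_N, lam (b (fcoord d)) < 0 -> cv y d = 0.
Proof.
rewrite (collapsed_chart sT wp); split=> h; first by move=> d /h; rewrite slice_free.
move=> k neg; case: (slotP A theta J k) => [d e _|l lJ e|l lJ e]; first by rewrite e slice_free h // -e.
  have lE : l \in wallE by rewrite -(idx_sc A theta J l) -e -(lam_bQ wp) lt_eqF.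
  have lj : l = j by apply/eqP; rewrite -(wall_single wp bJ jJ z lJ).
  by have := wall_positive wp bJ jJ z; rewrite -[sidx _ _ _ _]/(sc A theta J j) -lj -e ltNge (ltW neg).
have lE : l \in wallE by rewrite -(idx_sc A theta J l) -(idx_bar (sc A theta J l)) -e -(lam_bQ wp) lt_eqF.
have lj : l = j by apply/eqP; rewrite -(wall_single wp bJ jJ z lJ).
rewrite e co_slice slc_bar // lj /quad big1 ?oppr0 // => i' _.
have [c c0 cE] := wall_proportional wp bJ jJ z; have [iE'|niE] := boolP (i' \in wallE).
  by rewrite ext_pair ?mul0r // ext_negk.
by rewrite cE (_ : lam _ = 0) ?mulr0 ?rmorph0 ?mulr0 //; apply/eqP; rewrite -[_ == 0]negbK (lam_aQ wp) niE.
Qed.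

Variable c : 'I_N.
Hypothesis ec : fcoord c = bar (negk i).

Lemma tau_line y y' : collapsed (chart bJ y) -> collapsed (chart bJ y') ->
  (forall k : 'I_N, k != c -> cv y k = cv y' k) -> tau (chart bJ y) = tau (chart bJ y').
Proof.
move=> cy cy' yy; have h := (chart_collapsed y).1 cy; have h' := (chart_collapsed y').1 cy'.
have v0 := Vss_wall sT wp (slice_Vss bJ (gt bJ) (cv y)); have v0' := Vss_wall sT wp (slice_Vss bJ (gt bJ) (cv y')).
rewrite !(chart_qpt wp) (vtau_qpt sT wp _ v0) (vtau_qpt sT wp _ v0'); apply/qpt_eq.
apply: (wall_same_ideal wp); [exact: (collapsed_chart sT wp bJ y).1|exact: (collapsed_chart sT wp bJ y').1|].
have ext_eq k : idx k \notin wallE -> ext (cv y) k = ext (cv y') k.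
  move=> kE; rewrite /ext; apply: eq_bigr => d /eqP ed; apply: yy; apply: contraNneq kE => dc.
  by rewrite -ed dc ec idx_bar idx_negk.
move=> k l0; have kE : idx k \notin wallE by rewrite -(lam_bQ wp) negbK l0 eqxx.
rewrite !co_slice /slc; case: ifP => _; first exact: ext_eq.
case: ifP => // _; congr (- _); rewrite /quad; apply: eq_bigr => i' _; congr (_ * _).
have [iE'|niE] := boolP (i' \in wallE); last by rewrite !ext_eq ?idx_l ?idx_r.
by rewrite !ext_pair // ext_negk.
Qed.

(** Allowed nonzero coordinates on a contracted curve: the normalised ones and one free coordinate
    of positive weight. *)
Definition line_set : {set I2} := [set k | (k == fcoord c) || ((idx k \in J) && (k == sc A theta J (idx k)))]%SET.

Lemma line_chart y : supported line_set (chart bJ y) <-> forall d, d != c -> cv y d = 0.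
Proof.
rewrite supported_chart; split=> [h d dc|h k kS].
  rewrite -(slice_free theta bJ (cv y) d); apply: h; rewrite !inE negb_or (negPf (fcoord_free d)) /= andbT.
  by apply: contraNneq dc => /fcoord_inj->.
case: (slotP A theta J k) kS => [d -> _|l lJ ->|l lJ ->]; rewrite !inE.
- by rewrite slice_free negb_or => /andP[dc _]; apply: h; apply: contraNneq dc => ->.
- by rewrite idx_sc lJ eqxx orbT.
move=> _; rewrite co_slice slc_bar // /quad big1 ?oppr0 // => i' _.
have E k' : k' != fcoord c -> ext (cv y) k' = 0.
  by move=> kc; rewrite /ext big1 // => d /eqP ed; apply: h; apply: contraNneq kc => <-; rewrite ed.
have [e|ne] := eqVneq (lshift n i') (fcoord c); last by rewrite E // !mul0r.
by rewrite (E (rshift n i')) ?mulr0 ?mul0r // -e -bar_l bar_neq.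
Qed.

Lemma line_collapsed y : (forall d, d != c -> cv y d = 0) -> collapsed (chart bJ y).
Proof.
move=> h; apply/chart_collapsed => d neg; apply: h; apply: contraTneq neg => ->.
by rewrite ec bQ_bar (lfN (lam_form wp)) oppr_lt0 -leNgt ltW // (lam_negk wp iE).
Qed.

Definition line_eq (k : 'I_N) : mpoly 1 C := if k == c then mpolyX C (mnm1 0) else 0.

Definition line_point (t : C) : affine_space C N := apt (\row_k (if k == c then t else 0)).

Lemma cv_line_point t (k : 'I_N) : cv (line_point t) k = if k == c then t else 0.
Proof. by rewrite /cv /aff_val /= mxE. Qed.

Lemma line_pointP y : (forall d, d != c -> cv y d = 0) -> y = line_point (cv y c).
Proof. by move=> h; apply: affine_ext => k; rewrite cv_line_point; case: eqVneq => [->//|]; exact: h. Qed.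

Lemma line_point_supported t : supported line_set (chart bJ (line_point t)).
Proof. by apply/line_chart => d /negPf dc; rewrite cv_line_point dc. Qed.

Lemma line_irreducible : irreducible_set (chart bJ @` range line_point).
Proof.
have -> : range line_point = range (polymap line_eq).
  have E (t : affine_space C 1) : polymap line_eq t = line_point (aff_val t 0 0).
    apply: affine_ext => k; rewrite cv_line_point /cv polymap_coord /line_eq; case: ifP => _; last exact: ev0.
    exact: mevalXU.
  apply/seteqP; split=> _ [t _ <-]; last by exists (aff_val t 0 0).
  exists (apt (\row__ t)) => //; rewrite E; congr line_point; by rewrite /aff_val /= mxE.
by apply: irreducible_image; [move=> O; exact: chart_continuous|exact: polymap_irreducible].
Qed.

Lemma line_chain Z d : irr_chain Z d -> Z d = supported line_set -> Z 0%N `&` gU gt bJ !=set0 -> (d <= 1)%N.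
Proof.
move=> ch e meet; apply: (@parametrised_dim_bound R r n A theta J bJ (gt bJ) 1 line_eq d Z ch meet) => x.
rewrite e => sx /(chart_onto (wp := wp))[y ey]; rewrite ey in sx *; exists (fun=> cv y c).
rewrite [in LHS](line_pointP ((line_chart y).1 sx)); congr (chart bJ (apt _)); apply/rowP => k.
rewrite !mxE /line_eq; case: ifP => _; [by rewrite mevalXU|by rewrite meval0].
Qed.

End Chart.

Section Divisor.
Hypothesis card : #|wallE| = 2%N.

(** With two columns off the hyperplane there is a single free coordinate [a] of negative weight, so
    its whole hypersurface is collapsed; through each point of it runs a contracted line in the
    direction of the opposite coordinate [c]. *)
Lemma wall_divisorial : divisorial tau.
Proof.
split; first exact: (@wall_not_fibre R r n A sT nc uni theta theta0 J0 j0 wp).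
have bJ := wp_base wp; have jJ := wp_in wp; have z := wp_zero wp; have jE := wall_in0 wp.
have [i iE ij] := wall_two wp nc jE.
have two (k : 'I_n) : k \in wallE -> k = j0 \/ k = i.
  have : #|wallE :\ j0 :\ i| = 0%N.
    have := finset.cardsD1 j0 wallE; rewrite jE card add1n => -[e].
    by have := finset.cardsD1 i (wallE :\ j0)%SET; rewrite finset.in_setD1 ij iE -e add1n => -[<-].
  move=> /eqP; rewrite finset.cards_eq0 => /eqP e0 kE.
  have [->|kj] := eqVneq k j0; first by left.
  right; apply/eqP; apply: contraT => ki.
  by have := finset.in_set0 k; rewrite -e0 !finset.in_setD1 ki kj kE.
have iJ := flop_out wp bJ jJ z iE ij.
have [a ea] : exists a : 'I_(sdim J0), fcoord a = negk i by apply: (free_slot A theta); rewrite idx_negk.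
have [c ec] : exists a : 'I_(sdim J0), fcoord a = bar (negk i) by apply: (free_slot A theta); rewrite idx_bar idx_negk.
have ac : a != c by apply: contraTneq (bar_neq (negk i)) => e; rewrite -ec -ea e eqxx.
have irrX := X_irreducible R sT nc gt; have iso := g_iso R uni gt bJ.
have pf : prime_elt (mpolyX C (mnm1 a) : mpoly (sdim J0) C) by exact: prime_mpolyX.
have hE (y : affine_space C (sdim J0)) : hypersurface (mpolyX C (mnm1 a)) y <-> cv y a = 0.
  by rewrite /hypersurface /= (_ : ev _ y = cv y a) //; exact: mevalXU.
have col (y : affine_space C (sdim J0)) : cv y a = 0 -> collapsed (chart bJ y).
  move=> ya; apply/(chart_collapsed bJ jJ z) => d neg.
  have dE : idx (fcoord d) \in wallE by rewrite -(lam_bQ wp) lt_eqF.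
  have [e|e] := two _ dE; first by have := fcoord_free d; rewrite e jJ.
  suff -> : d = a by []. by apply: fcoord_inj; rewrite ea (negkE wp neg) e.
exists (closure (chart bJ @` hypersurface (mpolyX C (mnm1 a)))).
split; first exact: (hypersurface_prime_divisor iso irrX pf).
have cX : closed (exceptional_locus tau) by exact: exceptional_closed.
rewrite (closure_id (exceptional_locus tau)).1 //; apply: closureS => _ [y /hE ya <-].
pose l (k : 'I_(sdim J0)) : mpoly 1 C := if k == c then mpolyX C (mnm1 0) else mpolyC _ (cv y k).
have lE (k : 'I_(sdim J0)) (t : affine_space C 1) : cv (polymap l t) k = if k == c then aff_val t 0 0 else cv y k.
  by rewrite /cv polymap_coord /l; case: ifP => _; [exact: mevalXU|exact: evC].
pose f : mpoly (sdim J0) C := mpolyX C (mnm1 c) - mpolyC _ (cv y c).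
have fE y' : ev f y' = cv y' c - cv y c by rewrite evB evC; congr (_ - _); exact: mevalXU.
apply: (@exceptional_line _ _ _ tau (chart bJ @` range (polymap l))).
- by apply: irreducible_image; [move=> O; exact: chart_continuous|exact: polymap_irreducible].
- exists y => //; exists (apt (\row__ cv y c)) => //; apply: affine_ext => k; rewrite lE.
  by case: eqP => // ->; rewrite {1}/cv /aff_val /= mxE.
- move=> _ [_ [t _ <-] <-].
  have cy' : collapsed (chart bJ (polymap l t)) by apply: col; rewrite lE (negPf ac).
  have yy (k : 'I_(sdim J0)) : k != c -> cv (polymap l t) k = cv y k by move=> kc; rewrite lE (negPf kc).
  exact: (tau_line jJ z iE ec cy' (col y ya) yy).
exists (chart bJ @` nonzero f); split.
- by apply: chart_open_image => //; exact: nonzero_open.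
- move=> [y' ny /(chart_inj iso) e]; move: ny; rewrite e /nonzero /= fE subrr eqxx; by [].
pose t : affine_space C 1 := apt (\row__ (cv y c + 1)).
exists (chart bJ (polymap l t)); split; last by exists (polymap l t) => //; exists t.
exists (polymap l t) => //; rewrite /nonzero /= fE lE eqxx {1}/cv /aff_val /= mxE addrAC subrr add0r.
exact: oner_neq0.
Qed.

End Divisor.

End FlopChart.

(** * A curve contracted by the VGIT morphism *)

Section FlopCurve.
Variables (R : realType) (r n : nat) (A : 'M[int]_(r, n)).
Hypothesis sT : spanning A [set: 'I_n]%SET.
Hypothesis uni : forall J, base A J -> forall chi : 'rV[int]_r, iw A J (map_mx intr chi).
Local Notation C := R[i].
Local Notation V := (V R A).
Local Notation I2 := 'I_(n + n).
Local Notation sol := (sol A).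
Variables (theta theta0 : 'rV[rat]_r) (J0 : {set 'I_n}) (j0 : 'I_n).
Hypothesis wp : wall_point A theta theta0 J0 j0.
Local Notation gt := (wp_gen wp).
Local Notation X := (X R A theta).
Local Notation lam := (@lam r n A theta J0 j0).
Local Notation wallE := (@wallE r n A J0 j0).
Local Notation negk := (@negk r n A theta J0 j0).
Local Notation b := (bQ A).
Local Notation tau := (@vtau R r n A sT theta theta0 J0 j0 wp).
Local Notation collapsed := (@collapsed R r n A theta J0 j0).
Local Notation supported := (@supported R r n A theta).
Local Notation chart bJ := (@gcpt R r n A theta gt _ bJ).
Local Notation sl bJ y := (slice theta bJ (cv y)).
Implicit Types (u v : V) (k : I2).

Variable i : 'I_n.
Hypothesis iE : i \in wallE.
Hypothesis ij : i != j0.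
Local Notation J1 := (i |: J0 :\ j0)%SET.
Let b0 : base A J0 := wp_base wp.
Let jJ : j0 \in J0 := wp_in wp.
Let z0 : sol J0 theta0 0 j0 = 0 := wp_zero wp.
Let iJ : i \notin J0 := flop_out wp b0 jJ z0 iE ij.
Let b1 : base A J1 := flop_base wp b0 jJ z0 iE ij.
Let iJ1 : i \in J1. Proof. by rewrite !inE eqxx. Qed.
Let j1 : j0 \notin J1. Proof. by rewrite !inE eqxx (eq_sym j0 i) (negPf ij). Qed.
Let z1 : sol J1 theta0 0 i = 0.
Proof. by rewrite (flop_sol0 wp b0 jJ z0 iE ij) sol_out. Qed.
Let jE : j0 \in wallE := wall_in0 wp.

Variables (c0 : 'I_(sdim J0)) (c1 : 'I_(sdim J1)).
Hypothesis ec0 : fcoord c0 = bar (negk i).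
Hypothesis ec1 : fcoord c1 = bar (negk j0).
Local Notation S := (line_set A theta c0).

Lemma flop_sc l : l \in J0 -> l != j0 -> sc A theta J1 l = sc A theta J0 l.
Proof.
move=> lJ lj; have := flop_same_sign wp b0 jJ z0 iE ij lJ lj; rewrite /sc /sidx.
have [h|h] := ltP 0 (sol J0 theta 0 l); first by rewrite pmulr_rgt0 // => ->.
have h' : sol J0 theta 0 l < 0 by rewrite lt_neqAle h andbT; exact: (wp_gen wp).
by rewrite nmulr_rgt0 // => /ltW; rewrite leNgt => /negPf->.
Qed.

Lemma pos_i : bar (negk i) = sc A theta J1 i.
Proof. by rewrite (negk_pivot wp b1 iJ1 z1) barK. Qed.

Lemma pos_j : bar (negk j0) = sc A theta J0 j0.
Proof. by rewrite (negk_pivot wp b0 jJ z0) barK. Qed.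

(** Exchanging [j0] for [i] swaps the roles of pivot and free positive coordinate, so both charts
    describe the same support. *)
Lemma line_set_flop : line_set A theta c1 = S.
Proof.
apply/finset.setP => k; rewrite !inE ec0 ec1; apply/idP/idP.
  case/orP => [/eqP ->|/andP[/orP[/eqP e|/andP[kj kJ]] /eqP ek]].
  - by rewrite pos_j idx_sc jJ eqxx orbT.
  - by rewrite pos_i {1}ek e eqxx.
  - by rewrite kJ /= -flop_sc // -ek eqxx orbT.
case/orP => [/eqP ->|/andP[kJ /eqP ek]].
  by rewrite pos_i idx_sc !eqxx orbT.
have [e|kj] := eqVneq (idx k) j0; first by rewrite pos_j {1}ek e eqxx.
by rewrite kJ orbT /= flop_sc // -ek eqxx orbT.
Qed.

(** A chart around the point uses a base inside [i |: J0]. It cannot contain both [i] and [j0]: then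
    no coordinate of [theta0] would vanish in it, and by [wall_negative] it would normalise a
    coordinate of negative weight, which the support excludes. *)
Lemma supported_cover x : supported S x -> gU gt b0 x \/ gU gt b1 x.
Proof.
have [v [vss ->]] := qpt_surj x => sv; have [J bJ hJ] := gen_cover sT gt vss.
have inS j : j \in J -> sc A theta J j \in S.
  by move=> jJ'; apply: contraT => nS; case: (sv _ nS); apply/(coord_openE sT gt); exact: hJ.
have Kj j : j \in J -> j = i \/ j \in J0.
  move=> jJ'; have := inS j jJ'; rewrite !inE ec0 => /orP[/eqP e|/andP[]]; last by rewrite idx_sc; right.
  by left; rewrite -(idx_sc A theta J j) e idx_bar idx_negk.
have chartU J' (bJ' : base A J') : J = J' -> gU gt bJ' (qpt vss).
  by move=> e; subst J'; apply/(slice_openE bJ' (gt bJ') vss).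
have [iJ'|niJ] := boolP (i \in J); last first.
  left; apply: chartU; apply: (base_sub_eq b0 bJ); apply/fintype.subsetP => j jJ'.
  by have [e|//] := Kj j jJ'; rewrite e (negPf niJ) in jJ'.
have [jJ'|njJ] := boolP (j0 \in J); last first.
  right; apply: chartU; apply: (base_sub_eq b1 bJ); apply/fintype.subsetP => j jJ'; rewrite !inE.
  have [->|jJ0] := Kj j jJ'; first by rewrite eqxx.
  by rewrite jJ0 andbT; apply/orP; right; apply: contraNneq njJ => <-.
have nz l : l \in J -> sol J theta0 0 l != 0.
  move=> lJ; apply/eqP => zl; have := wall_single wp bJ lJ zl iJ'; have := wall_single wp bJ lJ zl jJ'.
  by rewrite iE jE => /esym/eqP <- /esym/eqP e; move: ij; rewrite e eqxx.
have [l lJ neg] := wall_negative wp bJ nz; rewrite -[sidx _ _ _ _]/(sc A theta J l) in neg.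
have := inS l lJ; rewrite !inE ec0 => /orP[/eqP e|/andP[lJ0 /eqP e]].
  by have := lam_negk wp iE; rewrite e bQ_bar (lfN (lam_form wp)) oppr_lt0 in neg *; rewrite ltNge (ltW neg).
rewrite idx_sc in lJ0 e; have lE : l \in wallE.
  by rewrite -(idx_sc A theta J l) -(lam_bQ wp) lt_eqF.
have lj : l = j0 by apply/eqP; rewrite -(wall_single wp b0 jJ z0 lJ0).
have p := wall_positive wp b0 jJ z0; exfalso; move: neg; rewrite e lj ltNge => /negP[].
exact: ltW p.
Qed.

Lemma line0_supported t : supported S (chart b0 (line_point c0 t)).
Proof. exact: (@line_point_supported R r n A sT theta theta0 J0 j0 wp J0 b0 c0 t). Qed.

Lemma line1_supported t : supported S (chart b1 (line_point c1 t)).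
Proof. by rewrite -line_set_flop; exact: (@line_point_supported R r n A sT theta theta0 J0 j0 wp J1 b1 c1 t). Qed.

Lemma supported_line0 y : supported S (chart b0 y) <-> forall d, d != c0 -> cv y d = 0.
Proof. exact: (line_chart sT wp b0 c0 y). Qed.

Lemma supported_line1 y : supported S (chart b1 y) <-> forall d, d != c1 -> cv y d = 0.
Proof. by rewrite -line_set_flop; exact: (line_chart sT wp b1 c1 y). Qed.

Lemma flop_common : exists y0 y1, [/\ chart b0 y0 = chart b1 y1, supported S (chart b0 y0) & cv y0 c0 != 0].
Proof.
pose y0 := line_point c0 (1 : C); have y0c : cv y0 c0 = 1 by rewrite cv_line_point eqxx.
have s0 : supported S (chart b0 y0) := @line0_supported 1.
have U1 : gU gt b1 (chart b0 y0).
  rewrite (chart_qpt wp); apply/(slice_openE b1 (gt b1) _) => l; rewrite !inE => /orP[/eqP->|/andP[lj lJ]].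
    by rewrite -pos_i -ec0 slice_free y0c oner_neq0.
  by rewrite flop_sc // slice_one // oner_neq0.
have [y1 e] := chart_onto (wp := wp) U1; exists y0, y1; split=> //; by rewrite y0c oner_neq0.
Qed.

Lemma tau_supported x x' : supported S x -> supported S x' -> tau x = tau x'.
Proof.
have [y0 [y1 [e s0 _]]] := flop_common.
suff h x1 : supported S x1 -> tau x1 = tau (chart b0 y0) by move=> /h -> /h ->.
move=> sx; have [/(chart_onto (wp := wp))[y ey]|/(chart_onto (wp := wp))[y ey]] := supported_cover sx.
  rewrite ey in sx *; have l := (supported_line0 y).1 sx; have l0 := (supported_line0 y0).1 s0.
  apply: (tau_line sT jJ z0 iE ec0).
  - exact: (line_collapsed sT jJ z0 iE ec0).
  - exact: (line_collapsed sT jJ z0 iE ec0).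
  - by move=> k kc; rewrite l // l0.
rewrite ey e in sx s0 *; have l := (supported_line1 y).1 sx; have l0 := (supported_line1 y1).1 s0.
apply: (tau_line sT iJ1 z1 jE ec1).
- exact: (line_collapsed sT iJ1 z1 jE ec1).
- exact: (line_collapsed sT iJ1 z1 jE ec1).
- by move=> k kc; rewrite l // l0.
Qed.

Lemma supported_irreducible : irreducible_set (supported S).
Proof.
have irr0 := line_irreducible R uni wp b0 c0; have irr1 := line_irreducible R uni wp b1 c1.
have cS := @supported_closed R r n A sT uni theta theta0 J0 j0 wp S.
have [y0 [y1 [e s0 _]]] := flop_common.
suff -> : supported S = closure (chart b0 @` range (line_point c0)) by exact: irreducible_closure.
apply/seteqP; split; last first.
  rewrite (closure_id (supported S)).1 //; apply: closureS => _ [_ [t _ <-] <-].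
  exact: line0_supported.
have in0 y : supported S (chart b0 y) -> (chart b0 @` range (line_point c0)) (chart b0 y).
  by move=> /supported_line0 l; exists y => //; exists (cv y c0) => //; rewrite -line_pointP.
have in1 y : supported S (chart b1 y) -> (chart b1 @` range (line_point c1)) (chart b1 y).
  by move=> /supported_line1 l; exists y => //; exists (cv y c1) => //; rewrite -line_pointP.
move=> x sx; have [/(chart_onto (wp := wp))[y ey]|/(chart_onto (wp := wp))[y ey]] := supported_cover sx.
  by rewrite ey in sx *; apply: subset_closure; exact: in0.
rewrite ey in sx *; move=> O; rewrite nbhsE => -[O' [oO' O'x] O'O].
have oU := @gU_open R r n A theta gt J0 b0.
have [||x1 [[_ [t _ <-] ex1] [O'x1 Ux1]]] := irreducible_open irr1 oO' oU.
- by exists (chart b1 y); split=> //; exact: in1.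
- exists (chart b1 y1); split; first by apply: in1; rewrite -e.
  by rewrite -e; exact: cpt_open.
- have sx1 : supported S x1.
    by rewrite -ex1; exact: line1_supported.
  have [y' ey'] := chart_onto (wp := wp) Ux1; exists x1; split; last exact: O'O.
  by rewrite ey' in sx1 *; exact: in0.
Qed.

(** The origin of one chart gives a chain of length one; longer chains are excluded because in
    either chart the curve is parametrised by one variable. *)
Lemma supported_curve : curve (supported S).
Proof.
have cS := @supported_closed R r n A sT uni theta theta0 J0 j0 wp S.
split; [exact: cS|exact: supported_irreducible| |].
  pose P := supported (S :\ fcoord c0)%SET; pose o := line_point c0 (0 : C).
  have PS : P `<=` supported S by move=> x h k kS; apply: h; rewrite finset.in_setD1 (negPf kS) andbF.
  have Po : P = [set chart b0 o].
    apply/seteqP; split=> [x Px|_ ->]; last first.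
      apply/(supported_chart sT wp) => k; rewrite finset.in_setD1 negb_and negbK => /orP[/eqP ->|kS].
        by rewrite slice_free cv_line_point eqxx.
      by have /(supported_chart sT wp) h := @line0_supported 0; exact: h.
    have [/(chart_onto (wp := wp))[y ey]|/(chart_onto (wp := wp))[y ey]] := supported_cover (PS _ Px).
      rewrite ey in Px *; congr (chart b0 _); apply: affine_ext => d; rewrite cv_line_point.
      rewrite if_same; have [->|dc] := eqVneq d c0; last by apply: ((supported_line0 y).1 (PS _ Px)).
      by have /(supported_chart sT wp) h := Px; rewrite -(slice_free theta b0 (cv y) c0) h // finset.in_setD1 eqxx.
    rewrite ey in Px; have /(supported_chart sT wp) h := Px.
    have := h (fcoord c0); rewrite finset.in_setD1 eqxx /= ec0 pos_i slice_one // => /(_ isT)/eqP.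
    by rewrite oner_eq0.
  exists (fun k : nat => if k is 0%N then P else supported S); split=> //; split=> [[|k] _|[|//] _].
  - split; first exact: (@supported_closed R r n A sT uni theta theta0 J0 j0 wp).
    rewrite Po; split; first by exists (chart b0 o).
    move=> F G _ _ h; have [Fo|Go] := h _ erefl; [left|right]; by move=> _ ->.
  - by split; [exact: cS|exact: supported_irreducible].
  - split=> // h; have [y0 [y1 [_ s0 n0]]] := flop_common.
    have /(supported_chart sT wp)/(_ (fcoord c0)) := h _ s0.
    by rewrite finset.in_setD1 eqxx slice_free => /(_ isT)/eqP; exact/negP.
move=> [Z [ch e]]; have [irr inc] := ch; have [_ [[x Zx] _]] := irr 0%N isT.
have sx : supported S x.
  by rewrite -e; have [+ _] := inc 1%N isT; apply; have [+ _] := inc 0%N isT; apply.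
have [U0|U1] := supported_cover sx.
  suff : (2 <= 1)%N by [].
  exact: (line_chain sT ch e (ex_intro _ x (conj Zx U0))).
suff : (2 <= 1)%N by [].
by rewrite -line_set_flop in e; exact: (line_chain sT ch e (ex_intro _ x (conj Zx U1))).
Qed.

End FlopCurve.

Section Contraction.
Variables (R : realType) (r n : nat) (A : 'M[int]_(r, n)).
Hypothesis sT : spanning A [set: 'I_n]%SET.
Hypothesis nc : nocoloop A.
Hypothesis uni : forall J, base A J -> forall chi : 'rV[int]_r, iw A J (map_mx intr chi).
Variables (theta theta0 : 'rV[rat]_r) (J0 : {set 'I_n}) (j0 : 'I_n).
Hypothesis wp : wall_point A theta theta0 J0 j0.

Lemma wall_contracts_curve : contracts_curve (@vtau R r n A sT theta theta0 J0 j0 wp).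
Proof.
have [i iE ij] := wall_two wp nc (wall_in0 wp).
have bJ := wp_base wp; have jJ := wp_in wp; have z := wp_zero wp.
have [c0 ec0] : exists c : 'I_(sdim J0), fcoord c = bar (negk A theta J0 j0 i).
  by apply: (free_slot A theta); rewrite idx_bar idx_negk; exact: (flop_out wp bJ jJ z iE ij).
have [c1 ec1] : exists c : 'I_(sdim (i |: J0 :\ j0)%SET), fcoord c = bar (negk A theta J0 j0 j0).
  by apply: (free_slot A theta); rewrite idx_bar idx_negk !inE eqxx (eq_sym j0) (negPf ij).
have cu := supported_curve R sT uni wp iE ij ec0 ec1.
have [_ [[x sx] _] _ _] := cu.
exists (supported (line_set A theta c0)), (vtau sT wp x); split; first exact: cu.
apply/seteqP; split=> [_ [x' sx' <-]|_ ->]; last by exists x.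
exact: (tau_supported sT wp iE ij ec0 ec1 sx' sx).
Qed.

End Contraction.

Lemma sign_trans_le (a b c : rat) : 0 < a * b -> 0 <= a * c -> 0 <= b * c.
Proof.
move=> h h'; have a0 : a != 0 by apply: contraTneq h => ->; rewrite mul0r ltxx.
have : 0 <= a ^+ 2 * (b * c) by rewrite expr2 mulrACA mulr_ge0 // ltW.
by rewrite pmulr_rge0 // exprn_even_gt0.
Qed.

(** * Regions *)

Section Walls.
Variables (R : realType) (r n : nat) (A : 'M[int]_(r, n)).
Hypothesis sT : spanning A [set: 'I_n]%SET.
Hypothesis nc : nocoloop A.
Hypothesis uni : forall J, base A J -> forall chi : 'rV[int]_r, iw A J (map_mx intr chi).
Local Notation C := R[i].
Local Notation sol := (sol A).
Local Notation base := (base A).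
Local Notation gen := (gen A).
Local Notation wall_point := (wall_point A).
Local Notation wallE := (wallE A).
Local Notation cls := (git_class R A).
Local Notation ET := 'rV[rat^o]_r.
Implicit Types (theta eta x y : 'rV[rat]_r) (J : {set 'I_n}) (D W : set 'rV[rat]_r).

Lemma wallE_eq theta theta' theta0 J0 j0 J1 j1 : wall_point theta theta0 J0 j0 -> wall_point theta' theta0 J1 j1 ->
  wallE J0 j0 = wallE J1 j1.
Proof.
move=> wp wp'; have [[_ [c c0 cE]]|] := wp_dich wp (wp_base wp') (wp_in wp'); last first.
  by rewrite (wp_zero wp') mulr0 ltxx.
by apply/finset.setP => i; rewrite !inE cE mulf_eq0 (negPf c0).
Qed.

Lemma wallE_card theta theta0 J0 j0 : wall_point theta theta0 J0 j0 -> (1 < #|wallE J0 j0|)%N.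
Proof.
move=> wp; have [i iE ij] := wall_two wp nc (wall_in0 wp).
by apply/card_gt1P; exists i, j0; split=> //; exact: wall_in0 wp.
Qed.

Lemma wall_point_adjacent theta theta' theta0 J0 j0 : wall_point theta theta0 J0 j0 -> gen theta' ->
  clQ (cls theta') theta0 -> wall_point theta' theta0 J0 j0.
Proof.
move=> wp g' c0; split=> //; [exact: wp_base wp|exact: wp_in wp|exact: wp_zero wp|].
move=> J j bJ jJ; have [|p] := wp_dich wp bJ jJ; first by left.
right; have n0 : sol J theta0 0 j != 0 by apply: contraTneq p => ->; rewrite mulr0 ltxx.
by move: c0; rewrite chamber_closure // => /(_ J j bJ jJ) h; rewrite lt_def h andbT mulf_neq0 // g'.
Qed.

Section TwoSides.
Variables (theta theta' theta0 : 'rV[rat]_r) (J0 : {set 'I_n}) (j0 : 'I_n).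
Hypotheses (wp : wall_point theta theta0 J0 j0) (wp' : wall_point theta' theta0 J0 j0).

Lemma two_sides J j : base J -> j \in J ->
  (exists2 c, c != 0 & forall y, sol J y 0 j = c * sol J0 y 0 j0) \/ 0 < sol J theta 0 j * sol J theta' 0 j.
Proof.
move=> bJ jJ; have [[_ h]|p] := wp_dich wp bJ jJ; first by left.
have [[z _]|p'] := wp_dich wp' bJ jJ; first by move: p; rewrite z mulr0 ltxx.
by right; move: p p'; rewrite ![_ * sol J theta0 0 j]mulrC; exact: sign_trans.
Qed.

Lemma same_side_class : 0 < sol J0 theta 0 j0 * sol J0 theta' 0 j0 -> cls theta = cls theta'.
Proof.
move=> p; have s : same_signs A theta theta'.
  move=> J j bJ jJ; have [[c c0 cE]|//] := two_sides bJ jJ.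
  by rewrite !cE mulrACA mulr_gt0 // -expr2 exprn_even_gt0.
have [_ eV] := (git_classE R sT theta' (wp_gen wp)).2 s.
by apply/seteqP; split=> eta [h h']; split=> //; rewrite h' eV.
Qed.

Lemma closure_transfer x : clQ (cls theta) x -> sol J0 x 0 j0 = 0 -> clQ (cls theta') x.
Proof.
rewrite (chamber_closure R sT (wp_gen wp)) (chamber_closure R sT (wp_gen wp')) => h z J j bJ jJ.
have [[c c0 cE]|p] := two_sides bJ jJ; first by rewrite (cE x) z mulr0 mulr0.
by apply: sign_trans_le p _; exact: h.
Qed.

End TwoSides.

Lemma wall_transfer theta theta' theta0 J0 j0 W : wall_point theta theta0 J0 j0 -> wall_point theta' theta0 J0 j0 ->
  wall_of R A (cls theta) W -> W = [set x | clQ (cls theta) x /\ sol J0 x 0 j0 = 0] -> wall_of R A (cls theta') W.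
Proof.
move=> wp wp' [_ fW] WE; split; first exact: gen_chamber (wp_gen wp').
have s0 := theta_j0 wp'; have [fD fZ] := sol_form (A := A) j0 (wp_base wp).
apply: (@facet_transfer r (cls theta) W fW _ (fun x => sol J0 theta' 0 j0 * sol J0 x 0 j0)).
- by split=> [x y|a x]; rewrite ?fD ?fZ ?mulrDr // mulrCA.
- move=> x; rewrite (chamber_closure R sT (wp_gen wp')); apply; [exact: wp_base wp|exact: wp_in wp].
rewrite {1}WE; apply/seteqP; split=> x [cx] => [z|/eqP].
  by split; [exact: (closure_transfer wp wp')|rewrite /= z mulr0].
by rewrite mulf_eq0 (negPf s0) => /eqP z; split=> //; exact: (closure_transfer wp' wp).
Qed.

Lemma wall_data D W : wall_of R A D W -> exists theta theta0 J0 j0,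
  [/\ D = cls theta, relint W theta0, wall_point theta theta0 J0 j0 &
      W = [set x | clQ (cls theta) x /\ sol J0 x 0 j0 = 0]].
Proof.
move=> wD; have [J0 [j0 [WE h]]] := wall_form sT wD; have [cD fW] := wD.
have [theta Dt gt] := chamber_ex sT cD; have [_ DE] := chamber_gen sT cD Dt.
have [theta0 r0] : exists x, relint W x.
  apply: (facet_relint (cell_linear A theta) (fun x => git_class_cell R sT x gt) (theta := theta)); last by rewrite -DE.
  by rewrite -DE.
exists theta, theta0, J0, j0; split=> //; first exact: h.
by rewrite -DE.
Qed.

Lemma wallE_unique D D' W theta theta' theta0 theta0' J0 j0 J1 j1 : wall_of R A D W -> wall_of R A D' W ->
  D theta -> D' theta' -> relint W theta0 -> relint W theta0' ->
  wall_point theta theta0 J0 j0 -> wall_point theta' theta0' J1 j1 -> wallE J0 j0 = wallE J1 j1.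
Proof.
move=> wD wD' Dt Dt' r0 r0' wp wp'; have [J2 [j2 [_ h]]] := wall_form sT wD'.
by rewrite (wallE_eq wp (h _ _ Dt' r0)) (wallE_eq wp' (h _ _ Dt' r0')).
Qed.

Section FixedWall.
Variables (D W : set 'rV[rat]_r) (theta theta0 : 'rV[rat]_r) (J0 : {set 'I_n}) (j0 : 'I_n).
Hypotheses (wD : wall_of R A D W) (Dt : D theta) (r0 : relint W theta0) (wp : wall_point theta theta0 J0 j0).

Lemma any_wall_point D' eta eta0 : wall_of R A D' W -> D' eta -> relint W eta0 -> exists J1 j1,
  wall_point eta eta0 J1 j1 /\ wallE J1 j1 = wallE J0 j0.
Proof.
move=> wD' De re; have [J1 [j1 [_ h]]] := wall_form sT wD'; exists J1, j1; split; first exact: h.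
by apply: (wallE_unique wD' wD De Dt re r0 _ wp); exact: h.
Qed.

Lemma wide_small D' : (2 < #|wallE J0 j0|)%N -> wall_of R A D' W -> vgit_type A (@small C) D' W.
Proof.
move=> card wD' eta eta0 De re; have [J1 [j1 [wp1 e]]] := any_wall_point wD' De re.
exists (@vtau R r n A sT _ _ J1 j1 wp1); split; first exact: vtau_vgit.
by apply: (@wall_small R r n A sT nc uni); rewrite e.
Qed.

Lemma narrow_divisorial D' : (#|wallE J0 j0| <= 2)%N -> wall_of R A D' W -> vgit_type A (@divisorial C) D' W.
Proof.
move=> card wD' eta eta0 De re; have [J1 [j1 [wp1 e]]] := any_wall_point wD' De re.
exists (@vtau R r n A sT _ _ J1 j1 wp1); split; first exact: vtau_vgit.
by apply: (@wall_divisorial R r n A sT nc uni); apply/eqP; rewrite eqn_leq e card -e (wallE_card wp1).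
Qed.

Lemma narrow_not_small : (#|wallE J0 j0| <= 2)%N -> ~ vgit_type A (@small C) D W.
Proof.
move=> card sm; have [t1 [v1 [_ d1]]] := narrow_divisorial card wD Dt r0.
have [t2 [v2 [_ s2]]] := sm _ _ Dt r0.
by apply: s2; rewrite (vgit_unique sT wp v2) -(vgit_unique sT wp v1).
Qed.

Lemma wide_flipping D' : (2 < #|wallE J0 j0|)%N -> separates R A W D D' -> flipping R A W.
Proof.
move=> card sep; exists D, D'; split=> // E ED eta eta0 Ee re.
have wE : wall_of R A E W by case: ED => ->; case: sep.
have [J1 [j1 [wp1 e]]] := any_wall_point wE Ee re.
exists (@vtau R r n A sT _ _ J1 j1 wp1); split; first exact: vtau_vgit.
- exact: (X_normal R sT nc uni (wp_gen wp1)).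
- by apply: (@wall_codim R r n A sT nc uni _ _ _ _ wp1); [rewrite e|exact: Uns_collapsed].
- exact: (@wall_contracts_curve R r n A sT nc uni).
Qed.

End FixedWall.

Lemma separating_chamber D W theta theta0 J0 j0 : wall_of R A D W -> D theta -> wall_point theta theta0 J0 j0 ->
  W = [set x | clQ D x /\ sol J0 x 0 j0 = 0] -> exists theta',
  [/\ separates R A W D (cls theta'), wall_point theta' theta0 J0 j0 & sol J0 theta 0 j0 * sol J0 theta' 0 j0 < 0].
Proof.
move=> wD Dt wp WE; have [cD _] := wD; have [gt DE] := chamber_gen sT cD Dt.
have [theta' [wp' neg _]] := wall_opposite wp; exists theta'; split=> //.
rewrite DE in wD WE *; split=> //; last exact: wall_transfer wp wp' wD WE.
move=> e; have : cls theta theta' by rewrite e; apply/(git_classE R sT _ (wp_gen wp')); exact: same_signs_refl (wp_gen wp').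
move/(git_classE R sT _ gt) => /(_ J0 j0 (wp_base wp) (wp_in wp)).
by rewrite ltNge (ltW neg).
Qed.

Section Narrow.
Variables (J0 : {set 'I_n}) (j0 : 'I_n).
Hypotheses (b0 : base J0) (jJ : j0 \in J0) (card : (#|wallE J0 j0| <= 2)%N).

(** If the crossed wall lay on this hyperplane, it would have at most two columns off it and be
    divisorial, so the crossing would not be small. *)
Lemma crossing_side D D' theta theta' : small_crossing R A D D' -> D theta -> D' theta' ->
  0 < sol J0 theta 0 j0 * sol J0 theta' 0 j0.
Proof.
move=> [W [[DD' wD wD'] sm _]] Dt Dt'; have [J1 [j1 [WE h]]] := wall_form sT wD.
have [_ [theta0 [_ [_ [_ r0 _ _]]]]] := wall_data wD; have wp := h _ _ Dt r0.
have [g DE] := chamber_gen sT wD.1 Dt; have [g' DE'] := chamber_gen sT wD'.1 Dt'.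
have W0 : W theta0 by have [] := r0.
have c0 : clQ (cls theta') theta0.
  rewrite -DE'; have [_ [[l [_ WE']] _]] := wD'.
  by move: W0; rewrite WE' => -[].
have wp' := wall_point_adjacent wp g' c0.
have [[c cn0 cE]|//] := two_sides wp wp' b0 jJ.
case: (@narrow_not_small D W theta theta0 J1 j1 wD Dt r0 wp _ sm).
suff <- : wallE J0 j0 = wallE J1 j1 by [].
by apply/finset.setP => i; rewrite !inE cE mulf_eq0 (negPf cn0).
Qed.

End Narrow.

Lemma crossing_chamber D D' : clos_refl_trans _ (small_crossing R A) D D' -> chamber R A D -> chamber R A D'.
Proof.
elim=> [{}D {}D' [W [[_ _ [c _]] _ _]] _|//|{}D D1 {}D' _ h _ h' c]; first exact: c.
exact/h'/h.
Qed.

Lemma chain_side J0 j0 D D' theta theta' : base J0 -> j0 \in J0 -> (#|wallE J0 j0| <= 2)%N ->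
  clos_refl_trans _ (small_crossing R A) D D' -> chamber R A D -> D theta -> D' theta' ->
  0 < sol J0 theta 0 j0 * sol J0 theta' 0 j0.
Proof.
move=> b0 jJ card ch; elim: ch theta theta' => [{}D {}D' sc|{}D|{}D D1 {}D' ch1 h1 ch2 h2] theta theta' cD Dt Dt'.
- exact: crossing_side sc Dt Dt'.
- have [g DE] := chamber_gen sT cD Dt; rewrite DE in Dt'.
  by apply: ((git_classE R sT _ g).1 Dt').
- have c1 := crossing_chamber ch1 cD; have [theta1 Dt1 _] := chamber_ex sT c1.
  have p1 := h1 _ _ cD Dt Dt1; have p2 := h2 _ _ c1 Dt1 Dt'.
  by move: p1 p2; rewrite [sol J0 theta 0 j0 * _]mulrC; exact: sign_trans.
Qed.

Lemma region_side J0 j0 D theta x : base J0 -> j0 \in J0 -> (#|wallE J0 j0| <= 2)%N ->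
  chamber R A D -> D theta -> region R A D x -> 0 <= sol J0 theta 0 j0 * sol J0 x 0 j0.
Proof.
move=> b0 jJ card cD Dt [D' ch cx]; have cD' := crossing_chamber ch cD.
have [theta' Dt' _] := chamber_ex sT cD'; have p := chain_side b0 jJ card ch cD Dt Dt'.
have [g' DE'] := chamber_gen sT cD' Dt'; move: cx; rewrite DE' (chamber_closure R sT g') => h.
by move: p; rewrite mulrC => p; apply: sign_trans_le p _; exact: h.
Qed.

Lemma sub_clQ D : D `<=` clQ D.
Proof. exact: (@subset_closure ET D). Qed.

(** A narrow wall cannot be interior: the region lies on one side of its hyperplane, whereas a
    neighbourhood of [theta0] contains [theta0 + e *: theta1] and [theta0 - e *: theta1]. *)
Lemma interior_wall_flipping D W : chamber R A D -> interior_wall R A (region R A D) W -> flipping R A W.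
Proof.
move=> cD [[D1 wD1] sub]; have [theta1 [theta0 [J0 [j0 [DE r0 wp WE]]]]] := wall_data wD1.
have g1 := wp_gen wp; have b0 := wp_base wp; have jJ := wp_in wp.
have Dt1 : D1 theta1 by rewrite DE; apply/(git_classE R sT _ g1); exact: same_signs_refl.
have [theta Dt gt] := chamber_ex sT cD.
have card : (2 < #|wallE J0 j0|)%N.
  rewrite ltnNge; apply/negP => card; have [e e0 [U1 U2]] := nbhs_line theta1 (sub _ r0).
  have lf := sol_form (A := A) j0 b0.
  have := region_side b0 jJ card cD Dt U1; have := region_side b0 jJ card cD Dt U2.
  rewrite (lfB lf) lf.1 lf.2 (wp_zero wp) sub0r add0r mulrN oppr_ge0 => h1 h2.
  have : sol J0 theta 0 j0 * (e * sol J0 theta1 0 j0) != 0.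
    by rewrite !mulf_neq0 ?(gt _ b0 _ jJ) ?(g1 _ b0 _ jJ) // lt0r_neq0.
  by rewrite (le_anti (introT andP (conj h1 h2))) eqxx.
have [|theta' [sep _ _]] := separating_chamber wD1 Dt1 wp; first by rewrite DE.
exact: (wide_flipping wD1 Dt1 r0 wp card sep).
Qed.

(** A wide wall would be a small crossing, so the region would also contain the opposite chamber and
    [theta0] would be interior to it. Hence the wall is narrow and divisorial, and since the region
    lies on one side of it, the adjacent chamber is unique. *)
Lemma boundary_wall_divisorial D W : chamber R A D -> boundary_wall R A (region R A D) W ->
  exists D', inner_chamber R A (region R A D) W D' /\ vgit_type A (@divisorial C) D' W.
Proof.
move=> cD [[D1 wD1] sub]; have [theta1 [theta0 [J0 [j0 [DE r0 wp1 WE]]]]] := wall_data wD1.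
have g1 := wp_gen wp1; have b0 := wp_base wp1; have jJ := wp_in wp1; rewrite DE in wD1.
have W0 : W theta0 by have [] := r0.
have [[D2 ch c2] nint] := sub _ W0.
have cD2 := crossing_chamber ch cD; have [theta2 Dt2 g2] := chamber_ex sT cD2.
have [_ DE2] := chamber_gen sT cD2 Dt2; rewrite DE2 in c2.
have wp2 := wall_point_adjacent wp1 g2 c2.
have wD2 : wall_of R A D2 W by rewrite DE2; exact: wall_transfer wp1 wp2 wD1 WE.
have WE2 : W = [set x | clQ D2 x /\ sol J0 x 0 j0 = 0].
  rewrite {1}WE DE2; apply/seteqP; split=> x [cx z]; split=> //.
    exact: (closure_transfer wp1 wp2).
  exact: (closure_transfer wp2 wp1).
have D2P : D2 `<=` region R A D by move=> x Dx; exists D2 => //; exact: sub_clQ.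
have [card|card] := leqP #|wallE J0 j0| 2; last first.
  case: nint; have [theta3 [sep wp3 neg]] := separating_chamber wD2 Dt2 wp2 WE2.
  have [_ _ wD3] := sep.
  have sc : small_crossing R A D2 (cls theta3).
    by exists W; split=> //; exact: (wide_small wD2 Dt2 r0 wp2).
  (* Near [theta0] every form not proportional to that of the wall keeps its sign, so the closures
     of the two chambers cover a neighbourhood. *)
  have nb := @positive_nbhs r _ (cell_ok A) _ (@cell_linear r n A theta2) theta0.
  apply: filterS nb => y hy.
  have pos J j : base J -> j \in J -> (exists2 c, c != 0 & forall y, sol J y 0 j = c * sol J0 y 0 j0) \/
      0 < sol J theta2 0 j * sol J y 0 j.
    move=> bJ jJ'; have [[_ h]|p] := wp_dich wp2 bJ jJ'; first by left.
    by right; have := hy (J, j) (conj bJ jJ'); rewrite !cell_formE //=; exact.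
  have [p|p] := leP 0 (sol J0 theta2 0 j0 * sol J0 y 0 j0).
    exists D2 => //; rewrite DE2 (chamber_closure R sT g2) => J j bJ jJ'.
    have [[c c0 cE]|/ltW//] := pos J j bJ jJ'.
    by rewrite !cE mulrACA mulr_ge0 // -expr2 sqr_ge0.
  exists (cls theta3); first exact: rt_trans ch (rt_step _ _ _ _ sc).
  have p3 : 0 < sol J0 theta3 0 j0 * sol J0 y 0 j0.
    have p' : 0 < sol J0 theta2 0 j0 * (- sol J0 y 0 j0) by rewrite mulrN oppr_gt0.
    have n' : 0 < sol J0 theta2 0 j0 * (- sol J0 theta3 0 j0) by rewrite mulrN oppr_gt0.
    by have := sign_trans n' p'; rewrite mulrNN.
  rewrite (chamber_closure R sT (wp_gen wp3)) => J j bJ jJ'.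
  have [[c c0 cE]|q] := pos J j bJ jJ'; first by rewrite !cE mulrACA mulr_ge0 ?(ltW p3) // -expr2 sqr_ge0.
  have [[c c0 cE]|q'] := two_sides wp2 wp3 bJ jJ'; first by rewrite !cE mulrACA mulr_ge0 ?(ltW p3) // -expr2 sqr_ge0.
  by apply: sign_trans_le q' _; exact: ltW.
exists D2; split; last exact: (narrow_divisorial wD2 Dt2 r0 wp2).
have [theta Dt gt] := chamber_ex sT cD.
split; first by split=> // x Wx; move: Wx; rewrite WE2 => -[].
move=> D4 [cD4 D4P WD4]; have [theta4 Dt4 g4] := chamber_ex sT cD4.
have [_ DE4] := chamber_gen sT cD4 Dt4.
have wp4 : wall_point theta4 theta0 J0 j0 by apply: (wall_point_adjacent wp1) => //; rewrite -DE4; exact: WD4.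
rewrite DE2 DE4; apply: (same_side_class wp2 wp4).
have side eta : gen eta -> region R A D eta -> 0 < sol J0 theta 0 j0 * sol J0 eta 0 j0.
  move=> ge re; rewrite lt_def (region_side b0 jJ card cD Dt re) andbT.
  by rewrite mulf_neq0 ?(gt _ b0 _ jJ) ?(ge _ b0 _ jJ).
by apply: (@sign_trans (sol J0 theta 0 j0)); apply: side => //; [exact: D2P|exact: D4P].
Qed.

End Walls.

Theorem theorem1p5 (R : realType) (r n : nat) (A : 'M[int]_(r, n))
    (B : 'M[int]_(n, n - r)) (theta : 'rV[rat]_r) :
  (r < n)%N ->
  gale_dual A B ->
  (forall i, row i B != 0) ->
  (forall eta, generic R A eta -> nonsingular (X R A eta)) ->
  generic R A theta ->
  let D := git_class R A theta in
  [/\ [/\ variety (X R A theta), normal (X R A theta),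
          Qfactorial (X R A theta) &
          exists L_C : {linear 'rV[rat]_r -> PicQ R A theta},
            linearisation_map L_C /\ bijective L_C],
      forall W, interior_wall R A (region R A D) W -> flipping R A W &
      forall W, boundary_wall R A (region R A D) W ->
        exists D', inner_chamber R A (region R A D) W D' /\
          (vgit_type A (@divisorial R[i]) D' W \/
           vgit_type A (@fibre_type R[i]) D' W)].
Proof.
move=> _ gale rows smooth gth D; have sl : spans_lattice A by case: gale.
have sT := lattice_spanning sl; have nc := gale_nocoloop gale rows.
have uni := smooth_unimodular nc sl smooth; have gt := generic_gen gth.
have cD : chamber R A D := gen_chamber R sT gt.
split=> [|W|W].
- split.
  + exact: (@X_variety R r n A theta sT nc uni gt).
  + exact: (@X_normal R r n A theta sT nc uni gt).
  + exact: (@X_Qfactorial R r n A theta sT nc uni gt).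
  + exact: (@linearisation_iso R r n A theta sT nc uni gt).
- exact: interior_wall_flipping.
move=> /(boundary_wall_divisorial sT nc uni cD)[D' [inner div]].
by exists D'; split=> //; left.
Qed.
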